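(* Let $A$ be a tractable commutative DG ring. Then: (1) $A$ has a dualizing DG module. (2) The operation $(P, R) \mapsto P \otimes^{\mathrm{L}}_A R$, for a tilting DG module $P$ and a dualizing DG module $R$, induces a simply transitive action of the group $\operatorname{DPic}(A)$ on the set of isomorphism classes (in $\mathsf{D}(A)$) of dualizing DG $A$-modules.
   Context: A commutative DG ring is a graded associative unital ring $A=\bigoplus_{i\le 0}A^i$ with a differential $\mathrm{d}$ of degree $1$ satisfying the graded Leibniz rule, such that $b\cdot a=(-1)^{ij}a\cdot b$ for $a\in A^i$, $b\in A^j$, and $a\cdot a=0$ for $a\in A^i$ with $i$ odd. Commutative rings are DG rings concentrated in degree $0$. Write $\bar A:=\mathrm{H}^0(A)$. $\mathsf{D}(A)$ is the derived category of DG $A$-modules (quasi-isomorphisms inverted). $A$ is cohomologically pseudo-noetherian if $\bar A$ is noetherian and every $\mathrm{H}^i(A)$ is a finitely generated $\bar A$-module. $A$ is tractable if it is cohomologically pseudo-noetherian and there exists a DG ring homomorphism $\mathbb{K}\to A$ from some finite dimensional regular noetherian commutative ring $\mathbb{K}$ such that the induced ring homomorphism $\mathbb{K}\to\bar A$ is essentially of finite type (a localization of a finitely generated $\mathbb{K}$-ring). A DG $A$-module $P$ is tilting if there is a DG $A$-module $Q$ with $P\otimes^{\mathrm{L}}_A Q\cong A$ in $\mathsf{D}(A)$. $\operatorname{DPic}(A)$ is the abelian group of isomorphism classes in $\mathsf{D}(A)$ of tilting DG $A$-modules, with product induced by $-\otimes^{\mathrm{L}}_A-$ and unit the class of $A$.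 For $A$ cohomologically pseudo-noetherian, a DG $A$-module $R$ is dualizing if: (i) each $\mathrm{H}^i(R)$ is a finitely generated $\bar A$-module; (ii) $R$ has finite injective dimension relative to $\mathsf{D}(A)$, i.e. there are integers $d_0\le d_1$ with $\operatorname{con}(\mathrm{H}(\operatorname{RHom}_A(M,R)))\subseteq-\operatorname{con}(\mathrm{H}(M))+[d_0,d_1]$ for all $M\in\mathsf{D}(A)$; (iii) the adjunction morphism $A\to\operatorname{RHom}_A(R,R)$ (given by multiplication) is an isomorphism in $\mathsf{D}(A)$. Here, for a graded module $H$, $\operatorname{con}(H)$ is the smallest integer interval (endpoints possibly $\pm\infty$; empty if $H=0$) containing all degrees $i$ with $H^i\ne0$; intervals are added endpoint-wise, $-[i_0,i_1]=[-i_1,-i_0]$, and $\varnothing+[d_0,d_1]=\varnothing$. *)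

(* Defs.v *)
From HB Require Import structures.
From mathcomp Require Import all_boot all_order all_algebra.
From mathcomp Require Import boolp.
From mathcomp Require Import ring zify.

Set Implicit Arguments.
Unset Strict Implicit.
Unset Printing Implicit Defensive.

Import GRing.Theory.
Local Open Scope ring_scope.
Local Open Scope quotient_scope.

(* [(-1)^n x]. *)
Definition zsign (n : int) (V : zmodType) (x : V) : V :=
  if odd (absz n) then - x else x.

Lemma odd_abszD (m n : int) : odd (absz (m + n)) = odd (absz m) (+) odd (absz n).
Proof. lia. Qed.

Lemma odd_abszM (m n : int) : odd (absz (m * n)) = odd (absz m) && odd (absz n).
Proof. by rewrite abszM oddM. Qed.

Section Sign.
Variables (V W : zmodType).
Implicit Types x y : V.

Lemma zsignD m n x : zsign (m + n) x = zsign m (zsign n x).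
Proof.
by rewrite /zsign odd_abszD; case: (odd _); case: (odd _); rewrite //= opprK.
Qed.

Lemma zsignK n x : zsign n (zsign n x) = x.
Proof. by rewrite /zsign; case: (odd _); rewrite ?opprK. Qed.

Lemma zsign0 x : zsign 0 x = x. Proof. by []. Qed.

Lemma zsign1 x : zsign 1 x = - x. Proof. by []. Qed.

Lemma zsignC m n x : zsign m (zsign n x) = zsign n (zsign m x).
Proof. by rewrite -!zsignD addrC. Qed.

Lemma zsign_addr n : {morph @zsign n V : x y / x + y}.
Proof. by move=> x y; rewrite /zsign; case: (odd _); rewrite ?opprD. Qed.

Lemma zsignN n x : zsign n (- x) = - zsign n x.
Proof. by rewrite /zsign; case: (odd _). Qed.

Lemma zsign00 n : zsign n (0 : V) = 0.
Proof. by rewrite /zsign; case: (odd _); rewrite ?oppr0. Qed.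

Variable f : V -> W.
Hypothesis fD : {morph f : x y / x + y}.

Lemma morphD0 : f 0 = 0.
Proof. by apply: (addrI (f 0)); rewrite -fD !addr0. Qed.

Lemma morphDN x : f (- x) = - f x.
Proof. by apply: (addrI (f x)); rewrite -fD !subrr morphD0. Qed.

Lemma morphDB x y : f (x - y) = f x - f y.
Proof. by rewrite fD morphDN. Qed.

Lemma morphD_zsign n x : f (zsign n x) = zsign n (f x).
Proof. by rewrite /zsign; case: (odd _); rewrite ?morphDN. Qed.
End Sign.

(* Graded objects are families indexed by [int].  An operation landing in a   *)
(* sum of degrees takes the target degree as an argument, with an equation;   *)
(* this keeps casts out of the axioms.                                        *)
Record cpx := Cpx {
  cx :> int -> zmodType;
  cd : forall i j, i + 1 = j -> cx i -> cx j;
  cdD : forall i j (e : i + 1 = j), {morph cd e : x y / x + y};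
  cdd : forall i j k (e : i + 1 = j) (e' : j + 1 = k) x, cd e' (cd e x) = 0 }.

Record cmap (C D : cpx) := CMap {
  cm :> forall i, C i -> D i;
  cmD : forall i, {morph @cm i : x y / x + y};
  cm_d : forall i j (e : i + 1 = j) x, cm (cd e x) = cd e (cm x) }.

Section Cohomology.
Variables (C : cpx) (i : int).

Definition cocycle : {pred C i} := [pred x | cd (erefl (i + 1)) x == 0].

Lemma cocycle_zmod : zmod_closed cocycle.
Proof.
split=> [|x y]; rewrite !inE; first by rewrite (morphD0 (cdD _)).
by move=> /eqP x0 /eqP y0; rewrite (morphDB (cdD _)) x0 y0 subr0.
Qed.
HB.instance Definition _ := GRing.isZmodClosed.Build _ cocycle cocycle_zmod.

Definition cyc : Type := {x : C i | x \in cocycle}.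
HB.instance Definition _ := SubChoice.on cyc.
HB.instance Definition _ := [SubChoice_isSubZmodule of cyc by <:].

Definition coboundary : {pred cyc} :=
  [pred x : cyc | `[< exists j (e : j + 1 = i) (y : C j), val x = cd e y >]].

Lemma coboundary_zmod : zmod_closed coboundary.
Proof.
split=> [|x y]; rewrite !inE.
  have e : (i - 1) + 1 = i by rewrite subrK.
  by apply/asboolP; exists (i - 1), e, 0; rewrite (morphD0 (cdD _)).
move=> /asboolP[j [e [u xu]]] /asboolP[j' [e' [v yv]]]; apply/asboolP.
have ej : j' = j by apply: (addIr 1); rewrite e e'.
subst j'; exists j, e, (u - v).
by rewrite (morphDB (cdD _)) raddfB /= xu yv (Prop_irrelevance e' e).
Qed.
HB.instance Definition _ := GRing.isZmodClosed.Build _ coboundary coboundary_zmod.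

Definition coh : Type := Quotient.quot coboundary.
HB.instance Definition _ := GRing.Zmodule.on coh.

Definition hcls (x : cyc) : coh := \pi_(Quotient.quot coboundary) x.
Definition hrep (x : coh) : cyc := repr (x : Quotient.quot coboundary).
End Cohomology.

Section CohomologyTheory.
Variables (C : cpx) (i : int).
Implicit Types x y : cyc C i.

Lemma hrepK (x : coh C i) : hcls (hrep x) = x.
Proof. exact: reprK. Qed.

Lemma hclsW (P : coh C i -> Prop) : (forall x, P (hcls x)) -> forall x : coh C i, P x.
Proof. by move=> h x; rewrite -(hrepK x). Qed.

Lemma hclsP x y :
  hcls x = hcls y <-> exists j (e : j + 1 = i) u, val x - val y = cd e u.
Proof.
have -> : hcls x = hcls y <-> x - y \in @coboundary C i.
  by rewrite Quotient.idealrBE; split=> [/eqP|/eqP].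
by rewrite -raddfB; split=> /asboolP.
Qed.

Lemma hclsD : {morph @hcls C i : x y / x + y}.
Proof. exact: raddfD. Qed.

Lemma cycP x j (e : i + 1 = j) : cd e (val x) = 0.
Proof. by subst j; apply/eqP; have := valP x; rewrite inE. Qed.

Lemma cocycleP (u : C i) : (forall j (e : i + 1 = j), cd e u = 0) -> u \in @cocycle C i.
Proof. by move=> h; rewrite inE h. Qed.
End CohomologyTheory.

Section CohomologyMap.
Variables (C D : cpx) (f : cmap C D) (i : int).

Lemma cycmap_subproof (x : cyc C i) : f i (val x) \in @cocycle D i.
Proof. by apply: cocycleP => j e; rewrite -cm_d cycP (morphD0 (@cmD _ _ f _)). Qed.

Definition cycmap (x : cyc C i) : cyc D i := Sub (f i (val x)) (cycmap_subproof x).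

Definition cohmap (x : coh C i) : coh D i := hcls (cycmap (hrep x)).

Lemma cohmapE x : cohmap (hcls x) = hcls (cycmap x).
Proof.
have /hclsP[j [e [u xu]]] := hrepK (hcls x).
apply/hclsP; exists j, e, (f j u).
by rewrite /cycmap !SubK -(morphDB (@cmD _ _ f i)) -cm_d xu.
Qed.
End CohomologyMap.

Record cdgRing := CDGRing {
  dgr_cpx :> cpx;
  dmul : forall i j k, i + j = k -> dgr_cpx i -> dgr_cpx j -> dgr_cpx k;
  dunit : dgr_cpx 0;
  dmulDl : forall i j k (e : i + j = k) a b c,
    dmul e (a + b) c = dmul e a c + dmul e b c;
  dmulDr : forall i j k (e : i + j = k) a b c,
    dmul e a (b + c) = dmul e a b + dmul e a c;
  dmulA : forall i j k ij jk ijk (e1 : i + j = ij) (e2 : ij + k = ijk)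
      (e3 : j + k = jk) (e4 : i + jk = ijk) a b c,
    dmul e2 (dmul e1 a b) c = dmul e4 a (dmul e3 b c);
  dmul1l : forall i (e : 0 + i = i) a, dmul e dunit a = a;
  dmul1r : forall i (e : i + 0 = i) a, dmul e a dunit = a;
  dleibniz : forall i j k i' j' k' (e : i + j = k)
      (ei : i + 1 = i') (ej : j + 1 = j') (ek : k + 1 = k')
      (e1 : i' + j = k') (e2 : i + j' = k') a b,
    cd ek (dmul e a b) = dmul e1 (cd ei a) b + zsign i (dmul e2 a (cd ej b));
  dmulC : forall i j k (e : i + j = k) (e' : j + i = k) a b,
    dmul e' b a = zsign (i * j) (dmul e a b);
  dsq0 : forall i k (e : i + i = k) a, odd (absz i) -> dmul e a a = 0;
  dnonpos : forall i, (0 < i)%R -> forall a : dgr_cpx i, a = 0 }.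

Record dgrHom (A B : cdgRing) := DGRHom {
  dgrh_cmap :> cmap A B;
  dgrh1 : dgrh_cmap 0 (dunit A) = dunit B;
  dgrhM : forall i j k (e : i + j = k) a b,
    dgrh_cmap k (dmul e a b) = dmul e (dgrh_cmap i a) (dgrh_cmap j b) }.

Record dgMod (A : cdgRing) := DGMod {
  dgm_cpx :> cpx;
  act : forall i j k, i + j = k -> A i -> dgm_cpx j -> dgm_cpx k;
  actDl : forall i j k (e : i + j = k) a b m,
    act e (a + b) m = act e a m + act e b m;
  actDr : forall i j k (e : i + j = k) a m n,
    act e a (m + n) = act e a m + act e a n;
  actA : forall i j k ij jk ijk (e1 : i + j = ij) (e2 : ij + k = ijk)
      (e3 : j + k = jk) (e4 : i + jk = ijk) a b m,
    act e2 (dmul e1 a b) m = act e4 a (act e3 b m);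
  act1 : forall i (e : 0 + i = i) m, act e (dunit A) m = m;
  act_leibniz : forall i j k i' j' k' (e : i + j = k)
      (ei : i + 1 = i') (ej : j + 1 = j') (ek : k + 1 = k')
      (e1 : i' + j = k') (e2 : i + j' = k') a m,
    cd ek (act e a m) = act e1 (cd ei a) m + zsign i (act e2 a (cd ej m)) }.

Record dgHom (A : cdgRing) (M N : dgMod A) := DGHom {
  dgh_cmap :> cmap M N;
  dgh_act : forall i j k (e : i + j = k) a m,
    dgh_cmap k (act e a m) = act e a (dgh_cmap j m) }.

Definition regMod (A : cdgRing) : dgMod A :=
  @DGMod A A (@dmul A) (@dmulDl A) (@dmulDr A) (@dmulA A) (@dmul1l A)
    (@dleibniz A).

Section ModTheory.
Variables (A : cdgRing) (M : dgMod A).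

Lemma act_addl i j k (e : i + j = k) (m : M j) :
  {morph (fun a => act e a m) : a b / a + b}.
Proof. by move=> a b; rewrite actDl. Qed.

Lemma act_addr i j k (e : i + j = k) (a : A i) :
  {morph (@act A M i j k e a) : m n / m + n}.
Proof. by move=> m n; rewrite actDr. Qed.

Lemma act0r i j k (e : i + j = k) (a : A i) : act e a (0 : M j) = 0.
Proof. exact: (morphD0 (act_addr e a)). Qed.
Lemma act0l i j k (e : i + j = k) (m : M j) : act e (0 : A i) m = 0.
Proof. exact: (morphD0 (act_addl e m)). Qed.
Lemma actNl i j k (e : i + j = k) a (m : M j) : act e (- a) m = - act e a m.
Proof. exact: (morphDN (act_addl e m)). Qed.
Lemma actNr i j k (e : i + j = k) a (m : M j) : act e a (- m) = - act e a m.
Proof. exact: (morphDN (act_addr e a)). Qed.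
Lemma actBl i j k (e : i + j = k) a b (m : M j) :
  act e (a - b) m = act e a m - act e b m.
Proof. exact: (morphDB (act_addl e m)). Qed.
Lemma actBr i j k (e : i + j = k) a (m n : M j) :
  act e a (m - n) = act e a m - act e a n.
Proof. exact: (morphDB (act_addr e a)). Qed.
Lemma act_zsignl i j k (e : i + j = k) p a (m : M j) :
  act e (zsign p a) m = zsign p (act e a m).
Proof. exact: (morphD_zsign (act_addl e m)). Qed.
Lemma act_zsignr i j k (e : i + j = k) p a (m : M j) :
  act e a (zsign p m) = zsign p (act e a m).
Proof. exact: (morphD_zsign (act_addr e a)). Qed.

Lemma actAC p q j pj qj k (e1 : q + j = qj) (e2 : p + qj = k) (e3 : p + j = pj)
    (e4 : q + pj = k) (a : A p) (b : A q) (m : M j) :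
  act e2 a (act e1 b m) = zsign (p * q) (act e4 b (act e3 a m)).
Proof.
have e5 : (p + q) + j = k by rewrite -addrA e1.
have e6 : q + p = p + q by rewrite addrC.
rewrite -(actA erefl e5 e1 e2) -(actA e6 e5 e3 e4).
by rewrite (dmulC (erefl (p + q)) e6) act_zsignl zsignK.
Qed.

Section HAct.
Variable j : int.

Lemma cycact_subproof (a : cyc A 0) (x : cyc M j) :
  act (add0r j) (val a) (val x) \in @cocycle M j.
Proof.
apply: cocycleP => k e.
have e1 : 1 + j = k by rewrite addrC.
have e2 : 0 + k = k by rewrite add0r.
by rewrite (act_leibniz (add0r j) (add0r 1) e e e1 e2) !cycP act0l act0r zsign00 addr0.
Qed.

Definition cycact (a : cyc A 0) (x : cyc M j) : cyc M j :=
  Sub (act (add0r j) (val a) (val x)) (cycact_subproof a x).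

Definition hact (a : coh A 0) (x : coh M j) : coh M j :=
  hcls (cycact (hrep a) (hrep x)).

Lemma hactE a x : hact (hcls a) (hcls x) = hcls (cycact a x).
Proof.
have /hclsP[p [e [u au]]] := hrepK (hcls a).
have /hclsP[q [e' [v xv]]] := hrepK (hcls x).
have eq0 : 0 + q = q by rewrite add0r.
have ep : p + j = q by lia.
apply/hclsP; exists q, e', (act ep u (val (hrep (hcls x))) + act eq0 (val a) v).
rewrite /cycact !SubK cdD.
have e'' : p + (j + 1) = j by lia.
have e4 : 1 + q = j by lia.
rewrite (act_leibniz ep e (erefl (j + 1)) e' (add0r j) e'').
rewrite (act_leibniz eq0 (add0r 1) e' e' e4 (add0r j)).
rewrite !cycP act0l act0r zsign00 addr0 add0r zsign0.
by rewrite -au -xv actBl actBr addrA subrK.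
Qed.

Lemma hactDl (a b : coh A 0) x : hact (a + b) x = hact a x + hact b x.
Proof.
elim/hclsW: a => a; elim/hclsW: b => b; elim/hclsW: x => x.
rewrite -hclsD !hactE -hclsD.
by congr hcls; apply/val_inj; rewrite raddfD /= actDl.
Qed.

Lemma hactDr (a : coh A 0) x y : hact a (x + y) = hact a x + hact a y.
Proof.
elim/hclsW: a => a; elim/hclsW: x => x; elim/hclsW: y => y.
rewrite -hclsD !hactE -hclsD.
by congr hcls; apply/val_inj; rewrite raddfD /= actDr.
Qed.
End HAct.
End ModTheory.

(* [\bar A := H^0(A)]. *)
Definition barRing (A : cdgRing) : Type := coh A 0.
HB.instance Definition _ (A : cdgRing) := GRing.Zmodule.on (barRing A).

Section BarRing.
Variable A : cdgRing.
Implicit Types a b c : barRing A.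

Lemma unit_cocycle : dunit A \in @cocycle A 0.
Proof.
apply: cocycleP => j e; have ej : j = 1 by rewrite -e add0r.
by apply: dnonpos; rewrite ej.
Qed.

Definition bar1 : barRing A := hcls (Sub (dunit A) unit_cocycle : cyc A 0).
Definition bar_mul (a b : barRing A) : barRing A := hact (M := regMod A) a b.

Lemma bar_mulA : associative bar_mul.
Proof.
elim/hclsW=> a; elim/hclsW=> b; elim/hclsW=> c.
rewrite /bar_mul (hactE (M := regMod A) b c) (hactE (M := regMod A) a b) !hactE.
by congr hcls; apply/val_inj; rewrite /= (dmulA _ _ (add0r 0) (add0r 0)).
Qed.

Lemma bar_mulC : commutative bar_mul.
Proof.
elim/hclsW=> a; elim/hclsW=> b; rewrite /bar_mul !hactE.
by congr hcls; apply/val_inj; rewrite /= (dmulC (add0r 0)) mulr0 zsign0.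
Qed.

Lemma bar_mul1 : left_id bar1 bar_mul.
Proof.
elim/hclsW=> a; rewrite /bar_mul /bar1 hactE.
by congr hcls; apply/val_inj; rewrite /= dmul1l.
Qed.

Lemma bar_mulDl : left_distributive bar_mul +%R.
Proof. by move=> a b c; apply: (@hactDl A (regMod A)). Qed.

HB.instance Definition _ := GRing.Zmodule_isComPzRing.Build (barRing A)
  bar_mulA bar_mulC bar_mul1 bar_mulDl.
End BarRing.

(* [H^i(M)] as a module over [H^0(A)]. *)
Definition Hmod (A : cdgRing) (M : dgMod A) (i : int) : Type := coh M i.
HB.instance Definition _ (A : cdgRing) (M : dgMod A) i :=
  GRing.Zmodule.on (Hmod M i).

Section HModule.
Variables (A : cdgRing) (M : dgMod A) (i : int).

Definition hscale (a : barRing A) (x : Hmod M i) : Hmod M i := hact a x.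

Lemma hscaleA (a b : barRing A) x : hscale a (hscale b x) = hscale (a * b) x.
Proof.
elim/hclsW: a => a; elim/hclsW: b => b; elim/hclsW: x => x.
rewrite /GRing.mul /= /bar_mul /hscale (hactE b x) (hactE (M := regMod A) a b) !hactE.
by congr hcls; apply/val_inj; rewrite /= (actA _ _ (add0r i) (add0r i)).
Qed.

Lemma hscale1 x : hscale 1 x = x.
Proof.
elim/hclsW: x => x; rewrite /hscale hactE.
by congr hcls; apply/val_inj; rewrite /= act1.
Qed.

Lemma hscaleDr : right_distributive hscale +%R.
Proof. by move=> a x y; apply: hactDr. Qed.

Lemma hscaleDl x : {morph hscale^~ x : a b / a + b}.
Proof. by move=> a b; apply: hactDl. Qed.

HB.instance Definition _ := GRing.Zmodule_isLmodule.Build (barRing A) (Hmod M i)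
  hscaleA hscale1 hscaleDr hscaleDl.
End HModule.

Definition acyclic (C : cpx) : Prop := forall i (x : coh C i), x = 0.

Definition quasi_iso (A : cdgRing) (M N : dgMod A) (f : dgHom M N) : Prop :=
  forall i, bijective (cohmap f (i := i)).

Local Obligation Tactic := idtac.

Section HomComplex.
Variables (A : cdgRing) (M N : dgMod A).

(* Homomorphisms of degree [n] that are linear over the graded ring           *)
(* underlying [A], not necessarily commuting with the differentials.          *)
Record hom (n : int) := Hom {
  hfun :> forall i j, i + n = j -> M i -> N j;
  homD : forall i j (e : i + n = j), {morph hfun e : x y / x + y};
  hom_act : forall p i k j l (e : p + i = k) (ej : i + n = j) (el : k + n = l)
      (e' : p + j = l) (a : A p) (m : M i),
    hfun el (act e a m) = zsign (p * n) (act e' a (hfun ej m)) }.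

Section Degree.
Variable n : int.
Implicit Types f g h : hom n.

Lemma hom_ext f g : (forall i j (e : i + n = j) m, f i j e m = g i j e m) -> f = g.
Proof.
case: f g => f fD fa [g gD ga] /= fg.
have {fg} E : f = g.
  apply: functional_extensionality_dep => i.
  apply: functional_extensionality_dep => j.
  apply: functional_extensionality_dep => e.
  by apply: functional_extensionality_dep => m.
by subst g; congr Hom; apply: Prop_irrelevance.
Qed.

HB.instance Definition _ := gen_eqMixin (hom n).
HB.instance Definition _ := gen_choiceMixin (hom n).

Program Definition hom0 : hom n := @Hom n (fun _ _ _ _ => 0) _ _.
Next Obligation. by move=> i j e x y /=; rewrite addr0. Qed.
Next Obligation. by move=> *; rewrite act0r zsign00. Qed.

Program Definition homN f : hom n := @Hom n (fun i j e m => - f i j e m) _ _.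
Next Obligation. by move=> f i j e x y /=; rewrite homD opprD. Qed.
Next Obligation.
by move=> f p i k j l e ej el e' a m /=; rewrite (hom_act _ e ej el e') actNr zsignN.
Qed.

Program Definition homDD f g : hom n :=
  @Hom n (fun i j e m => f i j e m + g i j e m) _ _.
Next Obligation. by move=> f g i j e x y; rewrite !homD addrACA. Qed.
Next Obligation.
move=> f g p i k j l e ej el e' a m /=.
by rewrite !(hom_act _ e ej el e') actDr zsign_addr.
Qed.

Lemma homDDA : associative homDD.
Proof. by move=> f g h; apply: hom_ext => * /=; rewrite addrA. Qed.
Lemma homDDC : commutative homDD.
Proof. by move=> f g; apply: hom_ext => * /=; rewrite addrC. Qed.
Lemma hom0D : left_id hom0 homDD.
Proof. by move=> f; apply: hom_ext => * /=; rewrite add0r. Qed.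
Lemma homND : left_inverse hom0 homN homDD.
Proof. by move=> f; apply: hom_ext => * /=; rewrite addNr. Qed.

HB.instance Definition _ := GRing.isZmodule.Build (hom n) homDDA homDDC hom0D homND.
End Degree.

Section Differential.
Variables (n n' : int) (en : n + 1 = n').

Lemma homd_e1 (i j : int) : i + n' = j -> i + n + 1 = j. Proof. lia. Qed.
Lemma homd_e2 (i j : int) : i + n' = j -> i + 1 + n = j. Proof. lia. Qed.

(* [d(f) = d o f - (-1)^n f o d]. *)
Definition homd_fun (f : hom n) i j (e : i + n' = j) (m : M i) : N j :=
  cd (homd_e1 e) (f i (i + n) erefl m)
    - zsign n (f (i + 1) j (homd_e2 e) (cd erefl m)).

Lemma homd_funE (f : hom n) i i' j j' (e : i + n' = j) (ei : i + 1 = i')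
    (ej : i + n = j') (e1 : j' + 1 = j) (e2 : i' + n = j) m :
  homd_fun f e m = cd e1 (f i j' ej m) - zsign n (f i' j e2 (cd ei m)).
Proof.
subst i' j'; rewrite /homd_fun.
by rewrite (Prop_irrelevance (homd_e1 e) e1) (Prop_irrelevance (homd_e2 e) e2).
Qed.

Program Definition homd (f : hom n) : hom n' := @Hom n' (homd_fun f) _ _.
Next Obligation.
move=> f i j e x y /=; rewrite /homd_fun !cdD !homD cdD zsign_addr.
by rewrite opprD addrACA.
Qed.
Next Obligation.
move=> f p i k j l e ej el e' a m /=.
have e1 : i + n = i + n by [].
have e3 : p + i + n = p + (i + n) by lia.
subst k.
have e4 : p + (i + n) + 1 = l by lia.
have e5 : p + i + 1 + n = l by lia.
rewrite (homd_funE f el (erefl (p + i + 1)) e3 e4 e5).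
have e6 : i + n + 1 = j by lia.
have e7 : i + 1 + n = j by lia.
rewrite (homd_funE f ej (erefl (i + 1)) e1 e6 e7).
rewrite (hom_act f (erefl (p + i)) e1 e3 (erefl (p + (i + n)))).
have f1 : (p + 1) + i = p + i + 1 by lia.
have f2 : p + (i + 1) = p + i + 1 by lia.
rewrite (act_leibniz (erefl (p + i)) (erefl (p + 1)) (erefl (i + 1)) (erefl (p + i + 1)) f1 f2).
have g1 : (p + 1) + (i + n) = l by lia.
rewrite homD (hom_act f f1 e1 e5 g1).
rewrite (morphD_zsign (@homD n f _ _ e5)) (hom_act f f2 e7 e5 e').
rewrite (morphD_zsign (@cdD _ _ _ _)).
rewrite (act_leibniz (erefl (p + (i + n))) (erefl (p + 1)) e6 e4 g1 e').
rewrite actBr act_zsignr.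
move: (act g1 _ _) (act e' a (cd _ _)) (act e' a (f _ _ _ _)) => X Y Z.
rewrite !zsign_addr !zsignN -!zsignD.
rewrite /zsign !(odd_abszD, odd_abszM) -en !(odd_abszD, odd_abszM) /=.
case: (odd (absz p)); case: (odd (absz n)) => /=;
  rewrite ?opprK ?opprD ?opprK ?addrA;
  by congr (_ + _); rewrite addrAC ?subrr ?addNr add0r.
Qed.
End Differential.

Lemma homd_addr n n' (en : n + 1 = n') : {morph homd en : f g / f + g}.
Proof.
move=> f g; apply: hom_ext => i j e m /=.
by rewrite /homd_fun /= cdD zsign_addr opprD addrACA.
Qed.

Lemma homdd n n' n'' (e : n + 1 = n') (e' : n' + 1 = n'') f :
  homd e' (homd e f) = 0.
Proof.
apply: hom_ext => i j ej m.
have -> : (0 : hom n'') i j ej m = 0 by [].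
have h1 : i + n' = i + n + 1 by lia.
have h2 : i + n + 1 + 1 = j by lia.
have h3 : i + 1 + n' = j by lia.
rewrite [LHS](homd_funE e' (homd e f) ej (erefl (i + 1)) h1 h2 h3) /=.
have h4 : i + 1 + n = i + n + 1 by lia.
rewrite (homd_funE e f h1 (erefl (i + 1)) (erefl (i + n)) (erefl _) h4).
have h5 : i + 1 + 1 + n = j by lia.
rewrite (homd_funE e f h3 (erefl (i + 1 + 1)) h4 h2 h5).
rewrite (morphDB (cdD _)) !cdd (morphD0 (@homD n f _ _ _)) zsign00 subr0 sub0r.
rewrite -e zsignD zsign1 (morphD_zsign (cdD _)).
by rewrite zsignN opprK addNr.
Qed.

Definition homc : cpx := @Cpx (fun n => hom n) homd homd_addr homdd.

Lemma homa_e (p n k i j : int) : p + n = k -> i + k = j -> p + (i + n) = j.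
Proof. lia. Qed.

(* [(a f)(m) = a (f m)]. *)
Definition homa_fun p n k (e : p + n = k) (a : A p) (f : hom n) i j
    (ej : i + k = j) (m : M i) : N j :=
  act (homa_e e ej) a (f i (i + n) erefl m).

Lemma homa_funE p n k (e : p + n = k) (a : A p) (f : hom n) i j j'
    (ej : i + k = j) (e1 : i + n = j') (e2 : p + j' = j) m :
  homa_fun e a f ej m = act e2 a (f i j' e1 m).
Proof. by subst j'; rewrite /homa_fun (Prop_irrelevance (homa_e e ej) e2). Qed.

Program Definition homa p n k (e : p + n = k) (a : A p) (f : hom n) : hom k :=
  @Hom k (homa_fun e a f) _ _.
Next Obligation.
by move=> p n k e a f i j ej x y; rewrite /homa_fun homD actDr.
Qed.
Next Obligation.
move=> p n k e a f q i r j l er ej el e' b m.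
have h1 : r + n = q + (i + n) by lia.
have h2 : p + (q + (i + n)) = l by lia.
have h3 : p + (i + n) = j by lia.
rewrite (homa_funE e a f el h1 h2) (homa_funE e a f ej (erefl (i + n)) h3).
rewrite (hom_act f er (erefl (i + n)) h1 (erefl (q + (i + n)))).
rewrite act_zsignr (actAC (erefl (q + (i + n))) h2 h3 e') -zsignD.
by rewrite -e mulrDr addrC (mulrC p q).
Qed.

Lemma homaDl i j k (e : i + j = k) a b f :
  homa e (a + b) f = homa e a f + homa e b f.
Proof. by apply: hom_ext => * /=; rewrite /homa_fun actDl. Qed.

Lemma homaDr i j k (e : i + j = k) a f g :
  homa e a (f + g) = homa e a f + homa e a g.
Proof. by apply: hom_ext => * /=; rewrite /homa_fun /= actDr. Qed.

Lemma homaA i j k ij jk ijk (e1 : i + j = ij) (e2 : ij + k = ijk)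
    (e3 : j + k = jk) (e4 : i + jk = ijk) a b f :
  homa e2 (dmul e1 a b) f = homa e4 a (homa e3 b f).
Proof.
apply: hom_ext => p q eq m /=.
have h1 : ij + (p + k) = q by lia.
have h2 : i + (p + jk) = q by lia.
have h3 : j + (p + k) = p + jk by lia.
rewrite (homa_funE e2 _ f eq (erefl (p + k)) h1).
rewrite (homa_funE e4 a _ eq (erefl (p + jk)) h2) /=.
rewrite (homa_funE e3 b f (erefl (p + jk)) (erefl (p + k)) h3).
exact: actA.
Qed.

Lemma homa1 i (e : 0 + i = i) f : homa e (dunit A) f = f.
Proof.
apply: hom_ext => p q eq m /=.
have h : 0 + q = q by rewrite add0r.
by rewrite (homa_funE e _ f eq eq h) act1.
Qed.

Lemma homa_leibniz i j k i' j' k' (e : i + j = k)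
    (ei : i + 1 = i') (ej : j + 1 = j') (ek : k + 1 = k')
    (e1 : i' + j = k') (e2 : i + j' = k') a f :
  homd ek (homa e a f)
    = homa e1 (cd ei a) f + zsign i (homa e2 a (homd ej f)).
Proof.
apply: hom_ext => p q eq m.
have -> : (homa e1 (cd ei a) f + zsign i (homa e2 a (homd ej f))) p q eq m
    = homa e1 (cd ei a) f p q eq m + zsign i (homa e2 a (homd ej f) p q eq m).
  by rewrite /zsign; case: (odd _).
rewrite /=.
have h1 : p + k + 1 = q by lia.
have h2 : p + 1 + k = q by lia.
rewrite (homd_funE ek (homa e a f) eq (erefl (p + 1)) (erefl (p + k)) h1 h2) /=.
have h3 : i + (p + j) = p + k by lia.
have h4 : i' + (p + j) = q by lia.
have h5 : p + j' = p + j + 1 by lia.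
have h6 : i + (p + j + 1) = q by lia.
have h7 : p + 1 + j = p + j + 1 by lia.
rewrite (homa_funE e a f (erefl (p + k)) (erefl (p + j)) h3).
rewrite (homa_funE e a f h2 h7 h6).
rewrite (homa_funE e1 _ f eq (erefl (p + j)) h4).
rewrite (homa_funE e2 a _ eq h5 h6) /=.
rewrite (homd_funE ej f h5 (erefl (p + 1)) (erefl (p + j)) (erefl _) h7).
rewrite (act_leibniz h3 ei (erefl (p + j + 1)) h1 h4 h6).
by rewrite actBr act_zsignr (morphDB (zsign_addr i)) -zsignD e addrA.
Qed.

Definition Homdg : dgMod A :=
  @DGMod A homc homa homaDl homaDr homaA homa1 homa_leibniz.
End HomComplex.

Section Tensor.
Variables (A : cdgRing) (M N : dgMod A).

(* The degree [k] part of [M (x)_A N], presented by the generators [m (x) n]  *)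
(* and the relations of biadditivity and [m a (x) n = m (x) a n], where       *)
(* [m a := (-1)^(|a||m|) a m].                                                *)
Inductive texp (k : int) : Type :=
| TPure i j of i + j = k & M i & N j
| TZero
| TOpp of texp k
| TAdd of texp k & texp k.

Inductive trel (k : int) : texp k -> texp k -> Prop :=
| trel_refl t : trel t t
| trel_sym t u : trel t u -> trel u t
| trel_trans t u v : trel t u -> trel u v -> trel t v
| trel_opp t u : trel t u -> trel (TOpp t) (TOpp u)
| trel_add t u t' u' : trel t u -> trel t' u' -> trel (TAdd t t') (TAdd u u')
| trel_addA t u v : trel (TAdd t (TAdd u v)) (TAdd (TAdd t u) v)
| trel_addC t u : trel (TAdd t u) (TAdd u t)
| trel_add0 t : trel (TAdd (TZero k) t) t
| trel_addN t : trel (TAdd (TOpp t) t) (TZero k)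
| trel_pureDl i j (e : i + j = k) m m' n :
    trel (TPure e (m + m') n) (TAdd (TPure e m n) (TPure e m' n))
| trel_pureDr i j (e : i + j = k) m n n' :
    trel (TPure e m (n + n')) (TAdd (TPure e m n) (TPure e m n'))
| trel_balanced i p j pi pj (e1 : p + i = pi) (e2 : p + j = pj)
    (e : pi + j = k) (e' : i + pj = k) m a n :
    trel (TPure e (zsign (p * i) (act e1 a m)) n) (TPure e' m (act e2 a n)).

HB.instance Definition _ k := gen_eqMixin (texp k).
HB.instance Definition _ k := gen_choiceMixin (texp k).

Section Degree.
Variable k : int.

Definition treqb (t u : texp k) : bool := `[< trel t u >].

Lemma treqb_equiv : equiv_class_of treqb.
Proof.
split.
- by move=> t; apply/asboolP; apply: trel_refl.
- by move=> t u; apply/asboolP/asboolP; apply: trel_sym.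
- by move=> u t v /asboolP tu /asboolP uv; apply/asboolP; apply: trel_trans tu uv.
Qed.

Canonical treqb_rel := EquivRelPack treqb_equiv.

Definition tens : Type := {eq_quot treqb_rel}.
HB.instance Definition _ := Choice.on tens.

Definition tcls (t : texp k) : tens := \pi_({eq_quot treqb_rel}) t.
Definition trep (x : tens) : texp k := repr (x : {eq_quot treqb_rel}).

Lemma tclsP t u : tcls t = tcls u <-> trel t u.
Proof.
split=> [/eqmodP/asboolP //|tu].
by apply/eqmodP/asboolP.
Qed.

Lemma tclsW (P : tens -> Prop) : (forall t, P (tcls t)) -> forall x : tens, P x.
Proof. by move=> h x; rewrite -[x]reprK; apply: h. Qed.

Lemma trepP t : trel (trep (tcls t)) t.
Proof. by apply/tclsP; apply: reprK. Qed.

Definition tens0 : tens := tcls (TZero k).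
Definition tensN (x : tens) : tens := tcls (TOpp (trep x)).
Definition tensD (x y : tens) : tens := tcls (TAdd (trep x) (trep y)).

Lemma tensNE t : tensN (tcls t) = tcls (TOpp t).
Proof. by apply/tclsP; apply/trel_opp/trepP. Qed.
Lemma tensDE t u : tensD (tcls t) (tcls u) = tcls (TAdd t u).
Proof. by apply/tclsP; apply: trel_add; apply: trepP. Qed.

Lemma tensDA : associative tensD.
Proof.
elim/tclsW=> t; elim/tclsW=> u; elim/tclsW=> v.
rewrite (tensDE u v) (tensDE t u) (tensDE t (TAdd u v)) tensDE.
by apply/tclsP; apply: trel_addA.
Qed.
Lemma tensDC : commutative tensD.
Proof.
elim/tclsW=> t; elim/tclsW=> u; rewrite (tensDE t u) (tensDE u t).
by apply/tclsP; apply: trel_addC.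
Qed.
Lemma tens0D : left_id tens0 tensD.
Proof.
elim/tclsW=> t; rewrite /tens0 tensDE.
by apply/tclsP; apply: trel_add0.
Qed.
Lemma tensND : left_inverse tens0 tensN tensD.
Proof.
elim/tclsW=> t; rewrite (tensNE t) tensDE.
by apply/tclsP; apply: trel_addN.
Qed.

HB.instance Definition _ := GRing.isZmodule.Build tens tensDA tensDC tens0D tensND.

Definition pure i j (e : i + j = k) (m : M i) (n : N j) : tens := tcls (TPure e m n).

Lemma pureDl i j (e : i + j = k) n : {morph (fun m : M i => pure e m n) : x y / x + y}.
Proof.
move=> x y; rewrite [RHS](tensDE (TPure e x n) (TPure e y n)).
by apply/tclsP; apply: trel_pureDl.
Qed.

Lemma pureDr i j (e : i + j = k) m : {morph (fun n : N j => pure e m n) : x y / x + y}.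
Proof.
move=> x y; rewrite [RHS](tensDE (TPure e m x) (TPure e m y)).
by apply/tclsP; apply: trel_pureDr.
Qed.

Lemma pure_balanced i p j pi pj (e1 : p + i = pi) (e2 : p + j = pj)
    (e : pi + j = k) (e' : i + pj = k) m a n :
  pure e (zsign (p * i) (act e1 a m)) n = pure e' m (act e2 a n).
Proof. by apply/tclsP; apply: trel_balanced. Qed.

Lemma tens_ext (V : zmodType) (f g : tens -> V) :
  {morph f : x y / x + y} -> {morph g : x y / x + y} ->
  (forall i j (e : i + j = k) m n, f (pure e m n) = g (pure e m n)) -> f =1 g.
Proof.
move=> fD gD fg; elim/tclsW; elim=> [i j e m n||t IH|t IHt u IHu].
- exact: fg.
- by rewrite (morphD0 fD : f (tcls _) = 0) (morphD0 gD : g (tcls _) = 0).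
- rewrite -(tensNE t).
  by rewrite (morphDN fD (tcls t) : f (tensN _) = _) (morphDN gD (tcls t) : g (tensN _) = _) IH.
- rewrite -(tensDE t u).
  by rewrite (fD (tcls t) (tcls u) : f (tensD _ _) = _) (gD (tcls t) (tcls u) : g (tensD _ _) = _) IHt IHu.
Qed.

Section Lift.
Variables (V : zmodType) (f : forall i j, i + j = k -> M i -> N j -> V).

Record balanced : Prop := Balanced {
  balancedDl : forall i j (e : i + j = k) n, {morph (fun m => f e m n) : x y / x + y};
  balancedDr : forall i j (e : i + j = k) m, {morph (fun n => f e m n) : x y / x + y};
  balancedA : forall i p j pi pj (e1 : p + i = pi) (e2 : p + j = pj)
    (e : pi + j = k) (e' : i + pj = k) (m : M i) (a : A p) (n : N j),
    f e (zsign (p * i) (act e1 a m)) n = f e' m (act e2 a n) }.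

Fixpoint teval (t : texp k) : V :=
  match t with
  | TPure _ _ e m n => f e m n
  | TZero => 0
  | TOpp t => - teval t
  | TAdd t u => teval t + teval u
  end.

Definition tlift (x : tens) : V := teval (trep x).

Hypothesis fb : balanced.

Lemma teval_rel t u : trel t u -> teval t = teval u.
Proof.
elim=> {t u} //=.
- by move=> t u v _ -> _ ->.
- by move=> t u _ ->.
- by move=> t u t' u' _ -> _ ->.
- by move=> t u v; rewrite addrA.
- by move=> t u; rewrite addrC.
- by move=> t; rewrite add0r.
- by move=> t; rewrite addNr.
- by move=> i j e m m' n; rewrite (balancedDl fb).
- by move=> i j e m n n'; rewrite (balancedDr fb).
- by move=> *; apply: (balancedA fb).
Qed.

Lemma tliftE t : tlift (tcls t) = teval t.
Proof. by apply: teval_rel; apply: trepP. Qed.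

Lemma tlift_pure i j (e : i + j = k) m n : tlift (pure e m n) = f e m n.
Proof. exact: tliftE. Qed.

Lemma tliftD : {morph tlift : x y / x + y}.
Proof.
elim/tclsW=> t; elim/tclsW=> u.
by rewrite (tliftE t) (tliftE u) -[tcls t + tcls u]/(tensD _ _) tensDE tliftE.
Qed.
End Lift.
End Degree.

Lemma pure_zsignl k i j (e : i + j = k) p m n :
  pure e (zsign p m) n = zsign p (pure e m n).
Proof. exact: (morphD_zsign (pureDl e n)). Qed.
Lemma pure_zsignr k i j (e : i + j = k) p m n :
  pure e m (zsign p n) = zsign p (pure e m n).
Proof. exact: (morphD_zsign (pureDr e m)). Qed.

Section Differential.
Variables (k k' : int) (ek : k + 1 = k').

Lemma tensd_e1 (i j : int) : i + j = k -> i + 1 + j = k'. Proof. lia. Qed.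
Lemma tensd_e2 (i j : int) : i + j = k -> i + (j + 1) = k'. Proof. lia. Qed.

(* [d(m (x) n) = d m (x) n + (-1)^|m| m (x) d n]. *)
Definition tensd_pure i j (e : i + j = k) (m : M i) (n : N j) : tens k' :=
  pure (tensd_e1 e) (cd erefl m) n + zsign i (pure (tensd_e2 e) m (cd erefl n)).

Lemma tensd_pureE i j i' j' (e : i + j = k) (ei : i + 1 = i') (ej : j + 1 = j')
    (e1 : i' + j = k') (e2 : i + j' = k') m n :
  tensd_pure e m n = pure e1 (cd ei m) n + zsign i (pure e2 m (cd ej n)).
Proof.
subst i' j'; rewrite /tensd_pure.
by rewrite (Prop_irrelevance (tensd_e1 e) e1) (Prop_irrelevance (tensd_e2 e) e2).
Qed.

Lemma tensd_balanced : balanced tensd_pure.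
Proof.
split.
- move=> i j e n x y; rewrite /tensd_pure cdD !pureDl zsign_addr.
  by rewrite addrACA.
- move=> i j e n x y; rewrite /tensd_pure cdD !pureDr zsign_addr.
  by rewrite addrACA.
move=> i p j pi pj e1 e2 e e' m a n.
have h1 : pi + 1 + j = k' by lia.
have h2 : pi + (j + 1) = k' by lia.
have h3 : i + 1 + pj = k' by lia.
have h4 : i + (pj + 1) = k' by lia.
rewrite (tensd_pureE e erefl erefl h1 h2) (tensd_pureE e' erefl erefl h3 h4).
have f1 : p + 1 + i = pi + 1 by lia.
have f2 : p + (i + 1) = pi + 1 by lia.
have f3 : p + 1 + j = pj + 1 by lia.
have f4 : p + (j + 1) = pj + 1 by lia.
rewrite (morphD_zsign (cdD _)).
rewrite (act_leibniz e1 (erefl (p + 1)) (erefl (i + 1)) (erefl (pi + 1)) f1 f2).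
rewrite (act_leibniz e2 (erefl (p + 1)) (erefl (j + 1)) (erefl (pj + 1)) f3 f4).
rewrite zsign_addr pureDl pureDr !zsign_addr.
rewrite pure_zsignr.
have E1 := pure_balanced f1 f3 h1 h4 m (cd (erefl (p + 1)) a) n.
have E2 := pure_balanced f2 e2 h1 h3 (cd (erefl (i + 1)) m) a n.
have E3 := pure_balanced e1 f4 h2 h4 m a (cd (erefl (j + 1)) n).
rewrite -E1 -E2 -E3 !pure_zsignl -!zsignD.
move: (pure _ _ _) (pure _ _ _) (pure _ _ _) => X Y Z.
rewrite addrCA addrA; congr (_ + _ + _).
- rewrite /zsign -?e1 !(odd_abszD, odd_abszM) /=.
  by case: (odd (absz p)); case: (odd (absz i)).
- rewrite /zsign !(odd_abszD, odd_abszM) /=.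
  by case: (odd (absz p)); case: (odd (absz i)).
rewrite /zsign -?e1 !(odd_abszD, odd_abszM) /=.
by case: (odd (absz p)); case: (odd (absz i)).
Qed.

Definition tensd : tens k -> tens k' := tlift tensd_pure.

Lemma tensd_addr : {morph tensd : x y / x + y}.
Proof. exact: tliftD tensd_balanced. Qed.

Lemma tensdE i j i' j' (e : i + j = k) (ei : i + 1 = i') (ej : j + 1 = j')
    (e1 : i' + j = k') (e2 : i + j' = k') m n :
  tensd (pure e m n) = pure e1 (cd ei m) n + zsign i (pure e2 m (cd ej n)).
Proof. by rewrite -tensd_pureE; apply: (tlift_pure tensd_balanced). Qed.
End Differential.

Lemma tensdd k k' k'' (e : k + 1 = k') (e' : k' + 1 = k'') x :
  tensd e' (tensd e x) = 0.
Proof.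
apply: (@tens_ext _ _ (fun x => tensd e' (tensd e x)) (fun=> 0)) x.
- by move=> x y; rewrite !tensd_addr.
- by move=> x y; rewrite addr0.
move=> i j e0 m n.
have h1 : i + 1 + j = k' by lia.
have h2 : i + (j + 1) = k' by lia.
rewrite (tensdE e e0 erefl erefl h1 h2) tensd_addr.
rewrite (morphD_zsign (tensd_addr e')).
have h3 : i + 1 + 1 + j = k'' by lia.
have h4 : i + 1 + (j + 1) = k'' by lia.
have h5 : i + (j + 1 + 1) = k'' by lia.
rewrite (tensdE e' h1 erefl erefl h3 h4) (tensdE e' h2 erefl erefl h4 h5).
rewrite !cdd (morphD0 (pureDl h3 n)) (morphD0 (pureDr h5 m)) zsign00 addr0 add0r.
by rewrite zsignD zsign1 zsignN addNr.
Qed.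

Definition tensc : cpx := @Cpx (fun k => tens k) tensd tensd_addr tensdd.

Section Action.
Variables (p k q : int) (e : p + k = q) (a : A p).

Lemma tensa_e (i j : int) : i + j = k -> p + i + j = q. Proof. lia. Qed.

(* [a (m (x) n) = a m (x) n]. *)
Definition tensa_pure i j (e0 : i + j = k) (m : M i) (n : N j) : tens q :=
  pure (tensa_e e0) (act erefl a m) n.

Lemma tensa_pureE i j i' (e0 : i + j = k) (e1 : p + i = i') (e2 : i' + j = q) m n :
  tensa_pure e0 m n = pure e2 (act e1 a m) n.
Proof.
by subst i'; rewrite /tensa_pure (Prop_irrelevance (tensa_e e0) e2).
Qed.

Lemma tensa_balanced : balanced tensa_pure.
Proof.
split.
- by move=> i j e0 n x y; rewrite /tensa_pure actDr pureDl.
- by move=> i j e0 n x y; rewrite /tensa_pure pureDr.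
move=> i r j ri rj e1 e2 e0 e' m b n.
have h1 : p + ri + j = q by lia.
have h2 : p + i + rj = q by lia.
rewrite (tensa_pureE e0 erefl h1) (tensa_pureE e' erefl h2).
have h3 : r + (p + i) = p + ri by lia.
rewrite -(pure_balanced h3 e2 h1 h2) act_zsignr.
rewrite (actAC e1 (erefl (p + ri)) (erefl (p + i)) h3) -zsignD.
congr (pure h1 (zsign _ _) n).
by rewrite mulrDr addrC (mulrC p r).
Qed.

Definition tensa : tens k -> tens q := tlift tensa_pure.

Lemma tensa_addr : {morph tensa : x y / x + y}.
Proof. exact: tliftD tensa_balanced. Qed.

Lemma tensaE i j i' (e0 : i + j = k) (e1 : p + i = i') (e2 : i' + j = q) m n :
  tensa (pure e0 m n) = pure e2 (act e1 a m) n.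
Proof. by rewrite -(tensa_pureE e0); apply: (tlift_pure tensa_balanced). Qed.
End Action.

Lemma tensaDl i j k (e : i + j = k) a b x :
  tensa e (a + b) x = tensa e a x + tensa e b x.
Proof.
apply: (@tens_ext _ _ (tensa e (a + b)) (fun x => tensa e a x + tensa e b x)) x.
- exact: tensa_addr.
- by move=> x y; rewrite !tensa_addr addrACA.
move=> p q e0 m n; have h : i + p + q = k by lia.
by rewrite !(tensaE e _ e0 erefl h) actDl pureDl.
Qed.

Lemma tensaDr i j k (e : i + j = k) a x y :
  tensa e a (x + y) = tensa e a x + tensa e a y.
Proof. exact: tensa_addr. Qed.

Lemma tensaA i j k ij jk ijk (e1 : i + j = ij) (e2 : ij + k = ijk)
    (e3 : j + k = jk) (e4 : i + jk = ijk) a b x :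
  tensa e2 (dmul e1 a b) x = tensa e4 a (tensa e3 b x).
Proof.
apply: (@tens_ext _ _ (tensa e2 (dmul e1 a b)) (fun x => tensa e4 a (tensa e3 b x))) x.
- exact: tensa_addr.
- by move=> x y; rewrite !tensa_addr.
move=> p q e0 m n.
have h1 : j + p + q = jk by lia.
have h2 : ij + p + q = ijk by lia.
have h3 : i + (j + p) = ij + p by lia.
rewrite (tensaE e2 _ e0 erefl h2) (tensaE e3 _ e0 erefl h1) (tensaE e4 _ h1 h3 h2).
by rewrite (actA e1 erefl erefl h3).
Qed.

Lemma tensa1 i (e : 0 + i = i) x : tensa e (dunit A) x = x.
Proof.
apply: (@tens_ext _ _ (tensa e (dunit A)) id) x => //; first exact: tensa_addr.
by move=> p q e0 m n; rewrite (tensaE e _ e0 (add0r p) e0) act1.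
Qed.

Lemma tensa_leibniz i j k i' j' k' (e : i + j = k)
    (ei : i + 1 = i') (ej : j + 1 = j') (ek : k + 1 = k')
    (e1 : i' + j = k') (e2 : i + j' = k') a x :
  tensd ek (tensa e a x)
    = tensa e1 (cd ei a) x + zsign i (tensa e2 a (tensd ej x)).
Proof.
apply: (@tens_ext _ _ (fun x => tensd ek (tensa e a x))
  (fun x => tensa e1 (cd ei a) x + zsign i (tensa e2 a (tensd ej x)))) x.
- by move=> x y; rewrite tensa_addr tensd_addr.
- by move=> x y; rewrite tensd_addr !tensa_addr zsign_addr addrACA.
move=> p q e0 m n.
have h1 : i + p + q = k by lia.
have h2 : i + p + 1 + q = k' by lia.
have h3 : i + p + (q + 1) = k' by lia.
have h4 : i' + p = i + p + 1 by lia.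
have h5 : i + (p + 1) = i + p + 1 by lia.
have h6 : p + 1 + q = j' by lia.
have h7 : p + (q + 1) = j' by lia.
rewrite (tensaE e _ e0 erefl h1) (tensdE ek h1 erefl erefl h2 h3).
rewrite (tensaE e1 _ e0 h4 h2) (tensdE ej e0 erefl erefl h6 h7).
rewrite tensa_addr (morphD_zsign (tensa_addr e2 a)).
rewrite (tensaE e2 a h6 h5 h2) (tensaE e2 a h7 erefl h3).
rewrite (act_leibniz erefl ei (erefl (p + 1)) erefl h4 h5).
by rewrite pureDl pure_zsignl zsign_addr -zsignD addrA.
Qed.

Definition tensor : dgMod A :=
  @DGMod A tensc tensa tensaDl tensaDr tensaA tensa1 tensa_leibniz.
End Tensor.

Section Morphisms.
Variable A : cdgRing.

Definition dg_id (M : dgMod A) : dgHom M M :=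
  @DGHom A M M (@CMap M M (fun _ x => x) (fun _ _ _ => erefl)
    (fun _ _ _ _ => erefl)) (fun _ _ _ _ _ _ => erefl).

Program Definition dg_comp (M N P : dgMod A) (g : dgHom N P) (f : dgHom M N) :
    dgHom M P :=
  @DGHom A M P (@CMap M P (fun i x => g i (f i x)) _ _) _.
Next Obligation. by move=> M N P g f i x y /=; rewrite !cmD. Qed.
Next Obligation. by move=> M N P g f i j e x /=; rewrite !cm_d. Qed.
Next Obligation. by move=> M N P g f i j k e a m /=; rewrite !dgh_act. Qed.

(* The derived category [D(A)], as the localization of the category of DG     *)
(* modules at the quasi-isomorphisms: [dmor M N] is the type of formal        *)
(* composites of morphisms and of inverses of quasi-isomorphisms, and [deq]   *)
(* is equality of such composites in [D(A)].                                  *)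
Inductive dmor : dgMod A -> dgMod A -> Type :=
| DId M : dmor M M
| DComp M N P : dmor N P -> dmor M N -> dmor M P
| DOf M N : dgHom M N -> dmor M N
| DInv M N (s : dgHom M N) : quasi_iso s -> dmor N M.

Inductive deq : forall M N, dmor M N -> dmor M N -> Prop :=
| deq_refl M N (f : dmor M N) : deq f f
| deq_sym M N (f g : dmor M N) : deq f g -> deq g f
| deq_trans M N (f g h : dmor M N) : deq f g -> deq g h -> deq f h
| deq_comp M N P (g g' : dmor N P) (f f' : dmor M N) :
    deq g g' -> deq f f' -> deq (DComp g f) (DComp g' f')
| deq_assoc M N P Q (h : dmor P Q) (g : dmor N P) (f : dmor M N) :
    deq (DComp h (DComp g f)) (DComp (DComp h g) f)
| deq_idl M N (f : dmor M N) : deq (DComp (DId N) f) f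
| deq_idr M N (f : dmor M N) : deq (DComp f (DId M)) f
| deq_of_id M : deq (DOf (dg_id M)) (DId M)
| deq_of_comp M N P (g : dgHom N P) (f : dgHom M N) :
    deq (DOf (dg_comp g f)) (DComp (DOf g) (DOf f))
| deq_invl M N (s : dgHom M N) (hs : quasi_iso s) :
    deq (DComp (DInv hs) (DOf s)) (DId M)
| deq_invr M N (s : dgHom M N) (hs : quasi_iso s) :
    deq (DComp (DOf s) (DInv hs)) (DId N).

Definition d_isom (M N : dgMod A) (f : dmor M N) : Prop :=
  exists g : dmor N M, deq (DComp g f) (DId M) /\ deq (DComp f g) (DId N).

Definition dIso (M N : dgMod A) : Prop := exists f : dmor M N, d_isom f.

Definition K_projective (P : dgMod A) : Prop :=
  forall N : dgMod A, acyclic N -> acyclic (Homdg P N).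

Definition K_flat (P : dgMod A) : Prop :=
  forall N : dgMod A, acyclic N -> acyclic (tensor P N).

(* [is_Ltensor M N T] : the object [M (x)^L_A N] of [D(A)] is isomorphic to   *)
(* [T]; the derived tensor product is computed by a K-flat resolution of [M]. *)
Definition is_Ltensor (M N T : dgMod A) : Prop :=
  exists (P : dgMod A) (s : dgHom P M),
    [/\ K_flat P, quasi_iso s & dIso (tensor P N) T].

(* [is_RHom M N T] : the object [RHom_A(M, N)] of [D(A)] is isomorphic to     *)
(* [T]; it is computed by a K-projective resolution of [M].                   *)
Definition is_RHom (M N T : dgMod A) : Prop :=
  exists (P : dgMod A) (s : dgHom P M),
    [/\ K_projective P, quasi_iso s & dIso (Homdg P N) T].

Section Homothety.
Variables (P R : dgMod A) (s : dgHom P R).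

Program Definition homothety_hom n (a : A n) : hom P R n :=
  @Hom A P R n (fun i j e p => act (etrans (addrC n i) e) a (s i p)) _ _.
Next Obligation. by move=> n a i j e x y /=; rewrite cmD actDr. Qed.
Next Obligation.
move=> n a p i k j l e ej el e' b m /=; rewrite dgh_act.
by rewrite (actAC e _ (etrans (addrC n i) ej) e') mulrC.
Qed.

(* [a |-> (p |-> a s(p))].  When [s : P -> R] is a K-projective resolution,   *)
(* this is the morphism [A -> Hom_A(R, R) -> Hom_A(P, R)] representing the    *)
(* adjunction morphism [A -> RHom_A(R, R)].                                   *)
Program Definition homothety : dgHom (regMod A) (Homdg P R) :=
  @DGHom A (regMod A) (Homdg P R)
    (@CMap (regMod A) (Homdg P R) homothety_hom _ _) _.
Next Obligation.
move=> n a b; apply: hom_ext => i j e m /=.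
by rewrite actDl.
Qed.
Next Obligation.
move=> n n' e a; apply: hom_ext => i j ej m /=.
have h1 : i + n + 1 = j by lia.
have h2 : i + 1 + n = j by lia.
rewrite (homd_funE e (homothety_hom a) ej erefl erefl h1 h2) /= cm_d.
have h3 : n + (i + 1) = j by lia.
rewrite (act_leibniz _ e (erefl (i + 1)) h1 (etrans (addrC n' i) ej) h3).
by rewrite (Prop_irrelevance (etrans _ h2) h3) addrK.
Qed.
Next Obligation.
move=> i j k e a b; apply: hom_ext => p q eq m /=.
have h1 : p + j = p + j by [].
have h2 : i + (p + j) = q by lia.
rewrite (homa_funE e a (homothety_hom b) eq h1 h2) /=.
exact: actA.
Qed.
End Homothety.
End Morphisms.

Section CommutativeAlgebra.
Implicit Types (R B : comPzRingType).

Definition is_ideal R (I : R -> Prop) : Prop :=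
  [/\ I 0, forall x y, I x -> I y -> I (x + y) & forall a x, I x -> I (a * x)].

Definition generates R (n : nat) (v : 'I_n -> R) (I : R -> Prop) : Prop :=
  forall x, I x <-> exists c : 'I_n -> R, x = \sum_i c i * v i.

Definition noetherian R : Prop :=
  forall I : R -> Prop, is_ideal I -> exists n (v : 'I_n -> R), generates v I.

Definition fg_module R (V : lmodType R) : Prop :=
  exists n (v : 'I_n -> V), forall x, exists c : 'I_n -> R, x = \sum_i c i *: v i.

Definition prime_ideal R (p : R -> Prop) : Prop :=
  [/\ is_ideal p, ~ p 1 & forall x y, p (x * y) -> p x \/ p y].

Definition prime_chain R (n : nat) (p : nat -> R -> Prop) : Prop :=
  (forall i, (i <= n)%N -> prime_ideal (p i)) /\
  (forall i, (i < n)%N ->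
     (forall x, p i x -> p i.+1 x) /\ exists x, p i.+1 x /\ ~ p i x).

Definition krull_dim_le R (n : nat) : Prop :=
  forall m p, prime_chain (R := R) m p -> (m <= n)%N.

Definition krull_dim R (n : nat) : Prop :=
  krull_dim_le R n /\ exists p, prime_chain (R := R) n p.

(* A noetherian local ring whose maximal ideal can be generated by as many    *)
(* elements as the Krull dimension.                                           *)
Definition regular_local R : Prop :=
  noetherian R /\
  exists m : R -> Prop,
    [/\ is_ideal m, ~ m 1,
        forall I : R -> Prop, is_ideal I -> ~ I 1 -> forall x, I x -> m x &
        exists n (v : 'I_n -> R), krull_dim R n /\ generates v m].

Definition mult_closed R (S : R -> Prop) : Prop :=
  S 1 /\ forall s t, S s -> S t -> S (s * t).

(* [g] exhibits [B] as the localization [S^-1 R]. *)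
Definition is_localization R B (S : R -> Prop) (g : {rmorphism R -> B}) : Prop :=
  [/\ mult_closed S,
      forall s, S s -> exists b, g s * b = 1,
      forall b, exists x s, S s /\ b * g s = g x &
      forall x, g x = 0 -> exists s, S s /\ s * x = 0].

(* A noetherian ring is regular when its local rings [R_p] are.               *)
Definition regular R : Prop :=
  noetherian R /\
  forall p : R -> Prop, prime_ideal p ->
  forall (L : comPzRingType) (g : {rmorphism R -> L}),
    is_localization (fun x => ~ p x) g -> regular_local L.

Definition finite_type R B (f : R -> B) : Prop :=
  exists n (v : 'I_n -> B), forall D : B -> Prop,
    (forall x, D (f x)) -> (forall i, D (v i)) ->
    (forall x y, D x -> D y -> D (x + y)) ->
    (forall x y, D x -> D y -> D (x * y)) -> forall b, D b.

Definition ess_finite_type R B (f : R -> B) : Prop :=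
  exists (C : comPzRingType) (h : {rmorphism R -> C}) (g : {rmorphism C -> B})
    (S : C -> Prop),
    [/\ finite_type h, is_localization S g & forall x, f x = g (h x)].
End CommutativeAlgebra.

(* A commutative ring as a DG ring concentrated in degree 0. *)
Section Concentrated.
Variable K : comPzRingType.

Definition conc_pred (i : int) : {pred K} := [pred x | (i == 0) || (x == 0)].

Lemma conc_zmod i : zmod_closed (conc_pred i).
Proof.
rewrite /conc_pred; split=> [|x y]; rewrite !inE ?eqxx ?orbT //.
by case: (i == 0) => //= /eqP -> /eqP ->; rewrite subrr.
Qed.
HB.instance Definition _ i :=
  GRing.isZmodClosed.Build K (conc_pred i) (conc_zmod i).

Definition conc (i : int) : Type := {x : K | x \in conc_pred i}.
HB.instance Definition _ i := SubChoice.on (conc i).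
HB.instance Definition _ i := [SubChoice_isSubZmodule of conc i by <:].

Definition conc_cpx : cpx.
Proof.
apply: (@Cpx (fun i => conc i) (fun i j _ _ => 0)) => //.
by move=> i j e x y; rewrite addr0.
Defined.

Lemma conc_val0 i (x : conc i) : i != 0 -> val x = 0.
Proof. by move=> i0; have := valP x; rewrite inE (negbTE i0) => /eqP. Qed.

Lemma conc_mul_subproof i j k (e : i + j = k) (x : conc i) (y : conc j) :
  val x * val y \in conc_pred k.
Proof.
rewrite inE; have [//|k0] := eqVneq k 0; apply/eqP.
have [i0|i0] := eqVneq i 0; last by rewrite conc_val0 // mul0r.
by rewrite [val y]conc_val0 ?mulr0 //; move: k0; rewrite -e i0 add0r.
Qed.

Definition conc_mul i j k (e : i + j = k) (x : conc i) (y : conc j) : conc k :=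
  Sub (val x * val y) (conc_mul_subproof e x y).

Definition conc_in (x : K) : conc 0 :=
  Sub x (introT orP (or_introl (eqxx 0)) : x \in conc_pred 0).

Definition concRing : cdgRing.
Proof.
apply: (@CDGRing conc_cpx conc_mul (conc_in 1)).
- by move=> i j k e a b c; apply/val_inj; rewrite raddfD /= mulrDl.
- by move=> i j k e a b c; apply/val_inj; rewrite raddfD /= mulrDr.
- by move=> *; apply/val_inj; rewrite /= mulrA.
- by move=> *; apply/val_inj; rewrite /= mul1r.
- by move=> *; apply/val_inj; rewrite /= mulr1.
- move=> i j k i' j' k' e ei ej ek e1 e2 a b; apply/val_inj.
  rewrite raddfD (morphD_zsign (raddfD val)).
  by rewrite /= mul0r mulr0 zsign00 addr0.
- move=> i j k e e' a b; apply/val_inj.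
  rewrite (morphD_zsign (raddfD val)) /= mulrC.
  have [i0|i0] := eqVneq i 0; last by rewrite (conc_val0 a i0 : sval a = 0) mul0r zsign00.
  have -> : i * j = 0 by rewrite i0 mul0r.
  by rewrite zsign0.
- move=> i k e a oi; apply/val_inj; rewrite /=.
  have i0 : i != 0 by apply: contraTneq oi => ->.
  by rewrite (conc_val0 a i0 : sval a = 0) mul0r.
- by move=> i i0 a; apply/val_inj; rewrite conc_val0 // Order.POrderTheory.gt_eqF.
Defined.
End Concentrated.

(* The ring homomorphism [K -> H^0(A)] induced by a DG ring homomorphism.     *)
Definition bar_map (K : comPzRingType) (A : cdgRing) (f : dgrHom (concRing K) A)
    (x : K) : barRing A :=
  cohmap f (hcls (Sub (conc_in x) (introT eqP erefl : conc_in x \in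
    @cocycle (concRing K) 0) : cyc (concRing K) 0)).

Definition coh_pseudo_noetherian (A : cdgRing) : Prop :=
  noetherian (barRing A) /\
  forall i, fg_module (Hmod (regMod A) i).

Definition tractable (A : cdgRing) : Prop :=
  coh_pseudo_noetherian A /\
  exists (K : comPzRingType) (f : dgrHom (concRing K) A),
    [/\ noetherian K, regular K, exists n, krull_dim_le K n &
        ess_finite_type (bar_map f)].

(* Integer intervals, possibly unbounded or empty, are the convex subsets of  *)
(* [int]; their endpoint-wise sum is then the elementwise sum.                *)
Definition int_interval (I : int -> Prop) : Prop :=
  forall x y z : int, (x <= y)%R -> (y <= z)%R -> I x -> I z -> I y.

Definition con (C : cpx) (n : int) : Prop :=
  forall I : int -> Prop, int_interval I ->
    (forall i, (exists x : coh C i, x <> 0) -> I i) -> I n.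

(* [- I + [d0, d1]]. *)
Definition opp_shift (I : int -> Prop) (d0 d1 n : int) : Prop :=
  exists i, I i /\ (- i + d0 <= n <= - i + d1)%R.

Definition finite_injdim (A : cdgRing) (R : dgMod A) : Prop :=
  exists d0 d1 : int, (d0 <= d1)%R /\
    forall M : dgMod A, exists2 T : dgMod A, is_RHom M R T &
      forall n, con T n -> opp_shift (con M) d0 d1 n.

Definition dualizing (A : cdgRing) (R : dgMod A) : Prop :=
  [/\ forall i, fg_module (Hmod R i),
      finite_injdim R &
      exists (P : dgMod A) (s : dgHom P R),
        [/\ K_projective P, quasi_iso s & d_isom (DOf (homothety s))]].

Definition tilting (A : cdgRing) (P : dgMod A) : Prop :=
  exists Q : dgMod A, is_Ltensor P Q (regMod A).

(* Isomorphism classes in [D(A)] of the DG modules satisfying [Phi]. *)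
Definition isoclass (A : cdgRing) (Phi : dgMod A -> Prop) : Type :=
  {C : dgMod A -> Prop | exists2 M, Phi M & C = dIso M}.

Definition DPic (A : cdgRing) : Type := isoclass (@tilting A).
Definition dualizing_classes (A : cdgRing) : Type := isoclass (@dualizing A).

(* [op] sends the classes of [P] and [R] to the class of [P (x)^L_A R].       *)
Definition induced_by_Ltensor (A : cdgRing) (Phi Psi : dgMod A -> Prop)
    (op : isoclass Phi -> isoclass Psi -> isoclass Psi) : Prop :=
  forall p r P R, sval p P -> sval r R ->
    forall T, is_Ltensor P R T <-> sval (op p r) T.

Definition abelian_group_law (G : Type) (mul : G -> G -> G) (one : G)
    (inv : G -> G) : Prop :=
  [/\ associative mul, commutative mul, left_id one mul & left_inverse one inv mul].

Definition group_action (G X : Type) (mul : G -> G -> G) (one : G)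
    (to : G -> X -> X) : Prop :=
  (forall x, to one x = x) /\ (forall g h x, to (mul g h) x = to g (to h x)).

Definition simply_transitive (G X : Type) (to : G -> X -> X) : Prop :=
  inhabited X /\ forall x y, exists! g, to g x = y.

(* Main.v *)
(* A dualizing module over [A] is obtained by coinduction. Adjoin to [K] finitely many
   variables mapping to lifts in [A^0] of generators of [H^0(A)]; this gives a regular
   ring [B] of finite dimension with a DG homomorphism [B -> A] for which [H^0(A)] is a
   quotient of [S^-1 B], [S] being the set of elements of [B] invertible in [H^0(A)].
   If [I] is a finite complex of injective [B]-modules resolving [S^-1 B], then
   [D(M) = Hom_A(M, R1)] with [R1 = Hom_B(A, I)] is [Hom_B(M, I)]; so [D] has finite
   amplitude, preserves finite generation of cohomology, and [M -> D(D(M))] is a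
   quasi-isomorphism by attaching cells to kill the top cohomology.
   Finiteness of the injective dimension is obtained without projective resolutions of
   modules: over a regular ring every map far enough to the left in an exact complex of
   finite free modules splits, and the resulting vanishing of Ext passes from [K] to
   [K[X]] through the coresolution of [N] by the coinduced modules [Hom_K(K[X], N)].
   For the action: if [R] is dualizing, then [Q = D(R)] is tilting with inverse
   [Hom(Q, A)], and [Hom(Q, A) (x) R1] is [Hom(Q, R1) = D(D(R)) = R]; hence every
   dualizing module is [X (x) R1] with [X] tilting. The stabilizers are trivial because
   [RHom(R, X (x) R) = X]. *)

From HB Require Import structures.
From mathcomp Require Import all_boot all_order all_algebra.
From mathcomp Require Import boolp.
From mathcomp Require classical_sets.
From mathcomp Require Import ring zify.
Require Import Defs.

Set Implicit Arguments.
Unset Strict Implicit.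
Unset Printing Implicit Defensive.

Import GRing.Theory.
Local Open Scope ring_scope.
Local Obligation Tactic := idtac.

(** * The DG category of DG modules *)

(** [D(A)] is met only at the two ends of the argument: isomorphism in it is shown to be a span of
    quasi-isomorphisms, and everything in between is a computation with DG modules and graded homs.
    No triangulated structure is set up; its place is taken by DG functors, which act on homs of
    every degree and therefore preserve graded-split triples and cones. The cone of a natural
    transformation is again a DG functor [T], so the claim that a transformation is a
    quasi-isomorphism is a vanishing claim about [T X], and it reduces to [X = A] once an amplitude
    bound for [T] is known. Biduality and the invertibility of [Q] are both obtained this way.
    Boundedness and finiteness of tilting modules come from compactness: the unit in [X (x) Y] is a
    finite sum of tensors, so it is supported in a truncation of [X]. DG modules are never
    localized. Statements about [S^-1 H(X)] are made by multiplying cocycles by elements of [S], and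
    [S] becomes invertible only at the end, in [H^0(A)]. *)

Definition cst (X : int -> zmodType) i j (e : i = j) : X i -> X j :=
  fun x => eq_rect i (fun k => X k : Type) x j e.

Lemma cst_id (X : int -> zmodType) i (e : i = i) (x : X i) : @cst X i i e x = x.
Proof. by rewrite (Prop_irrelevance e erefl). Qed.

Lemma cstD (X : int -> zmodType) i j (e : i = j) : {morph @cst X i j e : x y / x + y}.
Proof. by subst j. Qed.

Lemma zsign_par (V : zmodType) m n (x : V) :
  odd (absz m) = odd (absz n) -> zsign m x = zsign n x.
Proof. by rewrite /zsign => ->. Qed.

(** Koszul signs depend only on parities: the exponents are expanded modulo 2 and the parity of each
    degree is split on. *)
Ltac zpar := apply: zsign_par; subst;
  rewrite ?(mulr0, mul0r, mulr1, mul1r, mulrDl, mulrDr, mulrN, mulNr);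
  rewrite ?(odd_abszD, odd_abszM, abszN) /=; repeat match goal with |- context [odd ?n] => case: (odd n) end; done.

Lemma zsign_even (V : zmodType) m (x : V) : ~~ odd (absz m) -> zsign m x = x.
Proof. by rewrite /zsign => /negbTE ->. Qed.

Lemma zsignB (V : zmodType) n (x y : V) : zsign n (x - y) = zsign n x - zsign n y.
Proof. by rewrite zsign_addr zsignN. Qed.

Section HomCategory.
Variable A : cdgRing.
Implicit Types M N P Q : dgMod A.

Lemma hfun_irr M N n (f : hom M N n) i j (e e' : i + n = j) x :
  f i j e x = f i j e' x.
Proof. by rewrite (Prop_irrelevance e e'). Qed.

Lemma act_irr M i j k (e e' : i + j = k) a (m : M j) : act e a m = act e' a m.
Proof. by rewrite (Prop_irrelevance e e'). Qed.

Lemma cst_act M p i j k l (e : p + i = k) (e1 : i = j) (e2 : k = l) (e' : p + j = l)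
    a (x : M i) :
  @cst M k l e2 (act e a x) = act e' a (@cst M i j e1 x).
Proof. by subst j l; rewrite !cst_id; apply: act_irr. Qed.

Lemma cd_irr (X : cpx) i j (e e' : i + 1 = j) (x : X i) : cd e x = cd e' x.
Proof. by rewrite (Prop_irrelevance e e'). Qed.

Lemma hfun0 M N n (f : hom M N n) i j (e : i + n = j) : f i j e 0 = 0.
Proof. exact: (morphD0 (@homD _ _ _ _ f _ _ e)). Qed.
Lemma hfunN M N n (f : hom M N n) i j (e : i + n = j) x : f i j e (- x) = - f i j e x.
Proof. exact: (morphDN (@homD _ _ _ _ f _ _ e)). Qed.
Lemma hfunB M N n (f : hom M N n) i j (e : i + n = j) x y :
  f i j e (x - y) = f i j e x - f i j e y.
Proof. exact: (morphDB (@homD _ _ _ _ f _ _ e)). Qed.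
Lemma hfun_zsign M N n (f : hom M N n) i j (e : i + n = j) p x :
  f i j e (zsign p x) = zsign p (f i j e x).
Proof. exact: (morphD_zsign (@homD _ _ _ _ f _ _ e)). Qed.

Lemma hom_zsignE M N n (f : hom M N n) p i j (e : i + n = j) x :
  (zsign p f) i j e x = zsign p (f i j e x).
Proof. by rewrite /zsign; case: (odd _). Qed.

Lemma hom0E M N n i j (e : i + n = j) x : (0 : hom M N n) i j e x = 0.
Proof. by []. Qed.
Lemma homDE M N n (f g : hom M N n) i j (e : i + n = j) x :
  (f + g) i j e x = f i j e x + g i j e x.
Proof. by []. Qed.
Lemma homNE M N n (f : hom M N n) i j (e : i + n = j) x :
  (- f) i j e x = - f i j e x.
Proof. by []. Qed.

Lemma hcomp_e (n m k i j : int) : n + m = k -> i + k = j -> i + n + m = j.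
Proof. lia. Qed.

Program Definition hcomp M N P n m k (e : n + m = k) (g : hom N P m) (f : hom M N n) :
    hom M P k :=
  @Hom A M P k (fun i j ej x => g (i + n) j (hcomp_e e ej) (f i (i + n) erefl x)) _ _.
Next Obligation. by move=> M N P n m k e g f i j ej x y /=; rewrite !homD. Qed.
Next Obligation.
move=> M N P n m k0 e g f p i k j l e0 ej el e' a x /=.
have h : p + (i + n) = k + n by lia.
rewrite (hom_act f e0 erefl erefl h) hfun_zsign.
rewrite (hom_act g h (hcomp_e e ej) (hcomp_e e el) e').
rewrite -zsignD; zpar.
Qed.

Lemma hcompE M N P n m k (e : n + m = k) (g : hom N P m) (f : hom M N n)
    i j l (ej : i + k = j) (e1 : i + n = l) (e2 : l + m = j) x :
  hcomp e g f i j ej x = g l j e2 (f i l e1 x).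
Proof. by subst l => /=; apply: hfun_irr. Qed.

(** A hom of degree 0 has components [M i -> M j] for every [j] with [i + 0 = j], and this equation
    is not a conversion. The transport [cst] bridges the gap and disappears on equal indices. *)
Program Definition hid M : hom M M 0 :=
  @Hom A M M 0 (fun i j e x => @cst M i j (etrans (esym (addr0 i)) e) x) _ _.
Next Obligation. by move=> M i j e; apply: cstD. Qed.
Next Obligation.
move=> M p i k j l e ej el e' a x /=.
by rewrite mulr0 zsign0; apply: cst_act.
Qed.

Lemma hidE M i (e : i + 0 = i) x : hid M i i e x = x.
Proof. exact: cst_id. Qed.

Program Definition homof M N (f : dgHom M N) : hom M N 0 :=
  @Hom A M N 0 (fun i j e x => @cst N i j (etrans (esym (addr0 i)) e) (f i x)) _ _.
Next Obligation. by move=> M N f i j e x y /=; rewrite cmD cstD. Qed.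
Next Obligation.
move=> M N f p i k j l e ej el e' a x /=.
by rewrite mulr0 zsign0 dgh_act; apply: cst_act.
Qed.

Lemma homofE M N (f : dgHom M N) i (e : i + 0 = i) x : homof f i i e x = f i x.
Proof. exact: cst_id. Qed.

(* Equality of homs of degree 0 need only be tested on equal indices. *)
Lemma hom_ext0 M N (f g : hom M N 0) :
  (forall i (e : i + 0 = i) x, f i i e x = g i i e x) -> f = g.
Proof.
move=> fg; apply: hom_ext => i j e m.
have e1 : i = j by rewrite -e addr0.
by move: e; case: j / e1 => e; apply: fg.
Qed.

Lemma homdE M N n n' (en : n + 1 = n') (f : hom M N n) i i' j j' (e : i + n' = j)
    (ei : i + 1 = i') (ej : i + n = j') (e1 : j' + 1 = j) (e2 : i' + n = j) m :
  homd en f i j e m = cd e1 (f i j' ej m) - zsign n (f i' j e2 (cd ei m)).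
Proof. exact: (homd_funE en f e ei ej e1 e2 m). Qed.

Lemma homd_homof M N (f : dgHom M N) k (e : 0 + 1 = k) : homd e (homof f) = 0.
Proof.
apply: hom_ext => i j ej m.
have h1 : i + 1 = j by lia.
have h2 : i + 1 + 0 = j by lia.
rewrite (homdE e _ ej erefl (addr0 i) h1 h2) homofE zsign0.
case: j / h1 ej h2 => ej h2.
by rewrite homofE cm_d subrr.
Qed.

Program Definition dgof M N (f : hom M N 0) (df : homd (add0r 1) f = 0) : dgHom M N :=
  @DGHom A M N (@CMap M N (fun i => f i i (addr0 i)) _ _) _.
Next Obligation. by move=> M N f df i x y /=; rewrite homD. Qed.
Next Obligation.
move=> M N f df i j e x /=.
have h : i + 1 + 0 = i + 1 by lia.
have := homdE (add0r 1) f (erefl (i + 1)) erefl (addr0 i) erefl h x.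
rewrite df hom0E zsign0; case: j / e => /eqP; rewrite eq_sym subr_eq0 => /eqP ->.
exact: hfun_irr.
Qed.
Next Obligation.
move=> M N f df i j k e a x /=.
by rewrite (hom_act f e (addr0 j) (addr0 k) e) mulr0 zsign0.
Qed.

Lemma homofK M N (f : hom M N 0) df : homof (@dgof M N f df) = f.
Proof. by apply: hom_ext0 => i e x; rewrite homofE /=; apply: hfun_irr. Qed.

Lemma homof_id M : homof (dg_id M) = hid M.
Proof. by apply: hom_ext0 => i e x; rewrite homofE hidE. Qed.

Lemma homof_comp M N P (g : dgHom N P) (f : dgHom M N) (e : 0 + 0 = 0) :
  homof (dg_comp g f) = hcomp e (homof g) (homof f).
Proof.
apply: hom_ext0 => i ei x.
by rewrite (hcompE e _ _ ei ei ei) !homofE.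
Qed.

Lemma hcompDl M N P n m k (e : n + m = k) (g g' : hom N P m) (f : hom M N n) :
  hcomp e (g + g') f = hcomp e g f + hcomp e g' f.
Proof. by apply: hom_ext. Qed.
Lemma hcompDr M N P n m k (e : n + m = k) (g : hom N P m) (f f' : hom M N n) :
  hcomp e g (f + f') = hcomp e g f + hcomp e g f'.
Proof. by apply: hom_ext => i j ej x /=; rewrite homD. Qed.
Lemma hcomp0l M N P n m k (e : n + m = k) (f : hom M N n) :
  hcomp e (0 : hom N P m) f = 0.
Proof. by apply: hom_ext. Qed.
Lemma hcomp0r M N P n m k (e : n + m = k) (g : hom N P m) :
  hcomp e g (0 : hom M N n) = 0.
Proof. by apply: hom_ext => i j ej x /=; rewrite hfun0. Qed.
Lemma hcompNl M N P n m k (e : n + m = k) (g : hom N P m) (f : hom M N n) :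
  hcomp e (- g) f = - hcomp e g f.
Proof. by apply: hom_ext. Qed.
Lemma hcompNr M N P n m k (e : n + m = k) (g : hom N P m) (f : hom M N n) :
  hcomp e g (- f) = - hcomp e g f.
Proof. by apply: hom_ext => i j ej x /=; rewrite hfunN. Qed.
Lemma hcomp_zsignl M N P n m k (e : n + m = k) p (g : hom N P m) (f : hom M N n) :
  hcomp e (zsign p g) f = zsign p (hcomp e g f).
Proof. by rewrite /zsign; case: (odd _); rewrite // hcompNl. Qed.
Lemma hcomp_zsignr M N P n m k (e : n + m = k) p (g : hom N P m) (f : hom M N n) :
  hcomp e g (zsign p f) = zsign p (hcomp e g f).
Proof. by rewrite /zsign; case: (odd _); rewrite // hcompNr. Qed.

Lemma hcompA M N P Q n m l nm ml k (e1 : n + m = nm) (e2 : nm + l = k)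
    (e3 : m + l = ml) (e4 : n + ml = k) (h : hom P Q l) (g : hom N P m) (f : hom M N n) :
  hcomp e2 h (hcomp e1 g f) = hcomp e4 (hcomp e3 h g) f.
Proof.
apply: hom_ext => i j ej x.
have h1 : i + nm + l = j by lia.
have h2 : i + n + m = i + nm by lia.
have h3 : i + n + ml = j by lia.
rewrite (hcompE e2 _ _ ej erefl h1) (hcompE e1 _ _ erefl erefl h2).
by rewrite (hcompE e4 _ _ ej erefl h3) (hcompE e3 _ _ h3 h2 h1).
Qed.

Lemma hcomp1l M N n (e : n + 0 = n) (f : hom M N n) : hcomp e (hid N) f = f.
Proof.
apply: hom_ext => i j ej x.
by rewrite (hcompE e _ _ ej ej (addr0 j)) hidE.
Qed.
Lemma hcomp1r M N n (e : 0 + n = n) (f : hom M N n) : hcomp e f (hid M) = f.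
Proof.
apply: hom_ext => i j ej x.
by rewrite (hcompE e _ _ ej (addr0 i) ej) hidE.
Qed.

Lemma homd_comp M N P n m k n' m' k' (e : n + m = k) (en : n + 1 = n') (em : m + 1 = m')
    (ek : k + 1 = k') (e1 : n + m' = k') (e2 : n' + m = k')
    (g : hom N P m) (f : hom M N n) :
  homd ek (hcomp e g f) = hcomp e1 (homd em g) f + zsign m (hcomp e2 g (homd en f)).
Proof.
apply: hom_ext => i j ej x.
rewrite homDE hom_zsignE.
have h1 : i + n + m = i + k by lia.
have h2 : i + k + 1 = j by lia.
have h3 : i + 1 + k = j by lia.
have h4 : i + 1 + n + m = j by lia.
have h5 : i + n + m' = j by lia.
have h6 : i + n + 1 = i + 1 + n by lia.
have h7 : i + n' = i + 1 + n by lia.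
rewrite (homdE ek _ ej erefl erefl h2 h3).
rewrite (hcompE e _ _ erefl erefl h1) (hcompE e _ _ h3 erefl h4).
rewrite (hcompE e1 _ _ ej erefl h5) (hcompE e2 _ _ ej h7 h4).
rewrite (homdE em _ h5 h6 h1 h2 h4) (homdE en _ h7 erefl erefl h6 erefl).
rewrite hfunB hfun_zsign zsignB -zsignD addrA subrK.
by congr (_ - _); zpar.
Qed.

Lemma homd_id M k (e : 0 + 1 = k) : homd e (hid M) = 0.
Proof. by rewrite -homof_id homd_homof. Qed.

Lemma homd0 M N n n' (e : n + 1 = n') : homd e (0 : hom M N n) = 0.
Proof. exact: (morphD0 (homd_addr _)). Qed.
Lemma homd_zsign M N n n' (e : n + 1 = n') p (f : hom M N n) :
  homd e (zsign p f) = zsign p (homd e f).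
Proof. exact: (morphD_zsign (homd_addr _)). Qed.
End HomCategory.

(** * Cohomology, localized vanishing and DG functors *)

(** Cocycles and coboundaries quantify over the neighbouring degree, which spares casts; [isZP] and
    [isBP] fix it to one convenient value. *)
Definition isZ (X : cpx) i (x : X i) : Prop := forall j (e : i + 1 = j), cd e x = 0.
Definition isB (X : cpx) i (x : X i) : Prop := exists j (e : j + 1 = i) y, x = cd e y.

Section Cocycles.
Variable X : cpx.

Lemma cd0 i j (e : i + 1 = j) : cd e (0 : X i) = 0.
Proof. exact: (morphD0 (cdD e)). Qed.
Lemma cdN i j (e : i + 1 = j) (x : X i) : cd e (- x) = - cd e x.
Proof. exact: (morphDN (cdD e)). Qed.
Lemma cdB i j (e : i + 1 = j) (x y : X i) : cd e (x - y) = cd e x - cd e y.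
Proof. exact: (morphDB (cdD e)). Qed.
Lemma cd_zsign i j (e : i + 1 = j) p (x : X i) : cd e (zsign p x) = zsign p (cd e x).
Proof. exact: (morphD_zsign (cdD e)). Qed.

Lemma isZ0 i : isZ (0 : X i). Proof. by move=> j e; rewrite cd0. Qed.
Lemma isZD i (x y : X i) : isZ x -> isZ y -> isZ (x + y).
Proof. by move=> hx hy j e; rewrite cdD hx hy addr0. Qed.
Lemma isZN i (x : X i) : isZ x -> isZ (- x).
Proof. by move=> hx j e; rewrite cdN hx oppr0. Qed.
Lemma isZB i (x y : X i) : isZ x -> isZ y -> isZ (x - y).
Proof. by move=> hx hy; apply/isZD/isZN. Qed.
Lemma isZ_zsign i p (x : X i) : isZ x -> isZ (zsign p x).
Proof. by rewrite /zsign; case: (odd _) => //; apply: isZN. Qed.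
Lemma isZP i j (e : i + 1 = j) (x : X i) : cd e x = 0 -> isZ x.
Proof. move=> hx j' e'; have ej : j = j' by rewrite -e.
by case: j' / ej e' => e'; rewrite (cd_irr e' e). Qed.

Lemma isB0 i : isB (0 : X i).
Proof. by exists (i - 1), (subrK 1 i), 0; rewrite cd0. Qed.
Lemma isBP i j (e : j + 1 = i) (x : X i) : isB x <-> exists y, x = cd e y.
Proof.
split=> [[j' [e' [y xy]]]|[y xy]]; last by exists j, e, y.
have ej : j' = j by lia.
by case: j / ej e => e; exists y; rewrite (cd_irr e e').
Qed.
Lemma isBN i (x : X i) : isB x -> isB (- x).
Proof. by case=> j [e [y ->]]; exists j, e, (- y); rewrite cdN. Qed.
Lemma isBD i (x y : X i) : isB x -> isB y -> isB (x + y).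
Proof.
move=> [j [e [u ->]]] /(isBP e) [v ->].
by exists j, e, (u + v); rewrite cdD.
Qed.
Lemma isBB i (x y : X i) : isB x -> isB y -> isB (x - y).
Proof. by move=> hx hy; apply/isBD/isBN. Qed.
Lemma isB_zsign i p (x : X i) : isB x -> isB (zsign p x).
Proof. by rewrite /zsign; case: (odd _) => //; apply: isBN. Qed.
Lemma isB_cd i j (e : i + 1 = j) (x : X i) : isB (cd e x).
Proof. by exists i, e, x. Qed.
Lemma isBZ i (x : X i) : isB x -> isZ x.
Proof. by move=> [j [e [y ->]]] k e'; rewrite cdd. Qed.
Lemma isB_trans i (x y : X i) : isB (x - y) -> isB y -> isB x.
Proof. by move=> h1 h2; rewrite -[x](subrK y); apply: isBD. Qed.
Lemma isB_sym i (x y : X i) : isB (x - y) -> isB (y - x).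
Proof. by move=> /isBN; rewrite opprB. Qed.
Lemma isB_tr i (x y z : X i) : isB (x - y) -> isB (y - z) -> isB (x - z).
Proof. by move=> h1 h2; rewrite -(subrKA y); apply: isBD. Qed.
End Cocycles.

Section HomCocycle.
Variables (A : cdgRing) (M N : dgMod A) (n : int) (f : hom M N n).
Definition cocyc := forall k (e : n + 1 = k), homd e f = 0.
Hypothesis df : cocyc.

Lemma cocyc_cd i j k l (e1 : i + n = j) (e2 : j + 1 = k) (e3 : i + 1 = l) (e4 : l + n = k) x :
  cd e2 (f i j e1 x) = zsign n (f l k e4 (cd e3 x)).
Proof.
have h : i + (n + 1) = k by lia.
apply/eqP; rewrite -subr_eq0 -(homdE erefl f h e3 e1 e2 e4).
by rewrite df.
Qed.

Lemma cocyc_Z i j (e : i + n = j) x : isZ x -> isZ (f i j e x).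
Proof.
move=> hx k e2; have e4 : i + 1 + n = k by lia.
by rewrite (cocyc_cd e e2 erefl e4) hx hfun0 zsign00.
Qed.

Lemma cocyc_B i j (e : i + n = j) x : isB x -> isB (f i j e x).
Proof.
move=> [l [e3 [y ->]]].
have e1 : l + n = j - 1 by lia.
have e2 : j - 1 + 1 = j by lia.
exists (j - 1), e2, (zsign n (f l _ e1 y)).
by rewrite cd_zsign (cocyc_cd e1 e2 e3 e) zsignK.
Qed.
End HomCocycle.

Section Scalars.
Variables (A : cdgRing).

(** Non-positivity gives [A^1 = 0]. Every element of [A^0] is therefore a cocycle and acts by
    morphisms of complexes, which is what makes localization at subsets of [A^0] meaningful. *)
Lemma dA0 k (e : 0 + 1 = k) (a : A 0) : cd e a = 0.
Proof. by apply: dnonpos; rewrite -e. Qed.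

Definition sc (M : dgMod A) i (a : A 0) (x : M i) : M i := act (add0r i) a x.

Section One.
Variable M : dgMod A.
Implicit Types (i : int) (a b : A 0).
Lemma scE i a (x : M i) (e : 0 + i = i) : act e a x = sc a x.
Proof. exact: act_irr. Qed.
Lemma sc1 i (x : M i) : sc (dunit A) x = x.
Proof. exact: act1. Qed.
Lemma scDr i a (x y : M i) : sc a (x + y) = sc a x + sc a y.
Proof. exact: actDr. Qed.
Lemma scDl i a b (x : M i) : sc (a + b) x = sc a x + sc b x.
Proof. exact: actDl. Qed.
Lemma scBr i a (x y : M i) : sc a (x - y) = sc a x - sc a y.
Proof. exact: actBr. Qed.
Lemma scNl i a (x : M i) : sc (- a) x = - sc a x.
Proof. exact: actNl. Qed.
Lemma scBl i a b (x : M i) : sc (a - b) x = sc a x - sc b x.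
Proof. exact: actBl. Qed.
Lemma sc0r i a : sc a (0 : M i) = 0.
Proof. exact: act0r. Qed.
Lemma sc0l i (x : M i) : sc 0 x = 0.
Proof. exact: act0l. Qed.
Lemma scM i a b (x : M i) : sc (dmul (add0r 0) a b) x = sc a (sc b x).
Proof. exact: actA. Qed.
Lemma scC i a b (x : M i) : sc a (sc b x) = sc b (sc a x).
Proof. by rewrite /sc (actAC _ _ (add0r i) (add0r i)) mulr0 zsign0. Qed.
Lemma cd_sc i j (e : i + 1 = j) a (x : M i) : cd e (sc a x) = sc a (cd e x).
Proof.
have e1 : 0 + 1 + i = j by lia.
by rewrite /sc (act_leibniz (add0r i) erefl e e e1 (add0r j)) dA0 act0l add0r zsign0.
Qed.
Lemma sc_Z i a (x : M i) : isZ x -> isZ (sc a x).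
Proof. by move=> hx j e; rewrite cd_sc hx sc0r. Qed.
Lemma sc_B i a (x : M i) : isB x -> isB (sc a x).
Proof. by move=> [j [e [y ->]]]; exists j, e, (sc a y); rewrite cd_sc. Qed.
End One.

Lemma hfun_sc (M N : dgMod A) n (f : hom M N n) i j (e : i + n = j) a x :
  f i j e (sc a x) = sc a (f i j e x).
Proof. by rewrite /sc (hom_act f (add0r i) e e (add0r j)) mul0r zsign0. Qed.

Definition mset (S : A 0 -> Prop) : Prop :=
  S (dunit A) /\ forall s t, S s -> S t -> S (dmul (add0r 0) s t).

(** The trivial multiplicative set: with it, statements on localized cohomology specialize to
    ordinary cohomology, so each is proved once. *)
Definition S1 : A 0 -> Prop := fun s => s = dunit A.
Lemma mset1 : mset S1.
Proof. by split=> // s t -> ->; rewrite /S1 dmul1l. Qed.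

Section SVan.
Variable S : A 0 -> Prop.
Hypothesis mS : mset S.

Definition sbnd (M : dgMod A) i (x : M i) : Prop := exists s, S s /\ isB (sc s x).
(* [S^-1 H^i(M) = 0]. *)
Definition svan (M : dgMod A) i : Prop := forall x : M i, isZ x -> sbnd x.

Lemma isB_sbnd (M : dgMod A) i (x : M i) : isB x -> sbnd x.
Proof. by move=> hx; exists (dunit A); split; [case: mS | rewrite sc1]. Qed.
Lemma sbnd_sc (M : dgMod A) i s (x : M i) : S s -> sbnd (sc s x) -> sbnd x.
Proof.
move=> hs [t [ht hx]]; exists (dmul (add0r 0) t s).
by split; [apply: mS.2 | rewrite scM].
Qed.
End SVan.

Lemma sbnd1 (M : dgMod A) i (x : M i) : sbnd S1 x <-> isB x.
Proof.
by split=> [[s [-> ]]|hx]; [rewrite sc1 | exists (dunit A); rewrite sc1].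
Qed.

Definition van (M : dgMod A) i : Prop := forall x : M i, isZ x -> isB x.
Lemma svan1 (M : dgMod A) i : svan S1 M i <-> van M i.
Proof. by split=> h x hx; apply/sbnd1/h. Qed.
Lemma van_svan S (M : dgMod A) i : mset S -> van M i -> svan S M i.
Proof. by move=> mS h x hx; apply: isB_sbnd => //; apply: h. Qed.
End Scalars.

Section Triple.
Variables (A : cdgRing) (U V W : dgMod A) (p q : int) (u : hom U V p) (v : hom V W q).

(* A graded-split short exact sequence [U -> V -> W] of morphisms of degrees [p], [q]. *)
Record striple : Prop := STriple {
  st_du : cocyc u;
  st_dv : cocyc v;
  st_vu : forall k (e : p + q = k), hcomp e v u = 0;
  st_split : exists p' q' (r : hom V U p') (s : hom W V q')
     (e1 : p + p' = 0) (e2 : q' + q = 0) (e3 : p' + p = 0) (e4 : q + q' = 0),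
     [/\ hcomp e1 r u = hid U, hcomp e2 v s = hid W &
      hcomp e3 u r + hcomp e4 s v = hid V] }.

Hypothesis st : striple.

Lemma st_inj i j (e : i + p = j) x : u i j e x = 0 -> x = 0.
Proof.
have [p' [q' [r [s [e1 [e2 [e3 [e4 [ru _ _]]]]]]]]] := st_split st => ux.
have h : j + p' = i by lia.
by rewrite -(hidE (M:=U) (addr0 i) x) -ru (hcompE e1 _ _ _ e h) ux hfun0.
Qed.

Lemma st_surj i j (e : i + q = j) y : exists x, v i j e x = y.
Proof.
have [p' [q' [r [s [e1 [e2 [e3 [e4 [_ vs _]]]]]]]]] := st_split st.
have h : j + q' = i by lia.
exists (s j i h y).
by rewrite -[RHS](hidE (M:=W) (addr0 j) y) -vs (hcompE e2 _ _ _ h e).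
Qed.

Lemma st_vuE i j k (e : i + p = j) (e' : j + q = k) x : v j k e' (u i j e x) = 0.
Proof.
have h : i + (p + q) = k by lia.
by rewrite -(hcompE erefl v u h e e') (st_vu st) hom0E.
Qed.

Lemma st_exact i j k (e : i + q = j) (e' : k + p = i) y :
  v i j e y = 0 -> exists x, u k i e' x = y.
Proof.
have [p' [q' [r [s [e1 [e2 [e3 [e4 [_ _ ursv]]]]]]]]] := st_split st => vy.
have h : i + p' = k by lia.
have h' : j + q' = i by lia.
exists (r i k h y); rewrite -[RHS](hidE (M:=V) (addr0 i) y) -ursv homDE.
by rewrite (hcompE e3 _ _ _ h e') (hcompE e4 _ _ _ e h') vy hfun0 addr0.
Qed.

Lemma st_Zu i j (e : i + p = j) x : isZ (u i j e x) -> isZ x.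
Proof.
move=> hx k ek; have h : k + p = j + 1 by lia.
apply: (st_inj (e := h)); apply: (can_inj (zsignK p)).
by rewrite -(cocyc_cd (st_du st) e erefl ek h) hx zsign00.
Qed.

Variable S : A 0 -> Prop.
Hypothesis mS : mset S.

(** Exactness of the long cohomology sequence at [V]. After multiplication by some [s] the image in
    [W] bounds; correcting by a lift of the bounding element moves the cocycle into [U], where a
    second denominator [t] finishes. *)
Lemma svan_mid i j k : i + p = k -> k + q = j -> svan S U i -> svan S W j -> svan S V k.
Proof.
move=> e1 e2 hU hW x hx.
have [s [Ss sB]] := hW _ (cocyc_Z (st_dv st) e2 hx).
have e3 : j - 1 + 1 = j by lia.
move/(isBP e3): sB => [w hw].
have e4 : k - 1 + q = j - 1 by lia.
have e5 : k - 1 + 1 = k by lia.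
have [v' hv'] := st_surj e4 w.
have : v k j e2 (sc s x - zsign q (cd e5 v')) = 0.
  rewrite hfunB hfun_sc hw hfun_zsign -hv'.
  by rewrite (cocyc_cd (st_dv st) e4 e3 e5 e2) subrr.
move=> /(st_exact e1) [y hy].
have hz : isZ y.
  apply: (st_Zu (e := e1)); rewrite hy; apply: isZB; first exact: sc_Z.
  by apply/isZ_zsign/isBZ/isB_cd.
have [t [St tB]] := hU _ hz.
apply: (sbnd_sc mS Ss); exists t; split=> //.
rewrite -[sc s x](subrK (zsign q (cd e5 v'))) -hy scDr -hfun_sc.
apply: isBD; first exact: (cocyc_B (st_du st)).
by apply/sc_B/isB_zsign/isB_cd.
Qed.

(** Exactness at [U], with the connecting map hidden in the elements: if [s u(x) = d y], then [v(y)]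
    is a cocycle of [W]. Once a multiple of it bounds, the same multiple of [y] can be corrected to
    come from [U], and injectivity of [u] exhibits a multiple of [x] as a boundary. *)
Lemma svan_left i j k : i + p = j -> i + p + q = k + 1 -> svan S V j -> svan S W k -> svan S U i.
Proof.
move=> e1 e2 hV hW x hx.
have [s [Ss sB]] := hV _ (cocyc_Z (st_du st) e1 hx).
have e3 : j - 1 + 1 = j by lia.
have e4 : j - 1 + q = k by lia.
have e5 : j + q = k + 1 by lia.
move/(isBP e3): sB => [y hy].
have hvy : isZ (v _ k e4 y).
  apply: (isZP (e := erefl)).
  by rewrite (cocyc_cd (st_dv st) e4 erefl e3 e5) -hy hfun_sc st_vuE sc0r zsign00.
have [t [St]] := hW _ hvy.
have e6 : k - 1 + 1 = k by lia.
move/(isBP e6) => [w hw].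
have e7 : j - 2 + q = k - 1 by lia.
have e8 : j - 2 + 1 = j - 1 by lia.
have [y' hy'] := st_surj e7 w.
have e9 : i - 1 + p = j - 1 by lia.
have : v _ k e4 (sc t y - zsign q (cd e8 y')) = 0.
  rewrite hfunB hfun_sc hw hfun_zsign -hy'.
  by rewrite (cocyc_cd (st_dv st) e7 e6 e8 e4) subrr.
move=> /(st_exact e9) [z hz].
apply: (sbnd_sc mS Ss); exists t; split=> //.
have e10 : i - 1 + 1 = i by lia.
exists (i - 1), e10, (zsign p z); apply/eqP; rewrite -subr_eq0; apply/eqP.
apply: (st_inj (e := e1)); rewrite hfunB cd_zsign hfun_zsign.
rewrite -(cocyc_cd (st_du st) e9 e3 e10 e1) hz cdB cd_sc -hy.
by rewrite cd_zsign cdd zsign00 subr0 !hfun_sc subrr.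
Qed.

End Triple.

(** * DG functors, with Hom and the tensor product as examples *)

Section Functors.
Variables A B : cdgRing.

(** Acting on homs of all degrees, and not only on closed ones of degree 0, such a functor
    transports graded splittings and null-homotopies. It thus preserves triples, cones and homotopy
    equivalences without any exactness assumption. *)
Record dgfun := DGFun {
  fo :> dgMod A -> dgMod B;
  fh : forall M N n, hom M N n -> hom (fo M) (fo N) n;
  fhD : forall M N n (f g : hom M N n), fh (f + g) = fh f + fh g;
  fh_id : forall M, fh (hid M) = hid (fo M);
  fh_comp : forall M N P n m k (e : n + m = k) (g : hom N P m) (f : hom M N n),
    fh (hcomp e g f) = hcomp e (fh g) (fh f);
  fh_d : forall M N n k (e : n + 1 = k) (f : hom M N n), homd e (fh f) = fh (homd e f) }.

Record dgcof := DGCof {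
  co :> dgMod A -> dgMod B;
  ch : forall M N n, hom M N n -> hom (co N) (co M) n;
  chD : forall M N n (f g : hom M N n), ch (f + g) = ch f + ch g;
  ch_id : forall M, ch (hid M) = hid (co M);
  ch_comp : forall M N P n m k (e : n + m = k) (e' : m + n = k) (g : hom N P m) (f : hom M N n),
    ch (hcomp e g f) = zsign (n * m) (hcomp e' (ch f) (ch g));
  ch_d : forall M N n k (e : n + 1 = k) (f : hom M N n), homd e (ch f) = ch (homd e f) }.

Lemma fh0 (F : dgfun) M N n : fh F (0 : hom M N n) = 0.
Proof. exact: (morphD0 (@fhD F M N n)). Qed.
Lemma ch0 (F : dgcof) M N n : ch F (0 : hom M N n) = 0.
Proof. exact: (morphD0 (@chD F M N n)). Qed.

Lemma fh_cocyc (F : dgfun) M N n (f : hom M N n) : cocyc f -> cocyc (fh F f).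
Proof. by move=> df k e; rewrite fh_d df fh0. Qed.
Lemma ch_cocyc (F : dgcof) M N n (f : hom M N n) : cocyc f -> cocyc (ch F f).
Proof. by move=> df k e; rewrite ch_d df ch0. Qed.

Lemma striple_fun (F : dgfun) U V W p q (u : hom U V p) (v : hom V W q) :
  striple u v -> striple (fh F u) (fh F v).
Proof.
case=> du dv vu [p' [q' [r [s [e1 [e2 [e3 [e4 [h1 h2 h3]]]]]]]]].
split; [exact: fh_cocyc | exact: fh_cocyc | by move=> k e; rewrite -fh_comp vu fh0 |].
exists p', q', (fh F r), (fh F s), e1, e2, e3, e4.
by rewrite -!fh_comp h1 h2 !fh_id -fhD h3 fh_id.
Qed.

Lemma striple_cof (F : dgcof) U V W p q (u : hom U V p) (v : hom V W q) :
  striple u v -> striple (ch F v) (ch F u).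
Proof.
case=> du dv vu [p' [q' [r [s [e1 [e2 [e3 [e4 [h1 h2 h3]]]]]]]]].
have ep : p + q = q + p by rewrite addrC.
split; [exact: ch_cocyc | exact: ch_cocyc | |].
  move=> k e; have e' : p + q = k by lia.
  apply: (can_inj (zsignK (p * q))).
  by rewrite -(ch_comp F e' e) vu ch0 zsign00.
(* The splittings change sign because [ch] exchanges two maps of opposite degrees [q'] and [q], at
   the price of the sign of [q' q], which has the parity of [q]. *)
exists q', p', (zsign q (ch F s)), (zsign p (ch F r)), e4, e3, e2, e1.
have op : odd `|p'|%N = odd `|p|%N by lia.
have oq : odd `|q'|%N = odd `|q|%N by lia.
rewrite hcomp_zsignl hcomp_zsignr hcomp_zsignl hcomp_zsignr; split.
- rewrite -ch_id -h2 (ch_comp F e2 e4).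
  by apply: zsign_par; rewrite odd_abszM oq andbb.
- rewrite -ch_id -h1 (ch_comp F e1 e3).
  by apply: zsign_par; rewrite odd_abszM op andbb.
rewrite -ch_id -h3 chD (ch_comp F e3 e1) (ch_comp F e4 e2) addrC.
by congr (_ + _); apply: zsign_par; rewrite odd_abszM ?op ?oq andbb.
Qed.
End Functors.

Section HomFunctors.
Variable A : cdgRing.

Lemma homaE (M N : dgMod A) p n k (e : p + n = k) (a : A p) (f : hom M N n) i j j'
    (ej : i + k = j) (e1 : i + n = j') (e2 : p + j' = j) m :
  homa e a f i j ej m = act e2 a (f i j' e1 m).
Proof. exact: homa_funE. Qed.

Lemma hcomp_homar (Q M N : dgMod A) n (f : hom M N n) p i k j l (e : p + i = k)
    (ej : i + n = j) (el : k + n = l) (e' : p + j = l) a (h : hom Q M i) :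
  hcomp el f (homa e a h) = zsign (p * n) (homa e' a (hcomp ej f h)).
Proof.
apply: hom_ext => x y exy m; rewrite hom_zsignE.
have h1 : x + k + n = y by lia.
have h2 : p + (x + i) = x + k by lia.
have h3 : x + i + n = x + j by lia.
have h4 : p + (x + j) = y by lia.
rewrite (hcompE el _ _ exy erefl h1) (homaE e _ _ erefl erefl h2).
rewrite (homaE e' _ _ exy erefl h4) (hcompE ej _ _ erefl erefl h3).
exact: hom_act.
Qed.

Lemma hcomp_homal (Q M N : dgMod A) n (f : hom Q M n) p i k j l (e : p + i = k)
    (ej : n + i = j) (el : n + k = l) (e' : p + j = l) a (h : hom M N i) :
  hcomp el (homa e a h) f = homa e' a (hcomp ej h f).
Proof.
apply: hom_ext => x y exy m.
have h1 : x + n + k = y by lia.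
have h2 : x + n + i = x + j by lia.
have h4 : p + (x + j) = y by lia.
rewrite (hcompE el _ _ exy erefl h1) (homaE e _ _ h1 h2 h4).
by rewrite (homaE e' _ _ exy erefl h4) (hcompE ej _ _ erefl erefl h2).
Qed.

Section Post.
Variable Q : dgMod A.

Definition hpost (M N : dgMod A) n (f : hom M N n) : hom (Homdg Q M) (Homdg Q N) n :=
  @Hom A (Homdg Q M) (Homdg Q N) n (fun i j e (h : hom Q M i) => hcomp e f h : Homdg Q N j)
   (fun i j e x y => hcompDr e f x y)
   (fun p i k j l e ej el e' a h => hcomp_homar f e ej el e' a h).

Lemma hpostE (M N : dgMod A) n (f : hom M N n) i j (e : i + n = j) (h : hom Q M i) :
  hpost f i j e h = hcomp e f h.
Proof. by []. Qed.

Program Definition HomR : dgfun A A :=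
  @DGFun A A (fun M => Homdg Q M) (fun M N n f => hpost f) _ _ _ _.
Next Obligation. by move=> M N n f g; apply: hom_ext => i j e h; apply: hcompDl. Qed.
Next Obligation.
by move=> M; apply: hom_ext0 => i e h; rewrite hidE hpostE hcomp1l.
Qed.
Next Obligation.
move=> M N P n m k e g f; apply: hom_ext => i j ej h.
have h1 : i + n + m = j by lia.
by rewrite (hcompE e _ _ ej erefl h1) !hpostE; symmetry; apply: hcompA.
Qed.
Next Obligation.
move=> M N n k e f; apply: hom_ext => i j ej h.
have h1 : i + n + 1 = j by lia.
have h2 : i + 1 + n = j by lia.
rewrite (homdE e _ ej erefl erefl h1 h2) !hpostE.
by rewrite [cd h1 _](homd_comp erefl erefl e h1 ej h2) addrK.
Qed.
End Post.

Section Pre.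
Variable N : dgMod A.

Program Definition hpre (M M' : dgMod A) n (h : hom M M' n) : hom (Homdg M' N) (Homdg M N) n :=
  @Hom A (Homdg M' N) (Homdg M N) n
    (fun i j e (f : hom M' N i) => zsign (n * i) (hcomp (etrans (addrC n i) e) f h) : Homdg M N j)
    _ _.
Next Obligation. by move=> M M' n h i j e x y; rewrite hcompDl zsign_addr. Qed.
Next Obligation.
move=> M M' n h p i k j l e ej el e' a f.
have e1 : n + i = j by lia.
rewrite (hcomp_homal h e e1 _ e') [act e' _ _](morphD_zsign (fun x y => homaDr e' a x y)).
rewrite -!zsignD (Prop_irrelevance (etrans (addrC n i) ej) e1); zpar.
Qed.

Lemma hpreE (M M' : dgMod A) n (h : hom M M' n) i j (e : i + n = j) (e' : n + i = j)
   (f : hom M' N i) :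
  hpre h i j e f = zsign (n * i) (hcomp e' f h).
Proof. by rewrite (Prop_irrelevance e' (etrans (addrC n i) e)). Qed.

Program Definition HomL : dgcof A A :=
  @DGCof A A (fun M => Homdg M N) (fun M M' n f => hpre f) _ _ _ _.
Next Obligation.
move=> M M' n f g; apply: hom_ext => i j e h.
by rewrite homDE /= hcompDr zsign_addr.
Qed.
Next Obligation.
move=> M; apply: hom_ext0 => i e h.
by rewrite hidE (hpreE _ _ (add0r i)) mul0r zsign0 hcomp1r.
Qed.
Next Obligation.
move=> M M' P n m k e e' g f; apply: hom_ext => i j ej h; rewrite hom_zsignE.
have h1 : i + m + n = j by lia.
have h2 : k + i = j by lia.
have h3 : m + i = i + m by lia.
have h4 : n + (i + m) = j by lia.
rewrite (hcompE e' _ _ ej erefl h1) (hpreE _ ej h2) (hpreE _ _ h3) (hpreE _ h1 h4).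
rewrite (hcompA _ h2 h3 h4) hcomp_zsignl -!zsignD; zpar.
Qed.
Next Obligation.
move=> M M' n k e f; apply: hom_ext => i j ej h.
have h1 : i + n + 1 = j by lia.
have h2 : i + 1 + n = j by lia.
have h3 : n + i = i + n by lia.
have h4 : n + (i + 1) = j by lia.
have h5 : k + i = j by lia.
rewrite (homdE e _ ej erefl erefl h1 h2) (hpreE _ _ h3) (hpreE _ _ h4) (hpreE _ _ h5).
rewrite cd_zsign [cd h1 _](homd_comp h3 e erefl h1 h4 h5) zsign_addr -!zsignD.
rewrite addrAC -[RHS]add0r; congr (_ + _).
  by apply/eqP; rewrite subr_eq0; apply/eqP; zpar.
by zpar.
Qed.
End Pre.
End HomFunctors.

Section TensorFunctor.
Variables (A : cdgRing) (N : dgMod A).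

Section Map.
Variables (M M' : dgMod A) (n : int) (h : hom M M' n).

Lemma thom_e (a b i j : int) : a + b = i -> i + n = j -> a + n + b = j. Proof. lia. Qed.

Definition thom_pure i j (e : i + n = j) a b (e0 : a + b = i) (m : M a) (x : N b) :
   tens M' N j :=
  pure (thom_e e0 e) (h a (a + n) erefl m) x.

Lemma thom_pureE i j (e : i + n = j) a b a' (e0 : a + b = i) (e1 : a + n = a')
   (e2 : a' + b = j) m x :
  thom_pure e e0 m x = pure e2 (h a a' e1 m) x.
Proof. by subst a'; rewrite /thom_pure (Prop_irrelevance (thom_e e0 e) e2). Qed.

Lemma thom_balanced i j (e : i + n = j) : balanced (thom_pure e).
Proof.
split.
- by move=> a b e0 x m m'; rewrite /thom_pure homD pureDl.
- by move=> a b e0 m x x'; rewrite /thom_pure pureDr.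
move=> a p b pa pb e1 e2 e0 e0' m r x.
have h1 : pa + n + b = j by lia.
have h2 : a + n + pb = j by lia.
have h3 : p + (a + n) = pa + n by lia.
rewrite (thom_pureE e e0 erefl h1) (thom_pureE e e0' erefl h2).
rewrite hfun_zsign (hom_act h e1 erefl erefl h3) -(pure_balanced h3 e2 h1 h2).
rewrite -zsignD; congr (pure h1 _ x); zpar.
Qed.

Program Definition thom : hom (tensor M N) (tensor M' N) n :=
  @Hom A (tensor M N) (tensor M' N) n
    (fun i j e (t : tens M N i) => tlift (thom_pure e) t : tensor M' N j) _ _.
Next Obligation. by move=> i j e; apply: (tliftD (thom_balanced e)). Qed.
Next Obligation.
move=> p i k j l e ej el e' a.
apply: (@tens_ext _ _ _ _ _ (fun m => tlift (thom_pure el) (tensa e a m))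
  (fun m => zsign (p * n) (tensa e' a (tlift (thom_pure ej) m)))).
- by move=> x y; rewrite tensa_addr (tliftD (thom_balanced _)).
- by move=> x y; rewrite (tliftD (thom_balanced _)) tensa_addr zsign_addr.
move=> x y exy m z.
have h1 : p + x + y = k by lia.
have h2 : p + x + n + y = l by lia.
have h3 : x + n + y = j by lia.
have h4 : p + (x + n) = p + x + n by lia.
rewrite (tensaE e a exy erefl h1) !(tlift_pure (thom_balanced _)).
rewrite (thom_pureE el h1 erefl h2) (thom_pureE ej exy erefl h3).
rewrite (tensaE e' a h3 h4 h2) (hom_act h erefl erefl erefl h4).
by rewrite pure_zsignl.
Qed.

Lemma thomE i j (e : i + n = j) a b a' (e0 : a + b = i) (e1 : a + n = a')
   (e2 : a' + b = j) m x :
  thom i j e (pure e0 m x) = pure e2 (h a a' e1 m) x.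
Proof. by rewrite /= (tlift_pure (thom_balanced _)); apply: thom_pureE. Qed.
End Map.

Lemma homT_ext (M L : dgMod A) n (f g : hom (tensor M N) L n) :
  (forall i j (e : i + n = j) a b (e0 : a + b = i) m x,
     f i j e (pure e0 m x) = g i j e (pure e0 m x)) -> f = g.
Proof.
move=> fg; apply: hom_ext => i j e t.
by apply: (tens_ext (homD f e) (homD g e) (fg i j e)).
Qed.

Program Definition TensL : dgfun A A :=
  @DGFun A A (fun M => tensor M N) (fun M M' n f => thom f) _ _ _ _.
Next Obligation.
move=> M M' n f g; apply: homT_ext => i j e a b e0 m x.
have h : a + n + b = j by lia.
by rewrite homDE !(thomE _ e e0 erefl h) homDE pureDl.
Qed.
Next Obligation.
move=> M; apply: homT_ext => i j e a b e0 m x.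
have ei : i = j by rewrite -e addr0.
case: j / ei e => e.
by rewrite hidE (thomE _ e e0 (addr0 a) e0) hidE.
Qed.
Next Obligation.
move=> M M' P n m k e g f; apply: homT_ext => i j ej a b e0 x y.
have h1 : i + n + m = j by lia.
have h2 : a + n + b = i + n by lia.
have h3 : a + n + m + b = j by lia.
have h4 : a + k = a + n + m by lia.
rewrite (hcompE e _ _ ej erefl h1) (thomE _ erefl e0 erefl h2).
by rewrite (thomE _ h1 h2 erefl h3) (thomE _ ej e0 h4 h3) (hcompE e _ _ h4 erefl erefl).
Qed.
Next Obligation.
move=> M M' n k e f; apply: homT_ext => i j ej a b e0 m x.
have h1 : i + n + 1 = j by lia.
have h2 : i + 1 + n = j by lia.
rewrite (homdE e _ ej erefl erefl h1 h2).
have h3 : a + n + b = i + n by lia.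
have h4 : a + n + 1 + b = j by lia.
have h5 : a + n + (b + 1) = j by lia.
have h6 : a + 1 + b = i + 1 by lia.
have h7 : a + (b + 1) = i + 1 by lia.
have h8 : a + 1 + n = a + n + 1 by lia.
have h9 : a + k = a + n + 1 by lia.
rewrite (thomE _ erefl e0 erefl h3) (thomE _ ej e0 h9 h4).
rewrite [cd h1 _](tensdE h1 h3 erefl erefl h4 h5).
rewrite [cd (erefl (i + 1)) _](tensdE (erefl (i + 1)) e0 erefl erefl h6 h7).
rewrite homD hfun_zsign (thomE _ h2 h6 h8 h4) (thomE _ h2 h7 erefl h5).
rewrite (homdE e _ h9 erefl erefl erefl h8).
rewrite (morphDB (pureDl h4 x)) pure_zsignl zsign_addr -zsignD opprD addrACA.
rewrite -[RHS]addr0; congr (_ + _).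
by apply/eqP; rewrite subr_eq0; apply/eqP; zpar.
Qed.
End TensorFunctor.

(** * Shifts, cones and direct sums *)

Section Iso.
Variable A : cdgRing.

(** Strict isomorphisms of arbitrary degree. Admitting nonzero degrees lets a module be compared
    with its shifts directly, and vanishing in degree [i] becomes vanishing in degree [i + n]. *)
Definition hinv (M N : dgMod A) n n' (u : hom M N n) (v : hom N M n') : Prop :=
  exists (e : n + n' = 0) (e' : n' + n = 0),
    [/\ cocyc u, cocyc v, hcomp e v u = hid M & hcomp e' u v = hid N].

Lemma hinv_sym (M N : dgMod A) n n' (u : hom M N n) (v : hom N M n') : hinv u v -> hinv v u.
Proof. by move=> [e [e' [du dv vu uv]]]; exists e', e. Qed.

Lemma hinvE (M N : dgMod A) n n' (u : hom M N n) (v : hom N M n') i j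
    (e : i + n = j) (e' : j + n' = i) x : hinv u v -> v j i e' (u i j e x) = x.
Proof.
move=> [h [h' [_ _ vu _]]].
by rewrite -(hcompE h _ _ (addr0 i) e e') vu hidE.
Qed.

Lemma hinv_svan S (M N : dgMod A) n n' (u : hom M N n) (v : hom N M n') i j :
  i + n = j -> hinv u v -> svan S M i -> svan S N j.
Proof.
move=> e uv hM x hx; have e' : j + n' = i by case: uv => e1 _; lia.
have vu := hinv_sym uv; have [e0 [_ [du dv _ _]]] := uv.
have [s [Ss sB]] := hM _ (cocyc_Z dv e' hx).
exists s; split=> //; rewrite -(hinvE e' e x vu) -hfun_sc.
exact: (cocyc_B du).
Qed.

Lemma hinv_van (M N : dgMod A) n n' (u : hom M N n) (v : hom N M n') i j :
  i + n = j -> hinv u v -> van M i -> van N j.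
Proof. by move=> e uv /svan1 h; apply/svan1/(hinv_svan e uv). Qed.
End Iso.

Lemma hinv_fun A B (F : dgfun A B) (M N : dgMod A) n n' (u : hom M N n) (v : hom N M n') :
  hinv u v -> hinv (fh F u) (fh F v).
Proof.
move=> [e [e' [du dv vu uv]]]; exists e, e'.
by split; [exact: fh_cocyc | exact: fh_cocyc | |]; rewrite -fh_comp ?vu ?uv fh_id.
Qed.

Lemma hinv_cof A B (F : dgcof A B) (M N : dgMod A) n n' (u : hom M N n) (v : hom N M n') :
  hinv u v -> hinv (ch F u) (zsign n (ch F v)).
Proof.
move=> [e [e' [du dv vu uv]]]; exists e, e'.
have od : odd `|n'|%N = odd `|n|%N by lia.
split; [exact: ch_cocyc | | |].
- by move=> k ek; rewrite homd_zsign (ch_cocyc F dv) zsign00.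
- rewrite hcomp_zsignl -ch_id -uv (ch_comp F e' e).
  by apply: zsign_par; rewrite odd_abszM od andbb.
rewrite hcomp_zsignr -ch_id -vu (ch_comp F e e').
by apply: zsign_par; rewrite odd_abszM od andbb.
Qed.

Section Shift.
Variables (A : cdgRing) (n : int) (M : dgMod A).

Lemma sh_e1 (i j : int) : i + 1 = j -> i + n + 1 = j + n. Proof. lia. Qed.
Lemma sh_e2 (p i j : int) : p + i = j -> p + (i + n) = j + n. Proof. lia. Qed.

Program Definition shc : cpx :=
  @Cpx (fun i => M (i + n)) (fun i j e x => zsign n (cd (sh_e1 e) x)) _ _.
Next Obligation. by move=> i j e x y /=; rewrite cdD zsign_addr. Qed.
Next Obligation. by move=> i j k e e' x /=; rewrite cd_zsign cdd !zsign00. Qed.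

(* The action on a shift carries the sign of moving [a] past the shift. *)
Program Definition sh : dgMod A :=
  @DGMod A shc (fun p i k e a x => zsign (p * n) (act (sh_e2 e) a x)) _ _ _ _ _.
Next Obligation. by move=> * /=; rewrite actDl zsign_addr. Qed.
Next Obligation. by move=> * /=; rewrite actDr zsign_addr. Qed.
Next Obligation.
move=> i j k ij jk ijk e1 e2 e3 e4 a b m /=.
rewrite act_zsignr (actA e1 (sh_e2 e2) (sh_e2 e3) (sh_e2 e4)) -zsignD; zpar.
Qed.
Next Obligation. by move=> i e m /=; rewrite act1 mul0r zsign0. Qed.
Next Obligation.
move=> i j k i' j' k' e ei ej ek e1 e2 a m /=.
rewrite cd_zsign (act_leibniz (sh_e2 e) ei (sh_e1 ej) (sh_e1 ek) (sh_e2 e1) (sh_e2 e2)).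
rewrite act_zsignr !zsign_addr -!zsignD; congr (_ + _); zpar.
Qed.

Lemma shin_e (i j : int) : i + - n = j -> i = j + n. Proof. lia. Qed.

Program Definition shin : hom M sh (- n) :=
  @Hom A M sh (- n) (fun i j e x => @cst M _ _ (shin_e e) x : sh j) _ _.
Next Obligation. by move=> i j e x y; exact: (@cstD M _ _ (shin_e e) x y). Qed.
Next Obligation.
move=> p i k j l e ej el e' a m /=.
by rewrite (cst_act e (shin_e ej) (shin_e el) (sh_e2 e')) -zsignD zsign_even //; lia.
Qed.

Program Definition shout : hom sh M n :=
  @Hom A sh M n (fun i j e (x : sh i) => @cst M _ _ e x) _ _.
Next Obligation. by move=> i j e x y; exact: (@cstD M _ _ e x y). Qed.
Next Obligation.
move=> p i k j l e ej el e' a m /=.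
by rewrite -(cst_act (sh_e2 e) ej el e') (morphD_zsign (cstD el)).
Qed.

Lemma cst_cd (X : cpx) i j k l (e : i + 1 = j) (e1 : i = k) (e2 : j = l) (e' : k + 1 = l)
    (x : X i) : @cst X j l e2 (cd e x) = cd e' (@cst X i k e1 x).
Proof. by subst k l; rewrite !cst_id; apply: cd_irr. Qed.

Lemma cst_cst (X : cpx) i j k (e1 : i = j) (e2 : j = k) (e : i = k) (x : X i) :
  @cst X j k e2 (@cst X i j e1 x) = @cst X i k e x.
Proof. by subst j k; rewrite !cst_id. Qed.

Lemma hinv_sh : hinv shin shout.
Proof.
exists (addNr n), (addrN n); split.
- move=> k e; apply: hom_ext => i j ej m.
  have h1 : i + - n + 1 = j by lia.
  have h2 : i + 1 + - n = j by lia.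
  rewrite (homdE e _ ej erefl erefl h1 h2) /=.
  rewrite (cst_cd erefl (shin_e erefl) (shin_e h2) (sh_e1 h1)).
  by apply/eqP; rewrite subr_eq0; apply/eqP/zsign_par; rewrite abszN.
- move=> k e; apply: hom_ext => i j ej m.
  have h1 : i + n + 1 = j by lia.
  have h2 : i + 1 + n = j by lia.
  rewrite (homdE e _ ej erefl erefl h1 h2) /=.
  rewrite (morphD_zsign (cstD h2)) zsignK.
  by rewrite (cst_cd (sh_e1 erefl) erefl h2 h1) cst_id subrr.
- apply: hom_ext0 => i e x.
  have h : i + - n = i - n by [].
  have h2 : i - n + n = i by lia.
  by rewrite (hcompE (addNr n) _ _ e h h2) hidE /= (cst_cst _ _ erefl) cst_id.
apply: hom_ext0 => i e x.
have h2 : i + n - n = i by lia.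
by rewrite (hcompE (addrN n) _ _ e erefl h2) hidE /= cst_id.
Qed.
End Shift.

Lemma zsign_pair (V W : zmodType) n (x : V) (y : W) :
  zsign n (x, y) = (zsign n x, zsign n y) :> (V * W)%type.
Proof. by rewrite /zsign; case: (odd _). Qed.

Section Cone.
Variables (A : cdgRing) (X Y : dgMod A) (f : hom X Y 0).
Hypothesis df : cocyc f.

Lemma cone_e (i j : int) : i + 1 = j -> i + 1 + 0 = j. Proof. lia. Qed.
Lemma cone_e2 (i j : int) : i + 1 = j -> i + 1 + 1 = j + 1. Proof. lia. Qed.
Lemma cone_e3 (p i j : int) : p + i = j -> p + (i + 1) = j + 1. Proof. lia. Qed.

Definition coned i j (e : i + 1 = j) (z : X (i + 1)%R * Y i) : X (j + 1)%R * Y j :=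
  (- cd (cone_e2 e) z.1, f (i + 1) j (cone_e e) z.1 + cd e z.2).

Program Definition conec : cpx :=
  @Cpx (fun i => (X (i + 1)%R * Y i)%type) coned _ _.
Next Obligation.
move=> i j e [x y] [x' y']; rewrite /coned /=.
by rewrite cdD homD cdD opprD addrACA.
Qed.
Next Obligation.
move=> i j k e e' [x y]; rewrite /coned /= cdN cdd !oppr0.
rewrite hfunN cdD cdd addr0.
have h : i + 1 + 1 + 0 = k by lia.
rewrite (cocyc_cd df (cone_e e) e' (cone_e2 e) (cone_e e')) zsign0 addNr //.
Qed.

Definition conea p i j (e : p + i = j) (a : A p) (z : X (i + 1)%R * Y i) : X (j + 1)%R * Y j :=
  (zsign p (act (cone_e3 e) a z.1), act e a z.2).

Program Definition cone : dgMod A := @DGMod A conec conea _ _ _ _ _.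
Next Obligation. by move=> i j k e a b [x y]; rewrite /conea /= !actDl zsign_addr. Qed.
Next Obligation. by move=> i j k e a [x y] [x' y']; rewrite /conea /= !actDr zsign_addr. Qed.
Next Obligation.
move=> i j k ij jk ijk e1 e2 e3 e4 a b [x y]; rewrite /conea /=.
rewrite (actA e1 e2 e3 e4) act_zsignr (actA e1 (cone_e3 e2) (cone_e3 e3) (cone_e3 e4)).
by rewrite -zsignD; congr pair; zpar.
Qed.
Next Obligation. by move=> i e [x y]; rewrite /conea /= !act1. Qed.
Next Obligation.
move=> i j k i' j' k' e ei ej ek e1 e2 a [x y]; rewrite /coned /conea /=.
rewrite zsign_pair /GRing.add /= /add_pair /=.
congr pair.
  rewrite cd_zsign zsignK actNr -zsignN.
  rewrite (act_leibniz (cone_e3 e) ei (cone_e2 ej) (cone_e2 ek) (cone_e3 e1) (cone_e3 e2)).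
  rewrite opprD zsign_addr !zsignN zsignK; congr (_ + _).
  rewrite -zsignN -zsign1 -zsignD; zpar.
rewrite actDr zsign_addr (act_leibniz e ei ej ek e1 e2) addrCA.
rewrite hfun_zsign (hom_act f (cone_e3 e) (cone_e ej) (cone_e ek) e2).
by rewrite mulr0 zsign0.
Qed.

Program Definition ciY : hom Y cone 0 :=
  @Hom A Y cone 0 (fun i j e y => (0, @cst Y i j (etrans (esym (addr0 i)) e) y) : cone j) _ _.
Next Obligation. by move=> i j e x y; rewrite cstD /GRing.add /= /add_pair /= addr0. Qed.
Next Obligation.
move=> p i k j l e ej el e' a m /=.
by rewrite mulr0 zsign0 /conea /= act0r zsign00; congr pair; apply: cst_act.
Qed.

Program Definition cpY : hom cone Y 0 :=
  @Hom A cone Y 0 (fun i j e (z : cone i) => @cst Y i j (etrans (esym (addr0 i)) e) z.2) _ _.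
Next Obligation. by move=> i j e [x y] [x' y']; rewrite cstD. Qed.
Next Obligation.
move=> p i k j l e ej el e' a m /=.
by rewrite mulr0 zsign0 /conea /=; apply: cst_act.
Qed.

Program Definition cpX : hom cone X 1 :=
  @Hom A cone X 1 (fun i j e (z : cone i) => @cst X (i + 1) j e z.1) _ _.
Next Obligation. by move=> i j e [x y] [x' y']; rewrite cstD. Qed.
Next Obligation.
move=> p i k j l e ej el e' a m /=.
rewrite /conea /= (morphD_zsign (cstD el)) mulr1; congr zsign; exact: cst_act.
Qed.

Lemma ciX_e (i j : int) : i + - 1 = j -> i = j + 1. Proof. lia. Qed.

Program Definition ciX : hom X cone (- 1) :=
  @Hom A X cone (- 1) (fun i j e x => (@cst X i (j + 1) (ciX_e e) x, 0) : cone j) _ _.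
Next Obligation. by move=> i j e x y; rewrite cstD /GRing.add /= /add_pair /= addr0. Qed.
Next Obligation.
move=> p i k j l e ej el e' a m /=.
rewrite /conea /= act0r (cst_act e (ciX_e ej) (ciX_e el) (cone_e3 e')).
by rewrite zsign_pair zsign00 -zsignD [zsign (_ + _) _]zsign_even //; lia.
Qed.

Lemma st_cone : striple ciY cpX.
Proof.
split.
- move=> k e; apply: hom_ext => i j ej m.
  have h1 : i + 0 + 1 = j by lia.
  have h2 : i + 1 + 0 = j by lia.
  rewrite (homdE e _ ej erefl erefl h1 h2) zsign0 /= /coned /=.
  rewrite hfun0 cd0 oppr0 add0r.
  have hh : i + 1 = j by lia.
  rewrite (cst_cd erefl (etrans (esym (addr0 i)) erefl) (etrans (esym (addr0 (i + 1))) h2) h1).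
  exact: subrr.
- move=> k e; apply: hom_ext => i j ej [x y].
  have h1 : i + 1 + 1 = j by lia.
  rewrite (homdE e _ ej erefl erefl h1 h1) zsign1 opprK /=.
  rewrite (morphDN (cstD h1)) (cst_cd (cone_e2 erefl) erefl h1 h1) /=.
  exact: subrr.
- move=> k e; apply: hom_ext => i j ej m.
  have h1 : i + 0 = i by lia.
  have h2 : i + 1 = j by lia.
  rewrite (hcompE e _ _ ej h1 h2) /= (morphD0 (cstD _)) //.
have e1 : 0 + 0 = 0 :> int by lia.
have e2 : -1 + 1 = 0 :> int by lia.
have e4 : 1 + -1 = 0 :> int by lia.
(* [cpY] and [ciX] are linear but not closed: the cone splits only as a graded module. *)
exists 0, (-1), cpY, ciX, e1, e2, e1, e4; split.
- apply: hom_ext0 => i e x.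
  by rewrite (hcompE e1 _ _ e e e) hidE /= !cst_id.
- apply: hom_ext0 => i e x.
  have h1 : i + - 1 = i - 1 by [].
  have h2 : i - 1 + 1 = i by lia.
  by rewrite (hcompE e2 _ _ e h1 h2) hidE /= (cst_cst _ _ erefl) cst_id.
apply: hom_ext0 => i e [x y].
have h2 : i + 1 - 1 = i by lia.
rewrite homDE (hcompE e1 _ _ e e e) (hcompE e4 _ _ e erefl h2) hidE /=.
by rewrite !cst_id /GRing.add /= /add_pair /= add0r addr0 ?cst_id.
Qed.
End Cone.

Section DirectSum.
Variables (A : cdgRing) (I : choiceType) (F : I -> dgMod A).

Section Degree.
Variable k : int.

Record dsT := DsT {
  dsf :> forall i, F i k;
  ds_fin : exists s : seq I, forall i, i \notin s -> dsf i = 0 }.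

Lemma ds_ext (x y : dsT) : (forall i, x i = y i) -> x = y.
Proof.
case: x y => [x xs] [y ys] /= xy.
have E : x = y by apply: functional_extensionality_dep.
by subst y; congr DsT; apply: Prop_irrelevance.
Qed.

HB.instance Definition _ := gen_eqMixin dsT.
HB.instance Definition _ := gen_choiceMixin dsT.

Program Definition ds0 : dsT := @DsT (fun i => 0) _.
Next Obligation. by exists [::]. Qed.
Program Definition dsN (x : dsT) : dsT := @DsT (fun i => - x i) _.
Next Obligation.
by move=> x; have [s hs] := ds_fin x; exists s => i /hs ->; rewrite oppr0.
Qed.
Program Definition dsD (x y : dsT) : dsT := @DsT (fun i => x i + y i) _.
Next Obligation.
move=> x y; have [s hs] := ds_fin x; have [t ht] := ds_fin y.
exists (s ++ t) => i; rewrite mem_cat negb_or => /andP[/hs -> /ht ->].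
by rewrite addr0.
Qed.
Lemma dsDA : associative dsD.
Proof. by move=> x y z; apply: ds_ext => i /=; rewrite addrA. Qed.
Lemma dsDC : commutative dsD.
Proof. by move=> x y; apply: ds_ext => i /=; rewrite addrC. Qed.
Lemma ds0D : left_id ds0 dsD.
Proof. by move=> x; apply: ds_ext => i /=; rewrite add0r. Qed.
Lemma dsND : left_inverse ds0 dsN dsD.
Proof. by move=> x; apply: ds_ext => i /=; rewrite addNr. Qed.
HB.instance Definition _ := GRing.isZmodule.Build dsT dsDA dsDC ds0D dsND.

Lemma dsDE (x y : dsT) i : (x + y) i = x i + y i. Proof. by []. Qed.
Lemma ds0E i : (0 : dsT) i = 0. Proof. by []. Qed.
End Degree.

Program Definition ds_map k l (f : forall i, F i k -> F i l) (f0 : forall i, f i 0 = 0)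
    (x : dsT k) : dsT l := @DsT l (fun i => f i (x i)) _.
Next Obligation.
by move=> k l f f0 x; have [s hs] := ds_fin x; exists s => i /hs ->.
Qed.

Definition dsd k l (e : k + 1 = l) : dsT k -> dsT l :=
  @ds_map k l (fun i => @cd (F i) k l e) (fun i => @cd0 (F i) k l e).
Definition dsa p k l (e : p + k = l) (a : A p) : dsT k -> dsT l :=
  @ds_map k l (fun i => @act A (F i) p k l e a) (fun i => @act0r A (F i) p k l e a).

Program Definition dsc : cpx := @Cpx (fun k => dsT k) dsd _ _.
Next Obligation. by move=> k l e x y; apply: ds_ext => i /=; rewrite cdD. Qed.
Next Obligation. by move=> k l m e e' x; apply: ds_ext => i /=; rewrite cdd. Qed.

Program Definition dsum : dgMod A := @DGMod A dsc dsa _ _ _ _ _.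
Next Obligation. by move=> *; apply: ds_ext => z /=; rewrite actDl. Qed.
Next Obligation. by move=> *; apply: ds_ext => z /=; rewrite actDr. Qed.
Next Obligation.
by move=> i j k ij jk ijk e1 e2 e3 e4 a b m; apply: ds_ext => z /=; apply: actA.
Qed.
Next Obligation. by move=> *; apply: ds_ext => z /=; rewrite act1. Qed.
Next Obligation.
move=> i j k i' j' k' e ei ej ek e1 e2 a m; apply: ds_ext => z.
rewrite dsDE /zsign (fun_if (fun t : dsT k' => t z)) /=.
exact: act_leibniz.
Qed.

Definition ds_in i k (x : F i k) : dsT k.
Proof.
exists (fun j => if pselect (i = j) is left e then eq_rect i (fun j => F j k : Type) x j e else 0).
exists [:: i] => j; rewrite inE => ji; case: pselect => // e.
by case: (negP ji); apply/eqP.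
Defined.

Lemma ds_inE i k (x : F i k) : ds_in x i = x.
Proof. by rewrite /=; case: pselect => // e; rewrite (Prop_irrelevance e erefl). Qed.
Lemma ds_in0 i j k (x : F i k) : i <> j -> ds_in x j = 0.
Proof. by rewrite /=; case: pselect. Qed.

Lemma ds_in_map i k l (f : forall i, F i k -> F i l) f0 (x : F i k) :
  ds_map (f := f) f0 (ds_in x) = ds_in (f i x).
Proof.
apply: ds_ext => j /=; case: pselect => [e|_]; last exact: f0.
by case: j / e.
Qed.

Lemma ds_inD i k : {morph @ds_in i k : x y / x + y}.
Proof.
move=> x y; apply: ds_ext => j; rewrite dsDE /=.
by case: pselect => [e|_]; [case: j / e | rewrite addr0].
Qed.

Program Definition hin i : hom (F i) dsum 0 :=
  @Hom A (F i) dsum 0 (fun k l e x => ds_in (@cst (F i) k l (etrans (esym (addr0 k)) e) x) : dsum l) _ _.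
Next Obligation. by move=> i k l e x y; rewrite cstD ds_inD. Qed.
Next Obligation.
move=> i0 p i k j l e ej el e' a m.
rewrite mulr0 zsign0 [act e' _ _]ds_in_map; congr ds_in; exact: cst_act.
Qed.

Lemma hinE i k (e : k + 0 = k) x : hin i k k e x = ds_in x.
Proof. by rewrite /= cst_id. Qed.

Lemma cocyc_hin i : cocyc (hin i).
Proof.
move=> l e; apply: hom_ext => j k ek m.
have h1 : j + 1 = k by lia.
have h2 : j + 1 + 0 = k by lia.
rewrite (homdE e _ ek erefl (addr0 j) h1 h2) zsign0 hinE.
case: k / h1 ek h2 => ek h2; rewrite hinE [X in X - _]ds_in_map subrr //.
Qed.

Lemma ds_sum k (x : dsT k) s : uniq s -> (forall i, i \notin s -> x i = 0) ->
  x = \sum_(i <- s) ds_in (x i).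
Proof.
move=> us hs; apply: ds_ext => j.
have ev : {morph (fun y : dsT k => y j) : x y / x + y} by [].
rewrite (@big_morph _ _ (fun y : dsT k => y j) 0 +%R 0 +%R ev (ds0E k j)).
have [js|js] := boolP (j \in s).
  rewrite (bigD1_seq j) // ds_inE big1_seq; first exact/esym/addr0.
  move=> i /andP[ij _]; apply: ds_in0 => e; by rewrite e eqxx in ij.
rewrite hs // big1_seq // => i /andP[_ is_]; apply: ds_in0 => e.
by rewrite -e is_ in js.
Qed.

Lemma ds_supp k (x : dsT k) : exists2 s : seq I, uniq s & forall i, i \notin s -> x i = 0.
Proof.
have [s hs] := ds_fin x; exists (undup s); first exact: undup_uniq.
by move=> i; rewrite mem_undup; apply: hs.
Qed.

Lemma ds_add_ext k (V : zmodType) (f g : dsT k -> V) :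
  {morph f : x y / x + y} -> {morph g : x y / x + y} ->
  (forall i x, f (@ds_in i k x) = g (ds_in x)) -> f =1 g.
Proof.
move=> fD gD fg x; have [s us hs] := ds_supp x.
rewrite (ds_sum us hs) (big_morph f fD (morphD0 fD)) (big_morph g gD (morphD0 gD)).
by apply: eq_bigr => i _; apply: fg.
Qed.

Section Lift.
Variables (k : int) (V : zmodType) (f : forall i, F i k -> V).
Hypothesis fD : forall i, {morph @f i : x y / x + y}.

Lemma ds_lift_subproof (x : dsT k) : exists s : seq I, uniq s /\ forall i, i \notin s -> x i = 0.
Proof. by have [s us hs] := ds_supp x; exists s. Qed.

(** The sum runs over a chosen finite support; [ds_liftE] shows that the choice is immaterial. *)
Definition ds_lift (x : dsT k) : V := \sum_(i <- projT1 (cid (ds_lift_subproof x))) f (x i).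

Lemma ds_liftE (x : dsT k) s : uniq s -> (forall i, i \notin s -> x i = 0) ->
  ds_lift x = \sum_(i <- s) f (x i).
Proof.
rewrite /ds_lift; case: cid => t [/= ut ht] us hs.
rewrite (bigID (fun i => i \in s)) /= [X in _ + X]big1_seq ?addr0; last first.
  by move=> i /andP[/hs -> _]; rewrite (morphD0 (@fD i)).
rewrite [RHS](bigID (fun i => i \in t)) /= [X in _ + X]big1_seq ?addr0; last first.
  by move=> i /andP[/ht -> _]; rewrite (morphD0 (@fD i)).
rewrite -big_filter -[RHS]big_filter; apply: perm_big.
apply: uniq_perm; [exact: filter_uniq | exact: filter_uniq |].
by move=> i; rewrite !mem_filter andbC.
Qed.

Lemma ds_liftD : {morph ds_lift : x y / x + y}.
Proof.
move=> x y; have [s us hs] := ds_supp x; have [t ut ht] := ds_supp y.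
pose r := undup (s ++ t).
have hr i : i \notin r -> x i = 0 /\ y i = 0.
  by rewrite mem_undup mem_cat negb_or => /andP[/hs -> /ht ->].
rewrite !(@ds_liftE _ r) ?undup_uniq //; last 3 first.
- by move=> i /hr[].
- by move=> i /hr[].
- by move=> i /hr[hx hy]; rewrite dsDE hx hy addr0.
by rewrite -big_split; apply: eq_bigr => i _; rewrite dsDE fD.
Qed.

Lemma ds_lift_in i (x : F i k) : ds_lift (ds_in x) = f x.
Proof.
rewrite (@ds_liftE _ [:: i]) ?big_seq1 ?ds_inE // => j.
by rewrite inE => ij; apply: ds_in0 => e; rewrite e eqxx in ij.
Qed.
End Lift.

Program Definition hlift (N : dgMod A) n (g : forall i, hom (F i) N n) : hom dsum N n :=
  @Hom A dsum N n (fun k l e x => ds_lift (fun i => g i k l e) x) _ _.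
Next Obligation. by move=> N n g k l e; apply: ds_liftD => i; apply: homD. Qed.
Next Obligation.
move=> N n g p i k j l e ej el e' a.
apply: (@ds_add_ext _ _ (fun m => ds_lift (fun z => g z k l el) (dsa e a m))
  (fun m => zsign (p * n) (act e' a (ds_lift (fun z => g z i j ej) m)))).
- move=> x y; rewrite [dsa e a _](actDr (d := dsum)) ds_liftD // => z; exact: homD.
- by move=> x y; rewrite ds_liftD ?actDr ?zsign_addr // => z; apply: homD.
move=> z x.
rewrite /dsa ds_in_map ds_lift_in; last by move=> z'; apply: homD.
rewrite ds_lift_in; last by move=> z'; apply: homD.
exact: hom_act.
Qed.

Lemma hliftE (N : dgMod A) n (g : forall i, hom (F i) N n) k l (e : k + n = l) i x :
  hlift g k l e (ds_in x) = g i k l e x.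
Proof. by rewrite /= ds_lift_in // => j; apply: homD. Qed.

Lemma homS_ext (N : dgMod A) n (f g : hom dsum N n) :
  (forall i k l (e : k + n = l) x, f k l e (ds_in x) = g k l e (@ds_in i k x)) -> f = g.
Proof.
move=> fg; apply: hom_ext => k l e.
by apply: (ds_add_ext (homD f e) (homD g e)) => i x; apply: fg.
Qed.

Lemma hlift_hin (N : dgMod A) n (g : forall i, hom (F i) N n) i (e : 0 + n = n) :
  hcomp e (hlift g) (hin i) = g i.
Proof.
apply: hom_ext => k l ek x.
by rewrite (hcompE e _ _ ek (addr0 k) ek) hinE hliftE.
Qed.

Lemma hlift_eq (N : dgMod A) n (f g : hom dsum N n) (e : 0 + n = n) :
  (forall i, hcomp e f (hin i) = hcomp e g (hin i)) -> f = g.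
Proof.
move=> fg; apply: homS_ext => i k l ek x.
have : hcomp e f (hin i) k l ek x = hcomp e g (hin i) k l ek x by rewrite fg.
by rewrite !(hcompE e _ _ ek (addr0 k) ek) hinE.
Qed.

Lemma homd_hlift (N : dgMod A) n n' (e : n + 1 = n') (g : forall i, hom (F i) N n) :
  homd e (hlift g) = hlift (fun i => homd e (g i)).
Proof.
have e0 : 0 + n' = n' by rewrite add0r.
apply: (hlift_eq (e := e0)) => i.
rewrite hlift_hin -(hlift_hin g i (add0r n)).
have e1 : 0 + 1 = 1 :> int by rewrite add0r.
have e2 : 1 + n = n' by lia.
by rewrite (homd_comp (add0r n) e1 e e e0 e2) cocyc_hin hcomp0r zsign00 addr0.
Qed.

Lemma ds_van k : (forall i, van (F i) k) -> van dsum k.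
Proof.
move=> hF x hx.
(* A zero component gets the primitive 0, so that the family of chosen primitives again has finite
   support. *)
have h i : exists y : F i (k - 1), x i = cd (subrK 1 k) y /\ (x i = 0 -> y = 0).
  have hi : isZ (x i).
    by move=> l e; exact: (congr1 (fun z : dsT l => z i) (hx l e)).
  have [e0|e0] := pselect (x i = 0); first by exists 0; rewrite cd0.
  by have /(isBP (subrK 1 k)) [y xy] := hF i _ hi; exists y; split.
pose y i := projT1 (cid (h i)).
have hy i : x i = cd (subrK 1 k) (y i) /\ (x i = 0 -> y i = 0) by exact: (projT2 (cid (h i))).
have [s us hs] := ds_supp x.
have fy : exists s : seq I, forall i, i \notin s -> y i = 0.
  by exists s => i /hs; apply: (hy i).2.
exists (k - 1), (subrK 1 k), (DsT fy); apply: ds_ext => i; exact: (hy i).1.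
Qed.
End DirectSum.

(** * Free modules and currying *)

Section Pure.
Variables (A : cdgRing) (M N : dgMod A).
Lemma cd_pure k k' (ek : k + 1 = k') i j i' j' (e : i + j = k) (ei : i + 1 = i')
    (ej : j + 1 = j') (e1 : i' + j = k') (e2 : i + j' = k') m n :
  @cd (tensor M N) k k' ek (pure e m n) =
    pure e1 (cd ei m) n + zsign i (pure e2 m (cd ej n)).
Proof. exact: tensdE. Qed.
End Pure.

Section FreeHom.
Variables (A : cdgRing) (N : dgMod A).
Local Notation A1 := (regMod A).

Section Def.
Variables (n : int) (y : N n).

Program Definition hfree : hom A1 N n :=
  @Hom A A1 N n (fun i j e (a : A i) => zsign (i * n) (act e a y)) _ _.
Next Obligation. by move=> i j e a b; rewrite actDl zsign_addr. Qed.
Next Obligation.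
move=> p i k j l e ej el e' a b /=.
rewrite (actA e el ej e') act_zsignr -zsignD; zpar.
Qed.

Lemma hfreeE i j (e : i + n = j) a : hfree i j e a = zsign (i * n) (act e a y).
Proof. by []. Qed.

Lemma hfree1 (e : 0 + n = n) : hfree 0 n e (dunit A) = y.
Proof. by rewrite hfreeE mul0r zsign0 act1. Qed.
End Def.

Lemma homA_eval n (f : hom A1 N n) i j (e : i + n = j) (e0 : 0 + n = n) (a : A i) :
  f i j e a = zsign (i * n) (act e a (f 0 n e0 (dunit A))).
Proof. by rewrite -(hom_act f (addr0 i) e0 e e) [act _ a _]dmul1r. Qed.

Lemma homA_ext n (f g : hom A1 N n) (e : 0 + n = n) :
  f 0 n e (dunit A) = g 0 n e (dunit A) -> f = g.
Proof.
by move=> fg; apply: hom_ext => i j ej a; rewrite !(homA_eval _ ej e) fg.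
Qed.

Lemma d_unit k (e : 0 + 1 = k) : cd e (dunit A) = 0.
Proof. exact: dA0. Qed.

Lemma homd_hfree n k (e : n + 1 = k) (y : N n) : homd e (hfree y) = hfree (cd e y).
Proof.
apply: (homA_ext (e := add0r k)); rewrite hfree1.
have h2 : 1 + n = k by lia.
rewrite (homdE e _ (add0r k) (add0r 1) (add0r n) e h2) hfree1.
by rewrite [cd (add0r 1) _]dA0 hfun0 zsign00 subr0.
Qed.

Lemma cocyc_hfree n (y : N n) : isZ y -> cocyc (hfree y).
Proof.
move=> hy k e; rewrite homd_hfree hy; apply: (homA_ext (e := add0r k)).
by rewrite hfree1.
Qed.

Lemma hfree_eval n (f : hom A1 N n) (e : 0 + n = n) : hfree (f 0 n e (dunit A)) = f.
Proof. by apply: (homA_ext (e := e)); rewrite hfree1. Qed.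
End FreeHom.

Section Adjunction.
Variables (A : cdgRing) (M N L : dgMod A).

Section Uncurry.
Variables (n : int) (F : hom M (Homdg N L) n).

Lemma unc_e (a b i j : int) : a + b = i -> i + n = j -> b + (a + n) = j. Proof. lia. Qed.

Definition unc_pure i j (e : i + n = j) a b (e0 : a + b = i) (m : M a) (x : N b) : L j :=
  (F a (a + n) erefl m : hom N L (a + n)) b j (unc_e e0 e) x.

Lemma unc_pureE i j (e : i + n = j) a b c (e0 : a + b = i) (e1 : a + n = c)
   (e2 : b + c = j) m x :
  unc_pure e e0 m x = (F a c e1 m : hom N L c) b j e2 x.
Proof. by subst c; rewrite /unc_pure (Prop_irrelevance (unc_e e0 e) e2). Qed.

Lemma unc_balanced i j (e : i + n = j) : balanced (unc_pure e).
Proof.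
split.
- by move=> a b e0 x m m'; rewrite /unc_pure homD.
- by move=> a b e0 m x x'; rewrite /unc_pure homD.
move=> a p b pa pb e1 e2 e0 e0' m r x.
have h1 : b + (pa + n) = j by lia.
have h2 : pb + (a + n) = j by lia.
have h3 : p + (a + n) = pa + n by lia.

have h5 : p + (b + (a + n)) = j by lia.
rewrite (unc_pureE e e0 erefl h1) (unc_pureE e e0' erefl h2).
rewrite hfun_zsign hom_zsignE (hom_act F e1 erefl erefl h3) hom_zsignE.
rewrite [act h3 _ _](_ : _ = homa h3 r (F a (a + n) erefl m)) //.
rewrite (homaE h3 _ _ h1 erefl h5).
rewrite (hom_act (F a (a + n) erefl m : hom N L _) e2 erefl h2 h5) -zsignD; zpar.
Qed.

Program Definition huncurry : hom (tensor M N) L n :=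
  @Hom A (tensor M N) L n (fun i j e (t : tens M N i) => tlift (unc_pure e) t) _ _.
Next Obligation. by move=> i j e; apply: (tliftD (unc_balanced e)). Qed.
Next Obligation.
move=> p i k j l e ej el e' r.
apply: (@tens_ext _ _ _ _ _ (fun m => tlift (unc_pure el) (tensa e r m))
  (fun m => zsign (p * n) (act e' r (tlift (unc_pure ej) m)))).
- by move=> x y; rewrite tensa_addr (tliftD (unc_balanced _)).
- by move=> x y; rewrite (tliftD (unc_balanced _)) actDr zsign_addr.
move=> a b e0 m x.
have h1 : p + a + b = k by lia.
have h2 : b + (p + a + n) = l by lia.
have h3 : b + (a + n) = j by lia.
have h4 : p + (a + n) = p + a + n by lia.
rewrite (tensaE e r e0 erefl h1) !(tlift_pure (unc_balanced _)).
rewrite (unc_pureE el h1 erefl h2) (unc_pureE ej e0 erefl h3).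
rewrite (hom_act F erefl erefl erefl h4) hom_zsignE.
rewrite [act h4 _ _](_ : _ = homa h4 r (F a (a + n) erefl m)) //.
by rewrite (homaE h4 _ _ h2 h3 e').
Qed.

Lemma huncurryE i j (e : i + n = j) a b c (e0 : a + b = i) (e1 : a + n = c)
   (e2 : b + c = j) m x :
  huncurry i j e (pure e0 m x) = (F a c e1 m : hom N L c) b j e2 x.
Proof. by rewrite /= (tlift_pure (unc_balanced _)); apply: unc_pureE. Qed.
End Uncurry.

Section Curry.
Variables (n : int) (g : hom (tensor M N) L n).

Lemma cur_e (a b c j : int) : a + n = c -> b + c = j -> a + b + n = j. Proof. lia. Qed.

Program Definition hcurry1 a c (e : a + n = c) (m : M a) : hom N L c :=
  @Hom A N L c (fun b j e2 x => g (a + b) j (cur_e e e2) (pure erefl m x)) _ _.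
Next Obligation. by move=> a c e m b j e2 x x'; rewrite pureDr homD. Qed.
Next Obligation.
move=> a c e m p i k j l e1 ej el e' r x.
have h1 : p + a = p + a by [].
have h2 : p + a + i = a + k by lia.
have h3 : p + (a + i) = a + k by lia.
rewrite -(pure_balanced h1 e1 h2 erefl) pure_zsignl hfun_zsign.
rewrite -(tensaE h3 r erefl h1 h2).
rewrite (hom_act g h3 (cur_e e ej) (cur_e e el) e') -zsignD; zpar.
Qed.

Lemma hcurry1E a c (e : a + n = c) m b j i (e2 : b + c = j) (e3 : a + b = i) (e4 : i + n = j) x :
  hcurry1 e m b j e2 x = g i j e4 (pure e3 m x).
Proof. by subst i => /=; apply: hfun_irr. Qed.

Program Definition hcurry : hom M (Homdg N L) n :=
  @Hom A M (Homdg N L) n (fun a c e m => hcurry1 e m : Homdg N L c) _ _.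
Next Obligation.
move=> a c e m m'; apply: hom_ext => b j e2 x.
by rewrite homDE /= pureDl homD.
Qed.
Next Obligation.
move=> p a k c l e ec el e' r m; apply: hom_ext => b j e2 x.
have h1 : k + b = k + b by [].
have h2 : k + b + n = j by lia.
have h3 : p + (b + c) = j by lia.
have h4 : a + b + n = b + c by lia.
have h5 : p + (a + b) = k + b by lia.
rewrite hom_zsignE (hcurry1E _ _ e2 h1 h2) (homaE e' _ _ e2 erefl h3).
rewrite (hcurry1E _ _ erefl erefl h4) -(tensaE h5 r erefl e h1).
exact: (hom_act g h5 h4 h2 h3).
Qed.

Lemma hcurryE a c (e : a + n = c) m b j i (e2 : b + c = j) (e3 : a + b = i) (e4 : i + n = j) x :
  (hcurry a c e m : hom N L c) b j e2 x = g i j e4 (pure e3 m x).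
Proof. exact: hcurry1E. Qed.
End Curry.

Lemma huncurryK n (g : hom (tensor M N) L n) : huncurry (hcurry g) = g.
Proof.
apply: homT_ext => i j e a b e0 m x.
have h : b + (a + n) = j by lia.
by rewrite (huncurryE _ e e0 erefl h) (hcurryE g erefl m h e0 e).
Qed.

Lemma hcurryK n (F : hom M (Homdg N L) n) : hcurry (huncurry F) = F.
Proof.
apply: hom_ext => a c e m; apply: (@hom_ext _ _ _ c) => b j e2 x.
have h : a + b + n = j by lia.
by rewrite (hcurryE _ e m e2 erefl h) (huncurryE _ h erefl e e2).
Qed.

Lemma homd_hcurry n k (e : n + 1 = k) (g : hom (tensor M N) L n) :
  homd e (hcurry g) = hcurry (homd e g).
Proof.
apply: hom_ext => a c ec m; apply: (@hom_ext _ _ _ c) => b j e2 x.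
have h1 : a + n + 1 = c by lia.
have h2 : a + 1 + n = c by lia.
have h3 : b + (a + n) + 1 = j by lia.
have h4 : b + 1 + (a + n) = j by lia.
have h5 : a + b + k = j by lia.
have h6 : a + b + n = b + (a + n) by lia.
have h7 : a + (b + 1) = a + b + 1 by lia.
have h8 : a + b + 1 + n = j by lia.
have h9 : a + 1 + b = a + b + 1 by lia.
rewrite (homdE e _ ec erefl erefl h1 h2) homDE homNE hom_zsignE.
rewrite (homdE h1 _ e2 erefl erefl h3 h4) (hcurryE _ erefl m erefl erefl h6).
rewrite (hcurryE _ erefl m h4 h7 h8) (hcurryE _ h2 _ e2 h9 h8).
rewrite (hcurryE _ ec m e2 erefl h5) (homdE e _ h5 erefl h6 h3 h8).
rewrite [X in _ = _ - zsign n (g _ _ _ X)](tensdE erefl erefl erefl erefl h9 h7).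
rewrite homD zsign_addr hfun_zsign -zsignD (addrC n a).
move: (cd h3 _) (zsign (a + n) _) (zsign n _) => P Q R.
by rewrite opprD addrA addrAC.
Qed.

Program Definition curry : hom (Homdg (tensor M N) L) (Homdg M (Homdg N L)) 0 :=
  @Hom A (Homdg (tensor M N) L) (Homdg M (Homdg N L)) 0
   (fun n k e (g : hom (tensor M N) L n) =>
     @cst (Homdg M (Homdg N L)) _ _ (etrans (esym (addr0 n)) e) (hcurry g)) _ _.
Next Obligation.
move=> n k e g g'; rewrite -cstD; congr cst.
apply: hom_ext => a c ec m; apply: (@hom_ext _ _ _ c) => b j e2 x.
by rewrite !homDE.
Qed.
Next Obligation.
move=> p i k j l e ej el e' r g.
rewrite mulr0 zsign0 -(cst_act e (etrans (esym (addr0 i)) ej) (etrans (esym (addr0 k)) el)).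
congr cst; apply: hom_ext => a c ec m; apply: (@hom_ext _ _ _ c) => b z e2 x.
have h1 : a + b + k = z by lia.
have h2 : a + b + i = b + (a + i) by lia.
have h3 : p + (b + (a + i)) = z by lia.
have h4 : p + (a + i) = c by lia.
rewrite (hcurryE _ ec m e2 erefl h1) (homaE e _ _ h1 h2 h3).
rewrite (homaE e _ _ ec erefl h4) (homaE h4 _ _ e2 erefl h3).
by rewrite (hcurryE _ erefl m erefl erefl h2).
Qed.

Lemma curryE n (e : n + 0 = n) (g : hom (tensor M N) L n) : curry n n e g = hcurry g.
Proof. exact: cst_id. Qed.

Lemma cocyc_curry : cocyc curry.
Proof.
move=> k e; apply: hom_ext => i j ej g.
have h1 : i + 1 = j by lia.
have h2 : i + 1 + 0 = j by lia.
rewrite (homdE e _ ej erefl (addr0 i) h1 h2) curryE zsign0.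
case: j / h1 ej h2 => ej h2.
by rewrite curryE [X in X - _]homd_hcurry subrr.
Qed.
End Adjunction.

Section UnitComm.
Variable A : cdgRing.

Section Unit.
Variable N : dgMod A.
Local Notation A1 := (regMod A).

(** The action map [A (x) N -> N], written as the adjunct of the morphism [A -> Hom(N, N)] taking 1
    to the identity; its closedness is then formal. *)
Definition uni : hom (tensor A1 N) N 0 := huncurry (hfree (hid N : Homdg N N 0)).

Lemma uniE i j (e : i + 0 = j) a b (e0 : a + b = i) (e1 : a + b = j) m x :
  uni i j e (pure e0 m x) = act e1 m x.
Proof.
have h : b + a = j by lia.
rewrite (huncurryE _ e e0 (addr0 a) h) hfreeE mulr0 zsign0.
by rewrite (homaE (addr0 a) _ _ h (addr0 b) e1) hidE.
Qed.

Lemma huncurry_cocyc M L n (F : hom M (Homdg N L) n) : cocyc F -> cocyc (huncurry F).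
Proof.
move=> dF k e.
by rewrite -[homd e _]huncurryK -homd_hcurry hcurryK dF; apply: homT_ext => i j ej a b e0 m x;
  rewrite (huncurryE (n := k) _ ej e0 erefl (_ : b + (a + k) = j)) //; lia.
Qed.

Lemma cocyc_uni : cocyc uni.
Proof.
apply: huncurry_cocyc; apply: cocyc_hfree => k e; exact: homd_id.
Qed.

Program Definition uniV : hom N (tensor A1 N) 0 :=
  @Hom A N (tensor A1 N) 0
    (fun i j e x => pure (M := A1) (etrans (addrC 0 i) e) (dunit A) x : tensor A1 N j) _ _.
Next Obligation. by move=> i j e; apply: pureDr. Qed.
Next Obligation.
move=> p i k j l e ej el e' a x.
have h1 : 0 + k = l by lia.
have h2 : p + i = l by lia.
rewrite mulr0 zsign0 -(pure_balanced (M := A1) (addr0 p) e h2 _) mulr0 zsign0.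
by rewrite [act e' a _](tensaE e' a _ (addr0 p) h2).
Qed.

Lemma uniVE i j (e : i + 0 = j) (e' : 0 + i = j) x :
  uniV i j e x = pure (M := A1) e' (dunit A) x.
Proof. by rewrite /= (Prop_irrelevance (etrans _ e) e'). Qed.

Lemma hinv_uni : hinv uniV uni.
Proof.
exists (addr0 0), (addr0 0); split.
- move=> k e; apply: hom_ext => i j ej x.
  have h1 : i + 1 = j by lia.
  have h2 : i + 1 + 0 = j by lia.
  have h3 : 0 + (i + 1) = j by lia.
  have h4 : 1 + i = j by lia.
  rewrite (homdE e _ ej erefl (addr0 i) h1 h2) zsign0 (uniVE _ (add0r i)) (uniVE _ h3).
  rewrite [cd h1 _](tensdE h1 (add0r i) (add0r 1) erefl h4 h3).
  by rewrite zsign0 [cd _ (dunit A)]dA0 (morphD0 (pureDl h4 x)) add0r subrr.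
- exact: cocyc_uni.
- apply: hom_ext0 => i e x.
  by rewrite (hcompE _ _ _ e e e) (uniVE _ (add0r i)) (uniE e (add0r i) (add0r i)) act1 hidE.
apply: homT_ext => i j e a b e0 m x.
have ei : i = j by rewrite -e addr0.
case: j / ei e => e.
have h : 0 + i = i by lia.
rewrite hidE (hcompE _ _ _ e e e) (uniE _ _ e0) (uniVE _ h).
have := pure_balanced (M := A1) (N := N) (addr0 a) e0 e0 h (dunit A) m x.
by rewrite mulr0 zsign0 => <-; rewrite [act _ m _]dmul1r.
Qed.
End Unit.

Section Comm.
Variables M N : dgMod A.

Program Definition flip1 a (m : M a) : hom N (tensor N M) a :=
  @Hom A N (tensor N M) a (fun b j e x => zsign (a * b) (pure e x m) : tensor N M j) _ _.
Next Obligation. by move=> a m b j e x y; rewrite pureDl zsign_addr. Qed.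
Next Obligation.
move=> a m p i k j l e ej el e' r x.
rewrite [act e' r _](morphD_zsign (tensa_addr e' r)) (tensaE e' r ej e el).
by rewrite -zsignD; zpar.
Qed.

Program Definition flip : hom M (Homdg N (tensor N M)) 0 :=
  @Hom A M (Homdg N (tensor N M)) 0
    (fun a c e m => @cst (Homdg N (tensor N M)) _ _ (etrans (esym (addr0 a)) e) (flip1 m)) _ _.
Next Obligation.
move=> a c e m m'; rewrite -cstD; congr cst; apply: hom_ext => b j eb x.
by rewrite homDE /= pureDr zsign_addr.
Qed.
Next Obligation.
move=> p i k j l e ej el e' r m.
rewrite mulr0 zsign0 -(cst_act e (etrans (esym (addr0 i)) ej) (etrans (esym (addr0 k)) el)).
congr cst; apply: hom_ext => b z eb x.
have h1 : p + (b + i) = z by lia.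
have h2 : p + b + i = z by lia.
rewrite (homaE e _ _ eb erefl h1) /= -(pure_balanced erefl e h2 eb).
rewrite pure_zsignl [tensa h1 r _](morphD_zsign (tensa_addr h1 r)).
rewrite (tensaE h1 r erefl erefl h2) -zsignD; zpar.
Qed.

(** The symmetry with its Koszul sign, again an adjunct: compatibility with the relations of the
    tensor product is inherited from [huncurry]. *)
Definition comm : hom (tensor M N) (tensor N M) 0 := huncurry flip.

Lemma commE i (e : i + 0 = i) a b (e0 : a + b = i) (e1 : b + a = i) m x :
  comm i i e (pure e0 m x) = zsign (a * b) (pure e1 x m).
Proof. by rewrite (huncurryE _ e e0 (addr0 a) e1) /= cst_id. Qed.

Lemma cocyc_comm : cocyc comm.
Proof.
move=> k e; apply: homT_ext => i j ej a b e0 m x.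
have h1 : i + 1 = j by lia.
have h2 : i + 1 + 0 = j by lia.
rewrite hom0E (homdE e _ ej erefl (addr0 i) h1 h2) zsign0.
case: j / h1 ej h2 => ej h2.
have h3 : b + a = i by lia.
have h4 : a + 1 + b = i + 1 by lia.
have h5 : a + (b + 1) = i + 1 by lia.
have h6 : b + 1 + a = i + 1 by lia.
have h7 : b + (a + 1) = i + 1 by lia.
rewrite (commE _ _ h3) cd_zsign (cd_pure erefl h3 erefl erefl h6 h7).
rewrite (cd_pure erefl e0 erefl erefl h4 h5) homD hfun_zsign.
rewrite (commE _ _ h7) (commE _ _ h6) zsign_addr -!zsignD.
have -> (V : zmodType) (z : V) : zsign ((a + 1) * b) z = zsign (a * b + b) z by zpar.
have -> (V : zmodType) (z : V) : zsign (a + a * (b + 1)) z = zsign (a * b) z by zpar.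
by move: (zsign _ _) (zsign _ _) => P Q; rewrite [Q + P]addrC subrr.
Qed.
End Comm.

Lemma hinv_comm M N : hinv (comm M N) (comm N M).
Proof.
exists (addr0 0), (addr0 0); split; [exact: cocyc_comm | exact: cocyc_comm | |];
  apply: homT_ext => i j e a b e0 m x;
  have ei : i = j by [rewrite -e addr0 | rewrite -e addr0].
  case: j / ei e => e; have h : b + a = i by lia.
  rewrite hidE (hcompE _ _ _ e e e) (commE _ _ h) hfun_zsign (commE _ _ e0) -zsignD.
  by rewrite zsign_even // mulrC; lia.
case: j / ei e => e; have h : b + a = i by lia.
rewrite hidE (hcompE _ _ _ e e e) (commE _ _ h) hfun_zsign (commE _ _ e0) -zsignD.
by rewrite zsign_even // mulrC; lia.
Qed.
End UnitComm.

(** * Quasi-isomorphisms and resolutions *)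

Section QuasiIso.
Variable A : cdgRing.
Implicit Types M N X Y C P Q : dgMod A.

(** Injectivity and surjectivity on cohomology are kept apart and indexed by the degree, since a
    truncation map has the second only in part of the range. *)
Definition qI M N n (u : hom M N n) i : Prop :=
  forall j (e : i + n = j) x, isZ x -> isB (u i j e x) -> isB x.
Definition qS M N n (u : hom M N n) i : Prop :=
  forall j (e : i + n = j) y, isZ y -> exists x, isZ x /\ isB (y - u i j e x).
Definition qi M N n (u : hom M N n) : Prop := forall i, qI u i /\ qS u i.

Definition ac M : Prop := forall i, van M i.

(* A mapping cone of [s] up to degree shifts and signs, in terms of its structure maps;
   in this form the notion is preserved by covariant and contravariant DG functors. *)
Record conish X Y C n p q (s : hom X Y n) : Prop := Conish {
  ci_ex : exists p' q' g g' (ip : p + p' = 0) (iq : q' + q = 0) (ip' : p' + p = 0) (iq' : q + q' = 0)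
    (iY : hom Y C p) (pX : hom C X q) (iX : hom X C q') (pY : hom C Y p'),
   [/\ cocyc iY, cocyc pX, hcomp ip pY iY = hid Y & hcomp iq pX iX = hid X] /\
   [/\ forall k (e : p + q = k), hcomp e pX iY = 0,
       hcomp ip' iY pY + hcomp iq' iX pX = hid C,
       forall k (e : q' + 1 = k) (e' : n + p = k), homd e iX = zsign g (hcomp e' iY s) &
       forall k (e : p' + 1 = k) (e' : q + n = k), homd e pY = zsign g' (hcomp e' s pX)];
  ci_deg : p + n + q = 1 }.

Lemma hom_cd M N n k (e : n + 1 = k) (f : hom M N n) i j i' j' (e1 : i + n = j)
    (e2 : j + 1 = j') (e3 : i + 1 = i') (e4 : i' + n = j') (e5 : i + k = j') x :
  cd e2 (f i j e1 x) = homd e f i j' e5 x + zsign n (f i' j' e4 (cd e3 x)).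
Proof. by rewrite (homdE e f e5 e3 e1 e2 e4) subrK. Qed.

(** Exactness at [X]: if [s x = d w], then [iX x] corrected by [iY w] is a cocycle of the cone, and
    [pX] sends it to [x]. *)
Lemma conish_exX X Y C n p q (s : hom X Y n) : cocyc s -> conish C p q s ->
  exists pX : hom C X q, cocyc pX /\ forall i j k (e : i + n = j) (ek : k + q = i) x,
    isZ x -> isB (s i j e x) -> exists z, isZ z /\ isB (x - pX k i ek z).
Proof.
move=> ds [[p' [q' [g [g' [ip [iq [ip' [iq' [iY [pX [iX [pY]]]]]]]]]]]]].
move=> [[diY dpX pYY pXX] [pXY sum1 diX dpY]] deg; exists pX; split=> // i j k e ek x hx.
have e1 : j - 1 + 1 = j by lia.
move=> /(isBP e1) [w hw].
have f1 : i + q' = k by lia.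
have f2 : i + (q' + 1) = k + 1 by lia.
have f3 : n + p = q' + 1 by lia.
have f4 : i + 1 + q' = k + 1 by lia.
have f5 : j + p = k + 1 by lia.
have f6 : j - 1 + p = k by lia.
have f7 : i + (n + p) = k + 1 by lia.
exists (iX i k f1 x - zsign (g + p) (iY _ k f6 w)); split.
  apply: (isZP (e := erefl)).
  rewrite cdB cd_zsign (hom_cd erefl _ f1 erefl erefl f4 f2) (diX _ _ f3).
  rewrite hx hfun0 zsign00 addr0 hom_zsignE (hcompE f3 _ _ f2 e f5) hw.
  rewrite (cocyc_cd diY f6 erefl e1 f5) -zsignD.
  by apply/eqP; rewrite subr_eq0; apply/eqP/zsign_par; rewrite !odd_abszD addbK.
rewrite hfunB hfun_zsign.
have f8 : j - 1 + (p + q) = i by lia.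
rewrite -(hcompE erefl pX iY f8 f6 ek) pXY zsign00 subr0.
by rewrite -(hcompE iq pX iX (addr0 i) f1 ek) pXX hidE subrr; apply: isB0.
Qed.

(** Exactness at [Y]: if [t] is a primitive of [iY y], then [pX t] is a cocycle, and the component
    [pY t] shows that [y] is homologous to its image under [s], up to sign. *)
Lemma conish_exY X Y C n p q (s : hom X Y n) : conish C p q s ->
  exists iY : hom Y C p, cocyc iY /\ forall i j k (e : i + n = j) (f1 : j + p = k) y,
    isZ y -> isB (iY j k f1 y) -> exists x, isZ x /\ isB (y - s i j e x).
Proof.
move=> [[p' [q' [g [g' [ip [iq [ip' [iq' [iY [pX [iX [pY]]]]]]]]]]]]].
move=> [[diY dpX pYY pXX] [pXY sum1 diX dpY]] deg; exists iY; split=> // i j k e f1 y hy.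
have f2 : k - 1 + 1 = k by lia.
move=> /(isBP f2) [t ht].
have f3 : k - 1 + q = i by lia.
have f4 : k + q = i + 1 by lia.
have hx : isZ (pX _ i f3 t).
  apply: (isZP (e := erefl)).
  rewrite (cocyc_cd dpX f3 erefl f2 f4) -ht.
  have f5 : j + (p + q) = i + 1 by lia.
  by rewrite -(hcompE erefl pX iY f5 f1 f4) pXY zsign00.
have f6 : k - 1 + p' = j - 1 by lia.
have f7 : j - 1 + 1 = j by lia.
have f8 : k + p' = j by lia.
have f9 : k - 1 + (p' + 1) = j by lia.
have f10 : q + n = p' + 1 by lia.
exists (zsign (1 + p' + g') (pX _ i f3 t)); split; first exact: isZ_zsign.
exists (j - 1), f7, (zsign p' (pY _ _ f6 t)).
rewrite cd_zsign (hom_cd erefl _ f6 f7 f2 f8 f9) (dpY _ _ f10) hom_zsignE.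
rewrite (hcompE f10 _ _ f9 f3 e) zsign_addr zsignK -ht.
rewrite -(hcompE ip pY iY (addr0 j) f1 f8) pYY hidE addrC; congr (_ + _).
by rewrite hfun_zsign !zsignD zsign1 opprK.
Qed.

Lemma conish_qI X Y C n p q (s : hom X Y n) k i : cocyc s -> conish C p q s ->
  k + q = i -> van C k -> qI s i.
Proof.
move=> ds hc ek hC j e x hx hB; have [pX [dpX h]] := conish_exX ds hc.
have [z [hz xz]] := h i j k e ek x hx hB.
by apply: (isB_trans xz); apply: (cocyc_B dpX); apply: hC.
Qed.

Lemma conish_qS X Y C n p q (s : hom X Y n) k i : conish C p q s ->
  i + n + p = k -> van C k -> qS s i.
Proof.
move=> hc ek hC j e y hy; have [iY [diY h]] := conish_exY hc.
have f1 : j + p = k by lia.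
by apply: (h i j k e f1 y hy); apply: hC; apply: (cocyc_Z diY).
Qed.

(** Injectivity in one degree and surjectivity in the preceding one suffice for the cone to vanish
    in a degree; this one-sided form is what truncation maps can offer. *)
Lemma conish_van X Y C n p q (s : hom X Y n) k i i' : cocyc s -> conish C p q s ->
  k + q = i -> i' + 1 = i -> qI s i -> qS s i' -> van C k.
Proof.
move=> ds [[p' [q' [g [g' [ip [iq [ip' [iq' [iY [pX [iX [pY]]]]]]]]]]]]].
move=> [[diY dpX pYY pXX] [pXY sum1 diX dpY]] deg ek ei hI hS z hz.
have f1 : i + n = k + p' + 1 by lia.
have f2 : k + (p' + 1) = k + p' + 1 by lia.
have f3 : k + 1 + p' = k + p' + 1 by lia.
have f4 : q + n = p' + 1 by lia.
have hx := cocyc_Z dpX ek hz.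
have /(hI _ f1 _ hx) : isB (s i _ f1 (pX k i ek z)).
  exists (k + p'), erefl, (zsign g' (pY k _ erefl z)).
  rewrite cd_zsign (hom_cd erefl _ erefl erefl erefl f3 f2) hz hfun0 zsign00 addr0.
  by rewrite (dpY _ _ f4) hom_zsignE (hcompE f4 _ _ f2 ek f1) zsignK.
move=> /(isBP ei) [x' hx'].
have f5 : i' + q' = k - 1 by lia.
have f6 : k - 1 + 1 = k by lia.
have f7 : i + q' = k by lia.
have f8 : i' + (q' + 1) = k by lia.
have f9 : n + p = q' + 1 by lia.
have f10 : i' + n + p = k by lia.
have f11 : k + p' = i' + n by lia.
(* [z] is homologous to an element [iY y] *)
pose y := pY k _ f11 z - zsign (q' + g) (s i' _ erefl x').
have zE : z - zsign q' (cd f6 (iX _ _ f5 x')) = iY _ _ f10 y.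
  rewrite (hom_cd erefl _ f5 f6 ei f7 f8) (diX _ _ f9) zsign_addr zsignK.
  rewrite hom_zsignE (hcompE f9 _ _ f8 erefl f10) -hx'.
  rewrite -{1}[z](hidE (addr0 k)) -sum1 homDE (hcompE ip' _ _ (addr0 k) f11 f10).
  rewrite (hcompE iq' _ _ (addr0 k) ek f7) hfunB hfun_zsign -zsignD.
  by rewrite opprD [- _ - iX _ _ _ _]addrC addrA addrK.
have hy : isZ y.
  move=> l el.
  have f12 : l + p = k + 1 by lia.
  have f13 : k + 1 + p' = l by lia.
  have : isZ (iY _ _ f10 y).
    by rewrite -zE; apply: isZB => //; apply/isZ_zsign/isBZ/isB_cd.
  move=> /(_ _ erefl); rewrite (cocyc_cd diY f10 erefl el f12) => h0.
  have {}h0 : iY _ _ f12 (cd el y) = 0 by apply: (can_inj (zsignK p)); rewrite h0 zsign00.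
  by rewrite -[LHS](hidE (addr0 l)) -pYY (hcompE ip _ _ (addr0 l) f12 f13) h0 hfun0.
have [x'' [hx'' yB]] := hS _ erefl _ hy.
rewrite -[z](subrK (zsign q' (cd f6 (iX _ _ f5 x')))) zE.
apply: isBD; last by apply/isB_zsign/isB_cd.
rewrite -[y](subrK (s i' _ erefl x'')) homD; apply: isBD; first exact: (cocyc_B diY).
exists (k - 1), f6, (zsign g (iX _ _ f5 x'')).
rewrite cd_zsign (hom_cd erefl _ f5 f6 ei f7 f8) hx'' hfun0 zsign00 addr0.
by rewrite (diX _ _ f9) hom_zsignE zsignK (hcompE f9 _ _ f8 erefl f10).
Qed.

Lemma conish_cone X Y (f : hom X Y 0) (df : cocyc f) : conish (cone df) 0 1 f.
Proof.
split; last by lia.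
have [du dv vu [p' [q' [r [s [e1 [e2 [e3 [e4 _]]]]]]]]] := st_cone df.
have i1 : 0 + 0 = 0 :> int by lia.
have i2 : -1 + 1 = 0 :> int by lia.
have i3 : 1 + -1 = 0 :> int by lia.
exists 0, (-1), 0, 1, i1, i2, i1, i3, (ciY df), (cpX df), (ciX df), (cpY df).
have h1 : hcomp i1 (cpY df) (ciY df) = hid Y.
  apply: hom_ext0 => i e x.
  by rewrite (hcompE i1 _ _ e e e) hidE /= !cst_id.
have h2 : hcomp i2 (cpX df) (ciX df) = hid X.
  apply: hom_ext0 => i e x.
  have f1 : i + - 1 = i - 1 by [].
  have f2 : i - 1 + 1 = i by lia.
  by rewrite (hcompE i2 _ _ e f1 f2) hidE /= (cst_cst _ _ erefl) cst_id.
have h3 : hcomp i1 (ciY df) (cpY df) + hcomp i3 (ciX df) (cpX df) = hid (cone df).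
  apply: hom_ext0 => i e [x y].
  have f2 : i + 1 - 1 = i by lia.
  rewrite homDE (hcompE i1 _ _ e e e) (hcompE i3 _ _ e erefl f2) hidE /=.
  by rewrite !cst_id /GRing.add /= /add_pair /= add0r addr0 ?cst_id.
split; first by split.
split=> //.
- move=> k e e'; apply: hom_ext => i j ej x.
  have k0 : k = 0 by lia.
  have f1 : i = j by lia.
  case: j / f1 ej => ej.
  have f2 : i - 1 + 1 = i by lia.
  have f3 : i + 1 - 1 = i by lia.
  have f4 : i + 0 = i by lia.
  rewrite (homdE e _ ej erefl erefl f2 f3) zsign0 (hcompE e' _ _ ej f4 f4).
  have zN1 (V : zmodType) (v : V) : zsign (-1) v = - v by [].
  rewrite zN1 opprK.
  rewrite /= /coned /= cd0 (cst_cd erefl (ciX_e erefl) (ciX_e f3) (cone_e2 f2)) cst_id.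
  rewrite [LHS]/GRing.add /= /add_pair /=; congr pair; first exact: addNr.
  rewrite [LHS]addr0 [LHS]addr0.
  have hc : forall l (el : i = l) (el' : l + 0 = i), f l i el' (@cst X i l el x) = f i i f4 x.
    by move=> l el; case: l / el => el'; rewrite cst_id; apply: hfun_irr.
  exact: hc.
move=> k e e'; apply: hom_ext => i j ej [x y].
have f1 : i + 1 = j by lia.
have f2 : i + 1 + 0 = j by lia.
rewrite hom_zsignE zsign1 (homdE e _ ej erefl (addr0 i) f1 f2) zsign0.
rewrite (hcompE e' _ _ ej erefl f2) /= /coned /= !cst_id.
case: j / f1 ej f2 => ej f2.
rewrite !cst_id opprD addrCA subrr addr0; congr (- _); exact: hfun_irr.
Qed.
End QuasiIso.

Section ConishFunctor.
Variables A B : cdgRing.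

Lemma fh_zsign (F : dgfun A B) M N n g (f : hom M N n) : fh F (zsign g f) = zsign g (fh F f).
Proof. exact: (morphD_zsign (@fhD _ _ F M N n)). Qed.
Lemma ch_zsign (F : dgcof A B) M N n g (f : hom M N n) : ch F (zsign g f) = zsign g (ch F f).
Proof. exact: (morphD_zsign (@chD _ _ F M N n)). Qed.

Lemma conish_fun (F : dgfun A B) X Y C n p q (s : hom X Y n) :
  conish C p q s -> conish (F C) p q (fh F s).
Proof.
move=> [[p' [q' [g [g' [ip [iq [ip' [iq' [iY [pX [iX [pY]]]]]]]]]]]]].
move=> [[diY dpX pYY pXX] [pXY sum1 diX dpY]] deg; split=> //.
exists p', q', g, g', ip, iq, ip', iq', (fh F iY), (fh F pX), (fh F iX), (fh F pY).
split; split.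
- exact: fh_cocyc.
- exact: fh_cocyc.
- by rewrite -fh_comp pYY fh_id.
- by rewrite -fh_comp pXX fh_id.
- by move=> k e; rewrite -fh_comp pXY fh0.
- by rewrite -!fh_comp -fhD sum1 fh_id.
- by move=> k e e'; rewrite fh_d (diX _ _ e') fh_zsign fh_comp.
by move=> k e e'; rewrite fh_d (dpY _ _ e') fh_zsign fh_comp.
Qed.

Lemma conish_cof (F : dgcof A B) X Y C n p q (s : hom X Y n) :
  conish C p q s -> conish (F C) q p (ch F s).
Proof.
move=> [[p' [q' [g [g' [ip [iq [ip' [iq' [iY [pX [iX [pY]]]]]]]]]]]]].
move=> [[diY dpX pYY pXX] [pXY sum1 diX dpY]] deg; split; last by lia.
have op : odd `|p'|%N = odd `|p|%N by lia.
have oq : odd `|q'|%N = odd `|q|%N by lia.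
exists q', p', (g' + p' + n * q), (g + q' + n * p), iq', ip', iq, ip.
exists (ch F pX), (ch F iY), (zsign p (ch F pY)), (zsign q (ch F iX)).
rewrite !hcomp_zsignl !hcomp_zsignr.
split; split.
- exact: ch_cocyc.
- exact: ch_cocyc.
- rewrite -ch_id -pXX (ch_comp F iq iq').
  by apply: zsign_par; rewrite odd_abszM oq andbb.
- rewrite -ch_id -pYY (ch_comp F ip ip').
  by apply: zsign_par; rewrite odd_abszM op andbb.
- move=> k e; have e' : p + q = k by lia.
  apply: (can_inj (zsignK (p * q))).
  by rewrite -(ch_comp F e' e) pXY ch0 zsign00.
- rewrite -ch_id -sum1 chD (ch_comp F ip' ip) (ch_comp F iq' iq) addrC.
  by congr (_ + _); apply: zsign_par; rewrite odd_abszM ?op ?oq andbb.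
- move=> k e e'; have e1 : q + n = k by lia.
  rewrite homd_zsign ch_d (dpY _ _ e1) ch_zsign (ch_comp F e1 e') -!zsignD.
  apply: zsign_par; rewrite !(odd_abszD, odd_abszM) op.
  by case: (odd `|p|%N); case: (odd `|g'|%N); case: (odd `|n|%N); case: (odd `|q|%N).
move=> k e e'; have e1 : n + p = k by lia.
rewrite homd_zsign ch_d (diX _ _ e1) ch_zsign (ch_comp F e1 e') -!zsignD.
apply: zsign_par; rewrite !(odd_abszD, odd_abszM) oq.
by case: (odd `|p|%N); case: (odd `|g|%N); case: (odd `|n|%N); case: (odd `|q|%N).
Qed.

Lemma qi_fun_cone (F : dgfun A B) X Y (f : hom X Y 0) (df : cocyc f) :
  ac (F (cone df)) -> qi (fh F f).
Proof.
move=> h i; have hc := conish_fun F (conish_cone df); split.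
- have e : i - 1 + 1 = i by lia.
  by apply: (conish_qI (fh_cocyc F df) hc e); apply: h.
- by apply: (conish_qS hc erefl); apply: h.
Qed.

Lemma qi_cof_cone (F : dgcof A B) X Y (f : hom X Y 0) (df : cocyc f) :
  ac (F (cone df)) -> qi (ch F f).
Proof.
move=> h i; have hc := conish_cof F (conish_cone df); split.
- by apply: (conish_qI (ch_cocyc F df) hc (addr0 i)); apply: h.
- by apply: (conish_qS hc erefl); apply: h.
Qed.
End ConishFunctor.

Section ConeQi.
Variable A : cdgRing.
Implicit Types M N X Y P : dgMod A.

Lemma qi_cone X Y (f : hom X Y 0) (df : cocyc f) : ac (cone df) <-> qi f.
Proof.
have hc := conish_cone df; split=> [h i|h i].
  split; last by apply: (conish_qS hc erefl); apply: h.
  have e : i - 1 + 1 = i by lia.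
  by apply: (conish_qI df hc e); apply: h.
by apply: (conish_van df hc erefl erefl); have [] := h i; have [] := h (i + 1).
Qed.

End ConeQi.

Section Good.
Variable A : cdgRing.
Implicit Types M N P Q X Y : dgMod A.

Lemma acP M : ac M <-> acyclic M.
Proof.
split=> h i.
  elim/hclsW=> x.
  have -> : (0 : coh M i) = hcls 0 by rewrite (morphD0 (@hclsD M i)).
  apply/hclsP; have [|j [e [y xy]]] := h i (val x); first by move=> j e; apply: cycP.
  by exists j, e, y; apply: etrans xy; exact: subr0.
move=> x hx; pose c : cyc M i := Sub x (cocycleP hx).
have h0 : hcls c = hcls 0 by rewrite (h i (hcls c)) (h i (hcls 0)).
move/hclsP: h0 => [j [e [y xy]]].
by exists j, e, y; apply: etrans xy; exact/esym/subr0.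
Qed.

Definition Kp P : Prop := forall N, ac N -> ac (Homdg P N).
Definition Kf P : Prop := forall N, ac N -> ac (tensor P N).
Definition good P : Prop := Kp P /\ Kf P.

Lemma KpP P : Kp P <-> K_projective P.
Proof. by split=> h N /acP hN; apply/acP/h. Qed.
Lemma KfP P : Kf P <-> K_flat P.
Proof. by split=> h N /acP hN; apply/acP/h. Qed.

Lemma quasi_isoP M N (f : dgHom M N) : quasi_iso f <-> qi (homof f).
Proof.
split=> h i.
  have [g gK Kg] := h i; split=> [j e x hx|j e y hy].
    have ej : i = j by rewrite -e addr0.
    case: j / ej e => e; rewrite homofE => hB.
    pose c : cyc M i := Sub x (cocycleP hx).
    have : cohmap f (hcls c) = cohmap f (hcls 0).
      rewrite !cohmapE; apply/hclsP; move: hB => [j [e' [y xy]]].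
      exists j, e', y; rewrite !SubK -xy; apply: etrans (subr0 _).
      congr (_ - _); exact: (morphD0 (@cmD _ _ f i)).
    move=> /(can_inj gK) /hclsP [j [e' [y xy]]].
    by exists j, e', y; apply: etrans xy; exact/esym/subr0.
  have ej : i = j by rewrite -e addr0.
  case: j / ej e y hy => e y hy.
  pose c : cyc N i := Sub y (cocycleP hy).
  exists (val (hrep (g (hcls c)))); split; first by move=> j ej; apply: cycP.
  have : hcls c = cohmap f (hcls (hrep (g (hcls c)))) by rewrite hrepK Kg.
  rewrite cohmapE homofE => /hclsP [j [e' [w]]]; rewrite !SubK => yw.
  by exists j, e', w.
have [hI hS] := h i.
have inj : injective (cohmap f (i := i)).
  elim/hclsW=> x; elim/hclsW=> y; rewrite !cohmapE => /hclsP [j [e [w]]].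
  rewrite !SubK => xy; apply/hclsP.
  have hx : isZ (val x - val y) by apply: isZB => k ek; apply: cycP.
  have [|j' [e' [v xv]]] := hI i (addr0 i) _ hx; last by exists j', e', v.
  by rewrite homofE (morphDB (@cmD _ _ f i)); exists j, e, w.
have surj : forall y, exists x, cohmap f (i := i) x = y.
  elim/hclsW=> y.
  have [|x [hx [j [e [w xy]]]]] := hS i (addr0 i) (val y); first by move=> k ek; apply: cycP.
  pose c : cyc M i := Sub x (cocycleP hx).
  exists (hcls c); rewrite cohmapE; symmetry; apply/hclsP; exists j, e, w.
  by rewrite SubK -xy homofE.
exists (fun y => projT1 (cid (surj y))).
  by move=> x; apply: inj; case: (cid _).
by move=> y; case: (cid _).
Qed.

Lemma isB_hom M N n (f : hom M N n) i j (e : i + n = j) x :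
  isB (X := Homdg M N) f -> isZ x -> isB (f i j e x).
Proof.
move=> [k [ek [h ->]]] hx.
have e1 : i + k + 1 = j by lia.
have e2 : i + 1 + k = j by lia.
rewrite [cd ek h i j e x](homdE ek h e erefl erefl e1 e2) hx hfun0 zsign00 subr0.
exact: isB_cd.
Qed.

Definition heq M N (s : hom M N 0) : Prop :=
  exists t : hom N M 0, [/\ cocyc t, isB (X := Homdg M M) (hid M - hcomp (addr0 0) t s) &
     isB (X := Homdg N N) (hid N - hcomp (addr0 0) s t)].

Lemma heq_qi M N (s : hom M N 0) : cocyc s -> heq s -> qi s.
Proof.
move=> ds [t [dt h1 h2]] i; split=> [j e x hx hB|j e y hy].
  have e' : j + 0 = i by lia.
  have := isB_hom (addr0 i) h1 hx.
  rewrite homDE homNE hidE (hcompE (addr0 0) t s (addr0 i) e e') => /isB_trans; apply.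
  exact: (cocyc_B dt).
have e' : j + 0 = i by lia.
exists (t j i e' y); split; first exact: (cocyc_Z dt).
have := isB_hom (addr0 j) h2 hy.
by rewrite homDE homNE hidE (hcompE (addr0 0) s t (addr0 j) e' e).
Qed.

Lemma Kp_post P N N' (s : hom N N' 0) : cocyc s -> Kp P -> qi s -> qi (fh (HomR P) s).
Proof. by move=> ds hP /(qi_cone ds) /hP; apply: (@qi_fun_cone _ _ (HomR P) _ _ s ds). Qed.

Lemma Kp_lift P N N' (s : hom N N' 0) k (f : hom P N' k) : cocyc s -> Kp P -> qi s -> cocyc f ->
  exists g : hom P N k, cocyc g /\ isB (X := Homdg P N') (f - hcomp (addr0 k) s g).
Proof.
move=> ds hP hs df; have [_ hS] := Kp_post ds hP hs k.
by have [g [dg hg]] := hS k (addr0 k) f df; exists g.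
Qed.

Lemma Kp_inj P N N' (s : hom N N' 0) k (f : hom P N k) : cocyc s -> Kp P -> qi s -> cocyc f ->
  isB (X := Homdg P N') (hcomp (addr0 k) s f) -> isB (X := Homdg P N) f.
Proof.
by move=> ds hP hs df; have [hI _] := Kp_post ds hP hs k; apply: (hI k (addr0 k)).
Qed.

Lemma isB_hcompl M N L n m k (e : n + m = k) (g : hom N L m) (f : hom M N n) :
  cocyc g -> isB (X := Homdg M N) f -> isB (X := Homdg M L) (hcomp e g f).
Proof. by move=> dg; apply: (cocyc_B (fh_cocyc (HomR M) dg)). Qed.
Lemma isB_hcompr M N L n m k (e : n + m = k) (g : hom N L m) (f : hom M N n) :
  cocyc f -> isB (X := Homdg N L) g -> isB (X := Homdg M L) (hcomp e g f).
Proof.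
move=> df hg; have e' : m + n = k by lia.
have := cocyc_B (ch_cocyc (HomL L) df) e' hg.
rewrite [ch _ _ _ _ _ _](hpreE f e' e) => /(@isB_zsign _ _ (n * m)).
by rewrite zsignK.
Qed.

Lemma cocyc_hcomp M N L n m k (e : n + m = k) (g : hom N L m) (f : hom M N n) :
  cocyc g -> cocyc f -> cocyc (hcomp e g f).
Proof. by move=> dg df; apply: (cocyc_Z (fh_cocyc (HomR M) dg)). Qed.

Lemma cocyc_hid M : cocyc (hid M). Proof. by move=> k e; apply: homd_id. Qed.

Lemma cocycB M N n (f g : hom M N n) : cocyc f -> cocyc g -> cocyc (f - g).
Proof. exact: (@isZB (Homdg M N) n f g). Qed.
(** A lift [t] of the identity along [s] is a right inverse up to homotopy. It is also a left
    inverse, because [s (1 - t s) = (1 - s t) s] is a boundary and composition with [s] is injective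
    on homotopy classes of maps out of [P]. *)
Lemma Kp_heq P Q (s : hom P Q 0) : cocyc s -> Kp P -> Kp Q -> qi s -> heq s.
Proof.
move=> ds hP hQ hs; have [t [dt ht]] := Kp_lift ds hQ hs (@cocyc_hid Q).
exists t; split=> //; apply: (Kp_inj ds hP hs).
  by apply: cocycB; [apply: cocyc_hid | apply: cocyc_hcomp].
have -> : hcomp (addr0 0) s (hid P - hcomp (addr0 0) t s) =
    hcomp (addr0 0) (hid Q - hcomp (addr0 0) s t) s.
  rewrite hcompDr hcompDl hcompNr hcompNl; congr (_ - _).
    by rewrite hcomp1r hcomp1l.
  exact: hcompA.
exact: isB_hcompr.
Qed.
End Good.

Section HeqFunctor.
Variables A B : cdgRing.

Lemma isB_fh (F : dgfun A B) M N n (f : hom M N n) :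
  isB (X := Homdg M N) f -> isB (X := Homdg (F M) (F N)) (fh F f).
Proof. by move=> [k [e [h ->]]]; exists k, e, (fh F h); rewrite [RHS]fh_d. Qed.
Lemma isB_ch (F : dgcof A B) M N n (f : hom M N n) :
  isB (X := Homdg M N) f -> isB (X := Homdg (F N) (F M)) (ch F f).
Proof. by move=> [k [e [h ->]]]; exists k, e, (ch F h); rewrite [RHS]ch_d. Qed.

Lemma fhN (F : dgfun A B) M N n (f : hom M N n) : fh F (- f) = - fh F f.
Proof. exact: (morphDN (@fhD _ _ F M N n)). Qed.
Lemma chN (F : dgcof A B) M N n (f : hom M N n) : ch F (- f) = - ch F f.
Proof. exact: (morphDN (@chD _ _ F M N n)). Qed.

Lemma heq_fun (F : dgfun A B) M N (s : hom M N 0) : heq s -> heq (fh F s).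
Proof.
move=> [t [dt h1 h2]]; exists (fh F t); split; first exact: fh_cocyc.
  by have := isB_fh F h1; rewrite fhD fhN fh_id fh_comp.
by have := isB_fh F h2; rewrite fhD fhN fh_id fh_comp.
Qed.
Lemma heq_cof (F : dgcof A B) M N (s : hom M N 0) : heq s -> heq (ch F s).
Proof.
move=> [t [dt h1 h2]]; exists (ch F t); split; first exact: ch_cocyc.
  have := isB_ch F h2; rewrite chD chN ch_id (ch_comp F (addr0 0) (addr0 0)).
  by rewrite mulr0 zsign0.
have := isB_ch F h1; rewrite chD chN ch_id (ch_comp F (addr0 0) (addr0 0)).
by rewrite mulr0 zsign0.
Qed.

(** Between K-projective modules a quasi-isomorphism is a homotopy equivalence, and those survive
    every DG functor, whether or not the functor preserves quasi-isomorphisms in general. *)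
Lemma Kp_fun_qi (F : dgfun A B) M N (s : hom M N 0) : cocyc s -> Kp M -> Kp N -> qi s ->
  qi (fh F s).
Proof.
by move=> ds hM hN hs; apply: heq_qi; [exact: fh_cocyc | apply/heq_fun/Kp_heq].
Qed.
Lemma Kp_cof_qi (F : dgcof A B) M N (s : hom M N 0) : cocyc s -> Kp M -> Kp N -> qi s ->
  qi (ch F s).
Proof.
by move=> ds hM hN hs; apply: heq_qi; [exact: ch_cocyc | apply/heq_cof/Kp_heq].
Qed.
End HeqFunctor.

Section Closure.
Variable A : cdgRing.
Implicit Types M N P Q X Y : dgMod A.
Local Notation A1 := (regMod A).

Lemma good_reg : good A1.
Proof.
split=> N hN i.
  move=> f df; have e0 : 0 + i = i by rewrite add0r.
  have h : isZ ((f : hom A1 N i) 0 i e0 (dunit A)).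
    by apply: (cocyc_Z df) => j e; apply: d_unit.
  have [j [e [y fy]]] := hN i _ h.
  exists j, e, (hfree y : Homdg A1 N j).
  by rewrite [RHS]homd_hfree -fy hfree_eval.
exact: (hinv_van (addr0 i) (hinv_uni N)).
Qed.

Lemma good_sh n M : good M -> good (sh n M).
Proof.
move=> [hp hf]; split=> N hN i.
  have h := hinv_cof (HomL N) (hinv_sh n M).
  have e : i - n + n = i by lia.
  by apply: (hinv_van e (hinv_sym h)); apply: hp.
have h := hinv_fun (TensL N) (hinv_sh n M).
have e : i + n + - n = i by lia.
by apply: (hinv_van e h); apply: hf.
Qed.

Lemma good_cone X Y (f : hom X Y 0) (df : cocyc f) : good X -> good Y -> good (cone df).
Proof.
move=> [px fx] [py fy]; split=> N hN i.
  apply/svan1; have st := striple_cof (HomL N) (st_cone df).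
  have e : i - 1 + 1 = i by lia.
  apply: (svan_mid st (mset1 A) e (addr0 i)); apply/svan1; [exact: px | exact: py].
apply/svan1; have st := striple_fun (TensL N) (st_cone df).
by apply: (svan_mid st (mset1 A) (addr0 i) erefl); apply/svan1; [exact: fy | exact: fx].
Qed.

Lemma good_dsum (I : choiceType) (F : I -> dgMod A) : (forall i, good (F i)) -> good (dsum F).
Proof.
move=> hF; split=> N hN n.
  move=> f df.
  have h z : exists g : hom (F z) N (n - 1), hcomp (add0r n) f (hin F z) = homd (subrK 1 n) g.
    have hz : cocyc (hcomp (add0r n) f (hin F z)) by apply: cocyc_hcomp => //; apply: cocyc_hin.
    by have /(isBP (subrK 1 n)) [g hg] := (hF z).1 N hN n _ hz; exists g.
  have {}h z := cid (h z).
  exists (n - 1), (subrK 1 n), (hlift (fun z => projT1 (h z)) : Homdg (dsum F) N (n - 1)).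
  rewrite [RHS]homd_hlift; apply: (hlift_eq (e := add0r n)) => z.
  by rewrite hlift_hin; case: (h z).
(* Only the composite [bwd fwd = 1] is needed: the tensor product becomes a retract of a direct sum
   whose cohomology is known to vanish. *)
pose H := dsum (fun z => tensor (F z) N).
pose fwd : hom (tensor (dsum F) N) H 0 :=
  huncurry (hlift (fun z => hcurry (hin (fun z => tensor (F z) N) z))).
pose bwd : hom H (tensor (dsum F) N) 0 := hlift (fun z => thom N (hin F z)).
have dfwd : cocyc fwd.
  apply: huncurry_cocyc => k e; rewrite homd_hlift; apply: (hlift_eq (e := add0r k)) => z.
  rewrite hlift_hin homd_hcurry cocyc_hin hcomp0l.
  by apply: hom_ext => a c ec m; apply: hom_ext.
have dbwd : cocyc bwd.
  move=> k e; rewrite homd_hlift; apply: (hlift_eq (e := add0r k)) => z.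
  rewrite hlift_hin hcomp0l; apply: (fh_cocyc (TensL N)); exact: cocyc_hin.
have bf : hcomp (addr0 0) bwd fwd = hid _.
  apply: homT_ext => i j e a b e0 m x.
  have ei : i = j by rewrite -e addr0.
  case: j / ei e => e; rewrite hidE (hcompE _ _ _ e e e).
  apply: (@ds_add_ext _ _ _ _ _ (fun m => bwd i i e (fwd i i e (pure (M := dsum F) e0 m x)))
    (fun m => pure (M := dsum F) e0 m x)) m => [m m'|m m'|z m].
  - have E := pureDl (M := dsum F) (N := N) e0 x m m'; cbv beta in E.
    by rewrite [X in bwd i i e (fwd i i e X)](E : _ = _) !homD.
  - exact: (pureDl (M := dsum F)).
  have h : b + a = i by lia.
  rewrite (huncurryE _ e e0 (addr0 a) h) hliftE.
  rewrite (hcurryE _ (addr0 a) m h e0 e) hinE hliftE.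
  by rewrite (thomE _ e e0 (addr0 a) e0) hinE.
have hH : van H n by apply: ds_van => z; apply: (hF z).2.
move=> t ht; have /(cocyc_B dbwd (addr0 n)) := hH _ (cocyc_Z dfwd (addr0 n) ht).
by rewrite -(hcompE (addr0 0) bwd fwd (addr0 n)) bf hidE.
Qed.
End Closure.

Section ConeMap.
Variables (A : cdgRing) (X Y M : dgMod A) (phi : hom X Y 0) (dphi : cocyc phi).

Lemma homd_ciX k (e : -1 + 1 = k) (e' : 0 + 0 = k) :
  homd e (ciX dphi) = hcomp e' (ciY dphi) phi.
Proof.
apply: hom_ext => i j ej x.
have k0 : k = 0 by lia.
have f1 : i = j by lia.
case: j / f1 ej => ej.
have f2 : i - 1 + 1 = i by lia.
have f3 : i + 1 - 1 = i by lia.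
have f4 : i + 0 = i by lia.
rewrite (homdE e _ ej erefl erefl f2 f3) (hcompE e' _ _ ej f4 f4).
have zN1 (V : zmodType) (v : V) : zsign (-1) v = - v by [].
rewrite zN1 opprK.
rewrite /= /coned /= cd0 (cst_cd erefl (ciX_e erefl) (ciX_e f3) (cone_e2 f2)) cst_id.
rewrite [LHS]/GRing.add /= /add_pair /=; congr pair; first exact: addNr.
rewrite [LHS]addr0 [LHS]addr0.
have hc : forall l (el : i = l) (el' : l + 0 = i),
    phi l i el' (@cst X i l el x) = phi i i f4 x.
  by move=> l el; case: l / el => el'; rewrite cst_id; apply: hfun_irr.
exact: hc.
Qed.

Lemma homd_cpY k (e : 0 + 1 = k) (e' : 1 + 0 = k) :
  homd e (cpY dphi) = - hcomp e' phi (cpX dphi).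
Proof.
apply: hom_ext => i j ej [x y].
have f1 : i + 1 = j by lia.
have f2 : i + 1 + 0 = j by lia.
rewrite homNE (homdE e _ ej erefl (addr0 i) f1 f2) zsign0.
rewrite (hcompE e' _ _ ej erefl f2) /= /coned /= !cst_id.
case: j / f1 ej f2 => ej f2.
rewrite !cst_id opprD addrCA subrr addr0; congr (- _); exact: hfun_irr.
Qed.

Lemma cpY_ciY : hcomp (addr0 0) (cpY dphi) (ciY dphi) = hid Y.
Proof.
apply: hom_ext0 => i e x.
by rewrite (hcompE _ _ _ e e e) hidE /= !cst_id.
Qed.

Lemma cpY_ciX (e : -1 + 0 = -1) : hcomp e (cpY dphi) (ciX dphi) = 0.
Proof. by apply: hom_ext => i j ej x; rewrite (hcompE _ _ _ ej ej (addr0 j)) /= cst_id. Qed.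

Variables (f : hom Y M 0) (df : cocyc f) (h : hom X M (-1)).
Hypothesis dh : homd (addNr 1) h = hcomp (addr0 0) f phi.

(** A closed map out of the cone of [phi] amounts to a closed map [f] on [Y] together with a
    null-homotopy [h] of [f phi]. *)
Definition conemap : hom (cone dphi) M 0 :=
  hcomp (addr0 0) f (cpY dphi) + hcomp (addrN 1) h (cpX dphi).

Lemma cocyc_conemap : cocyc conemap.
Proof.
move=> k e; rewrite /conemap homd_addr.
have k1 : 1 = k by lia.
case: k / k1 e => e.
have e1 : 0 + 1 = 1 :> int by lia.
have e2 : 1 + 0 = 1 :> int by lia.
have e3 : 2 + -1 = 1 :> int by lia.
have e4 : 1 + 1 = 2 :> int by lia.
rewrite (homd_comp _ e1 e1 e e1 e2) df hcomp0l add0r zsign0 (homd_cpY e1 e2).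
rewrite (homd_comp _ e4 (addNr 1) e e2 e3) (st_dv (st_cone dphi)) hcomp0r zsign00 addr0 dh.
rewrite hcompNr (hcompA e2 e2 (addr0 0) e2) addNr //.
Qed.

Lemma conemap_ciY : hcomp (addr0 0) conemap (ciY dphi) = f.
Proof.
rewrite /conemap hcompDl -(hcompA (addr0 0) (addr0 0) (addr0 0) (addr0 0)) cpY_ciY hcomp1r.
have e1 : 0 + 1 = 1 :> int by lia.
by rewrite -(hcompA e1 (addrN 1)) (st_vu (st_cone dphi)) hcomp0r addr0.
Qed.
End ConeMap.

(** * Resolutions by iterated attachment of free cells *)

Section Resolution.
Variables (A : cdgRing) (M : dgMod A).
Local Notation A1 := (regMod A).

Implicit Types N L : dgMod A.

Record pre := Pre { prP :> dgMod A; prf : hom prP M 0; prdf : cocyc prf; prgood : good prP }.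

Section Step.
Variable T : pre.
Local Notation C := (cone (prdf T)).

(** A cocycle of the cone of [prf T] is a pair of a cocycle [p] of [T] and an element [m] of [M]
    with [f p = - d m]. One free cell per pair does two jobs: it kills [p], and for [p = 0] it adds
    a class mapping to that of the cocycle [m], up to sign. *)
Definition cells : choiceType := {i : int & cyc C i}.

Definition cellF (z : cells) : dgMod A := sh (- (tag z + 1)) A1.

(* The generator of [cellF z], in degree [tag z + 1], is sent to [y]. *)
Definition cellmap N k (z : cells) n (e : - (tag z + 1) + n = k) (y : N n) : hom (cellF z) N k :=
  hcomp e (hfree y) (shout (- (tag z + 1)) A1).

Lemma hfree0 N n : hfree (0 : N n) = 0.
Proof. by apply: (homA_ext (e := add0r n)); rewrite hfree1. Qed.

Lemma homd_cellmap N k k' z n n' (e : - (tag z + 1) + n = k) (e' : - (tag z + 1) + n' = k')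
    (ek : k + 1 = k') (en : n + 1 = n') (y : N n) :
  homd ek (cellmap e y) = cellmap e' (cd en y).
Proof.
have [_ [_ [_ dsh _ _]]] := hinv_sh (- (tag z + 1)) A1.
have h : - (tag z + 1) + 1 + n = k' by lia.
by rewrite /cellmap (homd_comp e erefl en ek e' h) homd_hfree dsh hcomp0r zsign00 addr0.
Qed.

Lemma hcomp_cellmap N N' k k' m z n n' (e : - (tag z + 1) + n = k) (e' : - (tag z + 1) + n' = k')
    (en : n + m = n') (ek : k + m = k') (g : hom N N' m) (y : N n) :
  hcomp ek g (cellmap e y) = cellmap e' (g n n' en y).
Proof.
rewrite /cellmap (hcompA _ _ en e'); congr hcomp.
apply: (homA_ext (e := add0r n')).
by rewrite (hcompE en _ _ _ (add0r n) en) !hfree1.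
Qed.

Lemma cell_e1 i : - (i + 1) + (i + 1) = 0 :> int. Proof. lia. Qed.
Lemma cell_e2 i : - (i + 1) + i = -1 :> int. Proof. lia. Qed.

Lemma cell_pZ (z : cells) : isZ (val (tagged z)).1.
Proof.
apply: (isZP (e := erefl)); have := cycP (tagged z) (erefl (tag z + 1)).
move=> /(congr1 fst) /= /eqP; rewrite oppr_eq0 => /eqP <-; exact: cd_irr.
Qed.

Lemma cell_f (z : cells) (e : tag z + 1 + 0 = tag z + 1) :
  prf T _ _ e (val (tagged z)).1 = cd erefl (- (val (tagged z)).2).
Proof.
have := cycP (tagged z) (erefl (tag z + 1)).
move=> /(congr1 snd) /= /eqP; rewrite addr_eq0 -cdN => /eqP <-; exact: hfun_irr.
Qed.

Definition cellphi : hom (dsum cellF) T 0 :=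
  hlift (fun z => cellmap (cell_e1 (tag z)) (val (tagged z)).1).
Definition cellh : hom (dsum cellF) M (-1) :=
  hlift (fun z => cellmap (cell_e2 (tag z)) (- (val (tagged z)).2)).

Lemma hcomp_hlift (I : choiceType) (F : I -> dgMod A) N L n m k (e : n + m = k) (g : hom N L m)
   (f : forall z, hom (F z) N n) : hcomp e g (hlift f) = hlift (fun z => hcomp e g (f z)).
Proof.
apply: (hlift_eq (e := add0r k)) => z; rewrite hlift_hin.
by rewrite -(hcompA (add0r n) e e (add0r k)) hlift_hin.
Qed.

Lemma hlift0 (I : choiceType) (F : I -> dgMod A) N n (f : forall z, hom (F z) N n) :
  (forall z, f z = 0) -> hlift f = 0.
Proof. by move=> h; apply: (hlift_eq (e := add0r n)) => z; rewrite hlift_hin h hcomp0l. Qed.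

Lemma hlift_ext (I : choiceType) (F : I -> dgMod A) N n (f g : forall z, hom (F z) N n) :
  (forall z, f z = g z) -> hlift f = hlift g.
Proof. by move=> h; apply: (hlift_eq (e := add0r n)) => z; rewrite !hlift_hin. Qed.

Lemma dcellphi : cocyc cellphi.
Proof.
move=> k e; rewrite homd_hlift; apply: hlift0 => z.
have e' : - (tag z + 1) + (tag z + 1 + 1) = k by lia.
rewrite (homd_cellmap _ e' e erefl) cell_pZ.
by rewrite /cellmap hfree0 hcomp0l.
Qed.

Lemma dcellh : homd (addNr 1) cellh = hcomp (addr0 0) (prf T) cellphi.
Proof.
rewrite homd_hlift hcomp_hlift; apply: hlift_ext => z.
rewrite (homd_cellmap _ (cell_e1 (tag z)) _ erefl).
by rewrite (hcomp_cellmap _ (cell_e1 (tag z)) (addr0 _)) cell_f.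
Qed.

Definition step : pre :=
  @Pre (cone dcellphi) (conemap dcellphi (prf T) cellh) (cocyc_conemap dcellphi (prdf T) dcellh)
   (good_cone dcellphi (good_dsum (fun z => good_sh _ (good_reg A))) (prgood T)).

Definition stepi : hom T step 0 := ciY dcellphi.

Lemma stepi_cocyc : cocyc stepi. Proof. exact: st_du (st_cone _). Qed.

Lemma stepi_f : hcomp (addr0 0) (prf step) stepi = prf T.
Proof. exact: conemap_ciY. Qed.

Lemma stepi_inj i j (e : i + 0 = j) x : stepi i j e x = 0 -> x = 0.
Proof. exact: (st_inj (st_cone dcellphi)). Qed.

Definition gen n : sh n A1 (- n) := @cst A1 0 (- n + n) (esym (addNr n)) (dunit A).

Lemma shout_gen n (e : - n + n = 0) : shout n A1 (- n) 0 e (gen n) = dunit A.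
Proof. by rewrite /= (cst_cst _ _ erefl) cst_id. Qed.

Lemma genZ n : isZ (gen n).
Proof.
have h := hinv_sh n A1; have h' := hinv_sym h.
have e1 : - n + n = 0 by lia.
have e2 : 0 + - n = - n by lia.
rewrite -(hinvE e1 e2 (gen n) h') shout_gen.
have [_ [_ [d1 _ _ _]]] := h.
by apply: (cocyc_Z d1) => j e; apply: d_unit.
Qed.

Lemma cellmap_gen N k z n (e : - (tag z + 1) + n = k) (y : N n) (e' : - - (tag z + 1) + k = n) :
  cellmap e y _ n e' (gen (- (tag z + 1))) = y.
Proof.
have e1 : - - (tag z + 1) + - (tag z + 1) = 0 by lia.
by rewrite /cellmap (hcompE _ _ _ e' e1 (add0r n)) shout_gen hfree1.
Qed.

Definition cellel (z : cells) : dsum cellF (tag z + 1) :=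
  hin cellF z _ _ (addr0 (tag z + 1))
    (@cst (cellF z) _ _ (opprK (tag z + 1)) (gen (- (tag z + 1)))).

Lemma hlift_cellel N k (g : forall z, hom (cellF z) N k) z j (e : tag z + 1 + k = j)
    (e' : - - (tag z + 1) + k = j) :
  hlift g (tag z + 1) j e (cellel z) = g z _ _ e' (gen (- (tag z + 1))).
Proof.
rewrite /cellel hinE hliftE.
have hc : forall l (el : - - (tag z + 1) = l) (el' : l + k = j) x,
    g z l j el' (@cst (cellF z) _ l el x) = g z _ j e' x.
  by move=> l el; case: l / el => el' x; rewrite cst_id; apply: hfun_irr.
exact: hc.
Qed.

Lemma cellelZ z : isZ (cellel z).
Proof.
apply: (cocyc_Z (@cocyc_hin _ _ _ _)) => j e.
have e' : - - (tag z + 1) + 1 = j by lia.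
by rewrite -(cst_cd e' (opprK (tag z + 1)) erefl e) genZ.
Qed.

Lemma cellphi_el z (e : tag z + 1 + 0 = tag z + 1) : cellphi _ _ e (cellel z) = (val (tagged z)).1.
Proof.
have e' : - - (tag z + 1) + 0 = tag z + 1 by lia.
by rewrite (hlift_cellel _ e e') cellmap_gen.
Qed.

Lemma cellh_el z (e : tag z + 1 + -1 = tag z) : cellh _ _ e (cellel z) = - (val (tagged z)).2.
Proof.
have e' : - - (tag z + 1) + -1 = tag z by lia.
by rewrite (hlift_cellel _ e e') cellmap_gen.
Qed.

Lemma cell_cd z (e : tag z + 1 + -1 = tag z) (e1 : tag z + 1 = tag z + 1) :
  cd e1 (ciX dcellphi _ _ e (cellel z)) = stepi _ _ (addr0 (tag z + 1)) (val (tagged z)).1.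
Proof.
have e2 : tag z + 1 + 1 + -1 = tag z + 1 by lia.
have e3 : tag z + 1 + 0 = tag z + 1 by lia.
rewrite (hom_cd (addNr 1) _ e e1 erefl e2 e3) cellelZ hfun0 zsign00 addr0.
by rewrite (homd_ciX _ _ (addr0 0)) (hcompE _ _ _ e3 e3 (addr0 _)) cellphi_el.
Qed.

(** The differential of the generator attached along [(p, - m)] is the image of [p] in the next
    stage. *)
Lemma step_kill i (p : T i) : isZ p -> isB (prf T i i (addr0 i) p) -> isB (stepi i i (addr0 i) p).
Proof.
have [i' ei] : exists i', i = i' + 1 by exists (i - 1); lia.
subst i => hp /(isBP erefl) [m hm].
have hz : ((p, - m) : C i') \in @cocycle C i'.
  apply: cocycleP => j e; rewrite /= /coned /=.
  have e0 : i' + 1 + 1 = i' + 1 + 1 by [].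
  rewrite hp oppr0; congr pair.
  case: j / e; rewrite (hfun_irr (prf T) _ (addr0 (i' + 1))) hm cdN subrr //.
pose z : cells := Tagged (fun i => cyc C i) (exist _ ((p, - m) : C i') hz : cyc C i').
have e : tag z + 1 + -1 = tag z by lia.
by have := cell_cd e erefl; rewrite /= => <-; apply: isB_cd.
Qed.

(** For the pair [(0, - m)] the attaching map is zero, so the new generator is a cocycle, and
    [cellh] sends it to [m]. *)
Lemma step_surj i (m : M i) : isZ m -> exists x : step i, isZ x /\ prf step i i (addr0 i) x = m.
Proof.
move=> hm.
have hz : ((0, - m) : C i) \in @cocycle C i.
  apply: cocycleP => j e; rewrite /= /coned /=.
  by rewrite cd0 oppr0 hfun0 add0r cdN hm oppr0.
pose z : cells := Tagged (fun i => cyc C i) (exist _ ((0, - m) : C i) hz : cyc C i).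
have e : tag z + 1 + -1 = tag z by lia.
have hx : isZ (ciX dcellphi _ _ e (cellel z)).
  by apply: (isZP (e := erefl)); rewrite cell_cd; apply: hfun0.
exists (ciX dcellphi _ _ e (cellel z)); split; first exact: hx.
rewrite [LHS]homDE (hcompE _ _ _ (addr0 i) (addr0 i) (addr0 i)) (hcompE (addrN 1) _ _ (addr0 i) erefl e).
have e2 : tag z + 1 + (-1 + 0) = i by rewrite addr0.
have -> : cpY dcellphi i i (addr0 i) (ciX dcellphi _ _ e (cellel z)) = 0.
  by rewrite /= cst_id.
rewrite hfun0 add0r.
have -> : cpX dcellphi i (i + 1) erefl (ciX dcellphi _ _ e (cellel z)) = cellel z.
  exact: (@cst_id (dsum cellF) (tag z + 1) (ciX_e e) (cellel z)).
exact: (etrans (cellh_el e) (opprK m)).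
Qed.
End Step.

Definition pre0 : pre.
Proof.
apply: (@Pre A1 (hfree (0 : M 0)) _ (good_reg A)).
by apply: cocyc_hfree; apply: isZ0.
Defined.

Definition tw (n : nat) : pre := iter n step pre0.
Definition twi n : hom (tw n) (tw n.+1) 0 := stepi (tw n).

Definition tel := dsum (fun n => prP (tw n)).
Local Notation G := tel.
Local Notation hn := (hin (fun n => prP (tw n))).

(** Identity minus shift on the sum of all stages. Its cone is the mapping telescope, which replaces
    the union of the stages: its K-projectivity and K-flatness are immediate from those of sums and
    cones. *)
Definition telphi : hom G G 0 := hlift (fun n => hn n - hcomp (addr0 0) (hn n.+1) (twi n)).
Definition telf : hom G M 0 := hlift (fun n => prf (tw n)).

Lemma dtelphi : cocyc telphi.
Proof.
move=> k e; rewrite homd_hlift; apply: hlift0 => n.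
by apply: cocycB; [apply: cocyc_hin | apply: cocyc_hcomp; [exact: (@cocyc_hin _ _ (fun n => prP (tw n)) n.+1)|apply: stepi_cocyc]].
Qed.

Lemma dtelf : cocyc telf.
Proof. by move=> k e; rewrite homd_hlift; apply: hlift0 => n; apply: prdf. Qed.

Lemma telfphi : homd (addNr 1) (0 : hom G M (-1)) = hcomp (addr0 0) telf telphi.
Proof.
rewrite homd0 hcomp_hlift; symmetry; apply: hlift0 => n.
have E m : hcomp (addr0 0) telf (hn m) = prf (tw m) by apply: hlift_hin.
rewrite hcompDr hcompNr (hcompA _ _ (addr0 0) (addr0 0)) (E n) (E n.+1).
by rewrite [X in _ - X](stepi_f (tw n)) subrr.
Qed.

Definition rtel : dgMod A := cone dtelphi.
Definition rtelf : hom rtel M 0 := conemap dtelphi telf 0.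

Lemma drtelf : cocyc rtelf. Proof. exact: (cocyc_conemap dtelphi dtelf telfphi). Qed.

Lemma good_rtel : good rtel.
Proof. by apply: good_cone; apply: good_dsum => n; apply: prgood. Qed.

Lemma telphi_in n i (x : tw n i) :
  telphi i i (addr0 i) (@ds_in _ _ (fun n => prP (tw n)) n i x) =
   @ds_in _ _ (fun n => prP (tw n)) n i x
     - @ds_in _ _ (fun n => prP (tw n)) n.+1 i (twi n i i (addr0 i) x).
Proof.
rewrite hliftE homDE homNE hinE (hcompE _ _ _ (addr0 i) (addr0 i) (addr0 i)) hinE //.
Qed.

Local Notation dn n i x := (@ds_in A _ (fun m0 : nat => prP (tw m0)) n i x).

Lemma dsBE (n : nat) i (x y : G i) :
  ((x - y : G i) : dsT _ i) n = (x : dsT _ i) n - (y : dsT _ i) n.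
Proof. by []. Qed.

Lemma telphi_0 i (x : G i) : (telphi i i (addr0 i) x : dsT _ i) 0%N = (x : dsT _ i) 0%N.
Proof.
apply: (@ds_add_ext _ _ _ _ _ (fun x : G i => (telphi i i (addr0 i) x : dsT _ i) 0%N)
   (fun x : G i => (x : dsT _ i) 0%N)) x => [x y|x y|n x].
- by rewrite homD.
- by [].
rewrite telphi_in [LHS]dsBE.
by rewrite [X in _ - X]ds_in0 // subr0.
Qed.

Lemma telphi_S i (x : G i) n : (telphi i i (addr0 i) x : dsT _ i) n.+1
   = (x : dsT _ i) n.+1 - twi n i i (addr0 i) ((x : dsT _ i) n).
Proof.
apply: (@ds_add_ext _ _ _ _ _ (fun x : G i => (telphi i i (addr0 i) x : dsT _ i) n.+1)
   (fun x : G i => (x : dsT _ i) n.+1 - twi n i i (addr0 i) ((x : dsT _ i) n))) x => [x y|x y|m x].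
- by rewrite homD.
- by rewrite !dsDE homD opprD addrACA.
rewrite telphi_in [LHS]dsBE.
congr (_ - _); have [mn|mn] := eqVneq m n; first by subst m; rewrite !ds_inE.
rewrite !ds_in0 ?hfun0 // => e; [case/eqP: mn => // | case: e => e; case/eqP: mn => //].
Qed.

(** Modulo the image of [telphi], an element can be pushed forward until it is concentrated in a
    single stage. *)
Definition push (N : nat) i (y : G i) : Prop :=
  exists z u, y = dn N i z + telphi i i (addr0 i) u.

Lemma push_up (N : nat) i (y : G i) : push N y -> push N.+1 y.
Proof.
move=> [z [u ->]]; exists (twi N i i (addr0 i) z), (u + dn N i z).
have E (V : zmodType) (a b c : V) : a + c = b + (c + (a - b)).
  by rewrite [c + _]addrC addrA [b + _]addrC subrK.
by rewrite homD telphi_in; apply: (E (G i)).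
Qed.

Lemma push_le (N k : nat) i (y : G i) : push N y -> push (N + k) y.
Proof. by move=> h; elim: k => [|k IH]; [rewrite addn0 | rewrite addnS; apply: push_up]. Qed.

Lemma push_add (N : nat) i (x y : G i) : push N x -> push N y -> push N (x + y).
Proof.
move=> [z [u ->]] [z' [u' ->]]; exists (z + z'), (u + u').
by rewrite homD ds_inD addrACA.
Qed.

Lemma pushP i (y : G i) : exists N : nat, push N y.
Proof.
have [s us hs] := ds_supp (y : dsT _ i); rewrite (ds_sum us hs).
elim: s {us hs} => [|n s [N hN]].
  by exists 0%N, 0, 0; rewrite big_nil hfun0 addr0 (morphD0 (@ds_inD _ _ _ _ _)).
exists (n + N)%N; rewrite big_cons; apply: push_add; last by rewrite addnC; apply: push_le.
by apply: push_le; exists (y n), 0; rewrite hfun0 addr0.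
Qed.

Local Notation cY := (ciY dtelphi).

Lemma cpYE i (w : rtel i) (e : i + 0 = i) : cpY dtelphi i i e w = w.2.
Proof. by rewrite /= cst_id. Qed.

(** The cohomology of the telescope is the colimit of that of the stages; only the part needed is
    shown, that each class is represented by a cocycle in one stage. *)
Lemma rtel_rep i (w : rtel i) : isZ w ->
  exists n (y : tw n i), isZ y /\ isB (w - cY i i (addr0 i) (dn n i y)).
Proof.
move=> hw; have [N [z [u yE]]] := pushP w.2.
have e1 : i + 1 + -1 = i by lia.
have e2 : i - 1 + 1 = i by lia.
have e3 : i + -1 = i - 1 by [].
have e4 : i + 0 = i by lia.
(* Subtracting this boundary leaves a cocycle whose second component sits in stage [N] alone. It
   remains to see that its first component [x'] is zero. *)
pose b := cd e2 (ciX dtelphi _ _ e3 u).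
have bB : isB b by apply: isB_cd.
have hw' : isZ (w - b) by apply: isZB => //; apply: isBZ.
have b2 : b.2 = telphi i i (addr0 i) u.
  rewrite -(cpYE b (addr0 i)) /b (hom_cd (addNr 1) (ciX dtelphi) e3 e2 erefl e1 e4).
  rewrite (homd_ciX _ _ (addr0 0)) homD (hcompE _ _ _ e4 (addr0 i) (addr0 i)).
  rewrite -(hcompE (addr0 0) (cpY dtelphi) (ciY dtelphi) (addr0 i) (addr0 i) (addr0 i)).
  rewrite cpY_ciY hidE hfun_zsign.
  rewrite -(hcompE (addr0 (-1)) (cpY dtelphi) (ciX dtelphi) e1 e1 (addr0 i)).
  by rewrite cpY_ciX hom0E zsign00 addr0.
have w2 : (w - b).2 = dn N i z.
  have -> : (w - b).2 = w.2 - b.2 by [].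
  by rewrite b2 yE addrK.
case wE : (w - b) hw' w2 => [x' y'] hw' y'E; rewrite /= in y'E.
have hx : forall n, (telphi _ _ (addr0 (i + 1)) x' : dsT _ (i + 1)) n = - (cd erefl y' : dsT _ (i + 1)) n.
  have h : telphi _ _ (cone_e (erefl (i + 1))) x' + cd (erefl (i + 1)) y' = 0.
    exact: (congr1 snd (hw' _ (erefl (i + 1)))).
  move=> n; have -> : telphi _ _ (addr0 (i + 1)) x' = - cd (erefl (i + 1)) y'.
    rewrite (hfun_irr telphi (addr0 (i + 1)) (cone_e (erefl (i + 1)))).
    by apply/eqP; rewrite -addr_eq0 h.
  by [].
have dy n : N <> n -> (cd erefl y' : dsT _ (i + 1)) n = 0.
  by move=> Nn; rewrite y'E /= [X in cd _ X](ds_in0 (F := fun n => prP (tw n))) // cd0.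
(* Before stage [N] the cocycle equation determines the components of [x'] recursively, starting
   from 0. *)
have lt n : (n < N)%N -> (x' : dsT _ _) n = 0.
  elim: n => [|n IH] nN.
    rewrite -telphi_0 hx dy ?oppr0 //; lia.
  have := hx n.+1; rewrite telphi_S (IH (ltnW nN)) hfun0 subr0 dy ?oppr0 //; lia.
(* From stage [N] on the recursion runs backwards, from the end of the finite support, because the
   maps between stages are injective. *)
have gt n : (x' : dsT _ _) n.+1 = 0 -> (N < n.+1)%N -> (x' : dsT _ _) n = 0.
  move=> h nN; have := hx n.+1; rewrite telphi_S h sub0r dy; last by lia.
  by rewrite oppr0 => /eqP; rewrite oppr_eq0 => /eqP /stepi_inj.
have [s hs] := ds_fin (x' : dsT _ _).
have [K hK] : exists K, forall n, (K <= n)%N -> (x' : dsT _ _) n = 0.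
  exists (\max_(n <- s) n).+1 => n hn; apply: hs; apply/negP => ns.
  by have := @leq_bigmax_seq _ s xpredT id n ns isT; rewrite leqNgt hn.
have ge n : (N <= n)%N -> (x' : dsT _ _) n = 0.
  move=> Nn; have [Kn|nK] := leqP K n; first exact: hK.
  rewrite -(subnK (ltnW nK)) in hK.
  have : (x' : dsT _ _) (K - n + n)%N = 0 by apply: hK.
  elim: (K - n)%N => [|k IH] //; rewrite addSn => h; apply: IH; apply: gt => //; lia.
have x0 : x' = 0.
  apply: ds_ext => n; have [/lt //|/ge //] := ltnP n N.
exists N, z; split.
  apply: (isZP (e := erefl)); have := hx N; rewrite x0 hfun0 => /esym/eqP.
  rewrite oppr_eq0 y'E => /eqP <-.
  exact: (congr1 (cd _) (esym (@ds_inE A _ (fun m0 : nat => prP (tw m0)) N i z))).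
have -> : w - cY i i (addr0 i) (dn N i z) = b.
  have -> : cY i i (addr0 i) (dn N i z) = w - b.
    by rewrite wE x0 y'E /= cst_id.
  by rewrite subKr.
exact: bB.
Qed.

Lemma rtelf_cY n i (y : tw n i) : rtelf i i (addr0 i) (cY i i (addr0 i) (dn n i y)) =
  prf (tw n) i i (addr0 i) y.
Proof.
rewrite -(hcompE (addr0 0) rtelf (ciY dtelphi) (addr0 i) (addr0 i) (addr0 i)).
rewrite conemap_ciY hliftE //.
Qed.

Lemma cY_shift n i (y : tw n i) : isZ y ->
  isB (cY i i (addr0 i) (dn n i y) - cY i i (addr0 i) (dn n.+1 i (twi n i i (addr0 i) y))).
Proof.
move=> hy; rewrite -hfunB.
have <- : telphi i i (addr0 i) (dn n i y) =
  dn n i y - dn n.+1 i (twi n i i (addr0 i) y) by exact: telphi_in.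
rewrite -(hcompE (addr0 0) (ciY dtelphi) telphi (addr0 i) (addr0 i) (addr0 i)).
rewrite -(homd_ciX dtelphi (addNr 1) (addr0 0)).
have hz : isZ (dn n i y : G i).
  have := cocyc_Z (@cocyc_hin A _ (fun m0 : nat => prP (tw m0)) n) (addr0 i) hy.
  by rewrite hinE.
apply: (@isB_hom A G rtel 0 _ i i (addr0 i) _ _ hz).
by exists (-1), (addNr 1), (ciX dtelphi).
Qed.

(** A class of stage [n] that dies in [M] is already killed in stage [n + 1], and every class of [M]
    is hit from stage 1. *)
Lemma qi_rtelf : qi rtelf.
Proof.
move=> i; split=> j e.
  have ej : i = j by rewrite -e addr0.
  case: j / ej e => e w hw hB.
  have [n [y [hy wB]]] := rtel_rep hw; apply: (isB_trans wB).
  apply: (isB_trans (cY_shift hy)).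
  have : isB (prf (tw n) i i (addr0 i) y).
    rewrite -rtelf_cY -[rtelf _ _ _ _](subrK (rtelf i i e w)); apply: isBD => //.
    rewrite (hfun_irr rtelf e (addr0 i)) -hfunB -opprB hfunN; apply: isBN.
    exact: (cocyc_B drtelf).
  move=> /(step_kill hy) kB.
  apply: (cocyc_B (st_du (st_cone dtelphi))).
  have := cocyc_B (@cocyc_hin A _ (fun m0 : nat => prP (tw m0)) n.+1) (addr0 i) kB.
  by rewrite hinE.
have ej : i = j by rewrite -e addr0.
case: j / ej e => e m hm.
have [x [hx xm]] := @step_surj (tw 0) i m hm.
exists (cY i i (addr0 i) (dn 1 i x)); split.
  apply: (cocyc_Z (st_du (st_cone dtelphi))).
  have := cocyc_Z (@cocyc_hin A _ (fun m0 : nat => prP (tw m0)) 1%N) (addr0 i) hx.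
  by rewrite hinE.
rewrite (hfun_irr rtelf e (addr0 i)) (@rtelf_cY 1%N i x) [prf _ _ _ _ _]xm subrr.
exact: isB0.
Qed.
End Resolution.

Section ResolutionUse.
Variable A : cdgRing.
Implicit Types M N P Q : dgMod A.

Lemma res_exists M : exists P, exists f : hom P M 0, [/\ cocyc f, good P & qi f].
Proof.
exists (rtel M), (rtelf M).
by split; [exact: drtelf | exact: good_rtel | exact: qi_rtelf].
Qed.

Definition res M : dgMod A := projT1 (cid (res_exists M)).
Definition resf M : hom (res M) M 0 := projT1 (cid (projT2 (cid (res_exists M)))).

Lemma resP M : [/\ cocyc (resf M), good (res M) & qi (resf M)].
Proof. exact: (projT2 (cid (projT2 (cid (res_exists M))))). Qed.
Lemma dresf M : cocyc (resf M). Proof. by case: (resP M). Qed.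
Lemma good_res M : good (res M). Proof. by case: (resP M). Qed.
Lemma qi_resf M : qi (resf M). Proof. by case: (resP M). Qed.

Definition dres M : dgHom (res M) M := dgof (dresf M (add0r 1)).

Lemma homof_dres M : homof (dres M) = resf M.
Proof. exact: homofK. Qed.

Lemma quasi_iso_dres M : quasi_iso (dres M).
Proof. by apply/quasi_isoP; rewrite homof_dres; apply: qi_resf. Qed.
End ResolutionUse.

(** * Isomorphism in the derived category *)

Section QiCalculus.
Variable A : cdgRing.
Implicit Types M N P Q L X : dgMod A.

Lemma qi_comp M N L n m k (e : n + m = k) (g : hom N L m) (f : hom M N n) :
  cocyc f -> cocyc g -> qi f -> qi g -> qi (hcomp e g f).
Proof.
move=> df dg hf hg i; split=> [j ej x hx|j ej y hy].
  have h : i + n + m = j by lia.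
  rewrite (hcompE e _ _ ej erefl h) => /((hg _).1 _ h _ (cocyc_Z df _ hx)).
  exact: (hf i).1.
have h : i + n + m = j by lia.
have [z [hz yz]] := (hg (i + n)).2 j h y hy.
have [x [hx zx]] := (hf i).2 _ erefl z hz.
exists x; split=> //; rewrite (hcompE e _ _ ej erefl h).
by apply: (isB_tr yz); rewrite -hfunB; apply: (cocyc_B dg).
Qed.

Lemma qi_cancell M N L n m k (e : n + m = k) (g : hom N L m) (f : hom M N n) :
  cocyc f -> cocyc g -> qi g -> qi (hcomp e g f) -> qi f.
Proof.
move=> df dg hg hgf i; split=> [j ej x hx hB|j ej y hy].
  have h : j + m = i + k by lia.
  apply: ((hgf i).1 _ erefl _ hx); rewrite (hcompE e _ _ erefl ej h).
  exact: (cocyc_B dg).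
have h : j + m = i + k by lia.
have [x [hx yx]] := (hgf i).2 _ erefl (g j _ h y) (cocyc_Z dg h hy).
exists x; split=> //; apply: ((hg j).1 _ h).
  by apply: isZB => //; apply: (cocyc_Z df).
by move: yx; rewrite (hcompE e _ _ erefl ej h) -hfunB.
Qed.

Lemma qi_homo M N n (f g : hom M N n) : isB (X := Homdg M N) (f - g) -> qi f -> qi g.
Proof.
move=> fg hf i; split=> [j e x hx hB|j e y hy].
  apply: ((hf i).1 j e x hx); apply: (isB_trans _ hB).
  exact: (isB_hom e fg hx).
have [x [hx yx]] := (hf i).2 j e y hy; exists x; split=> //.
exact: (isB_tr yx (isB_hom e fg hx)).
Qed.

Lemma qi_hinv M N n n' (u : hom M N n) (v : hom N M n') : hinv u v -> qi u.
Proof.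
move=> h i; have [e0 [_ [du dv _ _]]] := h.
split=> [j e x hx hB|j e y hy]; have e' : j + n' = i by lia.
  by rewrite -(hinvE e e' x h); apply: (cocyc_B dv).
exists (v j i e' y); split; first exact: (cocyc_Z dv).
by rewrite (hinvE e' e y (hinv_sym h)) subrr; apply: isB0.
Qed.

Lemma qi_hid M : qi (hid M).
Proof.
apply: (@qi_hinv M M 0 0 _ (hid M)); exists (addr0 0), (addr0 0).
by split; rewrite ?hcomp1l //; apply: cocyc_hid.
Qed.

Lemma qi_van M N n (f : hom M N n) i j : i + n = j -> cocyc f -> qi f -> van M i <-> van N j.
Proof.
move=> e df hf; split=> [h y hy|h x hx].
  have [x [hx yx]] := (hf i).2 j e y hy.
  by apply: (isB_trans yx); apply: (cocyc_B df); apply: h.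
by apply: ((hf i).1 j e x hx); apply: h; apply: (cocyc_Z df).
Qed.

(* Isomorphism in the derived category, as the existence of a span of quasi-isomorphisms. *)
Definition sim M N : Prop :=
  exists P (f : hom P M 0) (g : hom P N 0), [/\ cocyc f, cocyc g, qi f & qi g].

Lemma sim_qi M N (f : hom M N 0) : cocyc f -> qi f -> sim M N.
Proof. by move=> df hf; exists M, (hid M), f; split=> //; [apply: cocyc_hid | apply: qi_hid]. Qed.

Lemma sim_refl M : sim M M.
Proof. by apply: (sim_qi (@cocyc_hid A M)); apply: qi_hid. Qed.

Lemma sim_sym M N : sim M N -> sim N M.
Proof. by move=> [P [f [g [df dg hf hg]]]]; exists P, g, f. Qed.

Lemma sim_hinv M N (u : hom M N 0) (v : hom N M 0) : hinv u v -> sim M N.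
Proof.
move=> h; have [_ [_ [du _ _ _]]] := h; exact: (sim_qi du (qi_hinv h)).
Qed.

Lemma sim_res M : sim (res M) M.
Proof. exact: (sim_qi (dresf M) (qi_resf M)). Qed.

Lemma Kp_qi_lift P N N' (s : hom N N' 0) (f : hom P N' 0) :
  cocyc s -> cocyc f -> Kp P -> qi s ->
  exists g : hom P N 0, [/\ cocyc g, isB (X := Homdg P N') (f - hcomp (addr0 0) s g) &
   qi f -> qi g].
Proof.
move=> ds df hP hs; have [g [dg hg]] := Kp_lift ds hP hs df.
exists g; split=> // hf; apply: (qi_cancell (e := addr0 0) dg ds hs).
exact: (qi_homo hg hf).
Qed.

Lemma sim_Kp P M N : sim M N -> Kp P -> (exists f : hom P M 0, cocyc f /\ qi f) ->
  exists g : hom P N 0, cocyc g /\ qi g.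
Proof.
move=> [Q [a [b [da db ha hb]]]] hP [f [df hf]].
have [g [dg _ hg]] := Kp_qi_lift da df hP ha.
exists (hcomp (addr0 0) b g); split; first exact: cocyc_hcomp.
by apply: qi_comp => //; apply: hg.
Qed.

Lemma sim_resP M N : sim M N <-> exists g : hom (res M) N 0, cocyc g /\ qi g.
Proof.
split=> [h|[g [dg hg]]].
  apply: (sim_Kp h (good_res M).1); exists (resf M); split; [exact: dresf | exact: qi_resf].
by exists (res M), (resf M), g; split=> //; [exact: dresf | exact: qi_resf].
Qed.

(** Spans compose without fibre products: the first can be started at [res M], which lifts along the
    left leg of the second. *)
Lemma sim_trans N M L : sim M N -> sim N L -> sim M L.
Proof.
move=> /sim_resP hMN hNL; apply/sim_resP; exact: (sim_Kp hNL (good_res M).1 hMN).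
Qed.

Lemma sim_Kp_qi P M : Kp P -> sim P M -> exists f : hom P M 0, cocyc f /\ qi f.
Proof.
move=> hP h; apply: (sim_Kp h hP); exists (hid P); split; [exact: cocyc_hid | exact: qi_hid].
Qed.

Lemma sim_van M N i : sim M N -> van M i -> van N i.
Proof.
move=> [P [f [g [df dg hf hg]]]] /(qi_van (addr0 i) df hf) h.
by apply/(qi_van (addr0 i) dg hg).
Qed.

Lemma sim_funp (F : dgfun A A) M N :
  (forall X Y (f : hom X Y 0), cocyc f -> qi f -> qi (fh F f)) -> sim M N -> sim (F M) (F N).
Proof.
move=> hF [P [f [g [df dg hf hg]]]]; exists (F P), (fh F f), (fh F g).
by split; [exact: fh_cocyc | exact: fh_cocyc | exact: hF | exact: hF].
Qed.

Lemma sim_homR P M N : Kp P -> sim M N -> sim (Homdg P M) (Homdg P N).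
Proof. by move=> hP; apply: (@sim_funp (HomR P)) => X Y f df hf; apply: Kp_post. Qed.

Lemma sim_homL P P' N : Kp P -> Kp P' -> sim P P' -> sim (Homdg P N) (Homdg P' N).
Proof.
move=> hP hP' /(sim_Kp_qi hP) [f [df hf]]; apply: sim_sym.
exact: (sim_qi (ch_cocyc (HomL N) df) (Kp_cof_qi (HomL N) df hP hP' hf)).
Qed.

Lemma sim_comm M N : sim (tensor M N) (tensor N M).
Proof. exact: sim_hinv (hinv_comm M N). Qed.

Lemma Kf_pres X M N (f : hom M N 0) : Kf X -> cocyc f -> qi f -> qi (fh (TensL X) f).
Proof.
move=> hX df hf; apply: (qi_fun_cone (F := TensL X) (df := df)) => i.
apply: (hinv_van (addr0 i) (hinv_comm X (cone df))); apply: hX.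
by apply/qi_cone.
Qed.

Lemma sim_tensl X M N : Kf X -> sim M N -> sim (tensor M X) (tensor N X).
Proof. by move=> hX; apply: (@sim_funp (TensL X)) => Y Z f df hf; apply: Kf_pres. Qed.

Lemma sim_tensr X M N : Kf X -> sim M N -> sim (tensor X M) (tensor X N).
Proof.
move=> hX /(sim_tensl hX) h.
exact: (sim_trans (sim_comm _ _) (sim_trans h (sim_comm _ _))).
Qed.

(** With [M] replaced by its resolution, which is K-flat too, the comparison of [X] with [X'] can be
    tensored; flatness of [X] and of [X'] then returns to [M] at both ends. *)
Lemma sim_tens_flat X X' M : Kf X -> Kf X' -> sim X X' -> sim (tensor X M) (tensor X' M).
Proof.
move=> hX hX' h; have hM := good_res M.
apply: (sim_trans (sim_tensr hX (sim_sym (sim_res M)))).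
exact: (sim_trans (sim_tensl hM.2 h) (sim_tensr hX' (sim_res M))).
Qed.

Lemma sim_uni N : sim (tensor (regMod A) N) N.
Proof. exact: sim_sym (sim_hinv (hinv_uni N)). Qed.

Definition homA1 N : hom (Homdg (regMod A) N) N 0 :=
  @Hom A (Homdg (regMod A) N) N 0
   (fun i j e (f : hom (regMod A) N i) => f 0 j (etrans (add0r i) (etrans (esym (addr0 i)) e)) (dunit A))
   (fun i j e x y => erefl) (fun p i k j l e ej el e' a f =>
    etrans (homaE e a f (etrans (add0r k) (etrans (esym (addr0 k)) el))
      (etrans (add0r i) (etrans (esym (addr0 i)) ej)) e' (dunit A))
     (esym (congr1 (fun n => zsign n _) (mulr0 p)))).

Lemma homA1E N i (e : i + 0 = i) (f : hom (regMod A) N i) :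
  homA1 N i i e f = f 0 i (add0r i) (dunit A).
Proof. exact: (hfun_irr f). Qed.

Lemma cocyc_homA1 N : cocyc (homA1 N).
Proof.
move=> k e; apply: hom_ext => i j ej f.
have h1 : i + 1 = j by lia.
have h2 : i + 1 + 0 = j by lia.
have h3 : 1 + i = j by lia.
rewrite (homdE e _ ej erefl (addr0 i) h1 h2) zsign0 homA1E.
case: j / h1 ej h2 h3 => ej h2 h3; rewrite homA1E.
rewrite [X in _ - X](homdE (erefl (i + 1)) f _ (add0r 1) (add0r i) erefl h3).
by rewrite d_unit hfun0 zsign00 subr0 subrr.
Qed.

Lemma qi_homA1 N : qi (homA1 N).
Proof.
move=> i; split=> j e.
  have ej : i = j by rewrite -e addr0.
  case: j / ej e => e f df; rewrite homA1E => /(isBP (subrK 1 i)) [y fy].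
  exists (i - 1), (subrK 1 i), (hfree y : Homdg (regMod A) N _).
  by rewrite [RHS]homd_hfree -fy hfree_eval.
have ej : i = j by rewrite -e addr0.
case: j / ej e => e y hy; exists (hfree y); split; first exact: cocyc_hfree.
by rewrite homA1E hfree1 subrr; apply: isB0.
Qed.

Lemma sim_homA N : sim (Homdg (regMod A) N) N.
Proof. exact: sim_qi (@cocyc_homA1 N) (@qi_homA1 N). Qed.

Lemma curry_inv M N L i j (e : i + 0 = j) (F : hom M (Homdg N L) j) :
  exists g : hom (tensor M N) L i, curry M N L i j e g = F /\ (cocyc F -> cocyc g).
Proof.
have ej : i = j by rewrite -e addr0.
case: j / ej e F => e F; exists (huncurry F); split; last exact: huncurry_cocyc.
by rewrite curryE hcurryK.
Qed.

Lemma sim_curry M N L : sim (Homdg (tensor M N) L) (Homdg M (Homdg N L)).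
Proof.
apply: (sim_qi (@cocyc_curry _ M N L)) => i; split=> [j e g dg hB|j e F dF].
  have ej : i = j by rewrite -e addr0.
  case: j / ej e hB => e; rewrite curryE => /(isBP (subrK 1 i)) [F hF].
  exists (i - 1), (subrK 1 i), (huncurry F : Homdg (tensor M N) L _).
  rewrite -[g]huncurryK hF -[RHS]huncurryK; congr huncurry.
  exact: (etrans (congr1 (homd (subrK 1 i)) (esym (hcurryK F)))
    (homd_hcurry (subrK 1 i) (huncurry F))).
have [g [gF dg]] := curry_inv e F; exists g; split; first exact: dg.
by rewrite gF subrr; apply: isB0.
Qed.

Lemma Kp_tensor P Q : Kp P -> Kp Q -> Kp (tensor P Q).
Proof.
move=> hP hQ N hN i; apply: (sim_van (sim_sym (sim_curry P Q N))).
by apply: hP; apply: hQ.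
Qed.

Lemma sim_comm_hom M N L : sim (Homdg (tensor M N) L) (Homdg (tensor N M) L).
Proof.
apply: sim_sym; have h := hinv_cof (HomL L) (hinv_comm M N).
by apply: (sim_hinv h).
Qed.

Lemma sim_swap M N L : sim (Homdg M (Homdg N L)) (Homdg N (Homdg M L)).
Proof.
apply: (sim_trans (sim_sym (sim_curry M N L))).
exact: (sim_trans (sim_comm_hom M N L) (sim_curry N M L)).
Qed.
End QiCalculus.

(** * Associativity of the tensor product *)

Section Assoc.
Variable A : cdgRing.

Section Def.
Variables M N L : dgMod A.
Local Notation T := (tensor M (tensor N L)).

Definition assoc : hom (tensor (tensor M N) L) T 0 :=
  huncurry (huncurry (hcomp (addr0 0) (curry N L T) (hcurry (hid T)))).

Lemma assocE i (e : i + 0 = i) a b c ab bc (e1 : a + b = ab) (e2 : ab + c = i)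
    (e3 : b + c = bc) (e4 : a + bc = i) (m : M a) (n : N b) (l : L c) :
  assoc i i e (pure (M := tensor M N) e2 (pure e1 m n) l) = pure (N := tensor N L) e4 m (pure e3 n l).
Proof.
have h1 : c + ab = i by lia.
have h2 : b + a = ab by lia.
have h3 : bc + a = i by lia.
have h4 : a + 0 = a by lia.
rewrite (huncurryE _ e e2 (addr0 ab) h1) (huncurryE _ (addr0 ab) e1 h4 h2).
rewrite (hcompE (addr0 0) _ _ h4 h4 h4) curryE.
rewrite (hcurryE _ h2 n h1 e3 h3) (hcurryE _ h4 m h3 e4 e) hidE //.
Qed.

Lemma cocyc_assoc : cocyc assoc.
Proof.
apply: huncurry_cocyc; apply: huncurry_cocyc; apply: cocyc_hcomp; first exact: cocyc_curry.
move=> k e; rewrite homd_hcurry homd_id.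
by apply: hom_ext => a c ec m; apply: hom_ext.
Qed.

Lemma hom3_extn (X : dgMod A) p (f g : hom (tensor (tensor M N) L) X p) :
  (forall i j (e : i + p = j) a b c ab (e1 : a + b = ab) (e2 : ab + c = i) (m : M a) (n : N b) (l : L c),
     f i j e (pure (M := tensor M N) e2 (pure e1 m n) l) = g i j e (pure (M := tensor M N) e2 (pure e1 m n) l)) -> f = g.
Proof.
move=> fg; apply: homT_ext => i j e ab c e2 t l.
apply: (@tens_ext _ _ _ _ _ (fun t => f i j e (pure (M := tensor M N) e2 t l))
  (fun t => g i j e (pure (M := tensor M N) e2 t l))) t => [t t'|t t'|a b e1 m n]; last exact: fg.
- by have E := pureDl (M := tensor M N) e2 l t t'; cbv beta in E; rewrite [X in f i j e X](E : _ = _) homD.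
- by have E := pureDl (M := tensor M N) e2 l t t'; cbv beta in E; rewrite [X in g i j e X](E : _ = _) homD.
Qed.

Lemma hom3_ext (X : dgMod A) (f g : hom (tensor (tensor M N) L) X 0) :
  (forall i (e : i + 0 = i) a b c ab (e1 : a + b = ab) (e2 : ab + c = i) (m : M a) (n : N b) (l : L c),
     f i i e (pure (M := tensor M N) e2 (pure e1 m n) l) = g i i e (pure (M := tensor M N) e2 (pure e1 m n) l)) -> f = g.
Proof.
move=> fg; apply: hom3_extn => i j e a b c ab e1 e2 m n l.
have ej : i = j by rewrite -e addr0.
by case: j / ej e => e; apply: fg.
Qed.

Lemma hom3_extr (X : dgMod A) (f g : hom T X 0) :
  (forall i (e : i + 0 = i) a b c bc (e1 : b + c = bc) (e2 : a + bc = i) (m : M a) (n : N b) (l : L c),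
     f i i e (pure (N := tensor N L) e2 m (pure e1 n l)) = g i i e (pure (N := tensor N L) e2 m (pure e1 n l))) -> f = g.
Proof.
move=> fg; apply: homT_ext => i j e a bc e2 m t.
have ej : i = j by rewrite -e addr0.
case: j / ej e => e.
apply: (@tens_ext _ _ _ _ _ (fun t => f i i e (pure (N := tensor N L) e2 m t))
  (fun t => g i i e (pure (N := tensor N L) e2 m t))) t => [t t'|t t'|b c e1 n l]; last exact: fg.
- by have E := pureDr (N := tensor N L) e2 m t t'; cbv beta in E; rewrite [X in f i i e X](E : _ = _) homD.
- by have E := pureDr (N := tensor N L) e2 m t t'; cbv beta in E; rewrite [X in g i i e X](E : _ = _) homD.
Qed.
End Def.

Variables M N L : dgMod A.

(** The inverse is [assoc L N M] conjugated by symmetries, so no new balancedness has to be checked;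
    the Koszul signs cancel in pairs. *)
Definition assocV : hom (tensor M (tensor N L)) (tensor (tensor M N) L) 0 :=
  hcomp (addr0 0) (thom L (comm N M)) (hcomp (addr0 0) (comm L (tensor N M))
   (hcomp (addr0 0) (assoc L N M) (hcomp (addr0 0) (thom M (comm N L)) (comm M (tensor N L))))).

Lemma assocVE i (e : i + 0 = i) a b c ab bc (e1 : a + b = ab) (e2 : ab + c = i)
    (e3 : b + c = bc) (e4 : a + bc = i) (m : M a) (n : N b) (l : L c) :
  assocV i i e (pure (N := tensor N L) e4 m (pure e3 n l)) = pure (M := tensor M N) e2 (pure e1 m n) l.
Proof.
have h1 : bc + a = i by lia.
have h2 : c + b = bc by lia.
have h3 : b + a = ab by lia.
have h4 : c + ab = i by lia.
rewrite (hcompE _ _ _ e e e) (hcompE _ _ _ e e e) (hcompE _ _ _ e e e) (hcompE _ _ _ e e e).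
rewrite (commE e _ h1) !hfun_zsign (thomE _ e h1 (addr0 bc) h1) (commE (addr0 bc) _ h2).
rewrite [pure h1 (zsign _ _) m](morphD_zsign (pureDl (M := tensor L N) h1 m)) !hfun_zsign.
rewrite (assocE e h2 h1 h3 h4) (commE e h4 e2) !hfun_zsign (thomE _ e e2 (addr0 ab) e2).
rewrite (commE (addr0 ab) h3 e1) [pure e2 (zsign _ _) l](morphD_zsign (pureDl (M := tensor M N) e2 l)).
rewrite -!zsignD zsign_even //.
rewrite !(odd_abszD, odd_abszM) -e1 -e3 !odd_abszD.
by case: (odd `|a|%N); case: (odd `|b|%N); case: (odd `|c|%N).
Qed.

Lemma cocyc_thom (X Y Z : dgMod A) n (f : hom X Y n) : cocyc f -> cocyc (thom Z f).
Proof. exact: (fh_cocyc (TensL Z)). Qed.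

Lemma hinv_assoc : hinv (assoc M N L) assocV.
Proof.
exists (addr0 0), (addr0 0); split; first exact: cocyc_assoc.
- apply: cocyc_hcomp; first by apply: cocyc_thom; apply: cocyc_comm.
  apply: cocyc_hcomp; first exact: cocyc_comm.
  apply: cocyc_hcomp; first exact: cocyc_assoc.
  apply: cocyc_hcomp; last exact: cocyc_comm.
  by apply: cocyc_thom; apply: cocyc_comm.
- apply: hom3_ext => i e a b c ab e1 e2 m n l.
  have h : a + (b + c) = i by lia.
  by rewrite (hcompE _ _ _ e e e) (assocE e e1 e2 erefl h) (assocVE e e1 e2) hidE.
apply: hom3_extr => i e a b c bc e1 e2 m n l.
have h : a + b + c = i by lia.
by rewrite (hcompE _ _ _ e e e) (assocVE e erefl h) (assocE e _ _ e1 e2) hidE.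
Qed.

Lemma sim_assoc : sim (tensor (tensor M N) L) (tensor M (tensor N L)).
Proof. exact: sim_hinv hinv_assoc. Qed.
End Assoc.

(** * Comparison of spans with isomorphism in the localized category *)

Section DerivedIso.
Variable A : cdgRing.
Implicit Types M N P Q : dgMod A.

Definition cinv M N (s : dgHom M N) (hs : quasi_iso s) i (y : coh N i) : coh M i :=
  projT1 (cid (let: Bijective g _ Kg := hs i in ex_intro (fun x => cohmap s x = y) (g y) (Kg y))).

Lemma cinvK M N (s : dgHom M N) (hs : quasi_iso s) i (y : coh N i) : cohmap s (cinv hs y) = y.
Proof. by rewrite /cinv; case: cid. Qed.

Lemma quasi_iso_inj M N (s : dgHom M N) (hs : quasi_iso s) i : injective (cohmap s (i := i)).
Proof. exact: bij_inj. Qed.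

Lemma cinvK' M N (s : dgHom M N) (hs : quasi_iso s) i (x : coh M i) : cinv hs (cohmap s x) = x.
Proof. by apply: (quasi_iso_inj hs); rewrite cinvK. Qed.

(** Cohomology on formal composites, with formal inverses acting by inverse bijections; [Hmap_deq]
    shows that it is well defined on [D(A)]. *)
Fixpoint Hmap M N (f : dmor M N) i : coh M i -> coh N i :=
  match f in dmor M N return coh M i -> coh N i with
  | DId M => id
  | DComp M N P g f => fun x => Hmap g (Hmap f x)
  | DOf M N f => cohmap f (i := i)
  | DInv M N s hs => cinv hs (i := i)
  end.

Lemma cohmap_id M i (x : coh M i) : cohmap (dg_id M) x = x.
Proof. by elim/hclsW: x => x; rewrite cohmapE; congr hcls; apply: val_inj. Qed.

Lemma cohmap_comp M N P (g : dgHom N P) (f : dgHom M N) i (x : coh M i) :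
  cohmap (dg_comp g f) x = cohmap g (cohmap f x).
Proof. by elim/hclsW: x => x; rewrite !cohmapE; congr hcls; apply: val_inj. Qed.

Lemma Hmap_deq M N (f g : dmor M N) : deq f g -> forall i (x : coh M i), Hmap f x = Hmap g x.
Proof.
elim=> {M N f g} //=.
- by move=> M N f g h _ IH1 _ IH2 i x; rewrite IH1 IH2.
- by move=> M N P g g' f f' _ IH1 _ IH2 i x; rewrite IH2 IH1.
- by move=> M i x; apply: cohmap_id.
- by move=> M N P g f i x; apply: cohmap_comp.
- by move=> M N s hs i x; apply: cinvK'.
- by move=> M N s hs i x; apply: cinvK.
Qed.

Lemma d_isom_bij M N (f : dmor M N) i : d_isom f -> bijective (Hmap f (i := i)).
Proof.
move=> [g [gf fg]]; exists (Hmap g (i := i)) => x.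
- exact: (Hmap_deq gf x).
- exact: (Hmap_deq fg x).
Qed.

Lemma d_isom_of M N (f : dgHom M N) : d_isom (DOf f) <-> quasi_iso f.
Proof.
split=> [h i|h]; first exact: (d_isom_bij i h).
by exists (DInv h); split; constructor.
Qed.

Lemma dIso_sym M N : dIso M N -> dIso N M.
Proof. by move=> [f [g [gf fg]]]; exists g, f. Qed.

Lemma dIso_trans N M P : dIso M N -> dIso N P -> dIso M P.
Proof.
move=> [f [f' [f1 f2]]] [g [g' [g1 g2]]]; exists (DComp g f), (DComp f' g'); split.
  apply: deq_trans (_ : deq _ (DComp f' f)) _ => //.
  apply: deq_trans (deq_sym (deq_assoc _ _ _)) _; apply: deq_comp; first exact: deq_refl.
  apply: deq_trans (deq_assoc _ _ _) _.
  by apply: deq_trans (deq_comp g1 (deq_refl _)) _; apply: deq_idl.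
apply: deq_trans (_ : deq _ (DComp g g')) _ => //.
apply: deq_trans (deq_sym (deq_assoc _ _ _)) _; apply: deq_comp; first exact: deq_refl.
apply: deq_trans (deq_assoc _ _ _) _.
by apply: deq_trans (deq_comp f2 (deq_refl _)) _; apply: deq_idl.
Qed.

Lemma cohmap_homo M N (f g : dgHom M N) : isB (X := Homdg M N) (homof f - homof g) ->
  forall i (x : coh M i), cohmap f x = cohmap g x.
Proof.
move=> fg i x; elim/hclsW: x => x; rewrite !cohmapE; apply/hclsP; rewrite !SubK.
have := isB_hom (addr0 i) fg (_ : isZ (val x)); rewrite homDE homNE !homofE; apply.
by move=> j e; apply: cycP.
Qed.

Lemma dg_lift P N N' (s : dgHom N N') (f : dgHom P N') : Kp P -> quasi_iso s ->
  exists g : dgHom P N, forall i (x : coh P i), cohmap s (cohmap g x) = cohmap f x.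
Proof.
move=> hP /quasi_isoP hs.
have ds : cocyc (homof s) by move=> k e; apply: homd_homof.
have df : cocyc (homof f) by move=> k e; apply: homd_homof.
have [g [dg hg]] := Kp_lift ds hP hs df.
exists (dgof (dg _ (add0r 1))) => i x; rewrite -cohmap_comp; apply: cohmap_homo.
by rewrite (homof_comp _ _ (addr0 0)) homofK; apply: isB_sym.
Qed.

(** Each generator of [D(A)] lifts to resolutions by K-projectivity. Agreement is claimed on
    cohomology only, which is all that is needed to recognize a quasi-isomorphism and avoids
    relating [deq] to homotopy. *)
Lemma Hmap_lift M N (f : dmor M N) : exists g : dgHom (res M) (res N),
  forall i (x : coh (res M) i), Hmap f (cohmap (dres M) x) = cohmap (dres N) (cohmap g x).
Proof.
elim: f => {M N} [M|M N P g [g' hg] f [f' hf]|M N f|M N s hs] /=.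
- by exists (dg_id (res M)) => i x; rewrite (cohmap_id x).
- by exists (dg_comp g' f') => i x; rewrite hf hg cohmap_comp.
- have [g hg] := dg_lift (dg_comp f (dres M)) (good_res M).1 (quasi_iso_dres N).
  by exists g => i x; rewrite hg cohmap_comp.
have h : quasi_iso (dg_comp s (dres M)).
  apply/quasi_isoP; rewrite (homof_comp _ _ (addr0 0)).
  apply: qi_comp.
  - by move=> k e; apply: homd_homof.
  - by move=> k e; apply: homd_homof.
  - by apply/quasi_isoP/quasi_iso_dres.
  - exact/quasi_isoP.
have [g hg] := dg_lift (dres N) (good_res N).1 h.
exists g => i x; apply: (quasi_iso_inj hs); rewrite cinvK -hg cohmap_comp //.
Qed.

Lemma dIsoP M N : dIso M N <-> sim M N.
Proof.
split=> [[f hf]|[P [f [g [df dg hf hg]]]]]; last first.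
  apply: (@dIso_trans P).
    apply: dIso_sym; exists (DOf (dgof (df _ (add0r 1)))); apply/d_isom_of/quasi_isoP.
    by rewrite homofK.
  exists (DOf (dgof (dg _ (add0r 1)))); apply/d_isom_of/quasi_isoP.
  by rewrite homofK.
have [g hg] := Hmap_lift f.
(* In the square provided by [Hmap_lift] the other three sides are bijective on cohomology. *)
have hq : quasi_iso g.
  move=> i; have [a aK Ka] := quasi_iso_dres N i.
  have hb : bijective (fun x => Hmap f (cohmap (dres M) (i := i) x)).
    exact: (bij_comp (d_isom_bij i hf) (quasi_iso_dres M i)).
  have hb' : bijective (a \o (fun x => Hmap f (cohmap (dres M) (i := i) x))).
    by apply: bij_comp => //; exists (cohmap (dres N) (i := i)).
  by apply: (eq_bij hb') => x /=; rewrite hg aK.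
apply: (sim_trans (sim_sym (sim_res M))); apply: (sim_trans _ (sim_res N)).
apply: (@sim_qi _ _ _ (homof g)); last exact/quasi_isoP.
by move=> k e; apply: homd_homof.
Qed.

Lemma is_LtensorP M N T : is_Ltensor M N T <-> sim (tensor (res M) N) T.
Proof.
split=> [[P [s [/KfP hP /quasi_isoP hs /dIsoP h]]]|h].
  apply: (sim_trans _ h); apply: sim_tens_flat => //; first exact: (good_res M).2.
  apply: (sim_trans (sim_res M)); apply: sim_sym; apply: (sim_qi _ hs).
  by move=> k e; apply: homd_homof.
exists (res M), (dres M); split; last exact/dIsoP.
- by apply/KfP; apply: (good_res M).2.
- exact: quasi_iso_dres.
Qed.

Lemma is_RHomP M N T : is_RHom M N T <-> sim (Homdg (res M) N) T.
Proof.
split=> [[P [s [/KpP hP /quasi_isoP hs /dIsoP h]]]|h].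
  apply: (sim_trans _ h); apply: sim_homL => //; first exact: (good_res M).1.
  apply: (sim_trans (sim_res M)); apply: sim_sym; apply: (sim_qi _ hs).
  by move=> k e; apply: homd_homof.
exists (res M), (dres M); split; last exact/dIsoP.
- by apply/KpP; apply: (good_res M).1.
- exact: quasi_iso_dres.
Qed.

Lemma sim_RHom P M N : Kp P -> sim P M -> sim (Homdg P N) (Homdg (res M) N).
Proof.
move=> hP h; apply: sim_homL => //; first exact: (good_res M).1.
exact: (sim_trans h (sim_sym (sim_res M))).
Qed.
End DerivedIso.

(** * Truncation and directed unions *)

Section SubModule.
Variables (A : cdgRing) (U : dgMod A).

Record sdg := Sdg {
  sdS :> forall i, U i -> Prop;
  sd0 : forall i, sdS (0 : U i);
  sdD : forall i (x y : U i), sdS x -> sdS y -> sdS (x + y);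
  sda : forall p i j (e : p + i = j) (a : A p) (x : U i), sdS x -> sdS (act e a x);
  sdd : forall i j (e : i + 1 = j) (x : U i), sdS x -> sdS (cd e x) }.

Variable S : sdg.

Lemma sdN i (x : U i) : S i x -> S i (- x).
Proof. by rewrite -[x in - x](act1 (add0r i)) -actNl; apply: sda. Qed.

Definition sdp i : {pred U i} := [pred x | `[< S i x >]].

Lemma sdp_zmod i : zmod_closed (@sdp i).
Proof.
split=> [|x y]; rewrite !inE; first by apply/asboolP/sd0.
by move=> /asboolP hx /asboolP hy; apply/asboolP/sdD => //; apply: sdN.
Qed.
HB.instance Definition _ i := GRing.isZmodClosed.Build _ (@sdp i) (sdp_zmod i).

Definition sdT i : Type := {x : U i | x \in @sdp i}.
HB.instance Definition _ i := SubChoice.on (sdT i).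
HB.instance Definition _ i := [SubChoice_isSubZmodule of sdT i by <:].

Lemma sdTP i (x : sdT i) : S i (val x).
Proof. by have := valP x; rewrite inE => /asboolP. Qed.

Definition sdin i (x : U i) (h : S i x) : sdT i := exist _ x (asboolT h : x \in @sdp i).

Program Definition sdc : cpx :=
  @Cpx (fun i => sdT i) (fun i j e x => sdin (sdd e (sdTP x))) _ _.
Next Obligation. by move=> i j e x y; apply/val_inj; rewrite /= cdD. Qed.
Next Obligation. by move=> i j k e e' x; apply/val_inj; rewrite /= cdd. Qed.

Program Definition subM : dgMod A :=
  @DGMod A sdc (fun p i j e a x => sdin (sda e a (sdTP x))) _ _ _ _ _.
Next Obligation. by move=> *; apply/val_inj; rewrite /= actDl. Qed.
Next Obligation. by move=> *; apply/val_inj; rewrite /= actDr. Qed.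
Next Obligation. by move=> *; apply/val_inj; apply: actA. Qed.
Next Obligation. by move=> *; apply/val_inj; rewrite /= act1. Qed.
Next Obligation.
move=> i j k i' j' k' e ei ej ek e1 e2 a m; apply/val_inj.
rewrite raddfD (morphD_zsign (raddfD val)) /=; exact: act_leibniz.
Qed.

Program Definition sinc : hom subM U 0 :=
  @Hom A subM U 0 (fun i j e (x : sdT i) => @cst U i j (etrans (esym (addr0 i)) e) (val x)) _ _.
Next Obligation. by move=> i j e x y; rewrite [val _]raddfD cstD. Qed.
Next Obligation.
by move=> p i k j l e ej el e' a x; rewrite mulr0 zsign0; apply: cst_act.
Qed.

Lemma sincE i (e : i + 0 = i) (x : subM i) : sinc i i e x = val (x : sdT i).
Proof. exact: cst_id. Qed.

Lemma cocyc_sinc : cocyc sinc.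
Proof.
move=> k e; apply: hom_ext => i j ej x.
have h1 : i + 1 = j by lia.
have h2 : i + 1 + 0 = j by lia.
rewrite (homdE e _ ej erefl (addr0 i) h1 h2) zsign0 sincE.
by case: j / h1 ej h2 => ej h2; rewrite sincE subrr.
Qed.

Lemma sub_isZ i (x : subM i) : isZ x <-> isZ (val (x : sdT i)).
Proof.
split=> h j e; last by apply/val_inj; apply: h.
exact: (congr1 (fun y : sdT j => val y) (h j e)).
Qed.
End SubModule.

Section Truncation.
Variables (A : cdgRing) (U : dgMod A) (n : int).

(** The smart truncation in degrees at most [n], with cocycles only in degree [n]. It is stable
    under [A] because [A] lives in non-positive degrees. *)
Program Definition trS : sdg U :=
  @Sdg A U (fun i x => (i = n -> isZ x) /\ ((n < i)%R -> x = 0)) _ _ _ _.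
Next Obligation. by move=> i; split=> // _; apply: isZ0. Qed.
Next Obligation.
move=> i x y [h1 h2] [h3 h4]; split=> h; first by apply: isZD; auto.
by rewrite h2 // h4 // addr0.
Qed.
Next Obligation.
move=> p i j e a x [h1 h2].
have [p0|p0] := Order.TotalTheory.ltP 0 p.
  by rewrite (dnonpos p0 a) act0l; split=> // _; apply: isZ0.
have [ni|ni] := Order.TotalTheory.ltP n i.
  by rewrite h2 // act0r; split=> // _; apply: isZ0.
split=> h; last by lia.
have i1 : i = n by lia.
have p1 : p = 0 by lia.
subst p; have ij : i = j by lia.
by case: j / ij e h => e h; rewrite scE; apply: sc_Z; apply: h1.
Qed.
Next Obligation.
move=> i j e x [h1 h2]; split=> h; first by apply/isBZ/isB_cd.
have [ni|ni] := Order.TotalTheory.ltP n i; first by rewrite h2 // cd0.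
by apply: h1; lia.
Qed.

Definition tr : dgMod A := subM trS.

Lemma tr0 i (x : tr i) : (n < i)%R -> x = 0.
Proof. by move=> h; apply/val_inj; have [_ ->] := sdTP x. Qed.

Lemma trI i : qI (sinc trS) i.
Proof.
move=> j e x hx; have ej : i = j by rewrite -e addr0.
case: j / ej e => e; rewrite sincE => /(isBP (subrK 1 i)) [y xy].
have [ni|ni] := Order.TotalTheory.ltP n i; first by rewrite (tr0 x ni); apply: isB0.
have hy : trS (i - 1) y by split; lia.
by exists (i - 1), (subrK 1 i), (sdin hy : tr (i - 1)); apply/val_inj.
Qed.

Lemma trQ i : (i <= n)%R -> qS (sinc trS) i.
Proof.
move=> ni j e y hy; have ej : i = j by rewrite -e addr0.
case: j / ej e y hy => e y hy.
have hy' : trS i y by split=> // h; lia.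
exists (sdin hy' : tr i); split; first by apply/sub_isZ.
by rewrite sincE subrr; apply: isB0.
Qed.

Definition below (P : dgMod A) b : Prop := forall i, (b < i)%R -> van P i.

Lemma tr_qi : below U n -> qi (sinc trS).
Proof.
move=> h i; split; first exact: trI.
have [ni|ni] := Order.TotalTheory.ltP n i; last exact: trQ.
move=> j e y hy; exists 0; split; first exact: isZ0.
rewrite hfun0 subr0; apply: h => //; lia.
Qed.
End Truncation.

(** * Cohomological bounds for tensor products and Hom *)

Section Bounds.
Variable A : cdgRing.
Implicit Types M N P Q X : dgMod A.

(** Up to homotopy [P] is a retract of [X], so vanishing descends from [F X] to [F P] for every DG
    functor, including those that do not respect quasi-isomorphisms. *)
Lemma Kp_retract B (F : dgfun A B) X P (s : hom X P 0) i : cocyc s -> Kp P -> qi s ->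
  van (F X) i -> van (F P) i.
Proof.
move=> ds hP hs hX t ht.
have [g [dg hg]] := Kp_lift ds hP hs (@cocyc_hid A P).
have := isB_fh F hg; rewrite fhD fhN fh_id fh_comp => /(isB_hom (addr0 i))/(_ ht).
rewrite homDE homNE hidE (hcompE _ _ _ _ (addr0 i) (addr0 i)) => /isB_trans; apply.
apply: (cocyc_B (fh_cocyc F ds)); apply: hX.
exact: (cocyc_Z (fh_cocyc F dg)).
Qed.

(** After both modules have been replaced by truncations, a pure tensor of degree above [b + c] has
    a zero factor. *)
Lemma tens_below P Q b c : Kp P -> Kp Q -> below P b -> below Q c -> below (tensor P Q) (b + c).
Proof.
move=> hP hQ bP bQ j hj.
apply: (Kp_retract (F := TensL Q) (@cocyc_sinc _ _ (trS P b)) hP (tr_qi bP)).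
apply: (sim_van (sim_comm _ _)).
apply: (Kp_retract (F := TensL (tr P b)) (@cocyc_sinc _ _ (trS Q c)) hQ (tr_qi bQ)).
move=> t _; have -> : t = 0; last exact: isB0.
apply: (@tens_ext _ _ _ _ _ id (fun=> 0)) t => [//|x y|x y e m n]; first by rewrite addr0.
have [h|h] := Order.TotalTheory.ltP c x.
  by rewrite (tr0 m h) (morphD0 (pureDl e n)).
by rewrite (tr0 n) ?(morphD0 (pureDr e m)) //; lia.
Qed.

(** The truncation of [P] has a homotopy section [g], so only degrees up to [b] matter. There [f]
    takes values in the truncation of [M] at [j + b], which is acyclic, and K-projectivity
    applies. *)
Lemma hom_above P M b j : Kp P -> below P b -> (forall k, (k <= j + b)%R -> van M k) ->
  van (Homdg P M) j.
Proof.
move=> hP bP hM f df.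
have di := @cocyc_sinc _ _ (trS P b).
have [g [dg hg]] := Kp_lift di hP (tr_qi bP) (@cocyc_hid A P).
pose fi := hcomp (add0r j) f (sinc (trS P b)).
have dfi : cocyc fi by apply: cocyc_hcomp.
(* In the top degree [b] the truncation of [P] consists of cocycles, so [f] meets the condition
   imposed in degree [j + b]. *)
have hin i l (e : i + j = l) x : trS M (j + b) l (fi i l e x).
  split=> h.
    have ib : i = b by lia.
    apply: (cocyc_Z dfi); apply/sub_isZ.
    by have [h1 _] := sdTP (x : sdT (trS P b) i); apply: h1.
  by rewrite (tr0 x) ?hfun0 //; lia.
have [f' f'v] : exists f' : hom (tr P b) (tr M (j + b)) j, forall i l (e : i + j = l) x,
    val (f' i l e x : sdT (trS M (j + b)) l) = fi i l e x.
  unshelve eexists.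
    apply: (@Hom A (tr P b) (tr M (j + b)) j (fun i l e x => sdin (hin i l e x) : tr M (j + b) l)).
    - by move=> i l e x y; apply/val_inj; rewrite [RHS]raddfD; exact: (homD fi e x y).
    move=> p i k l m e el em e' a x; apply/val_inj.
    rewrite [RHS](morphD_zsign (raddfD val)); exact: (hom_act fi).
  by [].
have f'E : hcomp (addr0 j) (sinc _) f' = fi.
  apply: hom_ext => i l e x.
  by rewrite (hcompE _ _ _ e e (addr0 l)) sincE f'v.
have df' : cocyc f'.
  move=> k e; apply: hom_ext => i l el x; apply/val_inj.
  have := congr1 (fun h : hom _ _ k => h i l el x) (dfi k e).
  have h1 : i + j + 1 = l by lia.
  have h2 : i + 1 + j = l by lia.
  rewrite (homdE e _ el erefl erefl h1 h2) (homdE e _ el erefl erefl h1 h2) => h.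
  rewrite [LHS]raddfB [X in _ - X](morphD_zsign (raddfD val)) /= !f'v; exact: h.
have hac : ac (tr M (j + b)).
  move=> i x hx; apply: (@trI _ M (j + b) i i (addr0 i) x hx); rewrite sincE.
  have [h|h] := Order.TotalTheory.ltP (j + b) i.
    by rewrite (tr0 x h); apply: isB0.
  by apply: hM => //; apply/sub_isZ.
have h1 : isB (X := Homdg P (tr M (j + b))) (hcomp (add0r j) f' g).
  by apply: hP => //; apply: cocyc_hcomp.
have h2 : isB (X := Homdg P M) (hcomp (add0r j) fi g).
  rewrite -f'E -(hcompA (add0r j) (addr0 j) (addr0 j) (add0r j)).
  by apply: isB_hcompl => //; apply: cocyc_sinc.
apply: (@isB_trans (Homdg P M) j f _ _ h2).
have -> : f - hcomp (add0r j) fi g = hcomp (add0r j) f (hid P - hcomp (addr0 0) (sinc _) g).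
  by rewrite hcompDr hcompNr hcomp1r (hcompA (addr0 0) (add0r j) (add0r j) (add0r j)).
by apply: isB_hcompl.
Qed.
End Bounds.

Section DirectedUnion.
Variables (A : cdgRing) (U X : dgMod A) (FF : sdg U -> Prop).

Definition sle (S T : sdg U) : Prop := forall i x, S i x -> T i x.

Record directed : Prop := Directed {
  dir_up : forall S T, FF S -> FF T -> exists R, [/\ FF R, sle S R & sle T R];
  dir_ex : forall i (x : U i), exists S, FF S /\ S i x }.

Hypothesis dF : directed.

Section Tmap.
Variables (M M' : dgMod A) (f : forall i, M i -> M' i) (k : int).
Fixpoint tmap (t : texp M X k) : texp M' X k :=
  match t with
  | TPure _ _ e m n => TPure e (f m) n
  | TZero => TZero _ _ _
  | TOpp t => TOpp (tmap t)
  | TAdd t u => TAdd (tmap t) (tmap u)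
  end.
End Tmap.

(* The set-theoretic retraction onto a submodule, with junk value 0 outside of it. *)
Definition sdproj (S : sdg U) i (x : U i) : subM S i :=
  if pselect (S i x) is left h then sdin h else 0.

Lemma rhoE (S : sdg U) i (x : U i) : S i x -> val (sdproj S x : sdT S i) = x.
Proof. by rewrite /sdproj; case: pselect. Qed.

Lemma rhoD (S : sdg U) i (x y : U i) : S i x -> S i y -> sdproj S (x + y) = sdproj S x + sdproj S y.
Proof.
move=> hx hy; apply/val_inj; rewrite raddfD /= !rhoE //; exact: sdD.
Qed.

Lemma rho_zact (S : sdg U) p i j (e : p + i = j) n (a : A p) (x : U i) : S i x ->
  sdproj S (zsign n (act e a x)) = zsign n (act e a (sdproj S x)).
Proof.
move=> hx; apply/val_inj; rewrite (morphD_zsign (raddfD val)) /= !rhoE //.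
by rewrite /zsign; case: (odd _); [apply: sdN|]; apply: sda.
Qed.

Lemma dir1 i (x : U i) S0 : FF S0 -> exists S, [/\ FF S, sle S0 S & S i x].
Proof.
move=> h0; have [S1 [h1 hx]] := dir_ex dF x.
by have [R [hR h0R h1R]] := dir_up dF h0 h1; exists R; split=> //; apply: h1R.
Qed.

(** A derivation of [trel] mentions finitely many elements of [U], hence can be repeated in all
    sufficiently large members of the family. *)
Lemma dir_rel k (t u : texp U X k) : trel t u ->
  exists S, FF S /\ forall R, FF R -> sle S R -> trel (tmap (sdproj R) t) (tmap (sdproj R) u).
Proof.
have any : exists S, FF S by have [S [hS _]] := dir_ex dF (0 : U 0); exists S.
have [S0 h0] := any.
elim=> {t u}.
- by move=> t; exists S0; split=> // R _ _; apply: trel_refl.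
- by move=> t u _ [S [hS h]]; exists S; split=> // R hR hSR; apply/trel_sym/h.
- move=> t u v _ [S [hS h]] _ [S' [hS' h']].
  have [T [hT a b]] := dir_up dF hS hS'; exists T; split=> // R hR hTR.
  by apply: (@trel_trans _ _ _ _ _ (tmap (sdproj R) u)); [apply: h | apply: h'] => // i x hx;
    apply: hTR; [apply: a | apply: b].
- by move=> t u _ [S [hS h]]; exists S; split=> // R hR hSR /=; apply/trel_opp/h.
- move=> t u t' u' _ [S [hS h]] _ [S' [hS' h']].
  have [T [hT a b]] := dir_up dF hS hS'; exists T; split=> // R hR hTR /=.
  by apply: trel_add; [apply: h | apply: h'] => // i x hx; apply: hTR; [apply: a | apply: b].
- by move=> t u v; exists S0; split=> // R _ _; apply: trel_addA.
- by move=> t u; exists S0; split=> // R _ _; apply: trel_addC.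
- by move=> t; exists S0; split=> // R _ _; apply: trel_add0.
- by move=> t; exists S0; split=> // R _ _; apply: trel_addN.
- move=> i j e m m' n.
  have [S [hS _ hm]] := dir1 m h0; have [T [hT hST hm']] := dir1 m' hS.
  exists T; split=> // R hR hTR /=; rewrite rhoD; last 2 first.
  + by apply/hTR/hST.
  + exact: hTR.
  exact: trel_pureDl.
- by move=> i j e m n n'; exists S0; split=> // R _ _; apply: trel_pureDr.
move=> i p j pi pj e1 e2 e e' m a n.
have [S [hS _ hm]] := dir1 m h0; exists S; split=> // R hR hSR /=.
rewrite rho_zact; last exact: hSR.
exact: trel_balanced.
Qed.

Lemma thom_tmap (M M' : dgMod A) (g : hom M M' 0) k (t : texp M X k) :
  thom X g k k (addr0 k) (tcls t) = tcls (tmap (fun i x => g i i (addr0 i) x) t).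
Proof.
elim: t => [i j e m n||t IH|t IHt u IHu] /=.
- exact: (thomE g (addr0 k) e (addr0 i) e).
- exact: (hfun0 (thom X g)).
- rewrite -tensNE -[tcls (TOpp (tmap _ _))]tensNE -IH.
  exact: (hfunN (thom X g)).
rewrite -tensDE -[tcls (TAdd (tmap _ _) _)]tensDE -IHt -IHu.
exact: (homD (thom X g)).
Qed.

Lemma tmap_comp (M M' M'' : dgMod A) (f : forall i, M i -> M' i) (g : forall i, M' i -> M'' i) k
  (t : texp M X k) : tmap g (tmap f t) = tmap (fun i x => g i (f i x)) t.
Proof. by elim: t => //= [t ->|t -> u ->]. Qed.

Lemma tmap_ext (M M' : dgMod A) (f g : forall i, M i -> M' i) k (t : texp M X k) :
  (forall i x, f i x = g i x) -> tmap f t = tmap g t.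
Proof.
by move=> fg; elim: t => //= [i j e m n|t ->|t -> u ->] //; rewrite fg.
Qed.

Lemma dir_in k (t : texp U X k) : exists S, FF S /\ forall R, FF R -> sle S R ->
  tmap (fun i (x : subM R i) => sinc R i i (addr0 i) x) (tmap (sdproj R) t) = t.
Proof.
elim: t => [i j e m n||t [S [hS h]]|t [S [hS h]] u [S' [hS' h']]].
- have [S [hS hm]] := dir_ex dF m; exists S; split=> // R hR hSR /=.
  by rewrite cst_id rhoE //; apply: hSR.
- by have [S [hS _]] := dir_ex dF (0 : U 0); exists S.
- by exists S; split=> // R hR hSR /=; rewrite h.
have [T [hT a b]] := dir_up dF hS hS'; exists T; split=> // R hR hTR /=.
by rewrite h ?h' // => i x hx; apply: hTR; [apply: b | apply: a].
Qed.

Program Definition sincl (S R : sdg U) (h : sle S R) : hom (subM S) (subM R) 0 :=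
  @Hom A (subM S) (subM R) 0
    (fun i j e (x : sdT S i) =>
       @cst (subM R) i j (etrans (esym (addr0 i)) e) (sdin (h _ _ (sdTP x)))) _ _.
Next Obligation.
move=> S R h i j e x y; rewrite -cstD; congr cst; apply/val_inj.
by rewrite [RHS]raddfD.
Qed.
Next Obligation.
move=> S R h p i k j l e ej el e' a x; rewrite mulr0 zsign0.
rewrite -(cst_act e (etrans (esym (addr0 i)) ej) (etrans (esym (addr0 k)) el)).
by congr cst; apply/val_inj.
Qed.

Lemma sinclE (S R : sdg U) (h : sle S R) i (e : i + 0 = i) (x : subM S i) :
  sincl h i i e x = sdin (h _ _ (sdTP (x : sdT S i))).
Proof. exact: cst_id. Qed.

Lemma cocyc_sincl (S R : sdg U) (h : sle S R) : cocyc (sincl h).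
Proof.
move=> k e; apply: hom_ext => i j ej x.
have h1 : i + 1 = j by lia.
have h2 : i + 1 + 0 = j by lia.
rewrite (homdE e _ ej erefl (addr0 i) h1 h2) zsign0 sinclE.
case: j / h1 ej h2 => ej h2; rewrite sinclE; apply/eqP; rewrite subr_eq0; apply/eqP.
exact/val_inj.
Qed.

(** Two finiteness arguments: the expression of [x] lives in some member [S], and the derivation
    showing [d x = 0] lives in some [S1]. A member containing both receives [x] as a cocycle. *)
Lemma dir_tens k (x : tensor U X k) : isZ x -> exists R x',
  [/\ FF R, isZ (x' : tensor (subM R) X k) & thom X (sinc R) k k (addr0 k) x' = x].
Proof.
elim/tclsW: x => t ht.
have [S [hS hin]] := dir_in t.
have E0 R : FF R -> sle S R ->
    thom X (sinc R) k k (addr0 k) (tcls (tmap (sdproj R) t)) = tcls t.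
  by move=> hR SR; rewrite thom_tmap hin.
pose y := @cd (tensor (subM S) X) k (k + 1) erefl (tcls (tmap (sdproj S) t)).
have y0 : thom X (sinc S) _ _ (addr0 (k + 1)) y = 0.
  have h := cocyc_cd (fh_cocyc (TensL X) (@cocyc_sinc _ _ S)) (addr0 k) erefl erefl (addr0 (k + 1)).
  by rewrite /y -[LHS](h (tcls (tmap (sdproj S) t))) [fh _ _ _ _ _ _]E0 // ht.
have [v yv] : exists v, y = tcls v by elim/tclsW: (y) => v; exists v.
have v0 : trel (tmap (fun i (x : subM S i) => sinc S i i (addr0 i) x) v) (TZero U X _).
  by apply/tclsP; rewrite -thom_tmap -yv y0.
have [S1 [hS1 h1]] := dir_rel v0.
have [R [hR SR S1R]] := dir_up dF hS hS1.
exists R, (tcls (tmap (sdproj R) t)); split; [exact: hR | | exact: E0].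
have E1 : thom X (sincl SR) k k (addr0 k) (tcls (tmap (sdproj S) t)) = tcls (tmap (sdproj R) t).
  rewrite thom_tmap -[in RHS](hin S) // !tmap_comp; congr tcls; apply: tmap_ext => i x.
  move: (sdproj S x) => {}x.
  by apply/val_inj; rewrite sinclE /= cst_id rhoE //; exact: (SR _ _ (sdTP _)).
apply: (isZP (e := erefl)); rewrite -E1.
have h := cocyc_cd (fh_cocyc (TensL X) (cocyc_sincl SR)) (addr0 k) erefl erefl (addr0 (k + 1)).
rewrite [LHS](h (tcls (tmap (sdproj S) t))).
transitivity (thom X (sincl SR) _ _ (addr0 (k + 1)) (tcls v)); first by rewrite -yv.
apply: etrans (thom_tmap (sincl SR) v) _.
apply: (etrans _ (_ : tcls (tmap (sdproj R) (tmap (fun i (x : subM S i) => sinc S i i (addr0 i) x) v)) = 0)).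
  rewrite tmap_comp; congr tcls; apply: tmap_ext => i x.
  by apply/val_inj; rewrite sinclE /= cst_id rhoE //; exact: (SR _ _ (sdTP _)).
by apply/tclsP; apply: h1.
Qed.
End DirectedUnion.

(** * Finitely generated cohomology *)

Section Finiteness.
Variable A : cdgRing.
Hypothesis hN : noetherian (barRing A).
Local Notation A1 := (regMod A).

Lemma A0_Z (a : A 0) : isZ a.
Proof. by move=> j e; apply: dA0. Qed.

Definition bcl (a : A 0) : barRing A := hcls (exist _ a (cocycleP (@A0_Z a)) : cyc A 0).

Lemma bclP (a b : A 0) : bcl a = bcl b <-> isB (a - b).
Proof. exact: hclsP. Qed.

Lemma bcl_surj (x : barRing A) : exists a, x = bcl a.
Proof.
elim/hclsW: x => x; exists (val x); congr hcls; exact: val_inj.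
Qed.

Lemma bclD a b : bcl (a + b) = bcl a + bcl b.
Proof. by rewrite /bcl -hclsD; congr hcls; apply: val_inj. Qed.

Lemma bclM (a b : A 0) : bcl (sc (M := A1) a b) = bcl a * bcl b.
Proof. by rewrite /bcl [RHS](hactE (M := A1)); congr hcls; apply: val_inj. Qed.

Lemma bcl0 : bcl 0 = 0.
Proof. exact: (morphD0 (f := bcl) bclD). Qed.

Lemma bcl1 : bcl (dunit A) = 1.
Proof. by rewrite [RHS]/(bar1 A) /bcl; congr hcls; apply: val_inj. Qed.

Lemma bcl_sum n (f : 'I_n -> A 0) : bcl (\sum_i f i) = \sum_i bcl (f i).
Proof. by apply: (big_morph bcl bclD bcl0). Qed.

(** Finite generation of submodules of a finite free module over [H^0(A)], kept in terms of lifts to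
    [A^0] and equality up to boundaries. The initial coordinates form a finitely generated ideal;
    once an initial coordinate has been made a boundary, [N'] treats the others by induction. *)
Lemma noeth_span n (N : ('I_n -> A1 0) -> Prop) : N (fun=> 0) ->
  (forall c c', N c -> N c' -> N (fun i => c i + c' i)) ->
  (forall a c, N c -> N (fun i => sc a (c i))) ->
  exists r (g : 'I_r -> 'I_n -> A1 0), (forall k, N (g k)) /\
    forall c, N c -> exists l : 'I_r -> A 0, forall i, isB (c i - \sum_k sc (l k) (g k i)).
Proof.
elim: n N => [|n IH] N N0 ND NM.
  exists 0%N, (fun _ _ => 0); split; first by case.
  by move=> c _; exists (fun=> 0); case.
have NMs r (l : 'I_r -> A 0) (g : 'I_r -> 'I_n.+1 -> A1 0) : (forall k, N (g k)) ->
    N (fun i => \sum_k sc (l k) (g k i)).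
  elim: r l g => [|r IHr] l g hg.
    have -> : (fun i : 'I_n.+1 => \sum_(k < 0) sc (l k) (g k i)) = (fun=> 0).
      by apply: funext => i; rewrite big_ord0.
    exact: N0.
  have -> : (fun i : 'I_n.+1 => \sum_(k < r.+1) sc (l k) (g k i)) =
     (fun i => sc (l ord0) (g ord0 i) + \sum_(k < r) sc (l (lift ord0 k)) (g (lift ord0 k) i)).
    by apply: funext => i; rewrite big_ord_recl.
  by apply: ND; [apply: NM | apply: IHr].
pose J (x : barRing A) := exists c, N c /\ x = bcl (c ord0).
have idJ : is_ideal J.
  split.
  - by exists (fun=> 0); rewrite bcl0.
  - move=> x y [c [hc ->]] [c' [hc' ->]]; exists (fun i => c i + c' i).
    by split; [apply: ND | rewrite bclD].
  move=> a x [c [hc ->]]; have [b ->] := bcl_surj a.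
  by exists (fun i => sc b (c i)); split; [apply: NM | rewrite bclM].
have [r [v hv]] := hN idJ.
have hvJ k : J (v k).
  apply/hv; exists (fun i => (i == k)%:R).
  by rewrite (bigD1 k) //= eqxx mul1r big1 ?addr0 // => i /negbTE ->; rewrite mul0r.
pose g k := projT1 (cid (hvJ k)).
have hg k : N (g k) /\ v k = bcl (g k ord0) by exact: (projT2 (cid (hvJ k))).
pose N' (c : 'I_n -> A1 0) := exists c', [/\ N c', isB (c' ord0) & forall i, c' (lift ord0 i) = c i].
have [r' [g' [hg' sp']]] : exists r (g : 'I_r -> 'I_n -> A1 0), (forall k, N' (g k)) /\
    forall c, N' c -> exists l : 'I_r -> A 0, forall i, isB (c i - \sum_k sc (l k) (g k i)).
  apply: IH.
  - by exists (fun=> 0); split=> //; apply: isB0.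
  - move=> c c' [d [h1 h2 h3]] [d' [h1' h2' h3']]; exists (fun i => d i + d' i); split.
    + exact: ND.
    + exact: isBD.
    + by move=> i; rewrite h3 h3'.
  move=> a c [d [h1 h2 h3]]; exists (fun i => sc a (d i)); split.
  - exact: NM.
  - exact: (sc_B (M := A1)).
  - by move=> i; rewrite h3.
pose G k := projT1 (cid (hg' k)).
have hG k : [/\ N (G k), isB (G k ord0) & forall i, G k (lift ord0 i) = g' k i].
  exact: (projT2 (cid (hg' k))).
exists (r + r')%N, (fun k => match split k with inl a => g a | inr b => G b end); split.
  by move=> k; case: (split k) => a; [case: (hg a) | case: (hG a)].
move=> c hc.
have [l hl] : exists l : 'I_r -> A 0, isB (c ord0 - \sum_k sc (l k) (g k ord0)).
  have /hv [m hm] : J (bcl (c ord0)) by exists c.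
  have hb k := cid (bcl_surj (m k)).
  exists (fun k => projT1 (hb k)); apply/bclP; rewrite hm bcl_sum.
  by apply: eq_bigr => k _; rewrite bclM -(hg k).2; congr (_ * _); exact: (projT2 (hb k)).
pose c1 i := c i - \sum_k sc (l k) (g k i).
have hc1 : N c1.
  have : N (fun i => c i + sc (- dunit A) (\sum_k sc (l k) (g k i))).
    by apply: ND => //; apply: (NM (- dunit A)); apply: NMs => k; case: (hg k).
  congr N; apply: funext => i; rewrite scNl; congr (_ - _); exact: (sc1 (M := A1)).
have [l' hl'] : exists l : 'I_r' -> A 0, forall i, isB (c1 (lift ord0 i) - \sum_k sc (l k) (g' k i)).
  by apply: (sp' (fun i => c1 (lift ord0 i))); exists c1.
exists (fun k => match split k with inl a => l a | inr b => l' b end) => i.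
rewrite big_split_ord /=.
under eq_bigr => k _ do rewrite (unsplitK (inl k)).
under [X in _ - (_ + X)]eq_bigr => k _ do rewrite (unsplitK (inr k)).
rewrite opprD addrA -/(c1 i).
have [->|[i' ->]] : i = ord0 \/ exists i', i = lift ord0 i'.
- by case: (unliftP ord0 i) => [i' ->|->]; [right; exists i' | left].
- apply: isBB; first exact: hl.
  elim/big_ind: _ => [|x y hx hy|k _]; [exact: isB0 | exact: isBD |].
  by apply: (sc_B (M := A1)); case: (hG k).
have := hl' i'; congr isB; congr (_ - _); apply: eq_bigr => k _.
by case: (hG k) => _ _ ->.
Qed.

Section FG.
Variable S : A 0 -> Prop.
Hypothesis mS : mset S.

Definition lcomb (M : dgMod A) i n (c : 'I_n -> A 0) (v : 'I_n -> M i) : M i :=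
  \sum_j sc (c j) (v j).

(* [S^-1 H^i(M)] is a finitely generated module. *)
Definition fgS (M : dgMod A) i : Prop := exists n (v : 'I_n -> M i),
  (forall j, isZ (v j)) /\
  forall x, isZ x -> exists s c, S s /\ isB (sc s x - lcomb c v).

Lemma sc_sum (M : dgMod A) i (a : A 0) n (f : 'I_n -> M i) : sc a (\sum_j f j) = \sum_j sc a (f j).
Proof. by apply: (big_morph (sc a)) => [x y|]; rewrite ?scDr ?sc0r. Qed.

Lemma hfun_sum (M N : dgMod A) n (f : hom M N n) i j (e : i + n = j) m (g : 'I_m -> M i) :
  f i j e (\sum_k g k) = \sum_k f i j e (g k).
Proof. by apply: (big_morph (f i j e)) => [x y|]; rewrite ?homD ?hfun0. Qed.

Lemma hfun_lcomb (M N : dgMod A) n (f : hom M N n) i j (e : i + n = j) m c (v : 'I_m -> M i) :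
  f i j e (lcomb c v) = lcomb c (fun k => f i j e (v k)).
Proof. by rewrite hfun_sum; apply: eq_bigr => k _; rewrite hfun_sc. Qed.

Lemma isB_sum (X : cpx) i n (f : 'I_n -> X i) : (forall j, isB (f j)) -> isB (\sum_j f j).
Proof. by move=> h; elim/big_ind: _ => //; [apply: isB0 | move=> *; apply: isBD]. Qed.

Lemma isZ_sum (X : cpx) i n (f : 'I_n -> X i) : (forall j, isZ (f j)) -> isZ (\sum_j f j).
Proof. by move=> h; elim/big_ind: _ => //; [apply: isZ0 | move=> *; apply: isZD]. Qed.

Lemma lcomb_Z (M : dgMod A) i n c (v : 'I_n -> M i) : (forall j, isZ (v j)) -> isZ (lcomb c v).
Proof. by move=> h; apply: isZ_sum => j; apply: sc_Z. Qed.

(** If [b = d y] and [x] is a cocycle then [b x = d (y x)]: only the class of a scalar in [H^0(A)]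
    matters. *)
Lemma scB_Z (M : dgMod A) i (b : A 0) (x : M i) : isB b -> isZ x -> isB (sc b x).
Proof.
move=> [j [e [y ->]]] hx.
have e1 : j + i = i - 1 by lia.
have e2 : i - 1 + 1 = i by lia.
have e3 : j + (i + 1) = i by lia.
exists (i - 1), e2, (act e1 y x).
rewrite (act_leibniz e1 e (erefl (i + 1)) e2 (add0r i) e3) hx act0r zsign00 addr0 //.
Qed.

Lemma lcomb_B (M : dgMod A) i n c c' (v : 'I_n -> M i) : (forall j, isZ (v j)) ->
  (forall j, isB (c j - c' j)) -> isB (lcomb c v - lcomb c' v).
Proof.
move=> hv hc; rewrite /lcomb -sumrB; apply: isB_sum => j.
by rewrite -scBl; apply: scB_Z.
Qed.

Lemma lcomb_D (M : dgMod A) i n c c' (v : 'I_n -> M i) :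
  lcomb (fun j => c j + c' j) v = lcomb c v + lcomb c' v.
Proof. by rewrite /lcomb -big_split; apply: eq_bigr => j _; rewrite scDl. Qed.

Lemma lcomb_M (M : dgMod A) i n a c (v : 'I_n -> M i) :
  lcomb (fun j => sc (M := A1) a (c j)) v = sc a (lcomb c v).
Proof. by rewrite /lcomb sc_sum; apply: eq_bigr => j _; rewrite -scM. Qed.

Lemma lcomb_sum (M : dgMod A) i n r (l : 'I_r -> A 0) (g : 'I_r -> 'I_n -> A1 0) (v : 'I_n -> M i) :
  lcomb (fun j => \sum_k sc (l k) (g k j)) v = \sum_k sc (l k) (lcomb (g k) v).
Proof.
elim: r l g => [|r IH] l g.
  by rewrite big_ord0 /lcomb big1 // => j _; rewrite big_ord0 sc0l.
rewrite big_ord_recl -IH -lcomb_M -lcomb_D; congr lcomb; apply: funext => j.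
by rewrite big_ord_recl.
Qed.

(** The coefficient vectors of those classes of [W] that come from [V] form a submodule of a free
    module, finitely generated by [noeth_span]. Preimages of its generators, together with the
    generators of [U], generate [V] after [S] is inverted. *)
Lemma fg_exact (U V W : dgMod A) p q i j k (u : hom U V p) (v : hom V W q)
    (e1 : i + p = j) (e2 : j + q = k) : cocyc u -> cocyc v ->
  (forall y, isZ y -> isB (v j k e2 y) -> exists x, isZ x /\ isB (y - u i j e1 x)) ->
  fgS U i -> fgS W k -> fgS V j.
Proof.
move=> du dv ex [m [x [hx gx]]] [n [w [hw gw]]].
pose N (c : 'I_n -> A1 0) := exists y, isZ y /\ isB (v j k e2 y - lcomb c w).
have [r [g [hg sp]]] : exists r (g : 'I_r -> 'I_n -> A1 0), (forall k, N (g k)) /\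
    forall c, N c -> exists l : 'I_r -> A 0, forall i, isB (c i - \sum_k sc (l k) (g k i)).
  apply: noeth_span.
  - exists 0; split; first exact: isZ0.
    have -> : lcomb (fun=> 0) w = 0 by rewrite /lcomb big1 // => a _; rewrite sc0l.
    by rewrite hfun0 subrr; apply: isB0.
  - move=> c c' [y [hy yc]] [y' [hy' yc']]; exists (y + y'); split; first exact: isZD.
    by rewrite homD lcomb_D opprD addrACA; apply: isBD.
  move=> a c [y [hy yc]]; exists (sc a y); split; first exact: sc_Z.
  by rewrite hfun_sc lcomb_M -scBr; apply: sc_B.
pose y a := projT1 (cid (hg a)).
have hy a : isZ (y a) /\ isB (v j k e2 (y a) - lcomb (g a) w) by exact: (projT2 (cid (hg a))).
exists (r + m)%N, (fun a => match split a with inl b => y b | inr b => u i j e1 (x b) end).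
split.
  by move=> a; case: (split a) => b; [case: (hy b) | apply: (cocyc_Z du)].
move=> z hz; have [s [c [Ss hc]]] := gw _ (cocyc_Z dv e2 hz).
have Nc : N c by exists (sc s z); split; [apply: sc_Z | rewrite hfun_sc].
have [l hl] := sp _ Nc.
pose z1 := sc s z - lcomb l y.
have hz1 : isZ z1.
  by apply: isZB; [apply: sc_Z | apply: lcomb_Z => a; case: (hy a)].
have vz1 : isB (v j k e2 z1).
  rewrite hfunB hfun_sc hfun_lcomb.
  apply: (isB_tr hc); apply: (isB_tr (lcomb_B hw hl)).
  rewrite lcomb_sum /lcomb -sumrB; apply: isB_sum => a.
  by rewrite -scBr; apply/sc_B/isB_sym; case: (hy a).
have [x1 [hx1 zx1]] := ex _ hz1 vz1.
have [t [d [St hd]]] := gx _ hx1.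
exists (dmul (add0r 0) t s), (fun a => match split a with inl b => sc (M := A1) t (l b) | inr b => d b end).
split; first exact: mS.2.
rewrite /lcomb big_split_ord /=.
under eq_bigr => a _ do rewrite (unsplitK (inl a)).
under [X in _ - (_ + X)]eq_bigr => a _ do rewrite (unsplitK (inr a)).
rewrite [\sum_(i0 < r) _](lcomb_M t l y) scM opprD addrA -scBr -/z1.
rewrite [\sum_(i0 < m) _](esym (hfun_lcomb u e1 d x)).
have := isBD (sc_B t zx1) (cocyc_B du e1 hd).
by rewrite scBr hfunB hfun_sc addrA subrK.
Qed.

Lemma fg_van (M : dgMod A) i : svan S M i -> fgS M i.
Proof.
move=> h; exists 0%N, (fun _ => 0); split; first by case.
move=> x hx; have [s [Ss sB]] := h x hx; exists s, (fun=> 0); split=> //.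
by rewrite /lcomb big_ord0 subr0.
Qed.

Section Triples.
Variables (U V W : dgMod A) (p q : int) (u : hom U V p) (v : hom V W q).
Hypothesis st : striple u v.

Lemma fg_mid i j k : i + p = j -> j + q = k -> fgS U i -> fgS W k -> fgS V j.
Proof.
move=> e1 e2 hU hW; apply: (@fg_exact _ _ _ _ _ _ _ _ u v e1 e2 (st_du st) (st_dv st) _ hU hW) => y hy.
have e3 : k - 1 + 1 = k by lia.
have e4 : j - 1 + q = k - 1 by lia.
have e5 : j - 1 + 1 = j by lia.
move=> /(isBP e3) [w hw]; have [y' hy'] := st_surj st e4 w.
have : v j k e2 (y - zsign q (cd e5 y')) = 0.
  rewrite hfunB hw hfun_zsign -hy'.
  by rewrite (cocyc_cd (st_dv st) e4 e3 e5 e2) subrr.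
move=> /(st_exact st e1) [x hx]; exists x; split.
  apply: (st_Zu st (e := e1)); rewrite hx; apply: isZB => //.
  by apply/isZ_zsign/isBZ/isB_cd.
by rewrite hx subKr; apply/isB_zsign/isB_cd.
Qed.

End Triples.
End FG.
End Finiteness.

(** * Tilting DG modules *)

Section Tilting.
Variable A : cdgRing.
Local Notation A1 := (regMod A).

Lemma hinv_cocyc (M N : dgMod A) n n' (f : hom M N n) (g : hom N M n') : hinv f g -> cocyc f.
Proof. by case=> ? [? []]. Qed.

Section Evaluation.
Variables (X Y : dgMod A) (ev : hom (tensor Y X) A1 0).
Hypotheses (dev : cocyc ev) (hev : qi ev) (hX : good X) (hY : good Y).

Implicit Types N : dgMod A.

(** The contraction of [Y] against [X] with coefficients in [N]. It is built from structure maps, so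
    it is natural in homs [N -> N'] of every degree. *)
Definition tev N : hom (tensor (tensor N Y) X) N 0 :=
  hcomp (addr0 0) (uni N) (hcomp (addr0 0) (thom N ev)
    (hcomp (addr0 0) (comm N (tensor Y X)) (assoc N Y X))).

Lemma dtev N : cocyc (tev N).
Proof.
apply: cocyc_hcomp; first exact: (hinv_cocyc (hinv_sym (hinv_uni N))).
apply: cocyc_hcomp; first exact: (fh_cocyc (TensL N)).
by apply: cocyc_hcomp; [apply: cocyc_comm | apply: cocyc_assoc].
Qed.

Lemma tevE N i (e : i + 0 = i) c b a cb ba (e1 : c + b = cb) (e2 : cb + a = i)
    (e3 : b + a = ba) (e4 : ba + 0 = ba) (e5 : ba + c = i) (n : N c) (y : Y b) (x : X a) :
  tev N i i e (pure (M := tensor N Y) e2 (pure e1 n y) x) =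
  zsign (c * ba) (act e5 (ev ba ba e4 (pure e3 y x)) n).
Proof.
have e6 : c + ba = i by lia.
rewrite /tev !(hcompE _ _ _ e e e) (assocE e e1 e2 e3 e6) (commE e e6 e5).
by rewrite hfun_zsign (thomE ev e e5 e4 e5) hfun_zsign (uniE (N := N) e e5 e5).
Qed.

Lemma tev_nat N N' p (f : hom N N' p) :
  hcomp (addr0 p) (tev N') (thom X (thom Y f)) = hcomp (add0r p) f (tev N).
Proof.
apply: hom3_extn => i j e c b a cb e1 e2 n y x.
have f1 : i + 0 = i by lia. have f2 : j + 0 = j by lia.
have f3 : cb + p = cb + p by []. have f4 : cb + p + a = j by lia.
have f5 : c + p + b = cb + p by lia.
have f6 : b + a + c = i by lia. have f7 : b + a + (c + p) = j by lia.
rewrite (hcompE _ _ _ _ e f2) (hcompE _ _ _ _ f1 e).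
rewrite (thomE (thom Y f) e e2 f3 f4) (thomE f f3 e1 erefl f5).
rewrite (tevE f2 _ _ erefl (addr0 _) f7) (tevE f1 _ _ erefl (addr0 _) f6).
rewrite hfun_zsign (hom_act f f6 erefl e f7) -zsignD.
by zpar.
Qed.

Lemma qi_tev N : qi (tev N).
Proof.
have qU : qi (uni N) by apply: (qi_hinv (hinv_sym (hinv_uni N))).
have dU : cocyc (uni N) by apply: (hinv_cocyc (hinv_sym (hinv_uni N))).
have dT : cocyc (thom N ev) by apply: (fh_cocyc (TensL N)).
have dC : cocyc (comm N (tensor Y X)) by apply: cocyc_comm.
have dS := cocyc_assoc N Y X.
apply: qi_comp => //; first by do 2?apply: cocyc_hcomp => //.
apply: qi_comp => //; first by apply: cocyc_hcomp.
  apply: qi_comp => //; first exact: (qi_hinv (hinv_assoc N Y X)).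
  exact: (qi_hinv (hinv_comm _ _)).
apply: (Kp_fun_qi (TensL N) dev _ _ hev); last exact: (good_reg A).1.
exact: Kp_tensor hY.1 hX.1.
Qed.

(** Take for [u] a preimage of 1 under the evaluation. The composite [A -> X (x) Y -> A] is then
    homotopic to the identity, and cancellation makes its first map a quasi-isomorphism. *)
Lemma exists_unit : exists u : tensor X Y 0, isZ u /\ qi (hfree u).
Proof.
have [_ hS] := hev 0.
have [v [hv hv1]] := hS 0 (addr0 0) (dunit A : A1 0) (@A0_Z A (dunit A)).
exists (comm Y X 0 0 (addr0 0) v); split; first exact: (cocyc_Z (cocyc_comm Y X) (addr0 0) hv).
have dv := cocyc_hfree (cocyc_Z (cocyc_comm Y X) (addr0 0) hv).
have dev' := cocyc_hcomp (addr0 0) dev (cocyc_comm X Y).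
apply: (qi_cancell (e := addr0 0) (g := hcomp (addr0 0) ev (comm X Y))) => //.
  apply: qi_comp => //; first exact: cocyc_comm.
  exact: (qi_hinv (hinv_comm _ _)).
have <- : hfree (ev 0 0 (addr0 0) v) =
   hcomp (addr0 0) (hcomp (addr0 0) ev (comm X Y)) (hfree (comm Y X 0 0 (addr0 0) v)).
  apply: (homA_ext (e := add0r 0)); rewrite hfree1.
  rewrite (hcompE _ _ _ _ (add0r 0) (addr0 0)) hfree1 (hcompE _ _ _ _ (addr0 0) (addr0 0)).
  by rewrite (hinvE _ _ _ (hinv_comm Y X)).
apply: (@qi_homo _ _ _ _ (hid A1)); last exact: qi_hid.
have -> : hid A1 = hfree (dunit A : A1 0).
  by apply: (homA_ext (e := add0r 0)); rewrite hfree1 (hidE (M := A1)).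
case: hv1 => j [e [y hy]]; exists j, e, (hfree y).
have E : homd e (hfree y) = hfree (cd e y) by apply: homd_hfree.
rewrite [RHS](E : _ = _) -hy.
by apply: (homA_ext (e := add0r 0)); rewrite homDE homNE !hfree1.
Qed.

Variable u : tensor X Y 0.
Hypotheses (hu : isZ u) (qu : qi (hfree u)).

Local Opaque tev.

(** The composite that a triangle identity would equate with the identity of [X]. As [u] is chosen
    from [ev] alone, [sigma] is merely some quasi-isomorphism, and this is enough. *)
Definition sigma : hom X X 0 :=
  hcomp (addr0 0) (tev X) (hcomp (addr0 0) (thom X (hfree u)) (uniV X)).

Lemma sigmaE i (e : i + 0 = i) (e' : 0 + i = i) x :
  sigma i i e x = tev X i i e (pure (M := tensor X Y) e' u x).
Proof.
rewrite (hcompE _ (tev X) _ _ e e) (hcompE _ _ (uniV X) _ e e) (uniVE e e').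
by rewrite (thomE (hfree u) e e' (addr0 0) e') hfree1.
Qed.

Lemma dsigma : cocyc sigma.
Proof.
apply: cocyc_hcomp; first exact: dtev.
apply: cocyc_hcomp; first by apply/(fh_cocyc (TensL X))/cocyc_hfree.
exact: (hinv_cocyc (hinv_uni X)).
Qed.

Lemma qi_free_tens N : qi (hcomp (addr0 0) (thom N (hfree u)) (uniV N)).
Proof.
have du := hinv_cocyc (hinv_uni N).
have dt : cocyc (thom N (hfree u)) by apply/(fh_cocyc (TensL N))/cocyc_hfree.
apply: qi_comp => //; first exact: (qi_hinv (hinv_uni N)).
apply: (Kp_fun_qi (TensL N)) => //; first exact: cocyc_hfree.
- exact: (good_reg A).1.
- exact: Kp_tensor hX.1 hY.1.
Qed.

Lemma qi_sigma : qi sigma.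
Proof.
apply: qi_comp; last exact: qi_tev.
- apply: cocyc_hcomp; first by apply/(fh_cocyc (TensL X))/cocyc_hfree.
  exact: (hinv_cocyc (hinv_uni X)).
- exact: dtev.
- exact: qi_free_tens.
Qed.

Definition hduo N : hom (tensor N Y) (Homdg X N) 0 := hcurry (tev N).

Lemma dhduo N : cocyc (hduo N).
Proof.
rewrite /hduo -(curryE (addr0 0)).
by have := cocyc_Z (cocyc_curry (tensor N Y) X N) (addr0 0) (@dtev N); apply.
Qed.

Lemma hduoE N k (e : k + 0 = k) (z : tensor N Y k) a i (e1 : k + a = i) (e2 : a + k = i)
    (e3 : i + 0 = i) x :
  (hduo N k k e z : hom X N k) a i e2 x = tev N i i e3 (pure (M := tensor N Y) e1 z x).
Proof. exact: hcurryE. Qed.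

Lemma hduo_thom N k (e : k + 0 = k) (phi : hom X N k) :
  hduo N k k e (thom Y phi 0 k (add0r k) u) = hcomp (add0r k) phi sigma.
Proof.
apply: hom_ext => a i ei x.
have e1 : k + a = i by lia. have e3 : i + 0 = i by lia. have e4 : a + 0 = a by lia.
rewrite (hduoE e _ e1 ei e3) (hcompE _ _ _ _ e4 ei) (sigmaE e4 (add0r a)).
have := congr1 (fun f : hom (tensor (tensor X Y) X) N k => f a i ei (pure (M := tensor X Y) (add0r a) u x)) (tev_nat phi).
move=> E; cbv beta in E; move: E; rewrite (hcompE _ _ _ _ ei e3) (hcompE _ _ _ _ e4 ei) => <-.
by rewrite (thomE (thom Y phi) ei (add0r a) (add0r k) e1).
Qed.

Lemma thom_hduo N k (e : k + 0 = k) (z : tensor N Y k) :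
  thom Y (hduo N k k e z : hom X N k) 0 k (add0r k) u =
  hcomp (addr0 0) (thom Y (tev N)) (hcomp (addr0 0) (assocV (tensor N Y) X Y)
    (hcomp (addr0 0) (comm (tensor X Y) (tensor N Y))
      (hcomp (addr0 0) (thom (tensor N Y) (hfree u)) (uniV (tensor N Y))))) k k e z.
Proof.
rewrite (hcompE _ (thom Y (tev N)) _ _ e e) (hcompE _ (assocV _ _ _) _ _ e e).
rewrite (hcompE _ (comm _ _) _ _ e e) (hcompE _ _ (uniV _) _ e e) (uniVE e (add0r k)).
rewrite (thomE (hfree u) e (add0r k) (addr0 0) (add0r k)) hfree1.
have h : k + 0 = k by lia.
rewrite (commE e (add0r k) h) mul0r zsign0.
move: u; apply: tens_ext.
- by move=> x y; rewrite homD.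
- move=> x y; rewrite -!homD.
  exact: (congr1 (fun t => thom Y (tev N) k k e (assocV (tensor N Y) X Y k k e t))
    (pureDr (N := tensor X Y) h z x y)).
move=> a b e0 x y.
have e1 : k + a = a + k by lia. have e2 : a + k + b = k by lia.
rewrite (thomE _ (add0r k) e0 erefl e2).
rewrite (assocVE e e1 e2 e0 h) (thomE (tev N) e e2 (addr0 _) e2).
by rewrite (hduoE e z e1 erefl (addr0 _)).
Qed.

(** The assignment [phi |-> (phi (x) Y)(u)] inverts [hduo] up to quasi-isomorphisms: in one order
    the composite is precomposition with [sigma], which gives surjectivity; in the other it is the
    composite of [thom_hduo], which gives injectivity. *)
Lemma qi_hduo N : qi (hduo N).
Proof.
move=> k; split=> [j e z hz [l [el [h hh]]]|j e phi hphi]; have ej : k = j by rewrite -e addr0.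
  case: j / ej e h el hh => e h el hh.
  set Q := hcomp (addr0 0) (thom Y (tev N)) (hcomp (addr0 0) (assocV (tensor N Y) X Y)
    (hcomp (addr0 0) (comm (tensor X Y) (tensor N Y))
      (hcomp (addr0 0) (thom (tensor N Y) (hfree u)) (uniV (tensor N Y))))).
  have [qQ dQ] : qi Q /\ cocyc Q.
    have dV := hinv_cocyc (hinv_sym (hinv_assoc (tensor N Y) X Y)).
    have qV := qi_hinv (hinv_sym (hinv_assoc (tensor N Y) X Y)).
    have dC := cocyc_comm (tensor X Y) (tensor N Y).
    have qC := qi_hinv (hinv_comm (tensor X Y) (tensor N Y)).
    have dT := cocyc_thom Y (@dtev N).
    have qT : qi (thom Y (tev N)) by apply: (Kf_pres hY.2) => //; [apply: dtev | apply: qi_tev].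
    have dU : cocyc (hcomp (addr0 0) (thom (tensor N Y) (hfree u)) (uniV (tensor N Y))).
      apply: cocyc_hcomp; first by apply/cocyc_thom/cocyc_hfree.
      exact: (hinv_cocyc (hinv_uni _)).
    have d1 := cocyc_hcomp (addr0 0) dC dU.
    have d2 := cocyc_hcomp (addr0 0) dV d1.
    split; last exact: cocyc_hcomp.
    by do 3!apply: qi_comp => //; apply: qi_free_tens.
  have [hI _] := qQ k; apply: (hI k e z hz).
  rewrite -(thom_hduo e z) hh; exists l, el, (thom Y (h : hom X N l) 0 l (add0r l) u).
  have -> : thom Y (cd el h : hom X N k) = homd el (thom Y (h : hom X N l)).
    by rewrite [RHS](fh_d (TensL Y)).
  have f1 : 0 + 1 = 1 :> int by []. have f2 : 1 + l = k by rewrite addrC.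
  by rewrite (homdE el (thom Y (h : hom X N l)) (add0r k) f1 (add0r l) el f2) hu hfun0 zsign00 subr0.
case: j / ej e phi hphi => e phi hphi.
have [_ hS] := Kp_cof_qi (HomL N) dsigma hX.1 hX.1 qi_sigma k.
have [psi [hpsi hb]] := hS k e phi hphi.
exists (thom Y (psi : hom X N k) 0 k (add0r k) u); split.
  by apply: cocyc_Z hu; apply: cocyc_thom.
rewrite hduo_thom; move: hb.
by rewrite (hpreE (N := N) sigma e (add0r k)) mul0r zsign0.
Qed.

(** By naturality of [tev], a map described by a tensor supported in a submodule takes its values
    there. This is the bridge from finite sums in [N (x) Y] to compactness of [X]. *)
Lemma hduo_sub N (R : sdg N) k (e : k + 0 = k) (z : tensor (subM R) Y k) a i (e2 : a + k = i) x :
  R i ((hduo N k k e (thom Y (sinc R) k k e z) : hom X N k) a i e2 x).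
Proof.
have e1 : k + a = i by lia. have e3 : i + 0 = i by lia.
rewrite (hduoE e _ e1 e2 e3).
have := congr1 (fun f : hom (tensor (tensor (subM R) Y) X) N 0 => f i i e3 (pure (M := tensor (subM R) Y) e1 z x)) (tev_nat (sinc R)).
move=> E; cbv beta in E; move: E; rewrite (hcompE _ (tev _) (thom X _) _ e3 e3) (hcompE _ (sinc R) (tev _) _ e3 e3).
rewrite (thomE (thom Y (sinc R)) e3 e1 e e1) => ->.
by rewrite sincE; apply: sdTP.
Qed.

Lemma sigma_sub (R : sdg X) i (e : i + 0 = i) x u' :
  u = thom Y (sinc R) 0 0 (addr0 0) u' -> R i (sigma i i e x).
Proof.
move=> hu'; rewrite (sigmaE e (add0r i)) hu'.
have := congr1 (fun f : hom (tensor (tensor (subM R) Y) X) X 0 => f i i e (pure (M := tensor (subM R) Y) (add0r i) u' x)) (tev_nat (sinc R)).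
move=> E; cbv beta in E; move: E; rewrite (hcompE _ (tev _) (thom X _) _ e e) (hcompE _ (sinc R) (tev _) _ e e).
rewrite (thomE (thom Y (sinc R)) e (add0r i) (addr0 0) (add0r i)) => ->.
by rewrite sincE; apply: sdTP.
Qed.
End Evaluation.
End Tilting.

(** * Attaching cells below a top degree *)

Section CellInduction.
Variable A : cdgRing.
Local Notation A1 := (regMod A).

Section Attach.
Variables (X : dgMod A) (b : int) (y : X b) (hy : isZ y).

Definition att : hom (sh (- b) A1) X 0 := hcomp (addNr b) (hfree y) (shout (- b) A1).

Lemma datt : cocyc att.
Proof.
apply: cocyc_hcomp; first exact: cocyc_hfree.
exact: hinv_cocyc (hinv_sym (hinv_sh (- b) A1)).
Qed.

Definition cell : dgMod A := cone datt.

Lemma att_gen (e : - - b + 0 = b) : att _ _ e (gen A (- b)) = y.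
Proof.
by rewrite (hcompE _ _ _ _ (addNr (- b)) (add0r b)) shout_gen hfree1.
Qed.

Lemma sh_top n i : (- n < i)%R -> forall x : sh n A1 i, x = 0.
Proof. by move=> h x; apply: (@dnonpos A (i + n)); lia. Qed.

Lemma cell_kill : isB (ciY datt b b (addr0 b) y).
Proof.
have e1 : - - b + -1 = b - 1 by lia. have e2 : b - 1 + 1 = b by lia.
have e3 : - - b + 0 = b by lia. have e4 : - - b + 1 = b + 1 by lia.
have e5 : b + 1 + -1 = b by lia.
exists (b - 1), e2, (ciX datt _ _ e1 (gen A (- b))).
rewrite (hom_cd (addNr 1) (ciX datt) e1 e2 e4 e5 e3) genZ hfun0 zsign00 addr0.
rewrite (homd_ciX datt (addNr 1) (addr0 0)) (hcompE _ _ _ _ e3 (addr0 b)).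
by rewrite att_gen.
Qed.
End Attach.

Section Induct.
Variable S : A 0 -> Prop.
Hypothesis mS : mset S.

Definition sbelow (X : dgMod A) (b : int) := forall i, (b < i)%R -> svan S X i.

Definition gens (X : dgMod A) i n : Prop := exists v : 'I_n -> X i,
  (forall j, isZ (v j)) /\
  forall x, isZ x -> exists s c, S s /\ isB (sc s x - lcomb c v).

Lemma sbelow_cell (X : dgMod A) b (y : X b) (hy : isZ y) : sbelow X b -> sbelow (cell hy) b.
Proof.
move=> h i bi.
apply: (svan_mid (st_cone (datt hy)) mS (addr0 i) (erefl (i + 1)) (h i bi)) => z _.
have -> : z = 0 by apply: sh_top; lia.
by apply: isB_sbnd => //; apply: isB0.
Qed.

Lemma gens_cell (X : dgMod A) b n : sbelow X b -> gens X b n.+1 ->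
  exists (y : X b) (hy : isZ y), gens (cell hy) b n.
Proof.
move=> hb [v [hv gv]]; exists (v ord0), (hv ord0).
set C := cell _; pose c := ciY (datt (hv ord0)) b b (addr0 b).
have dc := st_du (st_cone (datt (hv ord0))).
exists (fun j => c (v (lift ord0 j))); split=> [j|x hx]; first exact: (cocyc_Z dc).
have [x' ex] : exists x', c x' = x.
  apply: (st_exact (st_cone (datt (hv ord0))) (e := erefl (b + 1)) (addr0 b)).
  by apply: sh_top; lia.
have hx' : isZ x' by apply: (st_Zu (st_cone (datt (hv ord0))) (e := addr0 b)); rewrite -/c ex.
have [s [d [Ss hd]]] := gv _ hx'; exists s, (fun j => d (lift ord0 j)); split=> //.
have h1 := cocyc_B dc (addr0 b) hd; rewrite hfunB hfun_sc hfun_lcomb in h1.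
rewrite -/c ex in h1; apply: (isB_tr h1).
rewrite /lcomb big_ord_recl addrK.
exact: sc_B (cell_kill (hv ord0)).
Qed.

Lemma gens0 (X : dgMod A) b : gens X b 0 -> svan S X b.
Proof.
move=> [v [_ gv]] x hx; have [s [c [Ss h]]] := gv x hx.
by exists s; split=> //; move: h; rewrite /lcomb big_ord0 subr0.
Qed.

Variables (G : dgMod A -> Prop) (V : dgMod A -> int -> Prop) (c : int).
Hypothesis hG : forall (X : dgMod A) b (y : X b) (hy : isZ y), G X -> G (cell hy).
Hypothesis hfg : forall (X : dgMod A) (b : int), G X -> sbelow X b -> fgS S X b.
Hypothesis hV : forall (X : dgMod A) b (y : X b) (hy : isZ y) i,
  G X -> V (cell hy) i -> V X i.
Hypothesis hc : forall (X : dgMod A) (b i : int), G X -> sbelow X b -> (b + c < i)%R -> V X i.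

(* Attaching cells along generators of the top cohomology lowers the bound, until the range [b + c < i] is reached. *)
Lemma cell_ind (X : dgMod A) (b i : int) : G X -> sbelow X b -> V X i.
Proof.
have [k hk] : exists k : nat, (b + c - i < Posz k)%R by exists (absz (b + c - i)%R).+1; lia.
elim: k b X hk => [|k IH] b X hk gX hb; first by apply: (hc gX hb); lia.
have [n gn] := hfg gX hb.
elim: n X gX hb gn => [|n IHn] X gX hb gn.
  apply: (IH (b - 1)) => //; first by lia.
  move=> j bj; have [->|jb] := eqVneq j b; first exact: gens0.
  by apply: hb; lia.
have [y [hy gy]] := gens_cell hb gn.
apply: (hV (hy := hy) gX); apply: IHn => //; [exact: hG | exact: sbelow_cell].
Qed.
End Induct.
End CellInduction.

Section FgTransfer.
Variables (A : cdgRing) (S : A 0 -> Prop).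
Hypothesis mS : mset S.

Lemma fg_qi (M M' : dgMod A) n (f : hom M M' n) i j : cocyc f -> i + n = j ->
  qI f i -> qS f i -> fgS S M i <-> fgS S M' j.
Proof.
move=> df e hI hS; split=> [] [m [v [hv gv]]].
  exists m, (fun k => f i j e (v k)); split=> [k|y hy]; first exact: (cocyc_Z df).
  have [x [hx yx]] := hS j e y hy; have [s [c [Ss hc]]] := gv _ hx.
  exists s, c; split=> //; apply: (isB_tr (y := f i j e (sc s x))).
    by rewrite hfun_sc -scBr; apply: sc_B.
  by have := cocyc_B df e hc; rewrite hfunB hfun_lcomb.
have hw k := hS j e (v k) (hv k).
pose w k := projT1 (cid (hw k)).
have [wZ wE] : (forall k, isZ (w k)) /\ (forall k, isB (v k - f i j e (w k))).
  by split=> k; case: (projT2 (cid (hw k))).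
exists m, w; split=> // x hx; have [s [c [Ss hc]]] := gv _ (cocyc_Z df e hx).
exists s, c; split=> //; apply: (hI j e).
  by apply: isZB; [apply: sc_Z | apply: lcomb_Z].
rewrite hfunB hfun_sc hfun_lcomb; apply: (isB_tr hc).
rewrite /lcomb -sumrB; apply: isB_sum => k; rewrite -scBr; exact: sc_B.
Qed.

Lemma fg_sh n i : (forall i, fgS S (regMod A) i) -> fgS S (sh n (regMod A)) i.
Proof.
move=> hA; have h := hinv_sh n (regMod A); have [hI hS] := qi_hinv h (i + n).
by apply: (iffLR (fg_qi (hinv_cocyc h) _ hI hS)) => //; lia.
Qed.
End FgTransfer.

(** * Boundedness, compactness and finiteness of tilting modules *)

Section TiltingPairs.
Variable A : cdgRing.
Hypothesis hN : noetherian (barRing A).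
Hypothesis hA : forall i, fgS (@S1 A) (regMod A) i.
Local Notation A1 := (regMod A).
Implicit Types X Y N : dgMod A.

(* Mutually inverse tilting modules. *)
Definition tpair X Y : Prop :=
  [/\ good X, good Y & exists ev : hom (tensor Y X) A1 0, cocyc ev /\ qi ev].

Lemma tpair_sym X Y : tpair X Y -> tpair Y X.
Proof.
move=> [hX hY [ev [dev qev]]]; split=> //.
exists (hcomp (addr0 0) ev (comm X Y)); split.
  by apply: cocyc_hcomp => //; apply: cocyc_comm.
by apply: qi_comp => //; [apply: cocyc_comm | apply: (qi_hinv (hinv_comm X Y))].
Qed.

Lemma tpairP X Y : good X -> good Y -> sim (tensor X Y) A1 -> tpair X Y.
Proof.
move=> hX hY h; split=> //; apply: sim_Kp_qi; first exact: Kp_tensor hY.1 hX.1.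
exact: sim_trans (sim_comm Y X) h.
Qed.

Lemma tpair_sim X Y : tpair X Y -> sim (tensor X Y) A1.
Proof.
move=> [hX hY [ev [dev qev]]].
exact: sim_trans (sim_comm X Y) (sim_qi dev qev).
Qed.

Lemma tiltingP P : tilting P <-> exists Y, tpair (res P) Y.
Proof.
have gP := good_res P; split=> [[Q /is_LtensorP h]|[Y hY]].
  have gQ := good_res Q; exists (res Q); apply: tpairP => //.
  by apply: sim_trans h; apply: (sim_tensr gP.2); apply: sim_res.
by exists Y; apply/is_LtensorP; apply: tpair_sim.
Qed.

Lemma tpair_Hom X Y N : tpair X Y -> sim (tensor N Y) (Homdg X N).
Proof.
move=> [hX hY [ev [dev qev]]]; have [u [hu qu]] := exists_unit dev qev.
exact: sim_qi (dhduo dev N) (qi_hduo dev qev hX hY hu qu N).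
Qed.

Lemma dir_tr X : directed (fun S : sdg X => exists n, S = trS X n).
Proof.
split=> [_ _ [n ->] [m ->]|i x].
  have up n' k : (n' <= k)%R -> sle (trS X n') (trS X k).
    move=> nk i x [h1 h2]; split=> [ik|ki]; last by apply: h2; lia.
    have [ni|ni] := Order.TotalTheory.ltP n' i; first by rewrite h2 //; apply: isZ0.
    by apply: h1; lia.
  exists (trS X (Num.max n m)); split; [by exists (Num.max n m) | | ]; apply: up; lia.
exists (trS X (i + 1)); split; first by exists (i + 1).
by split; lia.
Qed.

(** The unit [u] is supported in a truncation of [X], so the quasi-isomorphism [sigma] has its image
    in that truncation and is zero above its bound. *)
Lemma tpair_below X Y : tpair X Y -> exists n, below X n.
Proof.
move=> [hX hY [ev [dev qev]]]; have [u [hu qu]] := exists_unit dev qev.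
have [R [u' [[n eR] hu' uu']]] := dir_tens (dir_tr X) hu; subst R.
exists n => i ni x hx; have [hI _] := qi_sigma dev qev hX hY hu qu i.
apply: (hI i (addr0 i) x hx).
have [_ ->] := sigma_sub ev (addr0 i) x (esym uu'); [exact: isB0 | done].
Qed.

(** Compactness of [X] at chain level: a closed map into a directed union can be deformed into one
    of its members. *)
Definition pc X : Prop := forall N (FF : sdg N -> Prop) i (phi : hom X N i),
  directed FF -> cocyc phi -> exists R (psi : hom X N i),
  [/\ FF R, cocyc psi, isB (X := Homdg X N) (phi - psi) & forall a j e x, R j (psi a j e x)].

Lemma tpair_pc X Y : tpair X Y -> pc X.
Proof.
move=> [hX hY [ev [dev qev]]] N FF i phi dF dphi.
have [u [hu qu]] := exists_unit dev qev.
have [_ hS] := qi_hduo dev qev hX hY hu qu N i.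
have [z [hz hb]] := hS i (addr0 i) phi dphi.
have [R [z' [FR hz' zz']]] := dir_tens dF hz.
exists R, (hduo ev N i i (addr0 i) z); split=> //.
  exact: (cocyc_Z (dhduo dev N) (addr0 i) hz).
by move=> a j e x; rewrite -zz'; apply: hduo_sub.
Qed.

(** Compactness survives the attachment of one cell: a map on the cone is controlled by its
    restriction to [X] and by the image of one further generator. *)
Lemma pc_cell X b (y : X b) (hy : isZ y) : pc X -> pc (cell hy).
Proof.
move=> hX N FF i phi dF dphi; rewrite /cell in phi dphi *.
set d := datt hy in phi dphi *; set C := cone d in phi dphi *.
have st := st_cone d.
have [R1 [psi [FR1 dpsi [l [el [h hh]]] hR1]]] :=
  hX N FF i (hcomp (add0r i) phi (ciY d)) dF (cocyc_hcomp _ dphi (st_du st)).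
have e0 : 0 + l = l by lia.
(* The homotopy [h] is extended by zero on the cell, so that [phi'] restricts to [psi] exactly, not
   only up to homotopy. *)
pose phi' : hom C N i := phi - homd el (hcomp e0 h (cpY d)).
have dphi' : cocyc phi'.
  apply: cocycB => // k e; exact: (homdd el e).
have E1 a j (e : a + i = j) (e' : a + 0 = a) x : phi' a j e (ciY d a a e' x) = psi a j e x.
  have f1 : a + l = a + l by []. have f2 : a + l + 1 = j by lia.
  have f3 : a + 1 + l = j by lia. have f4 : a + 1 = a + 1 by [].
  have f5 : a + 1 + 0 = a + 1 by lia.
  have cc (k : int) (w : X k) (g : k + 0 = k) : cpY d k k g (ciY d k k g w) = w by rewrite /= !cst_id.
  rewrite /phi' homDE homNE (homdE el _ e f4 f1 f2 f3).
  rewrite !(hcompE _ _ _ _ e' f1) (hcompE _ _ _ _ f5 f3).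
  rewrite (cocyc_cd (st_du st) e' f4 f4 f5) zsign0 !cc -(homdE el h e f4 f1 f2 f3).
  have -> : homd el h = hcomp (add0r i) phi (ciY d) - psi by rewrite -[homd el h]hh.
  by rewrite homDE homNE (hcompE _ _ _ _ e' e) subKr.
have g0 : - - b + -1 = b - 1 by lia.
have g1 : -1 + i = i - 1 by lia.
(* On the cell, [phi'] is determined by the image of the free generator, a single element of [N],
   which some member [R2] contains. *)
pose f := hcomp g1 phi' (ciX d).
have g2 : - - b + (i - 1) = b + (i - 1) by lia.
pose f' := hcomp g2 f (shin (- b) A1).
have g3 : 0 + (b + (i - 1)) = b + (i - 1) by lia.
have [R2 [FR2 hR2]] := dir_ex dF (f' _ _ g3 (dunit A)).
have [R [FR s1 s2]] := dir_up dF FR1 FR2.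
have E2 a j (e : a + (i - 1) = j) w : R j (f a j e w).
  have k1 : a + - b = a + - b by []. have k2 : a + - b + - - b = a by lia.
  have k3 : a + - b + (b + (i - 1)) = j by lia.
  have -> : f a j e w = f' _ _ k3 (shout (- b) A1 _ _ k1 w).
    rewrite (hcompE _ _ _ _ k2 e).
    by rewrite (hinvE k1 k2 w (hinv_sym (hinv_sh (- b) A1))).
  rewrite (homA_eval f' k3 g3); have : R _ (act k3 (shout (- b) A1 _ _ k1 w) (f' _ _ g3 (dunit A))).
    exact/sda/s2.
  by rewrite /zsign; case: ifP => // _; apply: sdN.
exists R, phi'; split=> //.
  exists l, el, (hcomp e0 h (cpY d)).
  by rewrite /phi' opprB addrC subrK.
move=> a j e z.
have e' : a + 0 = a by lia. have e1 : a + 1 + -1 = a by lia.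
have -> : z = ciX d (a + 1) a e1 z.1 + ciY d a a e' z.2.
  rewrite /= !cst_id; case: z => z1 z2.
  have -> : ((z1, 0) + (0, z2) : C a) = (z1 + 0, 0 + z2) by [].
  by rewrite addr0 add0r.
rewrite homD E1; apply: sdD; last exact/s1.
have e2 : a + 1 + (i - 1) = j by lia.
by have := E2 _ _ e2 z.1; rewrite (hcompE _ _ _ _ e1 e).
Qed.

Section FiniteTop.
Variables (X : dgMod A) (b : int).
Local Notation N := (tr X b).

Lemma tr_top_Z (x : N b) : isZ x.
Proof. by apply/sub_isZ; case: (sdTP (x : sdT (trS X b) b)) => h _; apply: h. Qed.

(** All of the truncation below degree [b], and in degree [b] the combinations of [v] modulo
    boundaries. Scalars of negative degree cannot reach degree [b], because the truncation vanishes
    above it. *)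
Program Definition spanS n (v : 'I_n -> N b) : sdg N :=
  @Sdg A N (fun i x => forall e : i = b, exists c, isB (@cst N i b e x - lcomb c v)) _ _ _ _.
Next Obligation.
move=> n v i e; case: b / e v => v; exists (fun=> 0); rewrite cst_id.
by rewrite /lcomb big1 ?subrr => [|j _]; [apply: isB0 | rewrite sc0l].
Qed.
Next Obligation.
move=> n v i x y hx hy e; have [c hc] := hx e; have [d hd] := hy e.
exists (fun j => c j + d j); rewrite cstD lcomb_D opprD addrACA; exact: isBD.
Qed.
Next Obligation.
move=> n v p i j e a x hx ej.
have [pp|pn] := Order.TotalTheory.ltP 0 p.
  exists (fun=> 0); rewrite (dnonpos pp a) act0l /lcomb big1 => [|k _]; last by rewrite sc0l.
  by rewrite subr0 (morphD0 (@cstD N _ _ ej)); apply: isB0.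
have [p0|p0] := eqVneq p 0; last first.
  exists (fun=> 0); rewrite (tr0 x); last by lia.
  rewrite act0r /lcomb big1 => [|k _]; last by rewrite sc0l.
  by rewrite subr0 (morphD0 (@cstD N _ _ ej)); apply: isB0.
subst p; have ei : i = b by lia.
have [c hc] := hx ei; exists (fun k => sc (M := A1) a (c k)).
have -> : @cst N j b ej (act e a x) = sc a (@cst N i b ei x) by apply: cst_act.
by rewrite lcomb_M -scBr; apply: sc_B.
Qed.
Next Obligation.
move=> n v i j e x hx ej; exists (fun=> 0).
rewrite /lcomb big1 => [|k _]; last by rewrite sc0l.
by rewrite subr0 (cst_cd e erefl ej (etrans e ej)); apply: isB_cd.
Qed.

Lemma lcomb_cat (M : dgMod A) i n m (v : 'I_n -> M i) (w : 'I_m -> M i) c d :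
  lcomb (fun a => match split a with inl k => c k | inr k => d k end)
    (fun a => match split a with inl k => v k | inr k => w k end) = lcomb c v + lcomb d w.
Proof.
rewrite /lcomb big_split_ord /=.
under eq_bigr => a _ do rewrite (unsplitK (inl a)).
by under [X in _ + X = _]eq_bigr => a _ do rewrite (unsplitK (inr a)).
Qed.

Lemma lcomb0 (M : dgMod A) i n (v : 'I_n -> M i) : lcomb (fun=> 0) v = 0.
Proof. by rewrite /lcomb big1 // => a _; rewrite sc0l. Qed.

Lemma dir_span : directed (fun S : sdg N => exists n (v : 'I_n -> N b), S = spanS v).
Proof.
split=> [_ _ [n [v ->]] [m [w ->]]|i x].
  exists (spanS (fun a => match split a with inl k => v k | inr k => w k end)); split.
  - by exists (n + m)%N, (fun a => match split a with inl k => v k | inr k => w k end).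
  - move=> i x h e; have [c hc] := h e.
    by exists (fun a => match split a with inl k => c k | inr k => 0 end); rewrite lcomb_cat lcomb0 addr0.
  - move=> i x h e; have [c hc] := h e.
    by exists (fun a => match split a with inl k => 0 | inr k => c k end); rewrite lcomb_cat lcomb0 add0r.
have [ib|ib] := eqVneq i b; last first.
  exists (@spanS 0 (fun=> 0)); split; first by exists 0%N, (fun=> 0).
  by move=> e; rewrite e eqxx in ib.
exists (@spanS 1 (fun=> @cst N i b ib x)); split; first by exists 1%N, (fun=> @cst N i b ib x).
move=> e; exists (fun=> dunit A); rewrite /lcomb big_ord1 sc1 (Prop_irrelevance e ib) subrr.
exact: isB0.
Qed.

(** The truncation at [b] is the directed union of the [spanS v]. By compactness the identity of [X]
    factors up to homotopy through one of them, so the finitely many [v] generate the top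
    cohomology. *)
Lemma pc_top : Kp X -> pc X -> below X b -> fgS (@S1 A) X b.
Proof.
move=> kX hX hb.
have [r [dr hr]] := Kp_lift (cocyc_sinc _) kX (tr_qi hb) (cocyc_hid X).
have [R [psi [[n [v eR]] dpsi hpsi hR]]] := hX _ _ _ r dir_span dr; subst R.
have dS := cocyc_sinc (trS X b); pose s := sinc (trS X b) b b (addr0 b).
exists n, (fun k => s (v k)); split=> [j|x hx]; first exact/(cocyc_Z dS)/tr_top_Z.
have [c hc] := hR b b (addr0 b) x erefl; rewrite cst_id in hc.
exists (dunit A), c; split=> //; rewrite sc1.
have := isB_hom (addr0 b) hr hx.
rewrite homDE homNE hidE (hcompE _ _ _ _ (addr0 b) (addr0 b)) => h1; apply: (isB_tr h1).
have := cocyc_B dS (addr0 b) (isB_hom (addr0 b) hpsi hx).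
rewrite homDE homNE hfunB => h2; apply: (isB_tr h2).
by have := cocyc_B dS (addr0 b) hc; rewrite hfunB hfun_lcomb.
Qed.
End FiniteTop.

(** Compactness yields generators only in the top degree. Since it is inherited by the cones, the
    top can be killed and the argument repeated one degree lower. *)
Lemma tpair_fg X Y i : tpair X Y -> fgS (@S1 A) X i.
Proof.
move=> h; have [b hb] := tpair_below h; have hp := tpair_pc h; have [gX _ _] := h.
pose G X := good X /\ pc X.
have GX : G X by [].
have {}hb : sbelow (@S1 A) X b by move=> k bk; apply/svan1/hb.
apply: (@cell_ind A (@S1 A) (mset1 A) G (fun X i => fgS (@S1 A) X i) 0 _ _ _ _ X b i GX hb) => {h hb hp gX GX X Y b i}.
- move=> X b y hy [gX hX]; split; last exact: pc_cell.
  by apply: good_cone => //; apply/good_sh/good_reg.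
- move=> X b [gX hX] hb; apply: pc_top => //; first exact: gX.1.
  by move=> j bj; apply/svan1/hb.
- move=> X b y hy i _ hC; pose d := datt hy.
  have [iY [diY ex]] := conish_exY (conish_cone d).
  have e : i + 0 = i by lia.
  apply: (@fg_exact A hN _ (mset1 A) _ _ _ _ _ _ _ _ (att y) iY e e d diY) => //; last exact: fg_sh.
  by move=> z hz hb; apply: ex hb.
move=> X b j _ hb bj; by apply: fg_van; apply: hb; lia.
Qed.
End TiltingPairs.

(** * Biduality *)

Section ConeFunctor.
Variables (A B : cdgRing) (F G : dgfun A B) (al : forall X, hom (F X) (G X) 0).
Hypothesis dal : forall X, cocyc (al X).
Hypothesis nat_al : forall X Y p (f : hom X Y p),
  hcomp (addr0 p) (al Y) (fh F f) = hcomp (add0r p) (fh G f) (al X).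

Lemma al_natE X Y p (f : hom X Y p) i j k l (e1 : i + p = j) (e2 : j + 0 = k)
   (e3 : i + 0 = l) (e4 : l + p = k) x :
  al Y j k e2 (fh F f i j e1 x) = fh G f l k e4 (al X i l e3 x).
Proof.
have e : i + p = k by lia.
have := congr1 (fun h : hom (F X) (G Y) p => h i k e x) (nat_al f).
by rewrite (hcompE _ _ _ e e1 e2) (hcompE _ _ _ e e3 e4).
Qed.

Lemma cf_e p (i j : int) : i + p = j -> i + 1 + p = j + 1. Proof. lia. Qed.

Program Definition cfh X Y p (f : hom X Y p) : hom (cone (dal X)) (cone (dal Y)) p :=
  @Hom B _ _ p (fun i j e (z : cone (dal X) i) =>
    (zsign p (fh F f (i + 1) (j + 1) (cf_e e) z.1), fh G f i j e z.2) : cone (dal Y) j) _ _.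
Next Obligation.
by move=> X Y p f i j e [x y] [x' y'] /=; rewrite !homD zsign_addr.
Qed.
Next Obligation.
move=> X Y p f q i k j l e ej el e' a [x y] /=; rewrite /conea zsign_pair /=.
rewrite hfun_zsign (hom_act (fh F f) (cone_e3 e) (cf_e ej) (cf_e el) (cone_e3 e')).
rewrite (hom_act (fh G f) e ej el e') act_zsignr; congr pair.
by rewrite -!zsignD; zpar.
Qed.

(** The cone of a natural transformation as a DG functor: the set of modules on which the
    transformation is a quasi-isomorphism can now be studied through triples and cells. *)
Program Definition cfun : dgfun A B :=
  @DGFun A B (fun X => cone (dal X)) cfh _ _ _ _.
Next Obligation.
move=> M N n f g; apply: hom_ext => i j e [x y] /=.
by rewrite !fhD !homDE zsign_addr.
Qed.
Next Obligation.
by move=> M; apply: hom_ext0 => i e [x y]; rewrite hidE /= !fh_id !hidE zsign0.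
Qed.
Next Obligation.
move=> M N P n m k e g f; apply: hom_ext => i j ej [x y].
have e1 : i + n + m = j by lia.
rewrite (hcompE e (cfh g) (cfh f) ej erefl e1) /= !fh_comp.
rewrite (hcompE _ _ _ _ (cf_e (erefl (i + n))) (cf_e e1)) (hcompE _ _ _ ej erefl e1).
rewrite hfun_zsign -zsignD; congr pair; subst k; zpar.
Qed.
Next Obligation.
move=> M N n k e f; apply: hom_ext => i j ej [x y].
have f1 : i + 1 = i + 1 by []. have f2 : i + n = i + n by [].
have f3 : i + n + 1 = j by lia. have f4 : i + 1 + n = j by lia.
rewrite (homdE e (cfh f) ej f1 f2 f3 f4) /= /coned /= -!fh_d.
rewrite (homdE e (fh F f) (cf_e ej) (cone_e2 f1) (cf_e f2) (cone_e2 f3) (cf_e f4)).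
rewrite (homdE e (fh G f) ej f1 f2 f3 f4).
rewrite zsign_pair; congr pair => /=.
  have zk (V : zmodType) (v : V) : zsign k v = - zsign n v by rewrite -e zsignD zsign1 zsignN.
  by rewrite zk cd_zsign zsignK hfunN opprK zsignB zsignK opprB; apply: addrC.
rewrite hfun_zsign homD (al_natE f (cf_e f2) _ (cone_e f1) f4) zsign_addr.
by rewrite opprD addrACA subrr add0r.
Qed.
End ConeFunctor.

Program Definition idfun A : dgfun A A :=
  @DGFun A A (fun X => X) (fun X Y p f => f) _ _ _ _.
Next Obligation. by []. Qed.
Next Obligation. by []. Qed.
Next Obligation. by []. Qed.
Next Obligation. by []. Qed.

Program Definition cofcof A B C (D : dgcof A B) (E : dgcof B C) : dgfun A C :=
  @DGFun A C (fun X => E (D X)) (fun X Y p f => ch E (ch D f)) _ _ _ _.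
Next Obligation. by move=> A B C D E M N n f g /=; rewrite !chD. Qed.
Next Obligation. by move=> A B C D E M /=; rewrite !ch_id. Qed.
Next Obligation.
move=> A B C D E M N P n m k e g f /=; have e' : m + n = k by lia.
rewrite (ch_comp D e e') ch_zsign (ch_comp E e' e) -zsignD zsign_even // odd_abszD mulrC; lia.
Qed.
Next Obligation. by move=> A B C D E M N n k e f /=; rewrite !ch_d. Qed.

Section Biduality.
Variables (A : cdgRing) (I : dgMod A).
Implicit Types X Y : dgMod A.

Definition bid X : hom X (Homdg (Homdg X I) I) 0 :=
  hcurry (hcomp (addr0 0) (huncurry (hid (Homdg X I))) (comm X (Homdg X I))).

Lemma bidE X i c (e : i + 0 = c) x n k (e2 : n + c = k) (e3 : i + n = k) (h : hom X I n) :
  (bid X i c e x : hom (Homdg X I) I c) n k e2 h = zsign (i * n) (h i k e3 x).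
Proof.
have f1 : i + n = i + n by []. have f2 : i + n + 0 = k by lia.
have f3 : n + i = i + n by lia. have f4 : n + 0 = n by lia.
rewrite [LHS](hcurryE _ e x e2 f1 f2).
have f5 : i + n + 0 = i + n by lia.
rewrite (hcompE _ _ _ f2 f5 f2) (commE f5 f1 f3) hfun_zsign.
by rewrite (huncurryE _ f2 f3 f4 e3) hidE.
Qed.

Lemma dbid X : cocyc (bid X).
Proof.
rewrite /bid -(curryE (addr0 0)).
have d : cocyc (hcomp (addr0 0) (huncurry (hid (Homdg X I))) (comm X (Homdg X I))).
  apply: cocyc_hcomp; last exact: cocyc_comm.
  exact: huncurry_cocyc (cocyc_hid _).
by have := cocyc_Z (cocyc_curry X (Homdg X I) I) (addr0 0) d; apply.
Qed.

Definition bifun : dgfun A A := cofcof (HomL I) (HomL I).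

Lemma nat_bid X Y p (f : hom X Y p) :
  hcomp (addr0 p) (bid Y) (fh (idfun A) f) = hcomp (add0r p) (fh bifun f) (bid X).
Proof.
apply: hom_ext => i j e x.
have f1 : j + 0 = j by lia. have f2 : i + 0 = i by lia.
rewrite (hcompE _ _ _ e e f1) (hcompE _ _ _ e f2 e).
have f3 : p + i = j by lia.
rewrite [RHS](hpreE (N := I) (hpre I f) e f3).
apply: hom_ext => n k ek h; rewrite hom_zsignE.
have g1 : n + p = n + p by []. have g2 : n + p + i = k by lia.
have g3 : i + (n + p) = k by lia. have g4 : j + n = k by lia.
have g5 : p + n = n + p by lia.
rewrite (bidE f1 _ ek g4) (hcompE _ _ _ ek g1 g2) (bidE f2 _ g2 g3).
rewrite (hpreE (N := I) f g1 g5) hom_zsignE (hcompE _ _ _ g3 e g4) -!zsignD.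
zpar.
Qed.

Definition bicone : dgfun A A := @cfun A A (idfun A) bifun bid dbid nat_bid.
End Biduality.

(** * Duality over the base ring, with values in a complex resolving its localization at [S] *)

Section LocalDuality.
Variables (B : cdgRing) (S : B 0 -> Prop) (I : dgMod B) (d : int) (j : hom (regMod B) I 0).
Hypothesis hN : noetherian (barRing B).
Hypothesis mS : mset S.
Hypothesis hd : (0 <= d)%R.
Hypothesis hB : forall i, fgS S (regMod B) i.
Hypothesis hI : forall (X : dgMod B) i,
  (forall k, (- i <= k)%R -> (k <= - i + d)%R -> svan S X k) -> van (Homdg X I) i.
Hypothesis dj : cocyc j.
Hypothesis hj : forall i, svan S (cone dj) i.
Implicit Types X Y : dgMod B.
Local Notation B1 := (regMod B).
Local Notation D := (HomL I).

Lemma conish_fg X Y C n p q (s : hom X Y n) i k : cocyc s -> conish C p q s ->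
  k + q = i -> fgS S C k -> fgS S Y (i + n) -> fgS S X i.
Proof.
move=> ds ci e hC hY; have [pX [dpX ex]] := conish_exX ds ci.
apply: (@fg_exact B hN S mS _ _ _ _ _ _ _ _ pX s e (erefl (i + n)) dpX ds) => // x hx hb.
exact: ex hb.
Qed.

Lemma conish_fgY X Y C n p q (s : hom X Y n) i k : cocyc s -> conish C p q s ->
  i + p = k -> fgS S C k -> fgS S X (i - n) -> fgS S Y i.
Proof.
move=> ds ci e hC hX; have [iY [diY ex]] := conish_exY ci.
have e' : i - n + n = i by lia.
apply: (@fg_exact B hN S mS _ _ _ _ _ _ _ _ s iY e' e ds diY) => // x hx hb.
exact: ex hb.
Qed.

Lemma fg_inj i : fgS S I i.
Proof.
by apply: (conish_fgY dj (conish_cone dj) (addr0 i)); [apply: fg_van | apply: hB].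
Qed.

Lemma dual_van X m : (forall k, (- m <= k)%R -> (k <= - m + d)%R -> van X k) -> van (D X) m.
Proof. by move=> h; apply: hI => k h1 h2; apply: van_svan => //; apply: h. Qed.

Lemma fg_dual_sh n i : fgS S (D (sh n B1)) i.
Proof.
have h : hinv (ch D (shin n B1)) (zsign (- n) (ch D (shout n B1))) := hinv_cof D (hinv_sh n B1).
have [hI1 hS1] := qi_hinv h i.
apply: (iffRL (fg_qi S (hinv_cocyc h) (erefl (i + - n)) hI1 hS1)).
have [hI2 hS2] := @qi_homA1 B I (i + - n).
by apply: (iffRL (fg_qi S (@cocyc_homA1 B I) (addr0 _) hI2 hS2)); apply: fg_inj.
Qed.

Lemma fg_cell X b (y : X b) (hy : isZ y) : (forall i, fgS S X i) -> forall i, fgS S (cell hy) i.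
Proof.
move=> hX i; apply: (fg_mid hN mS (st_cone (datt hy)) (addr0 i) (erefl (i + 1))) => //.
exact: fg_sh.
Qed.

Lemma fg_dual_below X b i : (forall i, fgS S X i) -> sbelow S X b -> fgS S (D X) i.
Proof.
move=> gX hb; rewrite -[i]opprK.
(* The dual is indexed by [- i] because duality reverses degrees: the range above the top of [X],
   where the cell argument wants an immediate answer, is then the one where [hI] gives vanishing. *)
pose G X := forall i, fgS S X i.
apply: (@cell_ind B S mS G (fun X i => fgS S (D X) (- i)) 0 _ _ _ _ X b (- i) gX hb) => {gX hb X b i}.
- by move=> X b y hy gX; apply: fg_cell.
- by move=> X b gX _; apply: gX.
- move=> X b y hy i gX hC; have ci := conish_cof D (conish_cone (datt hy)).
  by apply: (conish_fg (ch_cocyc D (datt hy)) ci (addr0 _) hC); apply: fg_dual_sh.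
move=> X b i gX hb bi; apply: fg_van; apply: van_svan => //; apply: hI => k k1 k2.
by apply: hb; lia.
Qed.

Lemma fg_tr X n : (forall i, fgS S X i) -> forall i, fgS S (tr X n) i.
Proof.
move=> gX i; have [ni|ni] := Order.TotalTheory.ltP n i.
  by apply: fg_van => x _; rewrite (tr0 x ni); apply: isB_sbnd => //; apply: isB0.
by apply: (iffRL (fg_qi S (cocyc_sinc _) (addr0 i) (@trI _ X n i) (trQ ni))).
Qed.

Lemma sbelow_tr X n : sbelow S (tr X n) n.
Proof. by move=> i ni x _; rewrite (tr0 x ni); apply: isB_sbnd => //; apply: isB0. Qed.

Lemma van_cone_tr X n k : (k <= n)%R -> van (cone (cocyc_sinc (trS X n))) k.
Proof.
move=> kn; apply: (conish_van (cocyc_sinc _) (conish_cone _) (erefl (k + 1)) (erefl (k + 1))).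
  exact: trI.
exact: trQ.
Qed.

(** The dual in degrees from [i] on sees [X] only in degrees up to [- i + d], so [X] may be
    truncated there. *)
Lemma fg_dual X i : (forall i, fgS S X i) -> fgS S (D X) i.
Proof.
move=> gX; pose n := - i + d; pose s := sinc (trS X n).
have ci := conish_cof D (conish_cone (cocyc_sinc (trS X n))).
have hC m : (i <= m)%R -> van (D (cone (cocyc_sinc (trS X n)))) m.
  by move=> im; apply: dual_van => k k1 k2; apply: van_cone_tr; lia.
have ds := ch_cocyc D (cocyc_sinc (trS X n)).
apply: (iffRL (fg_qi S ds (addr0 i) (conish_qI ds ci (addr0 i) (hC _ _)) (conish_qS ci erefl (hC _ _)))); try lia.
exact: fg_dual_below (fg_tr n gX) (@sbelow_tr X n).
Qed.

(** The cones of [f] and of [w f] agree up to quasi-isomorphism. The composite [g] is specified by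
    its values, so that it can be supplied in whatever form it arises. *)
Lemma svan_cone_qi X Y Z (f : hom X Y 0) (w : hom Y Z 0) (g : hom X Z 0)
    (df : cocyc f) (dg : cocyc g) i : cocyc w -> qi w ->
  (forall k l (e : k + 0 = k) (e' : k + 0 = l) (e1 : l + 0 = l) x, g k l e' x = w l l e1 (f k l e' x)) ->
  svan S (cone dg) i -> svan S (cone df) i.
Proof.
move=> dw qw gE h [x y] hz.
have := hz _ (erefl (i + 1)) => hxy.
have hx : cd (cone_e2 (erefl (i + 1))) x = 0.
  by have := congr1 fst hxy => /= /eqP; rewrite oppr_eq0 => /eqP.
have hy : f (i + 1) (i + 1) (cone_e (erefl _)) x + cd (erefl (i + 1)) y = 0 by have := congr1 snd hxy.
have e0 : i + 0 = i by lia. have e0' : i + 1 + 0 = i + 1 by lia.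
have cw : isZ ((x, w i i e0 y) : cone dg i).
  apply: (isZP (e := erefl (i + 1))); rewrite /= /coned /= hx oppr0.
  rewrite (gE _ _ e0' _ e0') (cocyc_cd dw e0 _ (erefl (i + 1)) e0') zsign0 -homD hy hfun0 //.
have [s [Ss [k [e [[x' y'] hz']]]]] := h _ cw.
have h1 : sc s x = - cd (cone_e2 e) x'.
  have := congr1 fst hz' => /=; rewrite zsign0 => <-; exact: act_irr.
have h2 : sc s (w i i e0 y) = g (k + 1) i (cone_e e) x' + cd e y'.
  by have := congr1 snd hz' => /= <-; exact: act_irr.
have k1 : k + 1 + 1 = i + 1 by lia. have k2 : i + 1 + 0 = i + 1 by lia.
have Z1 : isZ (sc s y - f (k + 1) i (cone_e e) x').
  apply: (isZP (e := erefl (i + 1))); rewrite cdB cd_sc.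
  rewrite (cocyc_cd df (cone_e e) (erefl (i + 1)) (cone_e2 e) k2) zsign0.
  have -> : cd (cone_e2 e) x' = - sc s x by rewrite h1 opprK.
  rewrite hfunN opprK hfun_sc -scDr; have -> : cd (erefl (i + 1)) y + f (i + 1) (i + 1) k2 x = 0.
    by rewrite (hfun_irr f k2 (cone_e (erefl (i + 1)))); rewrite [LHS]addrC.
  by rewrite sc0r.
have [hI' _] := qw i.
have [l [el [v hv]]] : isB (sc s y - f (k + 1) i (cone_e e) x').
  apply: (hI' _ e0 _ Z1); exists k, e, y'.
  have e3 : k + 1 + 0 = k + 1 by lia.
  by rewrite hfunB hfun_sc h2 (gE _ _ e3 _ e0) addrAC subrr add0r.
have lk : l = k by lia.
case: k / lk e x' y' hz' h1 h2 k1 Z1 hv => e x' y' hz' h1 h2 k1 Z1 hv.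
exists s; split=> //; exists l, e, ((x', v) : cone df l).
rewrite [RHS]/= /coned [sc _ _]/= /conea /= zsign0; congr pair.
  by rewrite -h1; apply: act_irr.
rewrite (cd_irr e el) -hv addrC subrK; exact: act_irr.
Qed.

Local Notation T := (bicone I).

(** Followed by the dual of [1 |-> j] and by evaluation at 1, the biduality map of [B] becomes [j]
    itself, whose cone vanishes after inverting [S]. The dual of [1 |-> j] is a quasi-isomorphism
    since [hI] only looks at localized cohomology. *)
Lemma svan_bid_reg i : svan S (T B1) i.
Proof.
pose u : Homdg B1 I 0 := j.
have du : cocyc (hfree u) by apply: cocyc_hfree.
have uS k : svan S (cone du) k.
  apply: (@svan_cone_qi _ _ _ (hfree u) (homA1 I) j du dj k (@cocyc_homA1 _ _) (@qi_homA1 _ _)) => //.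
  move=> l m e e' e1 x; have lm : l = m by lia.
  case: m / lm e' e1 => e' e1; rewrite homA1E (hfreeE u e' x) mulr0 zsign0.
  rewrite (homA_eval j e' (addr0 0)) mulr0 zsign0.
  have e2 : 0 + 0 = 0 :> int by [].
  rewrite [RHS](homaE e' x u (add0r l) e2 e'); congr (act _ _ _); exact: hfun_irr.
pose w := hcomp (addr0 0) (homA1 I) (ch D (hfree u)).
apply: (@svan_cone_qi _ _ _ (bid I B1) w j (@dbid B I B1) dj).
- by apply: cocyc_hcomp; [apply: cocyc_homA1 | apply: (ch_cocyc D)].
- apply: qi_comp; [exact: (ch_cocyc D) | exact: cocyc_homA1 | | exact: qi_homA1].
  by apply: (@qi_cof_cone _ _ D _ _ _ du) => k; apply: hI.
- move=> k l e e' e1 x; have kl : k = l by lia.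
  case: l / kl e' e1 => e' e1.
  rewrite (hcompE _ _ _ e1 e1 e1) homA1E (hpreE (N := I) (hfree u) e1 (add0r k)) mul0r zsign0.
  have f0 : 0 + 0 = 0 :> int by [].
  rewrite (hcompE _ _ _ _ f0 (add0r k)) hfree1 (bidE e' x (add0r k) e') mulr0 zsign0.
  exact: hfun_irr.
exact: hj.
Qed.

Lemma svan_bid_sh n i : svan S (T (sh n B1)) i.
Proof.
apply: (hinv_svan (i := i + n) _ (hinv_fun T (hinv_sh n B1))); first by lia.
exact: svan_bid_reg.
Qed.

Lemma svan_bid_mid X i : svan S (bifun I X) i -> svan S X (i + 1) -> svan S (T X) i.
Proof.
exact: (svan_mid (st_cone (dbid I X)) mS (addr0 i) (erefl (i + 1))).
Qed.

(** Here the constant of the cell argument is [d]: each of the two dualizations widens the range by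
    [d] on one side, so the double dual vanishes above [b + d]. *)
Lemma svan_bid_below X b i : (forall i, fgS S X i) -> sbelow S X b -> svan S (T X) i.
Proof.
pose G X := forall i, fgS S X i.
move=> gX hb.
apply: (@cell_ind B S mS G (fun X i => svan S (T X) i) d _ _ _ _ X b i gX hb) => {gX hb X b i}.
- by move=> X b y hy gX; apply: fg_cell.
- by move=> X b gX _; apply: gX.
- move=> X b y hy i gX hC; have st := striple_fun T (st_cone (datt hy)).
  apply: (svan_left st mS (addr0 i) _ hC); first by rewrite addr0.
  exact: svan_bid_sh.
move=> X b i gX hb bi; apply: svan_bid_mid; last by apply: hb; lia.
apply: van_svan => //; apply: dual_van => k k1 k2; apply: hI => l l1 l2; apply: hb; lia.
Qed.

Lemma svan_bid X i : (forall i, fgS S X i) -> svan S (T X) i.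
Proof.
(* In degree [i] the double dual depends on degrees up to [i + d], and the cone of the biduality map
   also involves degree [i + 1] of its source. *)
move=> gX; pose n := i + `|d| + 1; set C := cone (cocyc_sinc (trS X n)).
have st := striple_fun T (st_cone (cocyc_sinc (trS X n))).
apply: (svan_left st mS (addr0 i) (k := i)); first by rewrite addr0.
  have vC k : (k <= n)%R -> van C k by apply: van_cone_tr.
  apply: svan_bid_mid; last by apply: van_svan => //; apply: vC; lia.
  apply: van_svan => //; apply: dual_van => k k1 k2; apply: dual_van => l l1 l2; apply: vC; lia.
exact: svan_bid_below (fg_tr n gX) (@sbelow_tr X n).
Qed.
End LocalDuality.

(** * Change of rings *)

Section Restriction.
Variables (B A : cdgRing) (phi : dgrHom B A).
Implicit Types M N : dgMod A.

Program Definition rhoM M : dgMod B :=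
  @DGMod B M (fun i j k e b m => act e (phi i b) m) _ _ _ _ _.
Next Obligation. by move=> M i j k e a b m /=; rewrite cmD actDl. Qed.
Next Obligation. by move=> M i j k e a m n /=; rewrite actDr. Qed.
Next Obligation. by move=> M i j k ij jk ijk e1 e2 e3 e4 a b m /=; rewrite dgrhM (actA e1 e2 e3 e4). Qed.
Next Obligation. by move=> M i e m /=; rewrite dgrh1 act1. Qed.
Next Obligation.
move=> M i j k i' j' k' e ei ej ek e1 e2 a m /=.
by rewrite (act_leibniz e ei ej ek e1 e2) cm_d.
Qed.

Definition rhoH M N n (f : hom M N n) : hom (rhoM M) (rhoM N) n :=
  @Hom B (rhoM M) (rhoM N) n f (fun i j e => @homD A M N n f i j e)
    (fun p i k j l e ej el e' b m => hom_act f e ej el e' (phi p b) m).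

Program Definition rho : dgfun A B := @DGFun A B rhoM rhoH _ _ _ _.
Next Obligation. by move=> M N n f g; apply: hom_ext. Qed.
Next Obligation. by move=> M; apply: hom_ext. Qed.
Next Obligation. by move=> M N P n m k e g f; apply: hom_ext. Qed.
Next Obligation. by move=> M N n k e f; apply: hom_ext. Qed.

Section Coinduced.
Variable I : dgMod B.
Local Notation A1 := (regMod A).
Local Notation H := (Homdg (rho A1) I).

Lemma lmul_e (p i j : int) : i + p = j -> p + i = j. Proof. lia. Qed.

Program Definition lmul p (a : A p) : hom (rho A1) (rho A1) p :=
  @Hom B (rho A1) (rho A1) p (fun i j e (x : A1 i) => act (lmul_e e) a x : A1 j) _ _.
Next Obligation. by move=> p a i j e x y; rewrite actDr. Qed.
Next Obligation.
move=> p a q i k j l e ej el e' b m.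
have h : i + p = j by lia.
by have := actAC (M := A1) e (lmul_e el) (lmul_e ej) e' a (phi q b) m; rewrite [p * q]mulrC.
Qed.

Lemma lmulE p (a : A p) i j (e : i + p = j) (e' : p + i = j) (x : A1 i) :
  lmul a i j e x = act e' a x.
Proof. exact: (@act_irr A A1). Qed.

Lemma lmulD p (a b : A p) : lmul (a + b) = lmul a + lmul b.
Proof.
apply: hom_ext => i j e x; rewrite homDE !(lmulE _ e (lmul_e e)).
exact: (@actDl A A1).
Qed.

Lemma lmulM p q k (e : p + q = k) (e' : p + q = k) (a : A p) (b : A q) :
  lmul (dmul e a b) = zsign (p * q) (hcomp e' (lmul b) (lmul a)).
Proof.
apply: hom_ext => i j ej x; have h1 : p + i = i + p by lia.
have h2 : q + (i + p) = j by lia. have h3 : k + i = j by lia. have h4 : q + i = q + i by [].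
have h5 : p + (q + i) = j by lia. have h6 : i + p = i + p by []. have h7 : i + p + q = j by lia.
rewrite hom_zsignE (hcompE e' (lmul b) (lmul a) ej h6 h7) (lmulE a h6 h1) (lmulE b h7 h2) (lmulE _ ej h3).
rewrite [LHS](actA (d := A1) e h3 h4 h5) [RHS](congr1 _ (actAC (M := A1) h1 h2 h4 h5 b a x)).
by rewrite -zsignD [zsign _ _]zsign_even //; lia.
Qed.

Lemma lmul1 : lmul (dunit A) = hid (rho A1).
Proof.
apply: hom_ext0 => i e x; rewrite hidE (lmulE _ e (add0r i)).
exact: (@act1 A A1).
Qed.

Lemma lmul_d p k (e : p + 1 = k) (a : A p) : homd e (lmul a) = lmul (cd e a).
Proof.
apply: hom_ext => i j ej x.
have h1 : i + p = p + i by lia. have h2 : p + i + 1 = j by lia. have h3 : i + 1 + p = j by lia.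
have h4 : p + i = p + i by []. have h5 : p + (i + 1) = j by lia. have h6 : k + i = j by lia.
rewrite (homdE e (lmul a) ej (erefl (i + 1)) h1 h2 h3) (lmulE a h1 h4) (lmulE a h3 h5) (lmulE _ ej h6).
have := act_leibniz (d := A1) h4 e (erefl (i + 1)) h2 h6 h5 a x => E.
by rewrite [cd h2 _](E : _ = _) addrK.
Qed.

(** [A] acts through the functor [Hom(-, I)] applied to multiplication on [A], so the module axioms
    are those of [lmul]. *)
Definition coind_act i j k (e : i + j = k) (a : A i) (f : H j) : H k :=
  ch (HomL I) (lmul a) j k (lmul_e e) f.

Lemma coind_actE i j k (e : i + j = k) (a : A i) (f : hom (rho A1) I j) p q r (eq : p + k = q)
   (e1 : i + p = r) (e2 : r + j = q) (x : A1 p) :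
  (coind_act e a f : hom (rho A1) I k) p q eq x = zsign (i * j) (f r q e2 (act e1 a x : A1 r)).
Proof.
have e3 : p + i = r by lia.
rewrite [coind_act e a f](hpreE (N := I) (lmul a) (lmul_e e) e) hom_zsignE.
by rewrite (hcompE _ _ _ eq e3 e2) (lmulE a e3 e1).
Qed.

Program Definition coind : dgMod A := @DGMod A H coind_act _ _ _ _ _.
Next Obligation.
by move=> i j k e a b f; rewrite /coind_act lmulD (chD (HomL I)).
Qed.
Next Obligation. by move=> i j k e a f g; rewrite /coind_act homD. Qed.
Next Obligation.
move=> i j k ij jk ijk e1 e2 e3 e4 a b f; rewrite /coind_act.
have h : j + i = ij by lia.
rewrite (lmulM _ e1) ch_zsign (ch_comp (HomL I) e1 h) -zsignD zsign_even; last by rewrite odd_abszD; lia.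
by rewrite (hcompE _ _ _ _ (lmul_e e3) (lmul_e e4)).
Qed.
Next Obligation.
by move=> i e f; rewrite /coind_act lmul1 (ch_id (HomL I)) (hidE (M := H)).
Qed.
Next Obligation.
move=> i j k i' j' k' e ei ej ek e1 e2 a f; rewrite /coind_act.
rewrite (hom_cd ei (ch (HomL I) (lmul a)) (lmul_e e) ek ej (lmul_e e2) (lmul_e e1)).
by rewrite ch_d lmul_d.
Qed.

Program Definition cev : hom (rho coind) I 0 :=
  @Hom B (rho coind) I 0 (fun i j e (f : hom (rho A1) I i) =>
    f 0 j (etrans (add0r i) (etrans (esym (addr0 i)) e)) (dunit A)) _ _.
Next Obligation. by []. Qed.
Next Obligation.
move=> p i k j l e ej el e' b f /=.
have e1 : p + 0 = p by lia. have e2 : p + i = l by lia.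
rewrite (coind_actE e (phi p b) f _ e1 e2).
have e3 : 0 + i = j by lia.
have := hom_act f e1 e3 e2 e' b (dunit A) => E.
rewrite [f p l e2 _](E : _ = _) -zsignD mulr0 zsign0 zsign_even; last by rewrite odd_abszD; lia.
congr (act _ _ _); exact: hfun_irr.
Qed.

Lemma cevE i (e : i + 0 = i) (f : hom (rho A1) I i) : cev i i e f = f 0 i (add0r i) (dunit A).
Proof. exact: (@hfun_irr B (rho A1) I i f). Qed.

Lemma dcev : cocyc cev.
Proof.
move=> k e; have ek : 1 = k by lia.
case: k / ek e => e; apply: hom_ext => i j ej f.
have f1 : i + 0 = i by lia. have f2 : i + 1 + 0 = j by lia.
have f3 : i + 1 = j by lia. have f4 : j + 0 = j by lia.
rewrite (homdE e cev ej f3 f1 f3 f4) zsign0 !cevE hom0E.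
have f5 : 0 + j = j by lia. have f6 : 0 + i = i by lia. have f7 : 0 + 1 = 1 :> int by lia.
have f8 : 1 + i = j by lia.
rewrite [(cd f3 f : hom _ _ _) 0 j _ _](homdE f3 f (add0r j) f7 f6 f3 f8).
have -> : cd f7 (dunit A : rho A1 0) = 0 by apply: dA0.
by rewrite hfun0 zsign00 subr0 (hfun_irr f (add0r i) f6) subrr.
Qed.

Section Adjunct.
Variable M : dgMod A.
Local Notation DM := (Homdg M coind).
Local Notation DB := (Homdg (rho M) I).

Program Definition adj : hom (rho DM) DB 0 :=
  @Hom B (rho DM) DB 0 (fun n k e (F : hom M coind n) => hcomp e cev (fh rho F) : DB k) _ _.
Next Obligation. by move=> n k e F F'; rewrite fhD hcompDr. Qed.
Next Obligation.
move=> p i k j l e ej el e' b F; rewrite mulr0 zsign0.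
apply: hom_ext => a c ea m.
have f1 : a + k = c by lia. have f2 : c + 0 = c by lia. have f3 : a + i = a + i by [].
have f4 : a + i + 0 = a + i by lia. have f5 : p + (a + i) = c by lia. have f6 : a + j = a + i by lia.
rewrite (hcompE _ _ _ ea f1 f2) (homaE e' b _ ea f6 f5) (hcompE _ _ _ f6 f3 f4).
have -> : fh rho (act e b (F : rho DM i)) a c f1 m = act (d := rho coind) f5 b (fh rho F a (a + i) f3 m).
  exact (@homaE A M coind _ _ _ e (phi p b) F _ _ _ f1 f3 f5 m).
by rewrite (hom_act cev f5 f4 f2 f5) mulr0 zsign0.
Qed.

Lemma adjE n (e : n + 0 = n) (F : hom M coind n) i j (ej : i + n = j) m :
  (adj n n e F : hom (rho M) I n) i j ej m = (F i j ej m : hom (rho A1) I j) 0 j (add0r j) (dunit A).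
Proof. by rewrite (hcompE e cev (fh rho F) ej ej (addr0 j)) cevE. Qed.

Lemma coind_eval n (F : hom M coind n) i j (ej : i + n = j) m p q r (e1 : p + j = q) (e2 : p + i = r)
   (e3 : r + n = q) (a : A p) :
  (F i j ej m : hom (rho A1) I j) p q e1 a =
  zsign (p * i) ((F r q e3 (act e2 a m) : hom (rho A1) I q) 0 q (add0r q) (dunit A)).
Proof.
have e4 : p + 0 = p by lia.
rewrite (hom_act F e2 ej e3 e1) hom_zsignE (coind_actE e1 a _ _ e4 e1) -!zsignD.
rewrite [act e4 a _](dmul1r e4 a) zsign_even //.
rewrite !odd_abszD !odd_abszM; lia.
Qed.

Lemma adj_inj n (e : n + 0 = n) (F F' : hom M coind n) : adj n n e F = adj n n e F' -> F = F'.
Proof.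
move=> h; apply: hom_ext => i j ej m; apply: (@hom_ext _ (rho A1) I) => p q e1 a.
have e2 : p + i = p + i by []. have e3 : p + i + n = q by lia.
rewrite !(coind_eval _ ej m e1 e2 e3 a).
by rewrite -!(adjE e) h.
Qed.

Section Lift.
Variables (n : int) (g : hom (rho M) I n).

Lemma cl_e (p i c q : int) : i + n = c -> p + c = q -> p + i + n = q. Proof. lia. Qed.

Program Definition colift1 i c (ec : i + n = c) (m : M i) : hom (rho A1) I c :=
  @Hom B (rho A1) I c (fun p q e (a : A p) =>
     zsign (p * i) (g (p + i) q (cl_e ec e) (act (erefl (p + i)) a m : M (p + i)))) _ _.
Next Obligation. by move=> i c ec m p q e a b; rewrite actDl homD zsign_addr. Qed.

Next Obligation.
move=> i c ec m p k k' j l e ej el e' b a; cbv beta.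
have h1 : p + (k + i) = k' + i by lia.
rewrite (_ : act (erefl (k' + i)) (act e b a : A k') m = act (d := rho M) h1 b (act (erefl (k + i)) (a : A k) m)); last first.
  exact (actA e (erefl (k' + i)) (erefl (k + i)) h1 (phi p b) (a : A k) m).
rewrite (hom_act g h1 (cl_e ec ej) (cl_e ec el) e') act_zsignr -!zsignD.
subst k' c; zpar.
Qed.

Lemma colift1E i c (ec : i + n = c) (m : M i) p q (e : p + c = q) r (e1 : p + i = r) (e2 : r + n = q) a :
  colift1 ec m p q e a = zsign (p * i) (g r q e2 (act e1 a m : M r)).
Proof. by case: r / e1 e2 => e2; congr zsign; apply: hfun_irr. Qed.

Program Definition colift : hom M coind n :=
  @Hom A M coind n (fun i c ec m => colift1 ec m : coind c) _ _.
Next Obligation.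
move=> i c ec x y; apply: (@hom_ext _ (rho A1) I) => p q e a.
by rewrite homDE /= actDr homD zsign_addr.
Qed.
Next Obligation.
move=> p i k j l e ej el e' a m; apply: (@hom_ext _ (rho A1) I) => q r eq x.
have h1 : p + q = p + q by []. have h2 : p + q + j = r by lia.
have h3 : p + q + i = p + q + i by []. have h4 : p + q + i + n = r by lia.
have h5 : q + k = p + q + i by lia. have h6 : q + p = p + q by lia.
rewrite (colift1E el _ eq h5 h4) hom_zsignE (coind_actE e' a _ _ h1 h2) (colift1E ej m h2 h3 h4).
have E : act (d := A1) h1 a x = zsign (q * p) (dmul h6 (x : A q) a) by apply: dmulC.
rewrite E act_zsignl hfun_zsign (actA h6 h3 e h5) -!zsignD.
subst k j; zpar.
Qed.
End Lift.

Lemma adj_colift n (e : n + 0 = n) g : adj n n e (colift g) = g.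
Proof.
apply: hom_ext => i j ej m; rewrite adjE.
by rewrite (colift1E g ej m (add0r j) (add0r i) ej) mul0r zsign0 act1.
Qed.

Program Definition adjV : hom DB (rho DM) 0 :=
  @Hom B DB (rho DM) 0 (fun n k e g => colift (@cst DB n k (etrans (esym (addr0 n)) e) g) : rho DM k) _ _.
Next Obligation.
move=> n k e g g'; have nk : n = k by lia.
case: k / nk e => e; apply: (adj_inj (e := e)).
by rewrite homD !adj_colift !cst_id.
Qed.
Next Obligation.
move=> p i k j l e ej el e' b g; have ij : i = j by lia. have kl : k = l by lia.
case: j / ij ej e' => ej e'; case: l / kl el e' => el e'.
rewrite !cst_id; apply: (adj_inj (e := el)).
rewrite mulr0 zsign0 adj_colift.
by rewrite [RHS](hom_act adj e' ej el e') mulr0 zsign0 adj_colift (act_irr e e').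
Qed.

Lemma dadj : cocyc adj.
Proof.
move=> k e; have ek : 1 = k by lia.
case: k / ek e => e; apply: hom_ext => i j ej F.
have f1 : i + 0 = i by lia. have f3 : i + 1 = j by lia. have f4 : j + 0 = j by lia.
rewrite (homdE e adj ej f3 f1 f3 f4) zsign0 hom0E.
have f2 : 0 + 1 = 1 :> int by lia. have f5 : i + 1 = j by lia. have f6 : j + 0 = j by lia. have f7 : i + 1 = j by [].
have -> : cd f3 (adj i i f1 F : DB i) = homd f3 (hcomp f1 cev (fh rho F)) by [].
rewrite (homd_comp f1 f3 f2 f3 f5 f4) dcev hcomp0l add0r zsign0.
by rewrite fh_d subrr.
Qed.

Lemma hinv_adj : hinv adj adjV.
Proof.
have e : 0 + 0 = 0 :> int by [].
have E1 : hcomp e adjV adj = hid (rho DM).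
  apply: hom_ext0 => i ei F; apply: (adj_inj (e := ei)).
  by rewrite (hcompE _ _ _ _ ei ei) hidE adj_colift cst_id.
have E2 : hcomp e adj adjV = hid DB.
  by apply: hom_ext0 => i ei g; rewrite (hcompE _ _ _ _ ei ei) hidE adj_colift cst_id.
exists e, e; split=> //; first exact: dadj.
move=> k ek; have ek' : 1 = k by lia.
case: k / ek' ek => ek; apply: hom_ext => i j ej g.
have f1 : i + 0 = i by lia. have f3 : i + 1 = j by lia. have f4 : j + 0 = j by lia.
rewrite (homdE ek adjV ej f3 f1 f3 f4) zsign0 hom0E.
have Ev l (el : l + 0 = l) (x : DB l) : adjV l l el x = colift x by rewrite /= cst_id.
apply: (adj_inj (e := f4)); rewrite [LHS]hfunB hfun0 !Ev adj_colift.
have := cocyc_cd dadj f1 f3 f3 f4 (colift g : rho DM i); rewrite zsign0 adj_colift => <-.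
by rewrite subrr.
Qed.

End Adjunct.
(** Under the adjunction between restriction and coinduction, biduality over [A] corresponds to
    biduality over [B]; this is what lets the local result be transferred. *)
Lemma adj_bid M i (e : i + 0 = i) (m : M i) :
  adj (Homdg M coind) i i e (bid coind M i i e m) =
  (ch (HomL I) (adj M) i i e (bid I (rho M) i i e m) : hom (rho (Homdg M coind)) I i).
Proof.
apply: hom_ext => n q eq F; have h : i + n = q by lia. have e' : n + 0 = n by lia.
have -> := adjE e (bid coind M i i e m : hom (Homdg M coind) coind i) eq F.
rewrite (bidE e m eq h) hom_zsignE (hpreE (N := I) (adj M) e (add0r i)) mul0r zsign0.
by rewrite (hcompE _ _ _ eq e' eq) (bidE e (m : rho M i) eq h) (adjE e' F h).
Qed.
End Coinduced.
End Restriction.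

(** * Transfer of duality along a ring over which [H^0(A)] is a quotient of a localization *)

Section Transfer.
Variables (B A : cdgRing) (phi : dgrHom B A) (S : B 0 -> Prop).
Hypothesis mS : mset S.
Local Notation A1 := (regMod A).
Hypothesis hU : forall s, S s -> exists a, isB (sc (M := A1) a (phi 0 s) - dunit A).
Hypothesis hF : forall a, exists s b, S s /\ isB (sc (M := A1) (phi 0 s) a - phi 0 b).
Implicit Types M N : dgMod A.

Lemma unit_sc N i s a (x : N i) : isB (sc (M := A1) a (phi 0 s) - dunit A) -> isZ x ->
  isB (sc a (sc (phi 0 s) x) - x).
Proof.
move=> h hx; have := scB_Z h hx; rewrite scBl sc1.
have E : sc (sc (M := A1) a (phi 0 s) : A 0) x = sc a (sc (phi 0 s) x) by apply: scM.
by rewrite E.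
Qed.

Lemma svan_unit N i : svan S (rho phi N) i -> van N i.
Proof.
move=> h x hx; have [s [Ss hs]] := h x hx; have [a ha] := hU Ss.
exact: isB_trans (isB_sym (unit_sc ha hx)) (sc_B a hs).
Qed.

Lemma common_denom n (c : 'I_n -> A 0) : exists s b, S s /\
  forall k, isB (sc (M := A1) (phi 0 s) (c k) - phi 0 (b k)).
Proof.
have H m : exists s, S s /\ forall k : 'I_n, (k < m)%N ->
    exists b, isB (sc (M := A1) (phi 0 s) (c k) - phi 0 b).
  elim: m => [|m [s [Ss hs]]]; first by exists (dunit B); split=> //; case: mS.
  have [mn|nm] := ltnP m n; last first.
    by exists s; split=> // k _; apply: hs; apply: leq_trans (ltn_ord k) nm.
  have [t [b [St ht]]] := hF (c (Ordinal mn)).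
  exists (dmul (add0r 0) s t); split=> [|k]; first exact: mS.2.
  have E u : sc (M := A1) (phi 0 (dmul (add0r 0) s t)) u = sc (M := A1) (phi 0 s) (sc (M := A1) (phi 0 t) u).
    by rewrite (dgrhM phi); apply: (scM (M := A1)).
  rewrite ltnS leq_eqVlt => /orP[/eqP km|km].
    exists (dmul (add0r 0) s b); rewrite E; have -> : k = Ordinal mn by apply: val_inj.
    rewrite (dgrhM phi) -[X in _ - X]/(sc (M := A1) (phi 0 s) (phi 0 b)) -scBr.
    exact: sc_B.
  have [b' hb'] := hs k km; exists (dmul (add0r 0) t b').
  rewrite E scC (dgrhM phi) -[X in _ - X]/(sc (M := A1) (phi 0 t) (phi 0 b')) -scBr.
  exact: sc_B.
have [s [Ss hs]] := H n; have [b hb] := choice (fun k => hs k (ltn_ord k)).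
by exists s, b.
Qed.

(** Coefficients from [A^0] become coefficients from [B^0] after a common denominator, by [hF]; in
    the other direction denominators are divided out by [hU]. *)
Lemma fg_rho N i : fgS S (rho phi N) i <-> fgS (@S1 A) N i.
Proof.
split=> [] [n [v [hv gv]]]; exists n, v; split=> // x hx; have [s [c [Ss hc]]] := gv x hx.
  have [a ha] := hU Ss; exists (dunit A), (fun k => sc (M := A1) a (phi 0 (c k))); split=> //.
  rewrite sc1 lcomb_M; apply: (isB_tr (isB_sym (unit_sc ha hx))).
  by rewrite -scBr; apply: sc_B.
rewrite Ss sc1 in hc; have [t [b [St hb]]] := common_denom c; exists t, b; split=> //.
apply: (isB_tr (y := sc (phi 0 t) (lcomb c v))).
  by rewrite -[sc t x]/(sc (phi 0 t) x) -scBr; apply: sc_B.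
rewrite -lcomb_M; exact: lcomb_B.
Qed.

Variables (I : dgMod B) (d : int) (j : hom (regMod B) I 0).
Hypothesis hN : noetherian (barRing B).
Hypothesis hd : (0 <= d)%R.
Hypothesis hB : forall i, fgS S (regMod B) i.
Hypothesis hI : forall (X : dgMod B) i,
  (forall k, (- i <= k)%R -> (k <= - i + d)%R -> svan S X k) -> van (Homdg X I) i.
Hypothesis dj : cocyc j.
Hypothesis hj : forall i, svan S (cone dj) i.

Local Notation R1 := (coind phi I).

Lemma coind_van M i : (forall k, (- i <= k)%R -> (k <= - i + d)%R -> van M k) ->
  van (Homdg M R1) i.
Proof.
move=> h; apply: (hinv_van (addr0 i) (hinv_sym (hinv_adj phi I M))).
by apply: hI => k h1 h2; apply: van_svan => //; apply: h.
Qed.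

Lemma coind_fg M i : (forall i, fgS (@S1 A) M i) -> fgS (@S1 A) (Homdg M R1) i.
Proof.
move=> gM; apply/fg_rho; have h := hinv_adj phi I M; have [h1 h2] := qi_hinv h i.
apply: (iffRL (fg_qi S (hinv_cocyc h) (addr0 i) h1 h2)).
by apply: (fg_dual hN mS hd hB hI hj) => k; apply/fg_rho.
Qed.

(** After restriction to [B], the biduality map is carried by two adjunction isomorphisms to the one
    already treated, and [svan_unit] removes the localization. *)
Lemma coind_bid M : (forall i, fgS (@S1 A) M i) -> qi (bid R1 M).
Proof.
move=> gM; apply/(qi_cone (@dbid A R1 M)) => i; apply: svan_unit.
have dr : cocyc (fh (rho phi) (bid R1 M)) by apply/fh_cocyc/dbid.
have h := hinv_cof (HomL I) (hinv_adj phi I M); rewrite zsign0 in h.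
pose w := hcomp (addr0 0) (ch (HomL I) (adjV phi I M)) (adj phi I (Homdg M R1)).
have dw : cocyc w.
  by apply: cocyc_hcomp; [apply: hinv_cocyc (hinv_sym h) | apply: hinv_cocyc (hinv_adj _ _ _)].
have qw : qi w.
  apply: qi_comp; [exact: hinv_cocyc (hinv_adj _ _ _) | exact: hinv_cocyc (hinv_sym h) | | ].
    exact: qi_hinv (hinv_adj _ _ _).
  exact: qi_hinv (hinv_sym h).
have := @svan_cone_qi B S d hd _ _ _ (fh (rho phi) (bid R1 M)) w (bid I (rho phi M)) dr (@dbid B I (rho phi M)) i dw qw.
apply=> [k l e e' e1 x|].
  have kl : k = l by lia.
  case: l / kl e' e1 => e' e1; rewrite (hcompE _ _ _ e1 e1 e1).
  rewrite [fh (rho phi) (bid R1 M) _ _ _ _](hfun_irr (bid R1 M) e' e1 (x : M k)) adj_bid.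
  by rewrite (hinvE _ _ _ h); apply: hfun_irr.
by apply: (svan_bid hN mS hd hB hI hj) => k; apply/fg_rho.
Qed.
End Transfer.

(** * Dualizing DG modules *)

Section FgModule.
Variable A : cdgRing.
Local Notation A1 := (regMod A).

Lemma cycZ (M : dgMod A) i (x : cyc M i) : isZ (val x).
Proof. by move=> k e; apply: cycP. Qed.

Definition cyc0 (a : A 0) : cyc A 0 := exist _ a (cocycleP (@A0_Z A a)).

Lemma hcls_lcomb (M : dgMod A) i n (c : 'I_n -> A 0) (v : 'I_n -> cyc M i) :
  \sum_k bcl (c k) *: (hcls (v k) : Hmod M i) = hcls (\sum_k cycact (cyc0 (c k)) (v k)).
Proof.
have h0 : hcls (0 : cyc M i) = 0 by apply: (addrI (hcls 0)); rewrite -hclsD !addr0.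
rewrite (big_morph _ (@hclsD M i) h0); apply: eq_bigr => k _.
exact: (hactE (cyc0 (c k)) (v k)).
Qed.

Lemma val_lcomb (M : dgMod A) i n (c : 'I_n -> A 0) (v : 'I_n -> cyc M i) :
  val (\sum_k cycact (cyc0 (c k)) (v k)) = lcomb c (fun k => val (v k)).
Proof. by rewrite (raddf_sum val). Qed.

Lemma fg_moduleP (M : dgMod A) i : fg_module (Hmod M i) <-> fgS (@S1 A) M i.
Proof.
split=> [[n [v gv]]|[n [v [hv gv]]]].
  exists n, (fun k => val (hrep (v k))); split=> [k|x hx]; first exact: cycZ.
  pose z : cyc M i := exist _ x (cocycleP hx).
  have [c hc] := gv (hcls z); have [a ha] := choice (fun k => bcl_surj (c k)).
  exists (dunit A), a; split=> //; rewrite sc1 -val_lcomb.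
  have /hclsP [j [e [u hu]]] : hcls z = hcls (\sum_k cycact (cyc0 (a k)) (hrep (v k))).
    rewrite hc -hcls_lcomb; apply: eq_bigr => k _; by rewrite ha hrepK.
  by exists j, e, u.
pose w k : cyc M i := exist _ (v k) (cocycleP (hv k)).
exists n, (fun k => hcls (w k) : Hmod M i) => x.
have [s [c [Ss hc]]] := gv _ (cycZ (hrep x)); rewrite Ss sc1 in hc.
exists (fun k => bcl (c k)); rewrite hcls_lcomb -[LHS]hrepK; apply/hclsP.
case: hc => j [e [u hu]]; exists j, e, u; by rewrite val_lcomb -hu.
Qed.
End FgModule.

(** * Finite injective dimension in terms of vanishing ranges *)

Section Injective.
Variable A : cdgRing.
Implicit Types M N T X : dgMod A.

Lemma vanP M i : van M i <-> forall x : coh M i, x = 0.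
Proof.
have h0 : hcls (0 : cyc M i) = 0 by apply: (addrI (hcls 0)); rewrite -hclsD !addr0.
split=> [h|h x hx].
  elim/hclsW => x; rewrite -h0; apply/hclsP; have [j [e [u hu]]] := h _ (cycZ x).
  by exists j, e, u; rewrite subr0.
have := h (hcls (exist _ x (cocycleP hx) : cyc M i)); rewrite -h0 => /hclsP [j [e [u hu]]].
by exists j, e, u; rewrite -hu /= subr0.
Qed.

Lemma nvanP M i : ~ van M i -> exists x : coh M i, x <> 0.
Proof. by move=> h; apply: contrapT => n; apply: h; apply/vanP => x; apply: contrapT => hx; apply: n; exists x. Qed.

Lemma con_in M i : ~ van M i -> con M i.
Proof. by move=> h I _; apply; apply: nvanP. Qed.

Lemma con_itv M : int_interval (con M).
Proof. by move=> x y z xy yz hx hz I hI hM; apply: (hI x y z) => //; [apply: hx | apply: hz]. Qed.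

Lemma con_sub M (I : int -> Prop) n : int_interval I -> (forall i, ~ I i -> van M i) -> con M n -> I n.
Proof.
move=> hI h; apply => // i [x hx]; apply: contrapT => /h /vanP /(_ x); exact: hx.
Qed.

Lemma injdim_of X (d0 d1 : int) : (d0 <= d1)%R ->
  (forall M i, (forall k, (- i + d0 <= k)%R -> (k <= - i + d1)%R -> van M k) ->
     van (Homdg (res M) X) i) -> finite_injdim X.
Proof.
move=> d01 h; exists d0, d1; split=> // M; exists (Homdg (res M) X).
  by apply/is_RHomP/sim_refl.
move=> n; apply: con_sub => [x y z xy yz [i [hi i1]] [k [hk k1]]|i ni].
  (* Convexity of [opp_shift]: a point lying after the window of [i] and before that of [k] belongs
     to the window of [d0 - y], an integer between [k] and [i]. *)
  have [y1|y1] := Order.TotalTheory.leP y (- i + d1); first by exists i; split=> //; lia.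
  have [y2|y2] := Order.TotalTheory.leP (- k + d0) y; first by exists k; split=> //; lia.
  by exists (d0 - y); split; [apply: (@con_itv M k _ i) => //; lia | lia].
apply: h => k k1 k2; apply: contrapT => /con_in hk; apply: ni; exists k; split=> //; lia.
Qed.

Lemma injdim_bounds X : finite_injdim X -> exists d0 d1 : int,
  (forall M a i, (forall k, (k < a)%R -> van M k) -> (- a + d1 < i)%R -> van (Homdg (res M) X) i) /\
  (forall M b i, below M b -> (i < - b + d0)%R -> van (Homdg (res M) X) i).
Proof.
move=> [d0 [d1 [_ h]]]; exists d0, d1.
have H M i (J : int -> Prop) : int_interval J -> (forall k, ~ J k -> van M k) ->
    (forall k, J k -> ~ (- k + d0 <= i <= - k + d1)%R) -> van (Homdg (res M) X) i.
  have [T /is_RHomP hT cT] := h M => iJ hJ hi; apply: (sim_van (sim_sym hT)).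
  by apply: contrapT => /con_in /cT [k [/(con_sub iJ hJ) /hi]].
split=> [M a i hM ai|M b i hM bi].
  apply: (H M i (fun k => (a <= k)%R)) => [x y z|k hk|k ak]; [lia | apply: hM; lia | lia].
apply: (H M i (fun k => (k <= b)%R)) => [x y z|k hk|k ak]; [lia | apply: hM; lia | lia].
Qed.
End Injective.

Section Homothety.
Variable A : cdgRing.
Local Notation A1 := (regMod A).
Implicit Types M N R P : dgMod A.

Lemma hfree_isB N n (y y' : N n) : isB (y - y') -> isB (X := Homdg A1 N) (hfree y - hfree y').
Proof.
case=> j [e [u hu]]; exists j, e, (hfree u).
have E : homd e (hfree u) = hfree (cd e u) by apply: homd_hfree.
rewrite [RHS](E : _ = _) -hu.
by apply: (homA_ext (e := add0r n)); rewrite homDE homNE !hfree1.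
Qed.

Lemma qi_unit (a b : A 0) : isB (X := A1) (dunit A - sc (M := A1) a b) -> qi (hfree (a : A1 0)).
Proof.
move=> hab.
have K i (x : A1 i) : isZ x -> isB (x - sc a (sc b x)).
  move=> hx; have := scB_Z hab hx; rewrite scBl sc1.
  by have -> : sc (sc (M := A1) a b : A 0) x = sc a (sc b x) by apply: scM.
have fE i j (e : i + 0 = j) (e' : i = j) (x : A1 i) : hfree (a : A1 0) i j e x = sc a (@cst A1 i j e' x).
  case: j / e' e => e; rewrite cst_id hfreeE mulr0 zsign0.
  by rewrite [LHS](dmulC (add0r i)) mul0r zsign0.
move=> i; split=> j e x hx; have ij : i = j by rewrite -e addr0.
  case: j / ij e => e; rewrite (fE _ _ e erefl) cst_id => hb.
  by apply: isB_trans (K _ _ hx) _; rewrite scC; apply: sc_B.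
case: j / ij e x hx => e x hx; exists (sc b x); split; first exact: sc_Z.
by rewrite (fE _ _ e erefl) cst_id; apply: K.
Qed.

(* If [phi] generates [H(Hom(P, R))] freely, write the resolution as [s = a phi] and [phi phi = b phi]; then [a b = 1] in [H^0(A)], so [s] generates too. *)
Lemma homothety_qi P R (s : hom P R 0) : Kp P -> cocyc s -> qi s ->
  sim A1 (Homdg P R) -> qi (hfree (s : Homdg P R 0)).
Proof.
move=> kP ds qs h; have [g [dg qg]] := sim_Kp_qi (good_reg A).1 h.
have e0 : 0 + 0 = 0 :> int by [].
pose phi : hom P R 0 := g 0 0 e0 (dunit A).
have gE (a : A 0) : g 0 0 e0 a = act e0 a (phi : Homdg P R 0).
  by rewrite (homA_eval g e0 e0) mulr0 zsign0.
have dphi : cocyc phi by apply: (cocyc_Z dg e0 (@A0_Z A (dunit A))).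
have [psi [dpsi hpsi]] := Kp_lift ds kP qs dphi.
have S0 f : cocyc f -> exists a : A 0, isB (X := Homdg P R) (f - act e0 a (phi : Homdg P R 0)).
  move=> df; have [_ hS] := qg 0; have [a [_ ha]] := hS 0 e0 (f : Homdg P R 0) df.
  by exists a; rewrite -gE.
have [a ha] := S0 s ds; have [b hb] := S0 _ (cocyc_hcomp (addr0 0) dphi dpsi).
have hab : isB (X := A1) (dunit A - sc (M := A1) a b).
  have [hI _] := qg 0; apply: (hI 0 e0); first exact: (@A0_Z A).
  rewrite hfunB !gE.
  have -> : act e0 (dunit A) (phi : Homdg P R 0) = phi :> Homdg P R 0 by apply: act1.
  apply: (isB_tr hpsi).
  have h1 : isB (X := Homdg P R) (hcomp (addr0 0) s psi - hcomp (addr0 0) (act e0 a (phi : Homdg P R 0) : hom P R 0) psi).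
    rewrite -hcompNl -hcompDl; exact: (isB_hcompr (addr0 0) dpsi ha).
  apply: (isB_tr h1).
  have -> : hcomp (addr0 0) (act e0 a (phi : Homdg P R 0) : hom P R 0) psi = act e0 a (hcomp (addr0 0) phi psi : Homdg P R 0) :> Homdg P R 0.
    by apply: (hcomp_homal psi e0 (addr0 0) (addr0 0) e0 a phi).
  have -> : act e0 (sc (M := A1) a b : A 0) (phi : Homdg P R 0) = act e0 a (act e0 b (phi : Homdg P R 0)) by apply: actA.
  by rewrite -actBr (scE a _ e0); apply: (sc_B a hb).
apply: (@qi_homo _ _ _ _ (hfree (act e0 a (phi : Homdg P R 0)))).
  by apply: hfree_isB; apply: isB_sym.
have -> : hfree (act e0 a (phi : Homdg P R 0)) = hcomp (addr0 0) g (hfree (a : A1 0)).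
  apply: (homA_ext (e := e0)); rewrite hfree1 (hcompE _ _ _ _ e0 e0) hfree1.
  by rewrite gE.
by apply: qi_comp => //; [apply/cocyc_hfree/(@A0_Z A) | apply: qi_unit hab].
Qed.

Lemma homof_homothety P R (s : dgHom P R) : homof (homothety s) = hfree (homof s : Homdg P R 0).
Proof.
apply: (homA_ext (e := add0r 0)); rewrite hfree1 homofE.
apply: hom_ext0 => i e x; rewrite homofE /=.
exact: act1.
Qed.

Definition adjoint_iso R := exists (P : dgMod A) (s : dgHom P R),
  [/\ K_projective P, quasi_iso s & d_isom (DOf (homothety s))].

(** By [homothety_qi] any isomorphism between [A] and [RHom(R, R)] forces the canonical one to be
    invertible. The condition thus becomes visibly invariant under isomorphism in [D(A)]. *)
Lemma adjoint_isoP R : adjoint_iso R <-> sim A1 (Homdg (res R) R).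
Proof.
have kR := (good_res R).1; split=> [[P [s [/KpP kP /quasi_isoP qs /d_isom_of /quasi_isoP]]]|h].
  have ds : cocyc (homof s) by move=> k e; apply: homd_homof.
  move=> q; apply: (sim_trans (N := Homdg P R)).
    by apply: sim_qi q => k e; apply: homd_homof.
  exact: sim_RHom kP (sim_qi ds qs).
exists (res R), (dres R); split; [exact/KpP | exact: quasi_iso_dres | ].
apply/d_isom_of/quasi_isoP; rewrite homof_homothety homof_dres.
exact: homothety_qi kR (dresf R) (qi_resf R) h.
Qed.
End Homothety.

Section TiltedBounds.
Variable A : cdgRing.
Local Notation A1 := (regMod A).
Implicit Types M N X Y P Q : dgMod A.

Lemma below_le X (b c : int) : (b <= c)%R -> below X b -> below X c.
Proof. by move=> bc h i ci; apply: h; lia. Qed.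

Lemma below_sim X Y b : sim X Y -> below X b -> below Y b.
Proof. by move=> s h i bi; apply: sim_van s _; apply: h. Qed.

(** The amplitude of [Hom(X, -)] is finite in both directions: from above because [X] is bounded,
    and from below because [Hom(X, T) = T (x) Y] with [Y] bounded. This controls the injective
    dimension of a tilted module. *)
Lemma tilt_local X Y (nX nY : int) M k : tpair X Y -> below X nX -> below Y nY ->
  (forall l, (k - nY <= l)%R -> (l <= k + nX)%R -> van M l) -> van (Homdg X M) k.
Proof.
(* With this [n] the truncated part tensored with [Y] is bounded by [n + nY = k - 1] and does not
   reach degree [k]. *)
move=> h hX hY hM; have [gX gY _] := h; pose n := k - nY - 1.
have dT := cocyc_sinc (trS M n); pose C := cone dT.
have st := striple_fun (HomR X) (st_cone dT).
have bT : below (tr M n) n by move=> i ni x _; rewrite (tr0 x ni); apply: isB0.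
suff : svan (@S1 A) (Homdg X M) k by move=> /svan1.
apply: (svan_left st (mset1 A) (addr0 k) (k := k)); rewrite ?addr0 //; apply/svan1.
  apply: (hom_above gX.1 hX) => l lk.
  have [ln|nl] := Order.TotalTheory.leP l n.
    apply: (conish_van dT (conish_cone dT) (erefl (l + 1)) (erefl (l + 1))); first exact: trI.
    exact: trQ.
  apply/svan1; apply: (svan_mid (st_cone dT) (mset1 A) (addr0 l) (erefl (l + 1))); apply/svan1.
    by apply: hM; lia.
  by apply: bT; lia.
apply: (sim_van (tpair_Hom (tr M n) h)).
apply: (sim_van (sim_tensl gY.2 (sim_res (tr M n)))).
apply: (tens_below (good_res _).1 gY.1 (b := n) (c := nY)) => //; last by rewrite /n; lia.
exact: below_sim (sim_sym (sim_res _)) bT.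
Qed.

Section NatHduo.
Variables (X Y : dgMod A) (ev : hom (tensor Y X) A1 0).
Hypothesis dev : cocyc ev.

Lemma nat_hduo N N' p (f : hom N N' p) :
  hcomp (addr0 p) (hduo ev N') (fh (TensL Y) f) = hcomp (add0r p) (fh (HomR X) f) (hduo ev N).
Proof.
apply: hom_ext => i j e z.
have f1 : j + 0 = j by lia. have f2 : i + 0 = i by lia.
rewrite (hcompE _ _ _ e e f1) (hcompE _ _ _ e f2 e).
apply: hom_ext => a c ec x.
have g1 : j + a = c by lia. have g2 : c + 0 = c by lia. have g3 : a + i = i + a by lia.
have g4 : i + a + p = c by lia. have g5 : i + a = i + a by []. have g6 : i + a + 0 = i + a by lia.
rewrite (hduoE ev f1 _ g1 ec g2) [fh (HomR X) f _ _ _ _](hpostE f e).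
rewrite (hcompE e f _ ec g3 g4) (hduoE ev f2 z g5 g3 g6).
have := congr1 (fun h : hom (tensor (tensor N Y) X) N' p => h (i + a) c g4 (pure (M := tensor N Y) g5 z x)) (tev_nat ev f).
move=> E; cbv beta in E; move: E; rewrite (hcompE _ (tev _ _) (thom X _) _ g4 g2) (hcompE _ f (tev _ _) _ g6 g4) => <-.
by rewrite (thomE (thom Y f) g4 g5 e g1).
Qed.

Definition hduofun : dgfun A A := @cfun A A (TensL Y) (HomR X) (hduo ev) (dhduo dev) nat_hduo.
End NatHduo.

(** For this evaluation the duality map at [A] is the resolution [W -> Hom(Q, A)] up to the unit
    isomorphism, so the starting case of the cell argument holds by construction. *)
Lemma hduo_reg Q (W := res (Homdg Q A1)) (ev : hom (tensor W Q) A1 0 := huncurry (resf (Homdg Q A1))) :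
  hduo ev A1 = hcomp (addr0 0) (resf (Homdg Q A1)) (uni W).
Proof.
apply: homT_ext => i j e a b e0 m w; have ij : i = j by lia.
case: j / ij e => e; apply: hom_ext => p q epq x.
have g1 : i + p = q by lia. have g2 : q + 0 = q by lia.
have g3 : b + p = b + p by []. have g4 : b + p + 0 = b + p by lia. have g5 : b + p + a = q by lia.
have g6 : b + 0 = b by lia. have g7 : p + b = b + p by lia. have g8 : a + (b + p) = q by lia.
rewrite (hduoE ev e _ g1 epq g2) (tevE ev g2 e0 g1 g3 g4 g5).
rewrite (huncurryE _ g4 g3 g6 g7) (hcompE _ _ _ _ e e) (uniE e e0 e0).
rewrite (hom_act (resf (Homdg Q A1)) e0 g6 e e0) mulr0 zsign0.
rewrite [RHS](homaE e0 m (resf (Homdg Q A1) b b g6 w : hom Q A1 b) epq g7 g8).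
by rewrite mulrC; apply/esym; apply: (dmulC g5 g8).
Qed.
End TiltedBounds.

(** * All dualizing modules from one duality *)

Section DualizingTheory.
Variables (A : cdgRing) (R1 : dgMod A) (d : int).
Local Notation A1 := (regMod A).
Implicit Types M N X Y P Q R : dgMod A.
Local Notation fg M := (forall i, fgS (@S1 A) M i).
Hypothesis hN : noetherian (barRing A).
Hypothesis hA : fg A1.
Hypothesis hd : (0 <= d)%R.
Hypothesis Ra : forall M i, (forall k, (- i <= k)%R -> (k <= - i + d)%R -> van M k) ->
  van (Homdg M R1) i.
Hypothesis Rb : forall M i, fg M -> fgS (@S1 A) (Homdg M R1) i.
Hypothesis Rc : forall M, fg M -> qi (bid R1 M).

Lemma dual_qi M N (f : hom M N 0) : cocyc f -> qi f -> qi (ch (HomL R1) f).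
Proof.
move=> df qf; apply: (@qi_cof_cone _ _ (HomL R1) _ _ _ df) => k.
by apply: Ra => l _ _; apply: (iffRL (qi_cone df) qf).
Qed.

Lemma sim_dual M N : sim M N -> sim (Homdg M R1) (Homdg N R1).
Proof.
move=> [P [f [g [df dg qf qg]]]].
apply: (sim_trans (N := Homdg P R1)).
  exact: sim_qi (ch_cocyc (HomL R1) df) (dual_qi df qf).
exact/sim_sym/(sim_qi (ch_cocyc (HomL R1) dg) (dual_qi dg qg)).
Qed.

Lemma fg_sim M N i : sim M N -> fgS (@S1 A) M i -> fgS (@S1 A) N i.
Proof.
move=> [P [f [g [df dg qf qg]]]] h; have [f1 f2] := qf i; have [g1 g2] := qg i.
apply/(fg_qi (@S1 A) dg (addr0 i) g1 g2).
by apply/(fg_qi (@S1 A) df (addr0 i) f1 f2).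
Qed.

Lemma bidual M : fg M -> sim M (Homdg (Homdg M R1) R1).
Proof. by move=> gM; apply: sim_qi (@dbid _ _ _) (Rc gM). Qed.

Lemma sim_RHom2 M M' N N' : sim M M' -> sim N N' -> sim (Homdg (res M) N) (Homdg (res M') N').
Proof.
move=> s t; apply: (sim_trans (N := Homdg (res M) N')).
  exact: sim_homR (good_res M).1 t.
by apply: sim_RHom (good_res M).1 _; apply: sim_trans (sim_res M) s.
Qed.

Lemma dual_reg : sim (Homdg A1 R1) R1. Proof. exact: sim_homA. Qed.

(** Biduality at [A], whose dual is [R1]. *)
Lemma adj_R1 : sim A1 (Homdg (res R1) R1).
Proof.
apply: (sim_trans (bidual hA)); apply: sim_dual.
exact: sim_trans dual_reg (sim_sym (sim_res _)).
Qed.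

(** Everything is read off from [X (x) R1 = Hom(Y, R1)]. Finiteness is that of the dual of [Y]; for
    the injective dimension, [Hom(M, Hom(Y, R1))] is the dual of [M (x) Y = Hom(X, M)], to which
    [tilt_local] applies. *)
Lemma dualizing_tilt X Y : tpair X Y -> dualizing (tensor X R1).
Proof.
move=> h; have h' := tpair_sym h; have [gX gY _] := h.
pose N := Homdg Y R1.
have sN : sim (tensor X R1) N.
  exact: sim_trans (sim_comm X R1) (tpair_Hom R1 h').
have [nX hX] := tpair_below h; have [nY hY] := tpair_below h'.
split.
- move=> i; apply/fg_moduleP; apply: (fg_sim (sim_sym sN)); apply: Rb => k.
  exact: tpair_fg h'.
(* The maximum with 0 guarantees [- c <= d + c]. *)
- pose c := Num.max 0 (Num.max nX nY).
  have hX' : below X c by apply: below_le hX; rewrite /c; lia.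
  have hY' : below Y c by apply: below_le hY; rewrite /c; lia.
  apply: (@injdim_of _ _ (- c) (d + c)); first by rewrite /c; lia.
  move=> M i hM; apply: (sim_van (sim_sym (sim_homR (good_res M).1 sN))).
  apply: (sim_van (sim_curry (res M) Y R1)); apply: Ra => k k1 k2.
  apply: (sim_van (sim_sym (tpair_Hom (res M) h))).
  apply: (tilt_local h hX' hY') => l l1 l2.
  by apply: (sim_van (sim_sym (sim_res M))); apply: hM; lia.
apply/adjoint_isoP; have gR := good_res R1.
have kXR : Kp (tensor X (res R1)) := Kp_tensor gX.1 gR.1.
have s1 : sim (tensor X (res R1)) (tensor X R1) := sim_tensr gX.2 (sim_res R1).
(* [Hom(X (x) R1, X (x) R1)] is unfolded to [Hom(R1, Hom(X, X (x) R1))], and the inner Hom is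
   [X (x) R1 (x) Y = R1]. *)
apply: (sim_trans adj_R1).
apply: (sim_trans (sim_homR gR.1 (sim_sym (sim_res R1)))).
apply: (sim_trans (N := Homdg (tensor X (res R1)) (tensor X R1))); last exact: sim_RHom.
apply: (sim_trans (N := Homdg (tensor X (res R1)) (tensor X (res R1)))); last exact: sim_homR.
apply: sim_sym; apply: (sim_trans (sim_comm_hom X (res R1) _)).
apply: (sim_trans (sim_curry (res R1) X _)).
apply: sim_homR gR.1 _.
apply: (sim_trans (N := tensor (tensor X (res R1)) Y)); first exact: sim_sym (tpair_Hom _ h).
apply: (sim_trans (sim_tensl gY.2 (sim_comm X (res R1)))).
apply: (sim_trans (sim_assoc (res R1) X Y)).
apply: (sim_trans (sim_tensr gR.2 (tpair_sim h))).
exact: sim_trans (sim_comm _ _) (sim_uni _).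
Qed.

Lemma dualizing_R1 : dualizing R1.
Proof.
split=> [i||]; last exact/adjoint_isoP/adj_R1.
  by apply/fg_moduleP; apply: fg_sim dual_reg _; apply: Rb.
apply: (@injdim_of _ _ 0 d hd) => M i hM; apply: Ra => k k1 k2.
by apply: (sim_van (sim_sym (sim_res M))); apply: hM; lia.
Qed.

Section Another.
Variable R : dgMod A.
Hypothesis hR : dualizing R.
Local Notation Q := (res (Homdg R R1)).

Lemma fg_dualizing : fg R.
Proof. by case: hR => h _ _ i; apply/fg_moduleP. Qed.

Lemma fg_Q : fg Q.
Proof. by move=> i; apply: (fg_sim (sim_sym (sim_res _))); apply: Rb; apply: fg_dualizing. Qed.

Lemma dual_Q : sim (Homdg Q R1) R.
Proof.
apply: (sim_trans (N := Homdg (Homdg R R1) R1)); first exact/sim_dual/sim_res.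
exact/sim_sym/bidual/fg_dualizing.
Qed.

(** Writing [D] for the duality, [Hom(DR, N) = Hom(DR, DDN) = Hom(DN, DDR) = Hom(DN, R)]: maps out
    of [Q] turn into maps into [R], where finite injective dimension can be used. *)
Lemma Hom_Q N : fg N -> sim (Homdg Q N) (Homdg (res (Homdg N R1)) R).
Proof.
move=> gN; have gQ := good_res (Homdg R R1); have gDN := good_res (Homdg N R1).
apply: (sim_trans (N := Homdg Q (Homdg (res (Homdg N R1)) R1))).
  apply: sim_homR gQ.1 _; apply: (sim_trans (bidual gN)).
  exact/sim_dual/sim_sym/sim_res.
apply: (sim_trans (sim_swap _ _ _)).
exact: sim_homR gDN.1 dual_Q.
Qed.

(** Finite injective dimension tested on [A] shows that [R] is bounded below, so its dual is bounded
    above. *)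
Lemma Q_below : exists b, below Q b.
Proof.
have [_ /injdim_bounds [d0 [d1 [_ h]]] _] := hR.
have vR i : (i < d0)%R -> van R i.
  move=> id; apply: (sim_van (sim_homA R)).
  apply: (sim_van (sim_homL R (good_res A1).1 (good_reg A).1 (sim_res A1))).
  apply: (h A1 0) => [k k0 x _|]; last by lia.
  by rewrite (dnonpos (c0 := A) k0 x); apply: isB0.
exists (d - d0) => i bi; apply: (sim_van (sim_sym (sim_res _))).
by apply: Ra => k k1 k2; apply: vR; lia.
Qed.

Lemma Hom_Q_below : exists c, forall N b, fg N -> below N b -> below (Homdg Q N) (b + c).
Proof.
have [_ /injdim_bounds [d0 [d1 [h _]]] _] := hR.
exists d1 => N b gN bN i bi; apply: (sim_van (sim_sym (Hom_Q gN))).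
apply: (h _ (- b)) => [k kb|]; last by lia.
by apply: Ra => l l1 l2; apply: bN; lia.
Qed.

(** With [W] resolving [Hom(Q, A)], the canonical map [N (x) W -> Hom(Q, N)] is shown to be a
    quasi-isomorphism at [N = Q]. Its target is then [Hom(Q, Q) = Hom(DQ, R) = RHom(R, R) = A]. *)
Lemma tpair_Q : tpair Q (res (Homdg Q A1)).
Proof.
set W := res (Homdg Q A1).
have gQ := good_res (Homdg R R1); have gW := good_res (Homdg Q A1).
pose ev : hom (tensor W Q) A1 0 := huncurry (resf (Homdg Q A1)).
have dev : cocyc ev by apply: huncurry_cocyc; apply: dresf.
have [c hc] := Hom_Q_below; have [b bQ] := Q_below.
have bA : below A1 0 by move=> i i0 x _; rewrite (dnonpos (c0 := A) i0 x); apply: isB0.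
have bW : below W c.
  apply: (below_sim (sim_sym (sim_res _))); have := hc A1 0 hA bA; by rewrite add0r.
pose T := hduofun dev.
have TA i : van (T A1) i.
  have : ac (cone (dhduo dev A1)); last exact.
  apply: (iffRL (qi_cone _)); rewrite hduo_reg.
  apply: qi_comp; [exact: hinv_cocyc (hinv_sym (hinv_uni _)) | exact: dresf | | exact: qi_resf].
  exact: qi_hinv (hinv_sym (hinv_uni _)).
have Tsh n i : van (T (sh n A1)) i.
  by apply: (hinv_van (i := i + n) _ (hinv_fun T (hinv_sh n A1))) => //; lia.
pose G X := fg X.
(* Source and target of the canonical map both vanish in degrees above [n + c], which is the bound
   the cell argument asks for; the case of a shift of [A] is [Tsh]. *)
have TN N n i : fg N -> below N n -> van (T N) i.
  move=> gN bN; apply/svan1; have {}bN : sbelow (@S1 A) N n by move=> k nk; apply/svan1/bN.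
  apply: (@cell_ind A (@S1 A) (mset1 A) G (fun X i => svan (@S1 A) (T X) i) c _ _ _ _ N n i gN bN) => {gN bN N n i}.
  - by move=> X n y hy gX k; apply: (fg_cell hN (mset1 A) hA).
  - by move=> X n gX _; apply: gX.
  - move=> X n y hy i gX hC; have st := striple_fun T (st_cone (datt hy)).
    apply: (svan_left st (mset1 A) (addr0 i) _ hC); first by rewrite addr0.
    exact/svan1/Tsh.
  move=> N n i gN bN ni; have {}bN : below N n by move=> k nk; apply/svan1/bN.
  apply: (svan_mid (st_cone (dhduo dev N)) (mset1 A) (addr0 i) (erefl (i + 1))); apply/svan1.
    by apply: (hc N n gN bN).
  apply: (sim_van (sim_tensl gW.2 (sim_res N))).
  apply: (tens_below (good_res _).1 gW.1 (b := n) (c := c)) => //; last by lia.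
  exact: below_sim (sim_sym (sim_res _)) bN.
apply: tpairP => //.
apply: (sim_trans (N := Homdg Q Q)).
  apply: (sim_qi (@dhduo _ _ _ ev dev Q)); apply/(qi_cone (dhduo dev Q)) => i.
  exact: TN fg_Q bQ.
apply: (sim_trans (Hom_Q fg_Q)).
have [_ _ /adjoint_isoP hh] := hR; apply: sim_trans (sim_sym hh).
exact: sim_RHom2 dual_Q (sim_refl _).
Qed.

Lemma dualizing_form : exists X Y, tpair X Y /\ sim (tensor X R1) R.
Proof.
exists (res (Homdg Q A1)), Q; split; first exact: tpair_sym tpair_Q.
apply: (sim_trans (sim_comm _ _)); apply: (sim_trans (tpair_Hom R1 tpair_Q)); exact: dual_Q.
Qed.

(** [Hom(R, Hom(Y, R))] is swapped to [Hom(Y, Hom(R, R)) = Hom(Y, A)], the inverse of [Y]. *)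
Lemma tpair_recover X Y : tpair X Y -> sim (Homdg (res R) (tensor X R)) X.
Proof.
move=> h; have h' := tpair_sym h; have [gX gY _] := h; have gR := good_res R.
apply: (sim_trans (N := Homdg (res R) (Homdg Y R))).
  by apply: sim_homR gR.1 _; apply: sim_trans (sim_comm X R) (tpair_Hom R h').
apply: (sim_trans (sim_swap _ _ _)).
have [_ _ /adjoint_isoP hh] := hR.
apply: (sim_trans (sim_homR gY.1 (sim_sym hh))).
apply: (sim_trans (sim_sym (tpair_Hom A1 h'))); exact: sim_uni.
Qed.
End Another.
End DualizingTheory.

(** * Localization and ideals of commutative rings *)

Section Localization.
Local Open Scope quotient_scope.
Variables (R : comPzRingType) (S J : R -> Prop).
Hypotheses (hS : mult_closed S) (hJ : is_ideal J).

Definition Sden : Type := {s : R | `[< S s >]}.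
HB.instance Definition _ := Choice.on Sden.
Lemma SdenP (s : Sden) : S (val s). Proof. exact/asboolP/(valP s). Qed.
Definition sden s (hs : S s) : Sden := exist _ s (asboolT hs).

(** The relation defining [S^-1 (R/J)]. One construction thus serves for localizations, quotients,
    and the local domains [(R/p)_q]. *)
Definition frel (x y : R * Sden) : bool :=
  `[< exists u, S u /\ J (u * (x.1 * val y.2 - y.1 * val x.2)) >].

Lemma J0 : J 0. Proof. by case: hJ. Qed.
Lemma JD x y : J x -> J y -> J (x + y). Proof. by case: hJ => _ h _; apply: h. Qed.
Lemma JM a x : J x -> J (a * x). Proof. by case: hJ => _ _; apply. Qed.
Lemma JN x : J x -> J (- x). Proof. by rewrite -mulN1r; apply: JM. Qed.

Lemma frel_equiv : equiv_class_of frel.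
Proof.
split.
- by move=> [r s]; apply/asboolP; exists 1; rewrite subrr mulr0; split; [case: hS | apply: J0].
- have sym x y : frel x y -> frel y x.
    move=> /asboolP[u [Su h]]; apply/asboolP; exists u; split=> //.
    by rewrite -opprB mulrN; apply: JN.
  by move=> x y; apply/idP/idP; apply: sym.
move=> [r' s'] [r s] [r'' s''] /asboolP[u [Su /= h]] /asboolP[v [Sv /= h']].
apply/asboolP; exists (val s' * u * v); split; first by do 2?apply: (hS.2) => //; apply: SdenP.
have -> : val s' * u * v * (r * val s'' - r'' * val s) =
   (v * val s'') * (u * (r * val s' - r' * val s)) + (u * val s) * (v * (r' * val s'' - r'' * val s')) by ring.
by apply: JD; apply: JM.
Qed.
Canonical frel_canon := EquivRelPack frel_equiv.

Definition loc : Type := {eq_quot frel_canon}.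
HB.instance Definition _ := Choice.on loc.

Definition frac r s (hs : S s) : loc := \pi_({eq_quot frel_canon}) (r, sden hs).
Definition frep (t : loc) : R * Sden := repr (t : {eq_quot frel_canon}).

Lemma fracP r s (hs : S s) r' s' (hs' : S s') :
  frac r hs = frac r' hs' <-> exists u, S u /\ J (u * (r * s' - r' * s)).
Proof. by split=> [/eqmodP/asboolP|h]; last apply/eqmodP/asboolP. Qed.

Lemma frepK t : frac (frep t).1 (SdenP (frep t).2) = t.
Proof.
rewrite -[RHS]reprK -/(frep t); case: (frep t) => r s /=.
rewrite /frac; congr \pi; congr pair; exact: val_inj.
Qed.

Lemma frac_ind (P : loc -> Prop) : (forall r s (hs : S s), P (frac r hs)) -> forall t, P t.
Proof. by move=> h t; rewrite -(frepK t). Qed.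

Definition loc_op (f : R -> R -> R -> R -> R) (x y : loc) : loc :=
  frac (f (frep x).1 (val (frep x).2) (frep y).1 (val (frep y).2))
    (hS.2 _ _ (SdenP (frep x).2) (SdenP (frep y).2)).

Lemma frac_rep r s (hs : S s) : exists u, S u /\ J (u * ((frep (frac r hs)).1 * s - r * val (frep (frac r hs)).2)).
Proof. exact: (iffLR (fracP _ (SdenP (frep (frac r hs)).2) _ hs) (frepK (frac r hs))). Qed.

Definition ladd := loc_op (fun r s r' s' => r * s' + r' * s).
Definition locmul := loc_op (fun r s r' s' => r * r').

Lemma laddE r s (hs : S s) r' s' (hs' : S s') :
  ladd (frac r hs) (frac r' hs') = frac (r * s' + r' * s) (hS.2 _ _ hs hs').
Proof.
have [u [Su hu]] := frac_rep r hs; have [v [Sv hv]] := frac_rep r' hs'.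
apply/fracP; exists (u * v); split; first exact: hS.2.
set p := frep (frac r hs) in hu *; set q := frep (frac r' hs') in hv *.
rewrite [X in J X](_ : _ = (v * s' * val q.2) * (u * (p.1 * s - r * val p.2)) + (u * s * val p.2) * (v * (q.1 * s' - r' * val q.2))); last by ring.
by apply: JD; apply: JM.
Qed.

Lemma lmulE' r s (hs : S s) r' s' (hs' : S s') :
  locmul (frac r hs) (frac r' hs') = frac (r * r') (hS.2 _ _ hs hs').
Proof.
have [u [Su hu]] := frac_rep r hs; have [v [Sv hv]] := frac_rep r' hs'.
apply/fracP; exists (u * v); split; first exact: hS.2.
set p := frep (frac r hs) in hu *; set q := frep (frac r' hs') in hv *.
rewrite [X in J X](_ : _ = (v * q.1 * s') * (u * (p.1 * s - r * val p.2)) + (u * r * val p.2) * (v * (q.1 * s' - r' * val q.2))); last by ring.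
by apply: JD; apply: JM.
Qed.

Definition linj (r : R) : loc := frac r hS.1.

Lemma frac_eq r s (hs : S s) r' s' (hs' : S s') : r * s' = r' * s -> frac r hs = frac r' hs'.
Proof. by move=> h; apply/fracP; exists 1; rewrite h subrr mulr0; split; [case: hS | apply: J0]. Qed.

Lemma laddA : associative ladd.
Proof.
elim/frac_ind=> r s hs; elim/frac_ind=> r' s' hs'; elim/frac_ind=> r'' s'' hs''.
by rewrite !laddE; apply: frac_eq; ring.
Qed.
Lemma laddC : commutative ladd.
Proof.
by elim/frac_ind=> r s hs; elim/frac_ind=> r' s' hs'; rewrite !laddE; apply: frac_eq; ring.
Qed.
Lemma ladd0 : left_id (linj 0) ladd.
Proof. by elim/frac_ind=> r s hs; rewrite laddE; apply: frac_eq; ring. Qed.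
Definition lopp (x : loc) : loc := locmul (linj (- 1)) x.
Lemma laddN : left_inverse (linj 0) lopp ladd.
Proof. by elim/frac_ind=> r s hs; rewrite /lopp lmulE' laddE; apply: frac_eq; ring. Qed.
HB.instance Definition _ := GRing.isZmodule.Build loc laddA laddC ladd0 laddN.

Lemma lmulA' : associative locmul.
Proof.
elim/frac_ind=> r s hs; elim/frac_ind=> r' s' hs'; elim/frac_ind=> r'' s'' hs''.
by rewrite !lmulE'; apply: frac_eq; ring.
Qed.
Lemma lmulC' : commutative locmul.
Proof.
by elim/frac_ind=> r s hs; elim/frac_ind=> r' s' hs'; rewrite !lmulE'; apply: frac_eq; ring.
Qed.
Lemma lmul1' : left_id (linj 1) locmul.
Proof. by elim/frac_ind=> r s hs; rewrite lmulE'; apply: frac_eq; ring. Qed.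
Lemma lmulDl' : left_distributive locmul ladd.
Proof.
elim/frac_ind=> r s hs; elim/frac_ind=> r' s' hs'; elim/frac_ind=> r'' s'' hs''.
by rewrite !(laddE, lmulE'); apply: frac_eq; ring.
Qed.
HB.instance Definition _ := GRing.Zmodule_isComPzRing.Build loc lmulA' lmulC' lmul1' lmulDl'.

Lemma linj_additive : zmod_morphism linj.
Proof.
move=> x y; have -> : linj x - linj y = ladd (linj x) (lopp (linj y)) by rewrite -[lopp _]/(- linj y).
by rewrite /lopp /linj lmulE' laddE; apply: frac_eq; ring.
Qed.
Lemma linj_mult : monoid_morphism linj.
Proof.
split=> // x y; have -> : linj x * linj y = locmul (linj x) (linj y) by [].
by rewrite /linj lmulE'; apply: frac_eq; ring.
Qed.
HB.instance Definition _ := GRing.isZmodMorphism.Build R loc linj linj_additive.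
HB.instance Definition _ := GRing.isMonoidMorphism.Build R loc linj linj_mult.

Lemma loc_frac (t : loc) : exists r s, S s /\ t * linj s = linj r.
Proof.
elim/frac_ind: t => r s hs; exists r, s; split=> //.
have -> : frac r hs * linj s = locmul (frac r hs) (linj s) by [].
by rewrite lmulE'; apply: frac_eq; ring.
Qed.

Lemma loc_unit s : S s -> exists t, linj s * t = 1.
Proof.
move=> hs; exists (frac 1 hs); have -> : linj s * frac 1 hs = locmul (linj s) (frac 1 hs) by [].
by rewrite lmulE'; apply: frac_eq; ring.
Qed.

Lemma loc0P r : linj r = 0 <-> exists s, S s /\ J (s * r).
Proof.
have -> : (0 : loc) = linj 0 by [].
by split=> [/fracP|] [s [Ss h]]; last apply/fracP; exists s; move: h; rewrite mul0r subr0 mulr1.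
Qed.
End Localization.

(** * Noetherian rings and the principal ideal theorem *)

Section Ideals.
Variable R : comPzRingType.
Implicit Types (I J P Q m : R -> Prop).

Lemma ideal0 I : is_ideal I -> I 0. Proof. by case. Qed.
Lemma idealD I x y : is_ideal I -> I x -> I y -> I (x + y). Proof. by case=> _ h _; apply: h. Qed.
Lemma idealM I a x : is_ideal I -> I x -> I (a * x). Proof. by case=> _ _; apply. Qed.
Lemma idealMr I a x : is_ideal I -> I x -> I (x * a). Proof. by rewrite mulrC; apply: idealM. Qed.
Lemma idealB I x y : is_ideal I -> I x -> I y -> I (x - y).
Proof. by move=> h hx hy; apply: (idealD h hx); rewrite -mulN1r; apply: idealM. Qed.
Lemma ideal_sum I n (f : 'I_n -> R) : is_ideal I -> (forall i, I (f i)) -> I (\sum_i f i).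
Proof. by move=> h hf; elim/big_ind: _ => // [|x y]; [apply: ideal0 | apply: idealD]. Qed.

Definition iadd I x : R -> Prop := fun z => exists a r, I a /\ z = a + r * x.

Lemma iadd_ideal I x : is_ideal I -> is_ideal (iadd I x).
Proof.
move=> h; split.
- by exists 0, 0; rewrite mul0r addr0; split=> //; apply: ideal0.
- move=> _ _ [a [r [Ia ->]]] [b [s [Ib ->]]]; exists (a + b), (r + s); split; first exact: idealD.
  by ring.
move=> c _ [a [r [Ia ->]]]; exists (c * a), (c * r); split; first exact: idealM.
by ring.
Qed.

Lemma iadd_l I x a : I a -> iadd I x a.
Proof. by move=> h; exists a, 0; rewrite mul0r addr0. Qed.

Lemma iadd_r I x : is_ideal I -> iadd I x x.
Proof. by move=> h; exists 0, 1; rewrite mul1r add0r; split=> //; apply: ideal0. Qed.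

Hypothesis hN : noetherian R.

(** Without a maximal member, choice produces a strictly increasing sequence of ideals; finitely
    many generators of its union already lie in one term. *)
Lemma noeth_max (F : (R -> Prop) -> Prop) : (forall I, F I -> is_ideal I) -> (exists I, F I) ->
  exists I, F I /\ forall J, F J -> (forall x, I x -> J x) -> forall x, J x -> I x.
Proof.
move=> hF [I0 FI0]; apply: contrapT => H.
pose T := {I : R -> Prop | F I}.
have step (I : T) : exists J : T, (forall x, sval I x -> sval J x) /\ exists x, sval J x /\ ~ sval I x.
  apply: contrapT => h; apply: H; exists (sval I); split; first exact: (proj2_sig I).
  move=> J FJ IJ x Jx; apply: contrapT => nIx; apply: h; exists (exist _ J FJ); split=> //.
  by exists x.
have [f hf] := choice step.
pose s n := iter n f (exist _ I0 FI0 : T).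
have sF n : is_ideal (sval (s n)) by apply: hF; exact: (proj2_sig (s n)).
have mono n k x : (n <= k)%N -> sval (s n) x -> sval (s k) x.
  move=> /subnK <-; elim: (k - n)%N => // l IH h; rewrite addSn; apply: (hf _).1; exact: IH.
pose U x := exists n, sval (s n) x.
have iU : is_ideal U.
  split; first by exists 0%N; apply: ideal0.
    move=> x y [n hx] [k hy]; exists (maxn n k); apply: (idealD (sF _)).
      exact: mono (leq_maxl _ _) hx.
    exact: mono (leq_maxr _ _) hy.
  by move=> a x [n hx]; exists n; apply: idealM.
have [k [v hv]] := hN iU.
have vU i : exists n, sval (s n) (v i).
  apply: (iffRL (hv (v i))); exists (fun j => (j == i)%:R).
  by rewrite (bigD1 i) //= eqxx mul1r big1 ?addr0 // => j /negbTE ->; rewrite mul0r.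
have [g hg] := choice vU.
have [x [hx nx]] := (hf (s (\max_i g i)%N)).2.
apply: nx; have /hv [c ->] : U x by exists (\max_i g i).+1.
apply: ideal_sum => // i; apply: idealM => //.
exact: mono (leq_bigmax i) (hg i).
Qed.

Lemma gens_in n (v : 'I_n -> R) I : generates v I -> forall i, I (v i).
Proof.
move=> hv i; apply/hv; exists (fun j => (j == i)%:R).
by rewrite (bigD1 i) //= eqxx mul1r big1 ?addr0 // => j /negbTE ->; rewrite mul0r.
Qed.

Lemma prime_above I : is_ideal I -> ~ I 1 -> exists P, prime_ideal P /\ forall x, I x -> P x.
Proof.
move=> iI I1; pose F J := [/\ is_ideal J, forall x, I x -> J x & ~ J 1].
have [P [[iP IP P1] mP]] : exists P, F P /\ forall J, F J -> (forall x, P x -> J x) -> forall x, J x -> P x.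
  by apply: noeth_max => [J []|] //; exists I.
exists P; split=> //; split=> // x y hxy.
have [hx|hx] := pselect (P x); [by left | right].
have [h1|h1] := pselect (iadd P x 1).
  case: h1 => a [r [Pa E]]; rewrite -[y]mul1r E mulrDl; apply: idealD => //; first exact: idealMr.
  by rewrite -mulrA; apply: idealM.
case: hx; apply: (mP (iadd P x)); last exact: iadd_r.
  by split=> //; [apply: iadd_ideal | move=> z /IP hz; apply: iadd_l].
by move=> z; apply: iadd_l.
Qed.

Definition isloc m := [/\ is_ideal m, ~ m 1 & forall y, m y \/ exists z, y * z = 1].

Lemma isloc_prime m : isloc m -> prime_ideal m.
Proof.
move=> [im m1 hm]; split=> // x y hxy; have [|[x' hx]] := hm x; [by left | right].
have -> : y = x' * (x * y) by rewrite mulrA [x' * x]mulrC hx mul1r.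
exact: idealM.
Qed.

Lemma isloc_sub m I : isloc m -> is_ideal I -> ~ I 1 -> forall x, I x -> m x.
Proof.
move=> [im m1 hm] iI I1 x Ix; have [//|[z hz]] := hm x.
by case: I1; rewrite -hz; apply: idealMr.
Qed.

(** Elimination instead of determinants: [1 - x c] is a unit for the coefficient [c] of the first
    generator in its own relation, so that generator is expressed through the others. *)
Lemma nakayama m x Q n (v : 'I_n -> R) : isloc m -> m x -> is_ideal Q ->
  (forall i, exists q c, Q q /\ v i = q + x * \sum_j c j * v j) -> forall i, Q (v i).
Proof.
move=> [im m1 hm] mx iQ; elim: n v => [|n IH] v hv; first by case.
pose w (i : 'I_n) := v (lift ord0 i).
have [q0 [c0 [Qq0 E0]]] := hv ord0.
have [u hu] : exists u, (1 - x * c0 ord0) * u = 1.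
  have [h|//] := hm (1 - x * c0 ord0); case: m1; rewrite -(subrK (x * c0 ord0) 1).
  by apply: idealD => //; apply: idealMr.
have E0' : v ord0 = u * q0 + x * \sum_j (u * c0 (lift ord0 j)) * w j.
  rewrite big_ord_recl in E0; have E1 : v ord0 * (1 - x * c0 ord0) = q0 + x * \sum_j c0 (lift ord0 j) * w j.
    by rewrite mulrBr mulr1 {1}E0 /w; ring.
  rewrite -[LHS]mulr1 -hu mulrA E1 mulrDl mulrC -!mulrA; congr (_ + x * _).
  by rewrite mulr_suml; apply: eq_bigr => j _; ring.
have Qw i : Q (w i).
  apply: IH => {i} i; have [q [c [Qq E]]] := hv (lift ord0 i).
  exists (q + x * c ord0 * u * q0), (fun j => c (lift ord0 j) + c ord0 * x * u * c0 (lift ord0 j)).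
  split; first by apply: idealD => //; apply: idealM.
  rewrite [LHS]E big_ord_recl E0' mulrDr mulrA [RHS](_ : _ = q + x * c ord0 * u * q0 + x * \sum_j (c (lift ord0 j) * w j + c ord0 * x * (u * c0 (lift ord0 j) * w j))).
    by rewrite big_split /= -mulr_sumr; ring.
  by congr (_ + x * _); apply: eq_bigr => j _; ring.
have Q0 : Q (v ord0).
  rewrite E0'; apply: idealD => //; first exact: idealM.
  by apply: idealM => //; apply: ideal_sum => // j; apply: idealM.
by move=> i; case: (unliftP ord0 i) => [j ->|->]; [apply: Qw | apply: Q0].
Qed.

Lemma nakayama_ideal m x Q I : isloc m -> m x -> is_ideal Q -> is_ideal I ->
  (forall a, I a -> exists q b, [/\ Q q, I b & a = q + x * b]) -> forall a, I a -> Q a.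
Proof.
move=> lm mx iQ iI h a Ia; have [n [v hv]] := hN iI.
have Qv : forall i, Q (v i).
  apply: (nakayama lm mx iQ) => i; have [q [b [Qq /hv [c ->] E]]] := h _ (gens_in hv i).
  by exists q, c.
by have /hv [c ->] := Ia; apply: ideal_sum => // i; apply: idealM.
Qed.

Definition desc (a : nat -> R -> Prop) := forall n, is_ideal (a n) /\ forall y, a n.+1 y -> a n y.
Definition stab (a : nat -> R -> Prop) := exists n, forall k, (n <= k)%N -> forall y, a n y -> a k y.

Lemma desc_le a n k : desc a -> (n <= k)%N -> forall y, a k y -> a n y.
Proof. by move=> h /subnK <-; elim: (k - n)%N => // l IH y; rewrite addSn => /(h _).2; apply: IH. Qed.

(** The ring modulo [x] is artinian. Take [b] containing [x] and maximal among the ideals above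
    which some descending chain does not stabilize. Such a [b] is prime, since a chain stabilizes as
    soon as its sums with [(y)] and its colon ideals by [y] do. Hence [b] contains [m], and above
    [m] every chain stabilizes. *)
Lemma local_dcc m x a : isloc m -> (forall P, prime_ideal P -> P x -> forall y, m y -> P y) ->
  desc a -> (forall n, a n x) -> stab a.
Proof.
move=> lm hm; move: a.
pose D (b : R -> Prop) := forall a, desc a -> (forall n y, b y -> a n y) -> stab a.
suff Dx : D (iadd (fun z => z = 0) x).
  move=> a da ax; apply: Dx => // n _ [_ [r [-> ->]]]; rewrite add0r; apply: idealM => //; exact: (da n).1.
apply: contrapT => nD; pose F b := [/\ is_ideal b, b x & ~ D b].
have i0 : is_ideal (fun z : R => z = 0).
  by split=> // [x' y -> ->|r y ->]; rewrite ?addr0 ?mulr0.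
have [b [[ib bx nb] mb]] : exists P, F P /\ forall J, F J -> (forall x, P x -> J x) -> forall x, J x -> P x.
  apply: noeth_max => [J []|] //; exists (iadd (fun z => z = 0) x).
  by split=> //; [apply: iadd_ideal | apply: iadd_r].
have big c z : is_ideal c -> (forall y, b y -> c y) -> c z -> ~ b z -> D c.
  move=> ic bc cz nz; apply: contrapT => nc; apply: nz; apply: (mb c) => //.
  by split=> //; apply: bc.
have pb : prime_ideal b.
  split=> //.
    move=> b1; apply: nb => a da ba; exists 0%N => k _ y _; apply: ba.
    by rewrite -[y]mulr1; apply: idealM.
  move=> y z byz; apply: contrapT => h.
  have ny : ~ b y by move=> ?; apply: h; left. have nz : ~ b z by move=> ?; apply: h; right.
  apply: nb => a da ba.
  have [n1 h1] : stab (fun n => iadd (a n) y).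
    apply: (big (iadd b y) y) => //; [exact: iadd_ideal | by move=> w; apply: iadd_l | exact: iadd_r | | ].
      move=> n; split; first by apply/iadd_ideal/(da n).1.
      by move=> _ [w [r [aw ->]]]; exists w, r; split=> //; apply: (da n).2.
    by move=> n _ [w [r [bw ->]]]; exists w, r; split=> //; apply: ba.
  have [n2 h2] : stab (fun n w => a n (y * w)).
    have ic c : is_ideal c -> is_ideal (fun w => c (y * w)).
      move=> ic; split=> [|u w hu hw|r w hw]; first by rewrite mulr0; apply: ideal0.
        by rewrite mulrDr; apply: idealD.
      by rewrite mulrCA; apply: idealM.
    apply: (big (fun w => b (y * w)) z) => //; [exact: ic | by move=> w; apply: idealM | | ].
      by move=> n; split; [apply/ic/(da n).1 | move=> w; apply: (da n).2].
    by move=> n w; apply: ba.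
  exists (maxn n1 n2) => k nk w aw.
  have [n1k n2k] : (n1 <= k)%N /\ (n2 <= k)%N by move: nk; rewrite geq_max => /andP.
  have aw1 := desc_le da (leq_maxl n1 n2) aw.
  have [w' [r [aw' E]]] := h1 k n1k w (iadd_l y aw1); rewrite E; apply: (idealD (da k).1 aw').
  rewrite mulrC; apply: h2 => //; rewrite mulrC.
  have -> : r * y = w - w' by rewrite E addrAC subrr add0r.
  apply: idealB (da _).1 _ _; first by apply: (desc_le da (leq_maxr n1 n2)).
  by apply: (desc_le da n2k).
have mb' := hm b pb bx; apply: nb => a da ba.
have [[n na]|h] := pselect (exists n, ~ a n 1).
  by exists n => k _ y /(isloc_sub lm (da n).1 na) /mb'; apply: ba.
exists 0%N => k _ y _; rewrite -[y]mulr1; apply: idealM (da k).1 _.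
by apply: contrapT => nk; apply: h; exists k.
Qed.

(* Krull's principal ideal theorem: the ideals [y^n R_q \cap R + (x)] stabilize, Nakayama removes [(x)], so [s y^n = r y^(n+1)] with [s] outside [q]. *)
Lemma principal_ideal_thm m x q y : isloc m -> m x ->
  (forall P, prime_ideal P -> P x -> forall y, m y -> P y) ->
  (forall a b : R, a * b = 0 -> a = 0 \/ b = 0) ->
  prime_ideal q -> ~ q x -> q y -> y = 0.
Proof.
move=> lm mx hm dom [iq q1 pq] nqx qy.
pose Q n a := exists s r, ~ q s /\ s * a = r * y ^+ n.
have qM s t : ~ q s -> ~ q t -> ~ q (s * t) by move=> ns nt /pq [].
have iQ n : is_ideal (Q n).
  split=> [|a b [s [r [qs E]]] [s' [r' [qs' E']]]|c a [s [r [qs E]]]].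
  - by exists 1, 0; rewrite mulr0 mul0r.
  - exists (s * s'), (s' * r + s * r'); split; first exact: qM.
    by rewrite mulrDr mulrDl -!mulrA -E -E'; ring.
  by exists s, (c * r); rewrite -mulrA -E; split=> //; ring.
have [n hn] : stab (fun n => iadd (Q n) x).
  apply: (local_dcc lm hm) => [n|n]; last exact: iadd_r.
  split; first exact: iadd_ideal.
  move=> _ [a [r [[s [t [qs E]]] ->]]]; exists a, r; split=> //.
  by exists s, (t * y); rewrite -mulrA -exprS.
have : Q n.+1 (y ^+ n).
  apply: (nakayama_ideal lm mx (iQ n.+1) (iQ n)); last by exists 1, 1.
  move=> a Qa; have [a' [r [Qa' E]]] := hn n.+1 (leqnSn n) a (iadd_l x Qa).
  exists a', r; split=> //; last by rewrite E mulrC.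
  case: Qa' => s [t [qs Es]]; case: Qa => s' [t' [qs' Es']].
  exists (s * s' * x), (s * t' - s' * t * y); split; first by apply: (qM) => //; apply: (qM).
  have -> : s * s' * x * r = s * (s' * a) - s' * (s * a') by rewrite E; ring.
  by rewrite Es Es' exprS; ring.
move=> [s [r [qs E]]].
have : y ^+ n * (s - r * y) = 0.
  by rewrite mulrBr [y ^+ n * s]mulrC E exprS; ring.
move=> /dom [|/eqP]; last by rewrite subr_eq0 => /eqP h; case: qs; rewrite h; apply: idealM.
elim: n {hn E} => [|n IH]; first by rewrite expr0 => h; case: q1; rewrite h; apply: ideal0.
by rewrite exprS => /dom [].
Qed.
End Ideals.

Section LocalizationTheory.
Variables (R T : comPzRingType) (p : {rmorphism R -> T}) (S J : R -> Prop).
Hypotheses (hS : mult_closed S).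
Hypothesis T1 : forall t, exists r s, S s /\ t * p s = p r.
Hypothesis T2 : forall s, S s -> exists t, p s * t = 1.
Hypothesis T3 : forall r, p r = 0 <-> exists s, S s /\ J (s * r).

Lemma noetherian_loc : noetherian R -> noetherian T.
Proof.
move=> hN I iI; have iI' : is_ideal (fun r => I (p r)).
  split=> [|x y hx hy|a x hx]; rewrite ?rmorph0 ?rmorphD ?rmorphM; [exact: ideal0 | exact: idealD | exact: idealM].
have [n [v hv]] := hN _ iI'; exists n, (p \o v) => t; split=> [It|[c ->]].
  have [r [s [Ss E]]] := T1 t; have [u hu] := T2 Ss.
  have /hv [c Er] : I (p r) by rewrite -E mulrC; apply: idealM.
  exists (fun i => u * p (c i)); have -> : t = u * p r by rewrite -E mulrCA [u * _]mulrC hu mulr1.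
  by rewrite Er rmorph_sum mulr_sumr; apply: eq_bigr => i _; rewrite rmorphM mulrA.
apply: ideal_sum => // i; apply: idealM => //; apply: (gens_in hv).
Qed.

Definition ext (q : R -> Prop) : T -> Prop := fun t => exists r s, [/\ q r, S s & t * p s = p r].

Section Prime.
Variable q : R -> Prop.
Hypotheses (pq : prime_ideal q) (Jq : forall r, J r -> q r) (Sq : forall s, S s -> ~ q s).

Lemma ext_pi r : ext q (p r) <-> q r.
Proof.
have [iq q1 pq'] := pq; split=> [[r' [s [qr' Ss E]]]|h].
  have /T3 [u [Su /Jq]] : p (r * s - r') = 0 by rewrite rmorphB rmorphM E subrr.
  move=> /pq' [/(Sq Su)//|h].
  have /pq' [//|/(Sq Ss)//] : q (r * s) by rewrite -(subrK r' (r * s)); apply: idealD.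
by exists r, 1; split=> //; [case: hS | rewrite rmorph1 mulr1].
Qed.

Lemma ext_prime : prime_ideal (ext q).
Proof.
have [iq q1 pq'] := pq; have [S1' SM] := hS; split.
- split.
  + by exists 0, 1; rewrite mul0r rmorph0; split=> //; apply: ideal0.
  + move=> t t' [r [s [qr Ss E]]] [r' [s' [qr' Ss' E']]].
    exists (r * s' + r' * s), (s * s'); split; [by apply: idealD => //; apply: idealMr | exact: SM | ].
    by rewrite rmorphD !rmorphM -E -E'; ring.
  move=> a t [r [s [qr Ss E]]]; have [r' [s' [Ss' E']]] := T1 a.
  exists (r' * r), (s' * s); split; [exact: idealM | exact: SM | ].
  by rewrite !rmorphM -E -E'; ring.
- by rewrite -(rmorph1 p) ext_pi.
move=> x y; have [r [s [Ss E]]] := T1 x; have [r' [s' [Ss' E']]] := T1 y.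
move=> [r2 [s2 [qr2 Ss2 E2]]].
have : ext q (p (r * r')).
  exists (s * s' * r2), s2; split=> //; first exact: idealM.
  by rewrite !rmorphM -E2 -E -E'; ring.
by rewrite ext_pi => /pq' [h|h]; [left; exists r, s | right; exists r', s'].
Qed.
End Prime.

Lemma pull_prime (P : T -> Prop) : prime_ideal P -> prime_ideal (fun r => P (p r)).
Proof.
move=> [iP P1 pP]; split; last by move=> x y; rewrite rmorphM => /pP.
  split=> [|x y hx hy|a x hx]; rewrite ?rmorph0 ?rmorphD ?rmorphM; [exact: ideal0 | exact: idealD | exact: idealM].
by rewrite rmorph1.
Qed.
End LocalizationTheory.

(** * Regular local rings *)

Section ChainExchange.
Variable R : comPzRingType.
Hypothesis hN : noetherian R.
Implicit Types (p q m : R -> Prop).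

Lemma zero_ideal : is_ideal (fun r : R => r = 0).
Proof. by split=> // [x y -> ->|r y ->]; rewrite ?addr0 ?mulr0. Qed.

Lemma prime_compl q : prime_ideal q -> mult_closed (fun s => ~ q s).
Proof. by move=> [_ q1 pq]; split=> // s t ns nt /pq []. Qed.

(** In the local domain [(R/p)_q], if no prime lies strictly between [p] and [q] and contains [x],
    the maximal ideal is minimal over [x]. The principal ideal theorem then makes [q'] vanish there,
    contrary to [y]. *)
Lemma exchange p q' q x y z : prime_ideal p -> prime_ideal q' -> prime_ideal q ->
  (forall r, p r -> q' r) -> (forall r, q' r -> q r) -> q' y -> ~ p y -> q z -> ~ q' z -> q x ->
  exists q'', [/\ prime_ideal q'', forall r, p r -> q'' r, forall r, q'' r -> q r,
    exists y, q'' y /\ ~ p y & (exists z, q z /\ ~ q'' z) /\ q'' x].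
Proof.
move=> Pp Pq' Pq pq' q'q q'y npy qz nq'z qx.
have [q'x|nq'x] := pselect (q' x).
  by exists q'; split=> //; [exists y | split=> //; exists z].
have [ip p1 pp] := Pp; have [iq q1 pq] := Pq; have hS := prime_compl Pq.
pose T := loc hS ip; pose pi : {rmorphism R -> T} := linj hS ip.
have T1 := loc_frac (hS := hS) (hJ := ip) : forall t : T, exists r s, ~ q s /\ t * pi s = pi r.
have T2 s : ~ q s -> exists t, pi s * t = 1 := @loc_unit _ _ _ hS ip s.
have T3 r : pi r = 0 <-> exists s, ~ q s /\ p (s * r) := loc0P hS ip r.
have Jq r : p r -> q r by move=> /pq' /q'q.
have nS s : ~ q s -> ~ q s by [].
have Pm := ext_prime hS T1 T3 Pq Jq nS.
have lm : isloc (ext pi (fun s => ~ q s) q).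
  case: Pm => im m1 _; split=> // t; have [r [s [Ss E]]] := T1 t.
  have [qr|nqr] := pselect (q r); [by left; exists r, s | right].
  by have [u hu] := T2 r nqr; exists (pi s * u); rewrite mulrA E.
apply: contrapT => H.
have : pi y = 0.
  apply: (principal_ideal_thm (noetherian_loc T1 T2 hN) lm (x := pi x) (q := ext pi (fun s => ~ q s) q')).
  - by apply/(ext_pi hS T3 Pq Jq nS).
  - move=> P PP Px; have PP' := pull_prime pi PP; have [iP P1 pP] := PP.
    have Pu s : ~ q s -> ~ P (pi s).
      by move=> ns hs; have [u hu] := T2 s ns; apply: P1; rewrite -hu; apply: idealMr.
    have sub r : q r -> P (pi r).
      move=> qr; apply: contrapT => nr; apply: H; exists (fun r => P (pi r)); split=> //.
      + move=> r' pr'; have -> : pi r' = 0 by apply/T3; exists 1; rewrite mul1r.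
        exact: ideal0.
      + by move=> r' Pr'; apply: contrapT => /Pu.
      + by exists x; split=> // /pq'.
      by split=> //; exists r.
    move=> t [r [s [qr ns E]]]; have /pP [//|/(Pu s ns)//] : P (t * pi s) by rewrite E; apply: sub.
  - move=> a b ab; have [r [s [Ss E]]] := T1 a; have [r' [s' [Ss' E']]] := T1 b.
    have z0 c t w : ~ q w -> c * pi w = pi t -> p t -> c = 0.
      move=> nw Ec pt; have [u hu] := T2 w nw; rewrite -[c]mulr1 -hu mulrA Ec.
      by have -> : pi t = 0; [apply/T3; exists 1; rewrite mul1r | rewrite mul0r].
    have /T3 [u [nu /pp [pu|/pp [pr|pr]]]] : pi (r * r') = 0.
      by rewrite rmorphM -E -E' mulrACA ab mul0r.
    + by case: nu; apply: Jq.
    + by left; apply: z0 Ss E pr.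
    by right; apply: z0 Ss' E' pr.
  - by apply: (ext_prime hS T1 T3 Pq') => // s ns /q'q.
  - by rewrite (ext_pi hS T3 Pq') // => s ns /q'q.
  by apply/(ext_pi hS T3 Pq') => // s ns /q'q.
by move=> /T3 [s [ns /pp [ps|//]]]; apply: ns; apply: Jq.
Qed.

(** Exchange moves [x] down the chain one prime at a time without changing the length, so that
    dividing by [x] shortens the chain by one only. *)
Lemma chain_exchange d (p : nat -> R -> Prop) x : prime_chain d p -> (0 < d)%N -> p d x ->
  exists p' : nat -> R -> Prop, [/\ prime_chain d p', forall r, p' d r <-> p d r & p' 1%N x].
Proof.
move=> hp d0; suff H j : (0 < j <= d)%N -> forall p : nat -> R -> Prop, prime_chain d p -> p j x ->
    exists p' : nat -> R -> Prop, [/\ prime_chain d p', forall r, p' d r <-> p d r & p' 1%N x].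
  by move=> h; apply: (H d) => //; rewrite d0 leqnn.
elim: j => // j IH; case: j IH => [|j] IH /andP[_ jd] {hp} {}p hp px; first by exists p.
have [hP hC] := hp.
have j1 : (j < d)%N by apply: leq_trans jd.
have [c1 [y [y1 y2]]] := hC j j1; have [c2 [z [z1 z2]]] := hC j.+1 jd.
have [q [Pq s1 s2 [y' [ny1 ny2]] [[z' [nz1 nz2]] qx]]] :=
  exchange (hP _ (ltnW j1)) (hP _ j1) (hP _ jd) c1 c2 y1 y2 z1 z2 px.
pose p2 i := if i == j.+1 then q else p i.
have [p' [hp' top hx]] : exists p' : nat -> R -> Prop, [/\ prime_chain d p', forall r, p' d r <-> p2 d r & p' 1%N x].
  apply: IH => //; last by rewrite /p2 eqxx.
  split=> [i id|i id]; first by rewrite /p2; case: eqP => // _; apply: hP.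
  rewrite /p2; case: (i =P j.+1) => [->|ni].
    by rewrite gtn_eqF //; split=> //; exists z'.
  rewrite eqSS; case: (i =P j) => [->|_]; last exact: hC.
  by split=> //; exists y'.
exists p'; split=> // r; rewrite top /p2 gtn_eqF //.
Qed.

Lemma chain_top m d (p : nat -> R -> Prop) : isloc m -> prime_chain d p ->
  exists p' : nat -> R -> Prop, prime_chain d p' /\ forall r, p' d r <-> m r.
Proof.
move=> lm [hP hC]; exists (fun i => if i == d then m else p i); split; last by rewrite eqxx.
split=> [i id|i id]; first by case: eqP => _; [apply: isloc_prime | apply: hP].
rewrite (ltn_eqF id); case: eqP => [E|_]; last exact: hC.
have sub r : p i.+1 r -> m r by have [ip p1 _] := hP _ id; apply: isloc_sub.
have [h [y [y1 y2]]] := hC i id; split=> [r /h /sub //|].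
by exists y; split=> //; apply: sub.
Qed.
End ChainExchange.

(** Primes containing the first generator are those of the quotient, so a chain above it descends at
    full length while the maximal ideal loses a generator. *)
Lemma quot_step (R : comPzRingType) (m : R -> Prop) k (v : 'I_k.+1 -> R) :
  noetherian R -> isloc m -> generates v m ->
  exists (T : comPzRingType) (pi : {rmorphism R -> T}),
  [/\ forall t, exists r, t = pi r, forall r, pi r = 0 <-> exists a, r = a * v ord0, noetherian T &
   exists m' (w : 'I_k -> T), [/\ isloc m', generates w m' &
     forall d p, prime_chain d p -> p 0%N (v ord0) ->
     exists p', prime_chain d p' /\ forall i r, (i <= d)%N -> p' i (pi r) <-> p i r]].
Proof.
move=> hN lm hv; pose S := fun s : R => s = 1; pose J r := exists a, r = a * v ord0.
have hS : mult_closed S by split=> // s t -> ->; rewrite mulr1.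
have hJ : is_ideal J.
  split=> [|_ _ [a ->] [b ->]|c _ [a ->]]; first by exists 0; rewrite mul0r.
    by exists (a + b); rewrite mulrDl.
  by exists (c * a); rewrite mulrA.
pose T := loc hS hJ; pose pi : {rmorphism R -> T} := linj hS hJ.
have T1 := loc_frac (hS := hS) (hJ := hJ) : forall t : T, exists r s, S s /\ t * pi s = pi r.
have T2 s : S s -> exists t, pi s * t = 1 := @loc_unit _ _ _ hS hJ s.
have T3 r : pi r = 0 <-> exists s, S s /\ J (s * r) := loc0P hS hJ r.
have surj t : exists r, t = pi r.
  by have [r [s [-> E]]] := T1 t; exists r; rewrite -E rmorph1 mulr1.
have mv := gens_in hv; have [im m1 hm] := lm.
have Jm r : J r -> m r by move=> [a ->]; apply: idealM.
have Sp (q : R -> Prop) : prime_ideal q -> forall s, S s -> ~ q s by move=> [_ q1 _] s ->.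
have Pm := isloc_prime lm.
exists T, pi; split=> //; [| exact: noetherian_loc T1 T2 hN | ].
  move=> r; rewrite T3; split=> [[s [-> [a E]]]|[a ->]]; first by exists a; rewrite -E mul1r.
  by exists 1; split=> //; exists a; rewrite mul1r.
exists (ext pi S m), (fun i => pi (v (lift ord0 i))); split.
- case: (ext_prime hS T1 T3 Pm Jm (Sp m Pm)) => h1 h2 _; split=> // t; have [r ->] := surj t.
  have [mr|[z hz]] := hm r; first by left; apply/(ext_pi hS T3 Pm Jm (Sp m Pm)).
  by right; exists (pi z); rewrite -rmorphM hz rmorph1.
- move=> t; have [r ->] := surj t; rewrite (ext_pi hS T3 Pm Jm (Sp m Pm)) hv.
  have v0 : pi (v ord0) = 0 by apply/T3; exists 1; split=> //; exists 1.
  split=> [[c ->]|[c E]].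
    exists (fun i => pi (c (lift ord0 i))); rewrite rmorph_sum big_ord_recl rmorphM v0 mulr0 add0r.
    by apply: eq_bigr => i _; rewrite rmorphM.
  have [c' hc'] := choice (fun i => surj (c i)).
  have /T3 [s [-> [a]]] : pi (r - \sum_i c' i * v (lift ord0 i)) = 0.
    by rewrite rmorphB E rmorph_sum; apply/eqP; rewrite subr_eq0; apply/eqP/eq_bigr => i _; rewrite rmorphM hc'.
  rewrite mul1r => /eqP; rewrite subr_eq => /eqP ->.
  exists (fun i => if unlift ord0 i is Some j then c' j else a).
  rewrite big_ord_recl unlift_none; congr (_ + _).
  by apply: eq_bigr => i _; rewrite liftK.
move=> d p [hP hC] p0.
have Jp i : (i <= d)%N -> forall r, J r -> p i r.
  elim: i => [|i IH] id r Jr.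
    by case: Jr => a ->; have [ip _ _] := hP 0%N id; apply: idealM.
  by apply: (hC i id).1; apply: IH => //; apply: ltnW.
have E i r : (i <= d)%N -> ext pi S (p i) (pi r) <-> p i r.
  by move=> id; apply: (ext_pi hS T3 (hP i id) (Jp i id) (Sp _ (hP i id))).
exists (fun i => ext pi S (p i)); split=> //; split=> [i id|i id].
  exact: (ext_prime hS T1 T3 (hP i id) (Jp i id) (Sp _ (hP i id))).
have [h1 [y [y1 y2]]] := hC i id; split=> [t|].
  by have [r ->] := surj t; rewrite !E //; [apply: h1 | apply: ltnW].
by exists (pi y); rewrite !E //; apply: ltnW.
Qed.

Lemma chain_shift (R : comPzRingType) d (p : nat -> R -> Prop) :
  prime_chain d.+1 p -> prime_chain d (fun i => p i.+1).
Proof. by move=> [hP hC]; split=> [i id|i id]; [apply: hP | apply: hC]. Qed.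

(** Exchange places the first generator in the second prime; without its first member the chain
    survives modulo that generator, and induction applies. *)
Lemma dim_le_gens k (R : comPzRingType) (m : R -> Prop) (v : 'I_k -> R) d (p : nat -> R -> Prop) :
  noetherian R -> isloc m -> generates v m -> prime_chain d p -> (d <= k)%N.
Proof.
elim: k R m v d p => [|k IH] R m v [//|d] p hN lm hv hp.
  have [p' [hp' top]] := chain_top lm hp; case: hp' => hP hC.
  have [_ [y [y1 y2]]] := hC d (ltnSn d).
  have /top/hv [c] := y1; rewrite big_ord0 => y0; case: y2; rewrite y0.
  by case: (hP d (leqnSn d)) => /ideal0.
have [p' [hp' top]] := chain_top lm hp.
have [p2 [hp2 _ x1]] := chain_exchange hN hp' (ltn0Sn d) (iffRL (top _) (gens_in hv ord0)).
have [T [pi [_ _ hT [m' [w [lm' hw hc]]]]]] := quot_step hN lm hv.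
have [p3 [hp3 _]] := hc d _ (chain_shift hp2) x1.
exact: IH hT lm' hw hp3.
Qed.

(** * Exact chains of finite free modules, as matrices acting on row vectors *)

Section MatrixChains.
Variable R : comPzRingType.

Definition exact a b c (psi : 'M[R]_(a, b)) (phi : 'M[R]_(b, c)) : Prop :=
  psi *m phi = 0 /\ forall r : 'rV[R]_b, r *m phi = 0 -> exists s, r = s *m psi.

(** [phi] is prolonged to the right by [k] matrices with exactness at each junction; in module
    terms, the cokernel of [phi] is a [k]-th syzygy. *)
Fixpoint xch k : forall a b, 'M[R]_(a, b) -> Prop :=
  if k is k'.+1 then fun a b phi => exists c (phi' : 'M[R]_(b, c)), exact phi phi' /\ xch k' phi'
  else fun _ _ _ => True.

(* Equivalently, the cokernel of [phi] is projective. *)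
Definition reg a b (phi : 'M[R]_(a, b)) : Prop := exists chi, phi *m chi *m phi = phi.

Lemma xch_le j k a b (phi : 'M[R]_(a, b)) : (j <= k)%N -> xch k phi -> xch j phi.
Proof.
elim: k j a b phi => [|k IH] [|j] a b phi // jk [c [phi' [h hx]]].
by exists c, phi'; split=> //; apply: IH.
Qed.

Lemma exact_rows a b c (psi : 'M[R]_(a, b)) (phi : 'M[R]_(b, c)) d (g : 'M[R]_(d, b)) :
  exact psi phi -> g *m phi = 0 -> exists s, g = s *m psi.
Proof.
move=> [_ h] gp.
have H i : exists s, row i g = s *m psi by apply: h; rewrite -row_mul gp row0.
have [s hs] := choice H; exists (\matrix_i s i).
by apply/row_matrixP => i; rewrite row_mul rowK hs.
Qed.
End MatrixChains.

Lemma reg_field (F : fieldType) a b (phi : 'M[F]_(a, b)) : reg phi.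
Proof. by exists (pinvmx phi); apply: mulmxKpV. Qed.

Lemma reg_field_nz (R : comNzRingType) a b (phi : 'M[R]_(a, b)) :
  (forall x : R, x = 0 \/ exists y, x * y = 1) -> reg phi.
Proof.
move=> h; have H (x : R) : exists y, x != 0 -> y * x = 1.
  by have [->|[y hy]] := h x; [exists 0; rewrite eqxx | exists y; rewrite mulrC].
have [inv hinv] := choice H.
pose inv' (x : R) := if x == 0 then 0 else inv x.
have h1 (x : R) : x != 0 -> inv' x * x = 1 by move=> x0; rewrite /inv' (negbTE x0) hinv.
have h2 : inv' 0 = 0 by rewrite /inv' eqxx.
pose F : fieldType := HB.pack (GRing.ComNzRing.sort R) (GRing.ComNzRing_isField.Build R h1 h2).
exact: (@reg_field F).
Qed.

Lemma reg_field_like (R : comPzRingType) a b (phi : 'M[R]_(a, b)) :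
  (1 : R) <> 0 -> (forall x : R, x = 0 \/ exists y, x * y = 1) -> reg phi.
Proof.
move=> nz0 h; have nz : (1 : R) != 0 by apply/eqP.
pose R1 : comNzRingType := HB.pack (GRing.ComPzRing.sort R) (GRing.PzSemiRing_isNonZero.Build R nz).
exact: (@reg_field_nz R1).
Qed.

(** By Cayley-Hamilton [det c] is, up to sign, a polynomial multiple of [c]. The relation
    [c phi = phi e] moves polynomials across [phi], so a unit determinant makes [phi] divisible by
    [e] on the right. *)
Lemma char_poly_lift (R : comNzRingType) a b (phi : 'M[R]_(a, b)) (c : 'M_a) (e : 'M_b) u :
  c *m phi = phi *m e -> \det c * u = 1 -> exists g, phi = phi *m g *m e.
Proof.
case: a phi c => [|a] phi c; first by exists 0; rewrite [LHS]flatmx0 [RHS]flatmx0.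
case: b phi e => [|b] phi e ce du; first by exists 0; rewrite [LHS]thinmx0 [RHS]thinmx0.
have H (q : {poly R}) : horner_mx c q *m phi = phi *m horner_mx e q.
  elim/poly_ind: q => [|q x IH]; first by rewrite !rmorph0 mul0mx mulmx0.
  rewrite !rmorphD !rmorphM /= !horner_mx_X !horner_mx_C mulmxDl mulmxDr.
  by rewrite -!mulmxE -mulmxA ce mulmxA IH -mulmxA mul_scalar_mx mul_mx_scalar.
have [q [x E]] : exists (q : {poly R}) x, char_poly c = q * 'X + x%:P.
  by elim/poly_ind: (char_poly c) => [|q x _]; [exists 0, 0; rewrite mul0r addr0 | exists q, x].
have Ex : x = (-1) ^+ a.+1 * \det c.
  by rewrite -char_poly_det E coefD coefMX coefC /= add0r.
have := Cayley_Hamilton c; rewrite E rmorphD rmorphM /= horner_mx_X horner_mx_C => CH.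
have {CH}CH : phi *m horner_mx e q *m e + x *: phi = 0.
  rewrite -H -mulmxA -ce mulmxA -mul_scalar_mx -mulmxDl.
  by rewrite [X in X *m _](CH : horner_mx c q *m c + x%:M = 0) mul0mx.
exists (- ((-1) ^+ a.+1 * u) *: horner_mx e q).
rewrite -scalemxAr -scalemxAl; move/eqP: CH; rewrite addr_eq0 => /eqP ->.
rewrite scalerN scaleNr opprK scalerA Ex.
rewrite [X in X *: _](_ : _ = 1) ?scale1r //.
have -> : (-1) ^+ a.+1 * u * ((-1) ^+ a.+1 * \det c) = ((-1) ^+ a.+1 * (-1) ^+ a.+1) * (\det c * u) by ring.
by rewrite du mulr1 -exprMn mulrNN mulr1 expr1n.
Qed.

(** Reduction modulo a non-zero-divisor costs one map of the chain: from [r phi' = x t] follows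
    [x (t phi'') = 0], so [t = u phi'], and [r - x u] is killed by [phi']. *)
Lemma xch_quot (R T : comPzRingType) (pi : {rmorphism R -> T}) (x : R) k a b (phi : 'M[R]_(a, b)) :
  (forall t, exists r, t = pi r) -> (forall r, pi r = 0 <-> exists a, r = a * x) ->
  (forall r, x * r = 0 -> r = 0) -> xch k.+1 phi -> xch k (map_mx pi phi).
Proof.
move=> surj ker nzd.
have divx m n (A : 'M[R]_(m, n)) : map_mx pi A = 0 -> exists B, A = x *: B.
  move=> A0; have h ij : exists y, A ij.1 ij.2 = y * x.
    by apply/ker; have := congr1 (fun M : 'M_(m, n) => M ij.1 ij.2) A0; rewrite !mxE.
  have [B hB] := choice h; exists (\matrix_(i, j) B (i, j)).
  by apply/matrixP => i j; rewrite !mxE mulrC -(hB (i, j)).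
have nzdm m n (A : 'M[R]_(m, n)) : x *: A = 0 -> A = 0.
  move=> h; apply/matrixP => i j; rewrite mxE; apply: nzd.
  by have := congr1 (fun M : 'M_(m, n) => M i j) h; rewrite !mxE.
have lift m n (A : 'M[T]_(m, n)) : exists B, A = map_mx pi B.
  have [B hB] := choice (fun ij : 'I_m * 'I_n => surj (A ij.1 ij.2)).
  by exists (\matrix_(i, j) B (i, j)); apply/matrixP => i j; rewrite !mxE (hB (i, j)).
elim: k a b phi => // k IH a b phi [c [phi' [[z ex] hx]]].
exists c, (map_mx pi phi'); split; last exact: IH hx.
split; first by rewrite -map_mxM z map_mx0.
move=> r0; have [r ->] := lift _ _ r0; rewrite -map_mxM => /divx [t Et].
case: hx => e [phi'' [[z' ex'] _]].
have /ex' [u Eu] : t *m phi'' = 0.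
  by apply: nzdm; rewrite scalemxAl -Et -mulmxA z' mulmx0.
have /ex [s Es] : (r - x *: u) *m phi' = 0.
  by rewrite mulmxBl Et Eu -scalemxAl subrr.
exists (map_mx pi s); rewrite -map_mxM -Es raddfB /=.
rewrite [X in _ - X](_ : _ = 0) ?subr0 //.
apply/matrixP => i j; rewrite !mxE; apply/ker; exists (u i j); exact: mulrC.
Qed.

(* Induction on the number of generators: the first one is regular, and it is inverted modulo itself by a determinant. *)
Lemma local_regular k (R : comPzRingType) (m : R -> Prop) (v : 'I_k -> R) (p : nat -> R -> Prop) :
  noetherian R -> isloc m -> generates v m -> prime_chain k p ->
  (forall x y : R, x * y = 0 -> x = 0 \/ y = 0) /\
  forall a b (phi : 'M[R]_(a, b)), xch k phi -> reg phi.
Proof.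
elim: k R m v p => [|k IH] R m v p hN lm hv hp.
  have [im m1 hm] := lm; have m0 x : m x -> x = 0 by move=> /hv [c]; rewrite big_ord0.
  have h (x : R) : x = 0 \/ exists y, x * y = 1 by have [/m0|] := hm x; [left | right].
  split=> [x y xy|a b phi _].
    have [->|[z hz]] := h x; [by left | right].
    by rewrite -[y]mul1r -hz mulrAC xy mul0r.
  by apply: reg_field_like => // h1; apply: m1; rewrite h1; apply: ideal0.
have [im m1 hm] := lm; pose x := v ord0.
have [p1 [hp1 top]] := chain_top lm hp.
have mx : m x := gens_in hv ord0.
have [p2 [hp2 _ x2]] := chain_exchange hN hp1 (ltn0Sn k) (iffRL (top _) mx).
have [T [pi [surj ker hT [m' [w [lm' hw hc]]]]]] := quot_step hN lm hv.
have [p3 [hp3 E3]] := hc k _ (chain_shift hp2) x2.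
have [domT regT] := IH T m' w p3 hT lm' hw hp3.
have [hP hC] := hp2; have [i0 n0 pr0] := hP 0%N isT.
(* [p2 1] is the ideal [(x)]. Otherwise its image in the domain [T] is nonzero, and the zero ideal
   could be put below the chain [p3], making it longer than the number of generators allows. *)
have sub1 y : p2 1%N y -> exists a, y = a * x.
  move=> y1; apply/ker; apply: contrapT => ny.
  pose q i := if i is i'.+1 then p3 i' else fun t : T => t = 0.
  suff hq : prime_chain k.+1 q by have := dim_le_gens hT lm' hw hq; rewrite ltnn.
  have [hP3 hC3] := hp3; split=> [[|i] ik|[|i] ik]; [ | exact: hP3 | | exact: hC3].
    split; [exact: zero_ideal | | exact: domT].
    by case: lm' => im' m1' _ h; apply: m1'; rewrite h; apply: ideal0.
  split=> [t ->|]; first by case: (hP3 0%N isT) => /ideal0.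
  by exists (pi y); split=> //; apply/E3.
have [h01 [y0 [y1 y2]]] := hC 0%N isT.
have nx : ~ p2 0%N x.
  by move=> h; apply: y2; have [a ->] := sub1 _ y1; apply: idealM.
(* [p2 0] lies in [(x)] and does not contain [x], so it equals [x] times itself and vanishes by
   Nakayama; hence [R] is a domain. *)
have p0 y : p2 0%N y -> y = 0.
  apply: (nakayama_ideal hN lm mx (zero_ideal R) i0) => a pa.
  have [b Eb] := sub1 _ (h01 _ pa); exists 0, b; split=> //; last by rewrite add0r mulrC.
  by have := pa; rewrite Eb => /pr0 [].
have dom (a b : R) : a * b = 0 -> a = 0 \/ b = 0.
  move=> ab; have /pr0 [/p0|/p0] : p2 0%N (a * b) by rewrite ab; apply: ideal0.
    by left.
  by right.
have nzd r : x * r = 0 -> r = 0 by move=> /dom [] // x0; case: nx; rewrite x0; apply: ideal0.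
split=> // a b phi hphi.
have [chi0 hchi0] := regT _ _ _ (xch_quot surj ker nzd hphi).
have [chi Echi] := choice (fun ij : 'I_b * 'I_a => surj (chi0 ij.1 ij.2)).
pose ch : 'M[R]_(b, a) := \matrix_(i, j) chi (i, j).
have Ech : chi0 = map_mx pi ch by apply/matrixP => i j; rewrite !mxE (Echi (i, j)).
have h ij : exists y, (phi *m ch *m phi - phi) ij.1 ij.2 = y * x.
  apply/ker; have := congr1 (fun M : 'M_(a, b) => M ij.1 ij.2) hchi0.
  rewrite Ech -!map_mxM mxE [in RHS]mxE => hh.
  by rewrite !mxE rmorphB /= -hh; apply/eqP; rewrite subr_eq0 !mxE.
have [g hg] := choice h; pose ga : 'M[R]_(a, b) := \matrix_(i, j) g (i, j).
have Ega : phi *m ch *m phi - phi = x *: ga.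
  by apply/matrixP => i j; rewrite (hg (i, j)) !mxE mulrC.
have [c [phi' [ex hx]]] := hphi.
have gz : ga *m phi' = 0.
  have : x *: (ga *m phi') = 0 by rewrite scalemxAl -Ega mulmxBl -(mulmxA (phi *m ch)) ex.1 mulmx0 subrr.
  move=> hh; apply/matrixP => i j; rewrite [RHS]mxE; apply: nzd.
  by have := congr1 (fun M : 'M_(a, c) => M i j) hh; rewrite [X in X = _]mxE [X in _ = X]mxE.
have [de Ede] := exact_rows ex gz.
(* [C] is the identity modulo [x], so its determinant is a unit, and [C phi = phi (ch phi)] is the
   input of [char_poly_lift]. *)
pose C : 'M[R]_a := 1%:M + x *: de.
have EC : C *m phi = phi *m (ch *m phi).
  by rewrite mulmxDl mul1mx -scalemxAl -Ede -Ega addrC subrK mulmxA.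
have [u du] : exists u, \det C * u = 1.
  have [md|//] := hm (\det C); case: m1.
  have : pi (\det C) = 1.
    rewrite -det_map_mx raddfD /= map_mx1 [X in _ + X](_ : _ = 0) ?addr0 ?det1 //.
    by apply/matrixP => i j; rewrite !mxE; apply/ker; exists (de i j); apply: mulrC.
  move=> d1; have [t Et] : exists t, \det C - 1 = t * x by apply/ker; rewrite rmorphB rmorph1 d1 subrr.
  have -> : 1 = \det C - t * x by rewrite -Et opprB addrC subrK.
  by apply: idealB => //; apply: idealM.
have nz : (1 : R) != 0 by apply/eqP => h1; apply: m1; rewrite h1; apply: ideal0.
pose R1 : comNzRingType := HB.pack (GRing.ComPzRing.sort R) (GRing.PzSemiRing_isNonZero.Build R nz).
have [e he] : exists e : 'M[R]_b, phi = phi *m e *m (ch *m phi) := @char_poly_lift R1 a b phi C (ch *m phi) u EC du.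
by exists (e *m ch); rewrite {3}he !mulmxA.
Qed.

Section LocalizeChains.
Variables (R T : comPzRingType) (pi : {rmorphism R -> T}) (S : R -> Prop).
Hypotheses (hS : mult_closed S).
Hypothesis T1 : forall t, exists r s, S s /\ t * pi s = pi r.
Hypothesis T2 : forall s, S s -> exists t, pi s * t = 1.
Hypothesis T3 : forall r, pi r = 0 <-> exists s, S s /\ s * r = 0.

Lemma S_prod (I : finType) (f : I -> R) : (forall i, S (f i)) -> S (\prod_i f i).
Proof. by move=> h; elim/big_ind: _ => // [|x y]; [case: hS | apply: hS.2]. Qed.

Lemma clear_denom (I : finType) (t : I -> T) :
  exists s (r : I -> R), S s /\ forall i, t i * pi s = pi (r i).
Proof.
have [r hr] := choice (fun i => T1 (t i)); have [s hs] := choice hr.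
exists (\prod_i s i), (fun i => r i * \prod_(j | j != i) s j); split.
  by apply: S_prod => i; case: (hs i).
move=> i; rewrite (bigD1 i) //= !rmorphM mulrA; congr (_ * _).
by case: (hs i).
Qed.

Lemma clear_zero (I : finType) (r : I -> R) : (forall i, pi (r i) = 0) ->
  exists s, S s /\ forall i, s * r i = 0.
Proof.
move=> h; have [s hs] := choice (fun i => iffLR (T3 (r i)) (h i)).
exists (\prod_i s i); split; first by apply: S_prod => i; case: (hs i).
by move=> i; rewrite (bigD1 i) //= mulrAC; case: (hs i) => _ ->; rewrite mul0r.
Qed.

Lemma clear_mx m n (A : 'M[T]_(m, n)) : exists s B, S s /\ pi s *: A = map_mx pi B.
Proof.
have [s [r [Ss h]]] := clear_denom (fun ij : 'I_m * 'I_n => A ij.1 ij.2).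
exists s, (\matrix_(i, j) r (i, j)); split=> //.
by apply/matrixP => i j; rewrite !mxE mulrC (h (i, j)).
Qed.

Lemma clear_mx0 m n (A : 'M[R]_(m, n)) : map_mx pi A = 0 -> exists s, S s /\ s *: A = 0.
Proof.
move=> h; have [|s [Ss hs]] := @clear_zero _ (fun ij : 'I_m * 'I_n => A ij.1 ij.2).
  by move=> ij; have := congr1 (fun M : 'M_(m, n) => M ij.1 ij.2) h; rewrite !mxE.
by exists s; split=> //; apply/matrixP => i j; rewrite !mxE; apply: (hs (i, j)).
Qed.

Lemma unscale m n (A : 'M[T]_(m, n)) s : S s -> exists u, u *: (pi s *: A) = A.
Proof. by move=> /T2 [u hu]; exists u; rewrite scalerA mulrC hu scale1r. Qed.

Lemma exact_loc a b c (psi : 'M[R]_(a, b)) (phi : 'M[R]_(b, c)) :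
  exact psi phi -> exact (map_mx pi psi) (map_mx pi phi).
Proof.
move=> [z ex]; split; first by rewrite -map_mxM z map_mx0.
move=> r hr; have [s [B [Ss hB]]] := clear_mx r.
have [s' [Ss' hs']] : exists s', S s' /\ s' *: (B *m phi) = 0.
  by apply: clear_mx0; rewrite map_mxM -hB -scalemxAl hr scaler0.
have /ex [t Et] : (s' *: B) *m phi = 0 by rewrite -scalemxAl.
have [u hu] := unscale r Ss; have [u' hu'] := unscale (pi s *: r) Ss'.
exists ((u * u') *: map_mx pi t).
rewrite -scalemxAl -map_mxM -Et -scalerA -[LHS]hu -[in LHS]hu' hB; congr (_ *: (_ *: _)).
by apply/matrixP => i j; rewrite !mxE rmorphM.
Qed.

Lemma xch_loc k a b (phi : 'M[R]_(a, b)) : xch k phi -> xch k (map_mx pi phi).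
Proof.
elim: k a b phi => // k IH a b phi [c [phi' [ex hx]]].
by exists c, (map_mx pi phi'); split; [apply: exact_loc | apply: IH].
Qed.

Lemma pull_chain d (p : nat -> T -> Prop) : prime_chain d p -> prime_chain d (fun i r => p i (pi r)).
Proof.
move=> [hP hC]; split=> [i id|i id]; first by apply: pull_prime; apply: hP.
have [h [y [y1 y2]]] := hC i id; split=> [x|]; first exact: h.
have [r [s [Ss E]]] := T1 y; exists r; rewrite -E; split.
  by have [ip _ _] := hP _ id; apply: idealMr.
have [u hu] := T2 Ss; have [ip _ _] := hP _ (ltnW id) => h'; apply: y2.
by rewrite -[y]mulr1 -hu mulrA; apply: idealMr.
Qed.
End LocalizeChains.

(** Being [reg] is local: the scalars [r] for which some [psi] satisfies [phi psi phi = r phi] form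
    an ideal. If it were proper it would lie in a prime [P], but the result over the regular local
    ring at [P], with denominators cleared, yields such an [r] outside [P]. *)
Lemma regular_reg (K : comPzRingType) n : noetherian K -> regular K -> krull_dim_le K n ->
  forall a b (phi : 'M[K]_(a, b)), xch n phi -> reg phi.
Proof.
move=> hN [_ hreg] hd a b phi hx; pose I r := exists psi, phi *m psi *m phi = r *: phi.
have iI : is_ideal I.
  split=> [|x y [p hp] [q hq]|c x [p hp]].
  - by exists 0; rewrite mulmx0 mul0mx scale0r.
  - by exists (p + q); rewrite mulmxDr mulmxDl hp hq scalerDl.
  by exists (c *: p); rewrite -scalemxAr -scalemxAl hp scalerA.
have [[psi h]|nI] := pselect (I 1); first by exists psi; rewrite h scale1r.
have [P [PP IP]] := prime_above hN iI nI; case: (nI); have hS := prime_compl PP.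
have J0 := zero_ideal K.
pose T := loc hS J0; pose pi : {rmorphism K -> T} := linj hS J0.
have T1 := loc_frac (hS := hS) (hJ := J0) : forall t : T, exists r s, ~ P s /\ t * pi s = pi r.
have T2 s : ~ P s -> exists t, pi s * t = 1 := @loc_unit _ _ _ hS J0 s.
have T3 r : pi r = 0 <-> exists s, ~ P s /\ s * r = 0 := loc0P hS J0 r.
have [|hT [m [im m1 mm [k [v [[hk [q hq]] hv]]]]]] := hreg P PP T pi.
  by split=> // r /T3.
have lm : isloc m.
  split=> // y; have [|ny] := pselect (exists z, y * z = 1); [by right | left].
  apply: (mm (fun t => exists z, t = z * y)); last by exists 1; rewrite mul1r.
    split=> [|_ _ [u ->] [w ->]|c _ [u ->]]; first by exists 0; rewrite mul0r.
      by exists (u + w); rewrite mulrDl.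
    by exists (c * u); rewrite mulrA.
  by move=> [z hz]; apply: ny; exists z; rewrite mulrC.
have kn : (k <= n)%N by apply: hd; apply: (pull_chain T1 T2 hq).
have [_ hr] := local_regular hT lm hv hq.
have [chi hchi] := hr _ _ _ (xch_loc hS T1 T2 T3 (xch_le kn hx)).
have [s [psi [ns Epsi]]] := clear_mx hS T1 chi.
have [u [nu hu]] : exists u, ~ P u /\ u *: (phi *m psi *m phi - s *: phi) = 0.
  apply: (clear_mx0 hS T3); rewrite raddfB /= !map_mxM -Epsi -scalemxAr -scalemxAl hchi.
  by apply/matrixP => i j; rewrite !mxE rmorphM subrr.
have [_ _ pP] := PP; case: (pP u s) => //; apply: IP; exists (u *: psi).
move/eqP: hu; rewrite scalerBr subr_eq0 => /eqP hu.
by rewrite -scalemxAr -scalemxAl hu scalerA.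
Qed.

(** * Injective dimension of modules *)

Section Modules.
Variable R : comPzRingType.
Implicit Types (M N E C : lmodType R).

Definition lin (M N : lmodType R) (f : M -> N) : Prop :=
  (forall x y, f (x + y) = f x + f y) /\ forall a x, f (a *: x) = a *: f x.

Lemma lin0 M N (f : M -> N) : lin f -> f 0 = 0.
Proof. by move=> h; apply: (addrI (f 0)); rewrite -h.1 !addr0. Qed.
Lemma linN M N (f : M -> N) x : lin f -> f (- x) = - f x.
Proof. by move=> h; rewrite -scaleN1r h.2 scaleN1r. Qed.
Lemma linB M N (f : M -> N) x y : lin f -> f (x - y) = f x - f y.
Proof. by move=> h; rewrite h.1 linN. Qed.
Lemma lin_sum M N (f : M -> N) n (g : 'I_n -> M) : lin f -> f (\sum_i g i) = \sum_i f (g i).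
Proof. by move=> h; apply: (big_morph f h.1 (lin0 h)). Qed.

Definition submod M (U : M -> Prop) : Prop :=
  [/\ U 0, forall x y, U x -> U y -> U (x + y) & forall a x, U x -> U (a *: x)].

Definition linon M N (U : M -> Prop) (f : M -> N) : Prop :=
  (forall x y, U x -> U y -> f (x + y) = f x + f y) /\ forall a x, U x -> f (a *: x) = a *: f x.

Definition inj E : Prop := forall M (U : M -> Prop) (f : M -> E), submod U -> linon U f ->
  exists g, lin g /\ forall x, U x -> g x = f x.

Definition baer E : Prop := forall (I : R -> Prop) (f : R -> E), is_ideal I ->
  (forall x y, I x -> I y -> f (x + y) = f x + f y) -> (forall a x, I x -> f (a * x) = a *: f x) ->
  exists e, forall x, I x -> f x = x *: e.

Definition ses N E C (i : N -> E) (p : E -> C) : Prop :=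
  [/\ lin i, lin p, injective i, forall c, exists e, p e = c & forall e, p e = 0 <-> exists n, e = i n].

Definition mxv N a b (phi : 'M[R]_(a, b)) (y : 'I_b -> N) : 'I_a -> N :=
  fun i => \sum_j phi i j *: y j.

Lemma mxvM N a b c (psi : 'M[R]_(a, b)) (phi : 'M[R]_(b, c)) (y : 'I_c -> N) i :
  mxv psi (mxv phi y) i = mxv (psi *m phi) y i.
Proof.
rewrite /mxv; under eq_bigr => j _ do rewrite scaler_sumr.
rewrite exchange_big /=; apply: eq_bigr => k _; rewrite mxE scaler_suml.
by apply: eq_bigr => j _; rewrite scalerA.
Qed.

Lemma mxv_lin N C (f : N -> C) a b (phi : 'M[R]_(a, b)) y i : lin f ->
  f (mxv phi y i) = mxv phi (fun j => f (y j)) i.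
Proof. by move=> h; rewrite lin_sum //; apply: eq_bigr => j _; rewrite h.2. Qed.

Lemma mxvB N a b (phi : 'M[R]_(a, b)) (y z : 'I_b -> N) i :
  mxv phi (fun j => y j - z j) i = mxv phi y i - mxv phi z i.
Proof. by rewrite /mxv -sumrB; apply: eq_bigr => j _; rewrite scalerBr. Qed.

Lemma mxv_eq N a b (phi : 'M[R]_(a, b)) (y z : 'I_b -> N) i : (forall j, y j = z j) ->
  mxv phi y i = mxv phi z i.
Proof. by move=> h; apply: eq_bigr => j _; rewrite h. Qed.

(* As [xch k phi] makes [phi] the first of [k + 1] consecutive maps of an exact complex of finite free modules, [EV k N] says that [Ext^(k+1)(M, N) = 0] for the last cokernel [M]. Stated with matrices, this bound on the injective dimension of [N] passes to localizations by clearing denominators. *)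
Definition EV k N : Prop := forall a b c (phi : 'M[R]_(b, c)) (psi : 'M[R]_(a, b)) (x : 'I_b -> N),
  xch k phi -> exact psi phi -> (forall i, mxv psi x i = 0) -> exists y, forall i, x i = mxv phi y i.

(** If [phi chi phi = phi], then [1 - phi chi] is killed by [phi] and so factors through [psi];
    hence [chi x] is a solution. *)
Lemma EV_reg N k : (forall a b (phi : 'M[R]_(a, b)), xch k phi -> reg phi) -> EV k N.
Proof.
move=> hreg a b c phi psi x hx ex hpsi; have [chi hchi] := hreg _ _ _ hx.
exists (mxv chi x) => i; rewrite mxvM.
have hz : (1%:M - phi *m chi) *m phi = 0 by rewrite mulmxBl mul1mx hchi subrr.
have [s hs] := exact_rows ex hz; apply/eqP; rewrite -subr_eq0; apply/eqP.
have -> : x i - mxv (phi *m chi) x i = mxv (1%:M - phi *m chi) x i.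
  rewrite /mxv; under [RHS]eq_bigr => j _ do rewrite mxE [X in (_ + X) *: _]mxE scalerBl.
  rewrite sumrB; congr (_ - _).
  rewrite (bigD1 i) //= mxE eqxx scale1r big1 ?addr0 // => j /negbTE ij.
  by rewrite mxE eq_sym ij scale0r.
rewrite hs -mxvM /mxv big1 // => j _; by rewrite [X in _ *: X](hpsi j) scaler0.
Qed.

Lemma inj_EV E k : inj E -> EV k E.
Proof.
move=> hE a b c phi psi x _ [z ex] hpsi.
pose val (r : 'rV[R]_b) : E := \sum_j r 0 j *: x j.
have valD r s : val (r + s) = val r + val s.
  by rewrite /val -big_split; apply: eq_bigr => j _; rewrite mxE scalerDl.
have valZ t r : val (t *: r) = t *: val r.
  by rewrite /val scaler_sumr; apply: eq_bigr => j _; rewrite mxE scalerA.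
have val0 r : r *m phi = 0 -> val r = 0.
  move=> /ex [s ->]; rewrite /val; under eq_bigr => j _ do rewrite mxE scaler_suml.
  rewrite exchange_big big1 // => k0 _; under eq_bigr => j _ do rewrite -scalerA.
  by rewrite -scaler_sumr [X in _ *: X](hpsi k0) scaler0.
have valeq r s : r *m phi = s *m phi -> val r = val s.
  move=> h; have : val (r - s) = 0 by apply: val0; rewrite mulmxBl h subrr.
  by rewrite valD -scaleN1r valZ scaleN1r => /eqP; rewrite subr_eq0 => /eqP.
pose U (w : 'rV[R]_c) := exists r : 'rV[R]_b, w = r *m phi.
have [F hF] : exists F : 'rV[R]_c -> E, forall r, F (r *m phi) = val r.
  have h (w : 'rV[R]_c) : exists e, forall r, w = r *m phi -> e = val r.
    have [[r0 ->]|nU] := pselect (U w); first by exists (val r0) => r; apply: valeq.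
    by exists 0 => r hr; case: nU; exists r.
  by have [F hF] := choice h; exists F => r; apply: hF.
have sU : submod U.
  split=> [|_ _ [r ->] [s ->]|t _ [r ->]]; first by exists 0; rewrite mul0mx.
    by exists (r + s); rewrite mulmxDl.
  by exists (t *: r); rewrite -scalemxAl.
have [|g [hg gF]] := hE _ U F sU.
  split=> [_ _ [r ->] [s ->]|t _ [r ->]]; first by rewrite -mulmxDl !hF valD.
  by rewrite scalemxAl !hF valZ.
exists (fun j => g (delta_mx 0 j)) => i.
have -> : x i = val (delta_mx 0 i).
  rewrite /val (bigD1 i) //= mxE !eqxx scale1r big1 ?addr0 // => j /negbTE ij.
  by rewrite mxE ij andbF scale0r.
rewrite -hF -gF; last by exists (delta_mx 0 i).
rewrite -rowE [row i phi]row_sum_delta (lin_sum _ hg); apply: eq_bigr => j _.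
by rewrite hg.2 mxE.
Qed.

(** Zorn's lemma on partial extensions. If the domain [V] of a maximal one misses [x], the map
    [r |-> g(r x)] on the ideal of those [r] with [r x] in [V] is multiplication by some [e], and
    [x |-> e] extends [g]. *)
Lemma baer_inj E : baer E -> inj E.
Proof.
move=> hb M U f sU lf.
pose ok (p : (M -> Prop) * (M -> E)) :=
  [/\ submod p.1, linon p.1 p.2, forall x, U x -> p.1 x & forall x, U x -> p.2 x = f x].
pose T := {p | ok p}.
pose le (s t : T) : Prop := forall x, (sval s).1 x -> (sval t).1 x /\ (sval t).2 x = (sval s).2 x.
have ok0 : ok (U, f) by split.
have [t ht] : exists t, classical_sets.premaximal (fun s t : T => `[< le s t >]) t.
  apply: (@classical_sets.ZL_preorder T (exist _ _ ok0)) => [t|r s t|A totA].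
  - by apply/asboolP.
  - move=> /asboolP h1 /asboolP h2; apply/asboolP => x hx.
    by have [h3 <-] := h1 x hx; apply: h2.
  have [[t0 At0]|nA] := pselect (exists t, A t); last first.
    by exists (exist _ _ ok0) => s As; case: nA; exists s.
  pose V x := exists s, A s /\ (sval s).1 x.
  have cmp s t x : A s -> A t -> (sval s).1 x -> (sval t).1 x -> (sval s).2 x = (sval t).2 x.
    by move=> As At sx tx; have [/asboolP|/asboolP] := totA s t As At => /(_ x); case=> // _ ->.
  have both x y : V x -> V y -> exists s, [/\ A s, (sval s).1 x & (sval s).1 y].
    move=> [s [As sx]] [s' [As' sy]]; have [/asboolP h|/asboolP h] := totA s s' As As'.
      by exists s'; split=> //; case: (h x sx).
    by exists s; split=> //; case: (h y sy).
  have [g hg] : exists g : M -> E, forall s x, A s -> (sval s).1 x -> g x = (sval s).2 x.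
    have h x : exists e, forall s, A s -> (sval s).1 x -> e = (sval s).2 x.
      have [[s [As sx]]|nV] := pselect (V x); last by exists 0 => s As sx; case: nV; exists s.
      by exists ((sval s).2 x) => s' As' sx'; apply: cmp.
    by have [g hg] := choice h; exists g => s x As sx; apply: hg.
  have okV : ok (V, g).
    split=> /=.
    - split=> [|x y Vx Vy|a x [s [As sx]]].
      + by exists t0; split=> //; case: (proj2_sig t0) => [[]].
      + by have [s [As sx sy]] := both x y Vx Vy; exists s; split=> //; case: (proj2_sig s) => [[_ h _] _ _ _]; apply: h.
      by exists s; split=> //; case: (proj2_sig s) => [[_ _ h] _ _ _]; apply: h.
    - split=> [x y Vx Vy|a x [s [As sx]]].
        have [s [As sx sy]] := both x y Vx Vy; case: (proj2_sig s) => [[_ h _] [l _] _ _].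
        by rewrite !(hg s) //; [apply: l | apply: h].
      case: (proj2_sig s) => [[_ _ h] [_ l] _ _].
      by rewrite !(hg s) //; [apply: l | apply: h].
    - by move=> x Ux; exists t0; split=> //; case: (proj2_sig t0) => _ _ h _; apply: h.
    by move=> x Ux; case: (proj2_sig t0) => _ _ h h'; rewrite (hg t0) //; [apply: h' | apply: h].
  exists (exist _ _ okV) => s As; apply/asboolP => x sx /=; split; first by exists s.
  exact: hg.
case: t ht => [[V g] okt] ht; have [/= sV [gD gZ] UV gf] := okt.
have VT x : V x.
  apply: contrapT => nVx; have [V0 VD VZ] := sV.
  pose I r := V (r *: x).
  have iI : is_ideal I.
    split=> [|r s hr hs|r s hs]; rewrite /I; first by rewrite scale0r.
      by rewrite scalerDl; apply: VD.
    by rewrite -scalerA; apply: VZ.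
  have [||e he] := hb I (fun r => g (r *: x)) iI.
  - by move=> r s hr hs; rewrite scalerDl gD.
  - by move=> r s hs; rewrite -scalerA gZ.
  pose W z := exists v r, V v /\ z = v + r *: x.
  have VN v : V v -> V (- v) by move=> hv; rewrite -scaleN1r; apply: VZ.
  have gN v : V v -> g (- v) = - g v by move=> hv; rewrite -scaleN1r gZ // scaleN1r.
  have [h hh] : exists h : M -> E, forall v r, V v -> h (v + r *: x) = g v + r *: e.
    have H z : exists e0, forall v r, V v -> z = v + r *: x -> e0 = g v + r *: e.
      have [[v0 [r0 [Vv0 E0]]]|nW] := pselect (W z); last first.
        by exists 0 => v r Vv hz; case: nW; exists v, r.
      exists (g v0 + r0 *: e) => v r Vv Ez.
      have E1 : (r0 - r) *: x = v - v0.
        rewrite scalerBl; apply/eqP; rewrite subr_eq addrAC -subr_eq opprK addrC.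
        by apply/eqP; rewrite [LHS]addrC -E0 Ez addrC.
      have Vd : V (v - v0) by apply: VD => //; apply: VN.
      have := he (r0 - r); rewrite /I E1 => /(_ Vd); rewrite gD ?gN //; last exact: VN.
      rewrite scalerBl => E2; apply/eqP; rewrite -subr_eq0 opprD addrACA -E2.
      by rewrite -[g v - g v0]opprB subrr.
    by have [h hh] := choice H; exists h => v r Vv; apply: hh.
  have okW : ok (W, h).
    split=> /=.
    - split=> [|_ _ [v [r [Vv ->]]] [w [s [Vw ->]]]|a _ [v [r [Vv ->]]]].
      + by exists 0, 0; rewrite scale0r addr0.
      + by exists (v + w), (r + s); rewrite scalerDl addrACA; split=> //; apply: VD.
      by exists (a *: v), (a * r); rewrite scalerDr scalerA; split=> //; apply: VZ.
    - split=> [_ _ [v [r [Vv ->]]] [w [s [Vw ->]]]|a _ [v [r [Vv ->]]]].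
        by rewrite addrACA -scalerDl !hh ?gD ?scalerDl 1?addrACA //; apply: VD.
      by rewrite scalerDr scalerA !hh ?gZ ?scalerDr ?scalerA //; apply: VZ.
    - by move=> y Uy; exists y, 0; rewrite scale0r addr0; split=> //; apply: UV.
    move=> y Uy; have := hh y 0; rewrite !scale0r !addr0 => ->; [exact: gf | exact: UV].
  have /asboolP /(_ x) [] //= : `[< le (exist _ _ okW) (exist _ _ okt) >]; last first.
    by exists 0, 1; rewrite scale1r add0r; split.
    apply: ht; apply/asboolP => y Vy /=; split; first by exists y, 0; rewrite scale0r addr0.
    by have := hh y 0 Vy; rewrite !scale0r !addr0.
by exists g; split=> [|x Ux]; [split=> *; [apply: gD | apply: gZ] | apply: gf].
Qed.

Hypothesis hN : noetherian R.

Lemma sub_fg n (N : ('I_n -> R) -> Prop) : N (fun=> 0) ->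
  (forall c c', N c -> N c' -> N (fun i => c i + c' i)) ->
  (forall a c, N c -> N (fun i => a * c i)) ->
  exists r (g : 'I_r -> 'I_n -> R), (forall k, N (g k)) /\
    forall c, N c -> exists l : 'I_r -> R, forall i, c i = \sum_k l k * g k i.
Proof.
elim: n N => [|n IH] N N0 ND NM.
  exists 0%N, (fun k => fun=> 0); split=> [[]//|c _].
  by exists (fun=> 0) => - [].
pose I x := exists c, N c /\ c ord0 = x.
have iI : is_ideal I.
  split=> [|_ _ [c [hc <-]] [d [hd <-]]|a _ [c [hc <-]]]; first by exists (fun=> 0).
    by exists (fun i => c i + d i); split=> //; apply: ND.
  by exists (fun i => a * c i); split=> //; apply: NM.
have [r [v hv]] := hN iI.
have [w hw] := choice (fun k => gens_in hv k).
pose cons0 (c : 'I_n -> R) (i : 'I_n.+1) := if unlift ord0 i is Some j then c j else 0.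
have [|||r' [g [hg sp]]] := IH (fun c => N (cons0 c)).
- by have -> : cons0 (fun=> 0) = fun=> 0 by apply: funext => i; rewrite /cons0; case: unlift.
- move=> c c' hc hc'; have -> : cons0 (fun i => c i + c' i) = fun i => cons0 c i + cons0 c' i.
    by apply: funext => i; rewrite /cons0; case: unlift; rewrite ?addr0.
  exact: ND.
- move=> a c hc; have -> : cons0 (fun i => a * c i) = fun i => a * cons0 c i.
    by apply: funext => i; rewrite /cons0; case: unlift; rewrite ?mulr0.
  exact: NM.
exists (r + r')%N, (fun k => match split k with inl a => w a | inr b => cons0 (g b) end); split.
  by move=> k; case: (split k) => a; [case: (hw a) | apply: hg].
move=> c hc; have /hv [l hl] : I (c ord0) by exists c.
have hd : N (fun i => c i + (-1) * \sum_k l k * w k i).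
  apply: (ND) => //; apply: (NM).
  have H (s : seq 'I_r) : N (fun i => \sum_(k <- s) l k * w k i).
    elim: s => [|k s IHs]; first by under [X in N X]funext => i do rewrite big_nil.
    under [X in N X]funext => i do rewrite big_cons.
    by apply: (ND) => //; apply: (NM); case: (hw k).
  exact: H.
pose d i := c i + (-1) * \sum_k l k * w k i.
have d0 : d ord0 = 0.
  rewrite /d hl mulN1r; apply/eqP; rewrite subr_eq0; apply/eqP/eq_bigr => k _.
  by case: (hw k) => _ ->.
have /sp [l' hl'] : N (cons0 (fun i => d (lift ord0 i))).
  have <- // : d = cons0 (fun i => d (lift ord0 i)).
  apply: funext => i; have [j ->|->] := unliftP ord0 i; first by rewrite /cons0 liftK.
  by rewrite /cons0 unlift_none.
exists (fun k => match split k with inl a => l a | inr b => l' b end) => i.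
rewrite big_split_ord /=.
under eq_bigr => a _ do rewrite (unsplitK (inl a)).
under [X in _ = _ + X]eq_bigr => a _ do rewrite (unsplitK (inr a)).
have -> : \sum_(i0 < r') l' i0 * cons0 (g i0) i = d i.
  have [j ->|->] := unliftP ord0 i; last first.
    by rewrite d0 big1 // => k _; rewrite /cons0 unlift_none mulr0.
  rewrite hl'; apply: eq_bigr => k _.
  by rewrite /cons0 liftK.
by rewrite /d mulN1r addrC subrK.
Qed.

Lemma syzygy a b (phi : 'M[R]_(a, b)) : exists c (psi : 'M[R]_(c, a)), exact psi phi.
Proof.
pose N (c : 'I_a -> R) := (\row_i c i) *m phi = 0.
have rD c c' : \row_i (c i + c' i) = \row_i c i + \row_i c' i :> 'rV[R]_a.
  by apply/rowP => i; rewrite !mxE.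
have rM t c : \row_i (t * c i) = t *: \row_i c i :> 'rV[R]_a.
  by apply/rowP => i; rewrite !mxE.
have r0 : \row_i 0 = 0 :> 'rV[R]_a by apply/rowP => i; rewrite !mxE.
have [|||r [g [hg sp]]] := @sub_fg a N.
- by rewrite /N r0 mul0mx.
- by move=> c c' hc hc'; rewrite /N rD mulmxDl hc hc' addr0.
- by move=> t c hc; rewrite /N rM -scalemxAl hc scaler0.
exists r, (\matrix_(k, i) g k i); split.
  apply/row_matrixP => k; rewrite row_mul row0 -(hg k); congr (_ *m _).
  by apply/rowP => i; rewrite !mxE.
move=> s hs; have /sp [l hl] : N (fun i => s 0 i).
  by rewrite /N -[RHS]hs; congr (_ *m _); apply/rowP => i; rewrite !mxE.
exists (\row_k l k); apply/rowP => i; rewrite hl !mxE.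
by apply: eq_bigr => k _; rewrite !mxE.
Qed.

(** Dimension shift: a solution in [C] is lifted to [E], and the defect lies in [N], one place
    further to the left. Noetherianity supplies the extra syzygy there. *)
Lemma ses_down N E C (i : N -> E) (p : E -> C) k : ses i p -> EV k E -> EV k.+1 N -> EV k C.
Proof.
move=> [li lp ii sp ex] hE hNk a b c phi psi x hx hex hpsi.
have [a' [psi' hex']] := syzygy psi.
have [e he] := choice (fun j => sp (x j)).
have /choice [n hn] : forall j, exists n, mxv psi e j = i n.
  by move=> j; apply/ex; rewrite mxv_lin //; rewrite -[RHS](hpsi j); apply: mxv_eq.
have [||y hy] := hNk _ _ _ psi psi' n _ hex'.
- by exists c, phi.
- move=> j; apply: ii; rewrite (lin0 li) mxv_lin //.
  rewrite -(mxv_eq psi' j hn) mxvM hex'.1 /mxv big1 // => l _; by rewrite mxE scale0r.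
have [|z hz] := hE _ _ _ phi psi (fun j => e j - i (y j)) hx hex.
  move=> j; rewrite mxvB hn hy mxv_lin // subrr //.
exists (fun j => p (z j)) => j; rewrite -mxv_lin // -hz linB // he.
by rewrite (iffRL (ex _)) ?subr0 //; exists (y j).
Qed.

(** The inverse shift: a solution exists in [E], and its image in [C] is corrected with the help of
    the next map of the chain. *)
Lemma ses_up N E C (i : N -> E) (p : E -> C) k : ses i p -> EV k.+1 E -> EV k C -> EV k.+1 N.
Proof.
move=> [li lp ii sp ex] hE hC a b c phi psi x hx hex hpsi.
have [|e he] := hE _ _ _ phi psi (fun j => i (x j)) hx hex.
  by move=> j; rewrite -mxv_lin // hpsi (lin0 li).
have [d [phi' [hex' hx']]] := hx.
have [|cb hcb] := hC _ _ _ phi' phi (fun j => p (e j)) hx' hex'.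
  by move=> j; rewrite -mxv_lin // -he; apply/ex; exists (x j).
have [e' he'] := choice (fun j => sp (cb j)).
have /choice [n hn] : forall j, exists n, e j - mxv phi' e' j = i n.
  move=> j; apply/ex; rewrite linB // hcb mxv_lin // (mxv_eq phi' j he') subrr //.
exists n => j; apply: ii; rewrite he mxv_lin // -(mxv_eq phi j hn) mxvB mxvM hex'.1.
rewrite [X in _ - X](_ : _ = 0) ?subr0 // /mxv big1 // => l _; by rewrite mxE scale0r.
Qed.

(** For an ideal with its generators written as a column, the relations among them are a syzygy, and
    [EV 0] is Baer's criterion. *)
Lemma EV0_inj E : EV 0 E -> inj E.
Proof.
move=> h; apply: baer_inj => I f iI fD fZ; have [n [v hv]] := hN iI.
pose phi : 'M[R]_(n, 1) := \matrix_(i, j) v i; have [c [psi hex]] := syzygy phi.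
have f0 : f 0 = 0 by rewrite -(scale0r (f 0)) -fZ ?mul0r //; apply: ideal0.
have fs (l : 'I_n -> R) : f (\sum_i l i * v i) = \sum_i l i *: f (v i).
  have vI i := gens_in hv i.
  have H (s : seq 'I_n) : I (\sum_(i <- s) l i * v i) /\
     f (\sum_(i <- s) l i * v i) = \sum_(i <- s) l i *: f (v i).
    elim: s => [|i s [IH1 IH2]]; first by rewrite !big_nil f0; split=> //; apply: ideal0.
    rewrite !big_cons; have hi : I (l i * v i) by apply: idealM.
    by split; [apply: idealD | rewrite fD // fZ // IH2].
  exact: (H _).2.
have [|y hy] := h _ _ _ phi psi (fun i => f (v i)) Logic.I hex.
  move=> j; rewrite /mxv -fs; have := congr1 (fun M : 'M_(c, 1) => M j 0) hex.1.
  by rewrite !mxE; under eq_bigr => l _ do rewrite mxE; move=> ->.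
exists (y 0) => x /hv [l ->]; rewrite fs scaler_suml; apply: eq_bigr => i _.
by rewrite hy /mxv big_ord1 mxE scalerA.
Qed.
End Modules.

Section Cokernel.
Variables (R : comPzRingType) (E : lmodType R) (U : E -> Prop).
Hypothesis sU : submod U.

Definition cok_pred : {pred E} := [pred x | `[< U x >]].
Lemma cok_zmod : zmod_closed cok_pred.
Proof.
case: sU => U0 UD UZ; split=> [|x y]; rewrite !inE; first exact/asboolP.
by move=> /asboolP hx /asboolP hy; apply/asboolP/UD => //; rewrite -scaleN1r; apply: UZ.
Qed.
HB.instance Definition _ := GRing.isZmodClosed.Build E cok_pred cok_zmod.
Definition cok : Type := Quotient.quot cok_pred.
HB.instance Definition _ := GRing.Zmodule.on cok.
Definition cokp (x : E) : cok := \pi_(Quotient.quot cok_pred)%qT x.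
Definition cokr (x : cok) : E := repr (x : Quotient.quot cok_pred).

Lemma cokP x y : cokp x = cokp y <-> U (x - y).
Proof.
have -> : cokp x = cokp y <-> x - y \in cok_pred by rewrite Quotient.idealrBE; split=> [/eqP|/eqP].
by split=> [/asboolP|h]; last apply/asboolP.
Qed.
Lemma cokrK x : cokp (cokr x) = x. Proof. exact: reprK. Qed.
Lemma cokpD : {morph cokp : x y / x + y}. Proof. exact: raddfD. Qed.

Definition cok_scale (a : R) (x : cok) : cok := cokp (a *: cokr x).
Lemma cok_scaleE a x : cok_scale a (cokp x) = cokp (a *: x).
Proof.
apply/cokP; rewrite -scalerBr; case: sU => _ _; apply; apply/cokP; exact: cokrK.
Qed.
Lemma cokW (P : cok -> Prop) : (forall x, P (cokp x)) -> forall x, P x.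
Proof. by move=> h x; rewrite -(cokrK x). Qed.

Lemma cok_scaleA a b x : cok_scale a (cok_scale b x) = cok_scale (a * b) x.
Proof. by elim/cokW: x => x; rewrite !cok_scaleE scalerA. Qed.
Lemma cok_scale1 : left_id 1 cok_scale.
Proof. by elim/cokW=> x; rewrite cok_scaleE scale1r. Qed.
Lemma cok_scaleDr : right_distributive cok_scale +%R.
Proof. by move=> a; elim/cokW=> x; elim/cokW=> y; rewrite -cokpD !cok_scaleE -cokpD scalerDr. Qed.
Lemma cok_scaleDl x : {morph cok_scale^~ x : a b / a + b}.
Proof. by move=> a b; elim/cokW: x => x; rewrite !cok_scaleE -cokpD scalerDl. Qed.
HB.instance Definition _ := GRing.Zmodule_isLmodule.Build R cok cok_scaleA cok_scale1 cok_scaleDr cok_scaleDl.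

Lemma cokp_lin : lin (cokp : E -> cok).
Proof. by split=> [x y|a x]; [apply: cokpD | rewrite [RHS]cok_scaleE]. Qed.
Lemma cokp0 x : cokp x = 0 <-> U x.
Proof. by rewrite -(lin0 cokp_lin) cokP subr0. Qed.
End Cokernel.

Lemma ses_coker (R : comPzRingType) (N E : lmodType R) (i : N -> E) : lin i -> injective i ->
  exists (C : lmodType R) (p : E -> C), ses i p.
Proof.
move=> li ii; pose U e := exists n, e = i n.
have sU : submod U.
  split=> [|_ _ [n ->] [m ->]|a _ [n ->]]; first by exists 0; rewrite lin0.
    by exists (n + m); rewrite li.1.
  by exists (a *: n); rewrite li.2.
exists (cok sU), (cokp sU); split=> //; first exact: cokp_lin.
  by move=> c; exists (cokr c); apply: cokrK.
by move=> e; apply: cokp0.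
Qed.

Section Restrict.
Variables (K L : comPzRingType) (g : {rmorphism K -> L}).
Definition resm (N : lmodType L) : Type := N.
HB.instance Definition _ N := GRing.Zmodule.on (resm N).
Section One.
Variable N : lmodType L.
Definition resm_scale (a : K) (x : resm N) : resm N := g a *: (x : N).
Lemma resm_A a b x : resm_scale a (resm_scale b x) = resm_scale (a * b) x.
Proof. by rewrite /resm_scale rmorphM scalerA. Qed.
Lemma resm_1 : left_id 1 resm_scale.
Proof. by move=> x; rewrite /resm_scale rmorph1 scale1r. Qed.
Lemma resm_Dr : right_distributive resm_scale +%R.
Proof. by move=> a x y; apply: scalerDr. Qed.
Lemma resm_Dl x : {morph resm_scale^~ x : a b / a + b}.
Proof. by move=> a b; rewrite /resm_scale rmorphD scalerDl. Qed.
End One.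
Definition resL (N : lmodType L) : lmodType K :=
  HB.pack (resm N) (GRing.Zmodule_isLmodule.Build K (resm N) (@resm_A N) (@resm_1 N) (@resm_Dr N) (@resm_Dl N)).

Lemma resLE (N : lmodType L) a (x : N) : a *: (x : resL N) = g a *: x.
Proof. by []. Qed.

Lemma ses_res (N E C : lmodType L) (i : N -> E) (p : E -> C) : ses i p ->
  ses (i : resL N -> resL E) (p : resL E -> resL C).
Proof.
by move=> [[iD iZ] [pD pZ] ii sp ex]; split=> //; split=> // a x; [apply: iZ | apply: pZ].
Qed.

Section Coinduce.
Variables (X : Type) (J : lmodType K).

(* A product, indexed by [X], of copies of the coinduced module [Hom_K(L, J)]. *)
Record cind := Cind { cfun_ :> X -> L -> J;
  cindD : forall c x y, cfun_ c (x + y) = cfun_ c x + cfun_ c y;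
  cindZ : forall c a x, cfun_ c (g a * x) = a *: cfun_ c x }.

Lemma cind_ext (F G : cind) : (forall c x, F c x = G c x) -> F = G.
Proof.
case: F G => f fD fZ [h hD hZ] /= E.
have {}E : f = h by apply: funext => c; apply: funext.
by subst h; congr Cind; apply: Prop_irrelevance.
Qed.
HB.instance Definition _ := gen_eqMixin cind.
HB.instance Definition _ := gen_choiceMixin cind.

Program Definition cind0 := @Cind (fun _ _ => 0) _ _.
Next Obligation. by move=> c x y; rewrite addr0. Qed.
Next Obligation. by move=> c a x; rewrite scaler0. Qed.
Program Definition cindN (F : cind) := @Cind (fun c x => - F c x) _ _.
Next Obligation. by move=> F c x y /=; rewrite cindD opprD. Qed.
Next Obligation. by move=> F c a x /=; rewrite cindZ scalerN. Qed.
Program Definition cindA (F G : cind) := @Cind (fun c x => F c x + G c x) _ _.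
Next Obligation. by move=> F G c x y /=; rewrite !cindD addrACA. Qed.
Next Obligation. by move=> F G c a x /=; rewrite !cindZ scalerDr. Qed.
Lemma cind_addA : associative cindA.
Proof. by move=> F G H; apply: cind_ext => c x /=; rewrite addrA. Qed.
Lemma cind_addC : commutative cindA.
Proof. by move=> F G; apply: cind_ext => c x /=; rewrite addrC. Qed.
Lemma cind_add0 : left_id cind0 cindA.
Proof. by move=> F; apply: cind_ext => c x /=; rewrite add0r. Qed.
Lemma cind_addN : left_inverse cind0 cindN cindA.
Proof. by move=> F; apply: cind_ext => c x /=; rewrite addNr. Qed.
HB.instance Definition _ := GRing.isZmodule.Build cind cind_addA cind_addC cind_add0 cind_addN.

Program Definition cind_scale (r : L) (F : cind) := @Cind (fun c x => F c (r * x)) _ _.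
Next Obligation. by move=> r F c x y /=; rewrite mulrDr cindD. Qed.
Next Obligation. by move=> r F c a x /=; rewrite mulrCA cindZ. Qed.
Lemma cind_scaleA a b F : cind_scale a (cind_scale b F) = cind_scale (a * b) F.
Proof. by apply: cind_ext => c x /=; rewrite mulrA [b * a]mulrC. Qed.
Lemma cind_scale1 : left_id 1 cind_scale.
Proof. by move=> F; apply: cind_ext => c x /=; rewrite mul1r. Qed.
Lemma cind_scaleDr : right_distributive cind_scale +%R.
Proof. by move=> a F G; apply: cind_ext. Qed.
Lemma cind_scaleDl F : {morph cind_scale^~ F : a b / a + b}.
Proof. by move=> a b; apply: cind_ext => c x /=; rewrite mulrDl cindD. Qed.
HB.instance Definition _ := GRing.Zmodule_isLmodule.Build L cind cind_scaleA cind_scale1 cind_scaleDr cind_scaleDl.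

Lemma inj_cind : inj J -> inj (cind : lmodType L).
Proof.
move=> hJ M U f [U0 UD UZ] [fD fZ].
have H c : exists h : resL M -> J, lin h /\ forall x, U x -> h x = f x c 1.
  apply: (hJ (resL M) U (fun x => f x c 1)); first by split=> // a x; apply: UZ.
  split=> [x y hx hy|a x hx]; first by rewrite fD.
  by rewrite resLE fZ //= -(cindZ (f x)) mulr1.
have [h hh] := choice H.
have gD x c (a b : L) : h c ((a + b) *: x) = h c (a *: x) + h c (b *: x).
  by rewrite scalerDl (hh c).1.1.
have gZ x c (a : K) (b : L) : h c ((g a * b) *: x) = a *: h c (b *: x).
  by rewrite -scalerA -[g a *: _]/(a *: (b *: x : resL M)) (hh c).1.2.
exists (fun x => @Cind (fun c l => h c (l *: x)) (gD x) (gZ x)); split.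
  split=> [x y|a x]; apply: cind_ext => c l /=; first by rewrite scalerDr (hh c).1.1.
  by rewrite scalerA mulrC.
move=> x Ux; apply: cind_ext => c l /=; rewrite (hh c).2; last exact: UZ.
by rewrite fZ //= mulr1.
Qed.
End Coinduce.
End Restrict.

(** * Enough injectives, from the rationals modulo the integers *)

Section Embedding.
Lemma int_ideal_gen (I : int -> Prop) : is_ideal I ->
  (forall x, I x -> x = 0) \/ exists n : nat, [/\ (0 < n)%N, I n%:Z & forall x, I x -> exists k, x = k * n%:Z].
Proof.
move=> iI; have [h|h] := pselect (forall x, I x -> x = 0); [by left | right].
have [x [Ix x0]] : exists x, I x /\ x <> 0.
  by apply: contrapT => H; apply: h => x Ix; apply: contrapT => x0; apply: H; exists x.
have Ia (y : int) : I y -> I (Posz `|y|%N).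
  case: y => [y|y] // Iy; have -> : Posz `|Negz y|%N = (-1) * Negz y by rewrite mulN1r NegzE opprK abszN.
  exact: idealM.
have ex : exists n : nat, (0 < n)%N && `[< I n%:Z >].
  by exists `|x|%N; apply/andP; split; [lia | apply/asboolP; apply: Ia].
exists (ex_minn ex); case: ex_minnP => n /andP[n0 /asboolP In] mn; split=> // y Iy.
exists (y %/ n%:Z)%Z; have := divz_eq y n%:Z.
have I2 : I (y %% n%:Z)%Z.
  have -> : (y %% n%:Z)%Z = y - (y %/ n%:Z)%Z * n%:Z by lia.
  by apply: idealB => //; apply: idealM.
have m0 : (0 <= y %% n%:Z)%Z by apply: modz_ge0; lia.
have mlt : (y %% n%:Z < n%:Z)%Z by apply: ltz_pmod; lia.
have [z0|zn] := eqVneq (y %% n%:Z)%Z 0; first by rewrite z0 addr0.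
have := mn `|(y %% n%:Z)%Z|%N; rewrite (asboolT (Ia _ I2)) andbT; lia.
Qed.

Definition Qz : lmodType int := resL (intr : {rmorphism int -> rat}) (rat^o : lmodType rat).
Definition isint (x : Qz) : Prop := exists k : int, x = k%:~R :> rat.
Lemma isint_sub : submod isint.
Proof.
split=> [|_ _ [k ->] [l ->]|a _ [k ->]]; first by exists 0.
  by exists (k + l); rewrite rmorphD.
by exists (a * k); rewrite rmorphM.
Qed.
Definition QZ : lmodType int := cok isint_sub.
Definition qz (x : rat) : QZ := cokp isint_sub (x : Qz).
Lemma qzZ (k : int) x : k *: qz x = qz (k%:~R * x).
Proof. exact: cok_scaleE. Qed.
Lemma qzD x y : qz (x + y) = qz x + qz y. Proof. exact: (cokpD isint_sub). Qed.

Lemma inj_QZ : inj QZ.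
Proof.
apply: baer_inj => I f iI fD fZ; have [h|[n [n0 In hn]]] := int_ideal_gen iI.
  exists 0 => x /h ->; rewrite scale0r -(scale0r (f 0)) -fZ ?mul0r //; exact: ideal0.
exists (qz ((cokr (f n%:Z) : rat) / n%:R)) => x /hn [k ->].
rewrite fZ // -scalerA; congr (_ *: _); rewrite qzZ.
rewrite mulrC divfK; first by rewrite /qz cokrK.
by rewrite Num.Theory.pnatr_eq0 -lt0n.
Qed.

Lemma QZ_cogen (N : lmodType int) (n : N) : n <> 0 -> exists chi : N -> QZ, lin chi /\ chi n <> 0.
Proof.
move=> n0; have iI : is_ideal (fun k : int => k *: n = 0).
  split=> [|x y hx hy|a x hx]; first by rewrite scale0r.
    by rewrite scalerDl hx hy addr0.
  by rewrite -scalerA hx scaler0.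
(* [m] is the order of [n], or 2 when the order is infinite; [1 / m] is then an admissible value at
   [n], nonzero modulo the integers. *)
have [m [m1 hm]] : exists m : nat, (1 < m)%N /\ forall k : int, k *: n = 0 -> exists l, k = l * m%:Z.
  have [h|[m [m0 Im hm]]] := int_ideal_gen iI; first by exists 2%N; split=> // k /h ->; exists 0.
  exists m; split=> //; rewrite ltn_neqAle m0 andbT eq_sym; apply/eqP => m1.
  by apply: n0; rewrite -[n]scale1r -Im m1.
have mr : (m%:R : rat) != 0 by rewrite Num.Theory.pnatr_eq0; lia.
have [f hf] : exists f : N -> QZ, forall k : int, f (k *: n) = qz (k%:~R / m%:R).
  have H z : exists e, forall k : int, z = k *: n -> e = qz (k%:~R / m%:R).
    have [[k ->]|nz] := pselect (exists k : int, z = k *: n); last by exists 0 => k hk; case: nz; exists k.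
    exists (qz (k%:~R / m%:R)) => k' hk; apply/cokP.
    have [|l hl] := hm (k - k'); first by rewrite scalerBl hk subrr.
    exists l; rewrite -[X in X = _]/((k%:~R / m%:R - k'%:~R / m%:R) : rat) -mulrBl -rmorphB /= hl rmorphM.
    by rewrite mulfK.
  by have [f hf] := choice H; exists f => k; apply: hf.
pose U z := exists k : int, z = k *: n.
have [||g [lg hg]] := inj_QZ (U := U) (f := f).
- split=> [|_ _ [k ->] [l ->]|a _ [k ->]]; first by exists 0; rewrite scale0r.
    by exists (k + l); rewrite scalerDl.
  by exists (a * k); rewrite scalerA.
- split=> [_ _ [k ->] [l ->]|a _ [k ->]]; first by rewrite -scalerDl !hf rmorphD mulrDl qzD.
  by rewrite scalerA !hf rmorphM -mulrA qzZ.
exists g; split=> //; rewrite hg; last by exists 1; rewrite scale1r.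
rewrite -[n]scale1r hf => /cokp0 [k] /(congr1 (fun x => x * m%:R)).
rewrite divfK // => hk; have : (1 : int) = k * m%:Z.
  by apply/eqP; rewrite -(eqr_int rat) rmorphM -hk.
by move=> /(congr1 absz); rewrite abszM; case: `|k|%N => [|[|]] //= *; lia.
Qed.

Variables (L : comPzRingType) (N : lmodType L).
Local Notation gi := (intr : {rmorphism int -> L}).
Definition cochar : Type := {chi : resL gi N -> QZ | lin chi}.
(** One coinduced copy of [QZ] for each character of [N], so that the embedding separates elements
    by [QZ_cogen]. *)
Definition hull : lmodType L := cind gi cochar QZ.
Program Definition hull_in (n : N) : hull := @Cind _ _ gi cochar QZ (fun c l => sval c (l *: n)) _ _.
Next Obligation.
move=> n c x y; cbv beta; rewrite scalerDl; exact: (proj2_sig c).1.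
Qed.
Next Obligation.
move=> n c a x; cbv beta; rewrite -scalerA; exact: (proj2_sig c).2.
Qed.

Lemma hull_lin : lin hull_in.
Proof.
split=> [x y|a x]; apply: cind_ext => c l /=; first by rewrite scalerDr (proj2_sig c).1.
by rewrite scalerA mulrC.
Qed.

Lemma hull_inj : injective hull_in.
Proof.
suff H n : hull_in n = 0 -> n = 0.
  move=> x y h; apply/eqP; rewrite -subr_eq0; apply/eqP/H.
  by rewrite (linB _ _ hull_lin) h subrr.
move=> h; apply: contrapT => n0.
have [chi [lchi hchi]] := QZ_cogen (N := resL gi N) n0.
apply: hchi; have := congr1 (fun F : cind gi cochar QZ => F (exist _ chi lchi) 1) h.
by rewrite /= scale1r.
Qed.

Lemma inj_hull : inj hull. Proof. exact: inj_cind inj_QZ. Qed.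

Lemma enough_inj : exists (E C : lmodType L) (i : N -> E) (p : E -> C), inj E /\ ses i p.
Proof.
have [C [p h]] := ses_coker hull_lin hull_inj.
by exists hull, C, hull_in, p; split=> //; apply: inj_hull.
Qed.
End Embedding.

(** * Polynomial rings: the Ext bound grows by one, and noetherianity is preserved *)

Section PolyStep.
Variable K : comNzRingType.
Local Notation P := {poly K}.
Local Notation g := (polyC : {rmorphism K -> P}).
Hypothesis hN : noetherian K.

Lemma poly_sumE (J : lmodType K) (F : P -> J) : (forall x y, F (x + y) = F x + F y) ->
  (forall a x, F (a%:P * x) = a *: F x) ->
  forall (q : P) n, (size q <= n)%N -> F q = \sum_(k < n) q`_k *: F 'X^k.
Proof.
move=> FD FZ q n hn.
have F0 : F 0 = 0 by apply: (addrI (F 0)); rewrite -FD !addr0.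
have {1}-> : q = \sum_(k < n) (q`_k)%:P * 'X^k :> P.
  apply/polyP => i; rewrite coef_sum.
  under eq_bigr => k _ do rewrite coefCM coefXn.
  have [hi|hi] := ltnP i n.
    rewrite (bigD1 (Ordinal hi)) //= eqxx mulr1 big1 ?addr0 // => k kn.
    by rewrite (_ : (i == k) = false) ?mulr0 //; apply/negbTE; move: kn; rewrite -val_eqE eq_sym.
  rewrite big1 => [|k _]; first by rewrite nth_default // (leq_trans hn hi).
  by rewrite (_ : (i == k) = false) ?mulr0 //; apply/negbTE; rewrite neq_ltn (leq_trans (ltn_ord k) hi) orbT.
by rewrite (big_morph F FD F0); apply: eq_bigr => k _.
Qed.

Lemma poly_uniq (J : lmodType K) (F G : P -> J) : (forall x y, F (x + y) = F x + F y) ->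
  (forall a x, F (a%:P * x) = a *: F x) -> (forall x y, G (x + y) = G x + G y) ->
  (forall a x, G (a%:P * x) = a *: G x) -> (forall k, F 'X^k = G 'X^k) -> forall q, F q = G q.
Proof.
move=> FD FZ GD GZ h q; rewrite (poly_sumE FD FZ (leqnn (size q))) (poly_sumE GD GZ (leqnn (size q))).
by apply: eq_bigr => k _; rewrite h.
Qed.

Lemma poly_ext (J : lmodType K) (e : nat -> J) : exists F : P -> J,
  [/\ forall x y, F (x + y) = F x + F y, forall a x, F (a%:P * x) = a *: F x & forall k, F 'X^k = e k].
Proof.
pose F (q : P) := \sum_(k < size q) q`_k *: e k.
have FE (q : P) n : (size q <= n)%N -> F q = \sum_(k < n) q`_k *: e k.
  move=> h; rewrite /F (big_ord_widen n (fun k => q`_k *: e k) h) big_mkcond.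
  apply: eq_bigr => k _; case: ltnP => // hk; by rewrite nth_default // scale0r.
exists F; split=> [x y|a x|k].
- pose m := maxn (size x) (size y); rewrite (FE (x + y) m) ?size_polyD //.
  rewrite (FE x m) ?leq_maxl // (FE y m) ?leq_maxr // -big_split; apply: eq_bigr => k _.
  by rewrite coefD scalerDl.
- rewrite (FE (a%:P * x) (size x)); last by rewrite mul_polyC size_scale_leq.
  by rewrite /F scaler_sumr; apply: eq_bigr => k _; rewrite coefCM scalerA.
rewrite (FE _ k.+1) ?size_polyXn // big_ord_recr /= coefXn eqxx scale1r big1 ?add0r // => i _.
by rewrite coefXn (ltn_eqF (ltn_ord i)) scale0r.
Qed.

Program Definition cind_map (J J' : lmodType K) (f : J -> J') (lf : lin f) (F : cind g unit J) :
  cind g unit J' := @Cind _ _ g unit J' (fun c x => f (F c x)) _ _.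
Next Obligation. by move=> J J' f lf F c x y; cbv beta; rewrite cindD lf.1. Qed.
Next Obligation. by move=> J J' f lf F c a x; cbv beta; rewrite cindZ lf.2. Qed.

(** [Hom_K(K[X], -)] is exact because [K[X]] is free on the powers of [X]: preimages are chosen on
    these powers. *)
Lemma ses_cind (N E C : lmodType K) (i : N -> E) (p : E -> C) : ses i p ->
  exists (I : (cind g unit N : lmodType P) -> (cind g unit E : lmodType P))
    (Q : (cind g unit E : lmodType P) -> (cind g unit C : lmodType P)), ses I Q.
Proof.
move=> [li lp ii sp ex]; exists (cind_map li), (cind_map lp); split.
- by split=> [x y|a x]; apply: cind_ext => c l //=; rewrite li.1.
- by split=> [x y|a x]; apply: cind_ext => c l //=; rewrite lp.1.
- move=> F G h; apply: cind_ext => c x; apply: ii.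
  by have := congr1 (fun H : cind g unit E => H c x) h.
- move=> G; have [e he] := choice (fun k => sp (G tt 'X^k)).
  have [F [FD FZ Fe]] := poly_ext e.
  exists (@Cind _ _ g unit E (fun _ => F) (fun _ => FD) (fun _ => FZ)).
  apply: cind_ext => -[] q /=; apply: (@poly_uniq C (fun q => p (F q)) (fun q => G tt q)).
  + by move=> x y; rewrite FD lp.1.
  + by move=> a x; rewrite FZ lp.2.
  + by move=> x y; rewrite cindD.
  + by move=> a x; rewrite (cindZ G).
  by move=> k; rewrite Fe he.
move=> F; split=> [h|[H ->]]; last first.
  by apply: cind_ext => c q /=; apply/ex; exists (H c q).
have /choice [n hn] : forall q, exists n, F tt q = i n.
  move=> q; apply/ex; by have := congr1 (fun H : cind g unit C => H tt q) h.
have nD x y : n (x + y) = n x + n y by apply: ii; rewrite li.1 -!hn cindD.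
have nZ a x : n (polyC a * x) = a *: n x by apply: ii; rewrite li.2 -!hn (cindZ F).
exists (@Cind _ _ g unit N (fun _ => n) (fun _ => nD) (fun _ => nZ)).
by apply: cind_ext => -[] q /=.
Qed.

(** Coinduction preserves injectives and short exact sequences, so a dimension shift over [K] turns
    into one over [K[X]]. *)
Lemma EV_cind n (N : lmodType K) : EV n N -> EV n (cind g unit N : lmodType P).
Proof.
elim: n N => [|n IH] N h; first by apply/inj_EV/inj_cind/EV0_inj.
have [E [C [i [p [hE s]]]]] := enough_inj N.
have [I [Q S]] := ses_cind s.
apply: (ses_up S); first exact/inj_EV/inj_cind.
by apply: IH; apply: (ses_down hN s) => //; apply: inj_EV.
Qed.

Lemma EV_le (R : comPzRingType) (N : lmodType R) k l : (k <= l)%N -> EV k N -> EV l N.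
Proof. by move=> kl h a b c phi psi x hx; apply: h; apply: xch_le hx. Qed.

Section OneModule.
Variable N : lmodType P.
Local Notation N0 := (resL g N).
Program Definition poly_in (x : N) : cind g unit N0 := @Cind _ _ g unit N0 (fun _ q => q *: x) _ _.
Next Obligation. by move=> x c q q'; cbv beta; exact: (@scalerDl P N x q q'). Qed.
Next Obligation. by move=> x c a q; cbv beta; rewrite -scalerA. Qed.
Program Definition poly_out (F : cind g unit N0) : cind g unit N0 :=
  @Cind _ _ g unit N0 (fun c q => (F c ('X * q) - ('X : P) *: (F c q : N)) : N0) _ _.
Next Obligation.
by move=> F c q q'; cbv beta; rewrite mulrDr !cindD [_ *: (_ + _)]scalerDr opprD addrACA.
Qed.
Next Obligation.
move=> F c a q; cbv beta; rewrite mulrCA !(cindZ F) /= [RHS]scalerBr; congr (_ - _).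
by rewrite ![_ *: (F c q : N0)]resLE ![RHS]resLE /= !scalerA mulrC.
Qed.

(** Inside the [K]-linear maps [K[X] -> N], those commuting with [X] are the multiplications by
    elements of [N]. This coresolution of length one raises the bound by one. *)
Lemma ses_poly : ses (poly_in : N -> (cind g unit N0 : lmodType P))
  (poly_out : (cind g unit N0 : lmodType P) -> (cind g unit N0 : lmodType P)).
Proof.
split.
- split=> [x y|a x]; apply: cind_ext => c q /=; first exact: scalerDr.
  by rewrite scalerA mulrC.
- split=> [F G|a F]; apply: cind_ext => c q /=; last by rewrite mulrCA.
  by rewrite [_ *: (_ + _)]scalerDr opprD addrACA.
- move=> x y h; have := congr1 (fun F : cind g unit N0 => F tt 1) h.
  by rewrite /= !scale1r.
(* The equation [F(X q) - X F(q) = G(q)] is solved recursively on the powers of [X], starting from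
   [F(1) = 0]. *)
- move=> G; pose e : nat -> N0 := fix e k := if k is k'.+1 then
    (('X : P) *: (e k' : N) + (G tt 'X^k' : N) : N) else 0.
  have [F [FD FZ Fe]] := poly_ext e.
  exists (@Cind _ _ g unit N0 (fun _ => F) (fun _ => FD) (fun _ => FZ)).
  apply: cind_ext => -[] q /=.
  apply: (@poly_uniq N0 (fun q => (F ('X * q) - ('X : P) *: (F q : N)) : N0) (fun q => G tt q)).
  + by move=> x y; rewrite mulrDr !FD [_ *: (_ + _)]scalerDr opprD addrACA.
  + move=> a x; rewrite mulrCA !FZ [RHS]scalerBr; congr (_ - _).
    by rewrite ![_ *: (F x : N0)]resLE ![RHS]resLE /= !scalerA mulrC.
  + by move=> x y; rewrite cindD.
  + by move=> a x; rewrite (cindZ G).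
  by move=> k; rewrite -exprS !Fe /= addrC addKr.
move=> F; split=> [h|[x ->]]; last first.
  by apply: cind_ext => c q /=; rewrite scalerA subrr.
have hX q : F tt ('X * q) = ('X : P) *: (F tt q : N).
  apply/eqP; rewrite -subr_eq0; apply/eqP.
  by have := congr1 (fun H : cind g unit N0 => H tt q) h.
exists (F tt 1 : N); apply: cind_ext => -[] q /=.
elim/poly_ind: q => [|q c IH].
  by rewrite scale0r; apply: (addrI (F tt 0)); rewrite -cindD !addr0.
rewrite cindD mulrC hX IH scalerA [RHS]scalerDl; congr (_ + _).
by rewrite -[X in F tt X]mulr1 (cindZ F).
Qed.
End OneModule.

Lemma EV_poly n : (forall N : lmodType K, EV n N) -> forall N : lmodType P, EV n.+1 N.
Proof.
move=> h N; apply: (ses_up (ses_poly N)); first by apply: (@EV_le _ _ n) => //; apply: EV_cind.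
exact: EV_cind.
Qed.

(** Polynomials realizing generators of the ideal of leading coefficients are raised to a common
    degree [D]. They lower degrees that are at least [D], and the members of [I] of smaller degree
    form a submodule of [K^D], finitely generated by [sub_fg]. *)
Lemma hilbert_basis : noetherian P.
Proof.
move=> I iI.
pose L (a : K) := exists p d, [/\ I p, (size p <= d.+1)%N & p`_d = a].
have IX (p : P) k : I p -> I ('X^k * p) by apply: idealM.
have lift (p : P) d e : I p -> (size p <= d.+1)%N -> (d <= e)%N ->
    [/\ I ('X^(e - d) * p), (size ('X^(e - d) * p)%R <= e.+1)%N & ('X^(e - d) * p)`_e = p`_d].
  move=> hp sp de; split; first exact: IX.
    by rewrite (leq_trans (size_polyMleq _ _)) // size_polyXn addSn /= (leq_trans (leq_add (leqnn _) sp)) // addnS subnK.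
  by rewrite coefXnM ltnNge leq_subr /= subKn.
have iL : is_ideal L.
  split; first by exists 0, 0%N; rewrite size_poly0 coef0; split=> //; apply: ideal0.
    move=> _ _ [p [d [Ip sp <-]]] [q [e [Iq sq <-]]].
    have [I1 s1 c1] := lift p d (maxn d e) Ip sp (leq_maxl _ _).
    have [I2 s2 c2] := lift q e (maxn d e) Iq sq (leq_maxr _ _).
    exists ('X^(maxn d e - d) * p + 'X^(maxn d e - e) * q), (maxn d e); split.
    - exact: idealD.
    - by rewrite (leq_trans (size_polyD _ _)) // geq_max s1.
    by rewrite coefD c1 c2.
  move=> a _ [p [d [Ip sp <-]]]; exists (a%:P * p), d; rewrite coefCM; split=> //.
    exact: idealM.
  by rewrite mul_polyC (leq_trans (size_scale_leq _ _)).
have [n [v hv]] := hN iL.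
have vL i := gens_in hv i.
have [p0 /choice [d0 h0]] := choice vL.
pose D := (\max_(i < n) d0 i)%N.
have dD i : (d0 i <= D)%N by apply: leq_bigmax.
pose f i := 'X^(D - d0 i) * p0 i.
have hf i : [/\ I (f i), (size (f i) <= D.+1)%N & (f i)`_D = v i].
  by case: (h0 i) => h1 h2 <-; apply: lift.
have pX c c' : \poly_(i < D) (if insub i is Some j then c j + c' j else 0) =
   \poly_(i < D) (if insub i is Some j then c j else 0) +
   \poly_(i < D) (if insub i is Some j then c' (j : 'I_D) else 0) :> P.
  apply/polyP => i; rewrite coefD !coef_poly; case: ltnP => hi; last by rewrite addr0.
  by rewrite insubT.
pose tp (c : 'I_D -> K) : P := \poly_(i < D) (if insub i is Some j then c j else 0).
have tpE c (i : 'I_D) : (tp c)`_i = c i.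
  by rewrite coef_poly ltn_ord valK.
have tp_size c : (size (tp c) <= D)%N by apply: size_poly.
have tpK (q : P) : (size q <= D)%N -> tp (fun i => q`_i) = q.
  move=> h; apply/polyP => i; have [hi|hi] := ltnP i D; first exact: (tpE _ (Ordinal hi)).
  by rewrite !nth_default // ?(leq_trans h) // (leq_trans (tp_size _)).
have tpM a c : tp (fun i => a * c i) = a%:P * tp c.
  apply/polyP => i; rewrite coefCM; have [hi|hi] := ltnP i D.
    by rewrite -[i]/(val (Ordinal hi)) !tpE.
  by rewrite !(nth_default _ (leq_trans (tp_size _) hi)) mulr0.
have tp0 : tp (fun=> 0) = 0.
  by apply/polyP => i; rewrite coef0 coef_poly; case: ltnP => // hi; rewrite insubT.
have [|||r [h [hh sp]]] := @sub_fg _ hN D (fun c => I (tp c)).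
- by rewrite tp0; apply: ideal0.
- by move=> c c' hc hc'; rewrite /tp pX; apply: idealD.
- by move=> a c hc; rewrite tpM; apply: idealM.
pose w (k : 'I_(n + r)) : P := match split k with inl i => f i | inr j => tp (h j) end.
exists (n + r)%N, w => q; split; last first.
  move=> [c ->]; apply: ideal_sum => // k; apply: idealM => //; rewrite /w.
  by case: (split k) => i; [case: (hf i) | apply: hh].
have comb (l1 : 'I_n -> P) (l2 : 'I_r -> P) : exists c : 'I_(n + r) -> P,
    \sum_k c k * w k = \sum_i l1 i * f i + \sum_j l2 j * tp (h j).
  exists (fun k => match split k with inl i => l1 i | inr j => l2 j end).
  rewrite big_split_ord /=; congr (_ + _); apply: eq_bigr => a _.
    by rewrite /w !(unsplitK (inl a)).
  by rewrite /w !(unsplitK (inr a)).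
suff H m : forall (q : P), (size q <= D + m)%N -> I q -> exists c, q = \sum_k c k * w k.
  by apply: (H (size q)); rewrite leq_addl.
elim: m => [|m IH] {}q sq Iq.
  rewrite addn0 in sq; have /sp [l hl] : I (tp (fun i => q`_i)) by rewrite tpK.
  have [c hc] := comb (fun=> 0) (fun j => (l j)%:P); exists c.
  rewrite hc big1 ?add0r => [|i _]; last by rewrite mul0r.
  rewrite -(tpK q sq); apply/polyP => i; rewrite coef_sum.
  under eq_bigr => j _ do rewrite coefCM.
  have [hi|hi] := ltnP i D; last first.
    rewrite nth_default ?(leq_trans (tp_size _)) // big1 // => j _.
    by rewrite nth_default ?mulr0 // (leq_trans (tp_size _)).
  rewrite -[i]/(val (Ordinal hi)) tpE hl; apply: eq_bigr => j _; by rewrite tpE.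
have /hv [l hl] : L q`_(D + m) by exists q, (D + m)%N; rewrite -addnS.
pose q' := q - \sum_i ((l i)%:P * 'X^m) * f i.
have Iq' : I q'.
  by apply: idealB => //; apply: ideal_sum => // i; apply: idealM => //; case: (hf i).
have [|c hc] := IH q' _ Iq'.
  apply/leq_sizeP => j; rewrite leq_eqVlt => /orP [/eqP <-|hj].
    rewrite coefB coef_sum hl; apply/eqP; rewrite subr_eq0; apply/eqP/eq_bigr => i _.
    rewrite -mulrA coefCM coefXnM ltnNge leq_addl /= addnK; by case: (hf i) => _ _ ->.
  rewrite coefB coef_sum nth_default ?sub0r; last by rewrite (leq_trans sq) // addnS.
  rewrite big1 ?oppr0 // => i _; rewrite -mulrA coefCM coefXnM.
  case: ltnP => _; rewrite ?mulr0 // nth_default ?mulr0 //.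
  by case: (hf i) => _ h1 _; apply: (leq_trans h1); lia.
have [c' hc'] := comb (fun i => (l i)%:P * 'X^m) (fun=> 0).
exists (fun k => c k + c' k); under eq_bigr => k _ do rewrite mulrDl.
rewrite big_split /= -hc hc' [X in _ + (_ + X)]big1 ?addr0; last by move=> j _; rewrite mul0r.
by rewrite /q' subrK.
Qed.
End PolyStep.

(** * Complexes of finite injective dimension over a commutative ring *)

Section ConcModules.
Variable B0 : comPzRingType.
Local Notation B := (concRing B0).
Implicit Types (M : dgMod B) (N E C : lmodType B0).
Definition cin (x : B0) : B 0 := conc_in x.

Lemma conc0_in (a : B 0) : a = cin (val a). Proof. exact: val_inj. Qed.

Lemma act_conc M p i j (e : p + i = j) (a : B p) (x : M i) : p <> 0 -> act e a x = 0.
Proof.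
move=> p0; have -> : a = 0 by apply: val_inj; rewrite (conc_val0 a) //; apply/eqP.
by rewrite (morphD0 (act_addl e x)).
Qed.

Lemma dmul_cin a b : dmul (add0r 0) (cin a) (cin b) = cin (a * b).
Proof. exact: val_inj. Qed.

Program Definition chom M M' n (f : forall i j, i + n = j -> M i -> M' j)
    (fD : forall i j (e : i + n = j), {morph f i j e : x y / x + y})
    (fZ : forall i j (e : i + n = j) a x, f i j e (sc (cin a) x) = sc (cin a) (f i j e x)) :=
  @Hom B M M' n f fD _.
Next Obligation.
move=> M M' n f fD fZ p i k j l e ej el e' a m.
have [p0|/eqP p0] := eqVneq p 0; last first.
  rewrite !act_conc // zsign00; exact: (morphD0 (@fD _ _ el)).
subst p; have ik : i = k by lia.
have jl : j = l by lia.
case: k / ik e el => e el; case: l / jl e' el => e' el; rewrite mul0r zsign0 (Prop_irrelevance e (add0r i)) (Prop_irrelevance e' (add0r j)).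
by rewrite (Prop_irrelevance el ej) (conc0_in a); apply: fZ.
Qed.

Section OneModule.
Variable N : lmodType B0.
(** A module in degree 0 has in every degree a subgroup of the same [N], zero outside degree 0; no
    case distinction enters the types. *)
Definition cmod_pred (i : int) : {pred N} := [pred x | (i == 0) || (x == 0)].
Lemma cmod_zmod i : zmod_closed (cmod_pred i).
Proof.
rewrite /cmod_pred; split=> [|x y]; rewrite !inE ?eqxx ?orbT //.
by case: (i == 0) => //= /eqP -> /eqP ->; rewrite subrr.
Qed.
HB.instance Definition _ i := GRing.isZmodClosed.Build N (cmod_pred i) (cmod_zmod i).
Definition cmodT (i : int) : Type := {x : N | x \in cmod_pred i}.
HB.instance Definition _ i := SubChoice.on (cmodT i).
HB.instance Definition _ i := [SubChoice_isSubZmodule of cmodT i by <:].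
Program Definition cmodc : cpx := @Cpx (fun i => cmodT i) (fun i j _ _ => 0) _ _.
Next Obligation. by move=> i j e x y; rewrite addr0. Qed.
Next Obligation. by []. Qed.

Lemma cmod_val0 i (x : cmodT i) : i != 0 -> val x = 0.
Proof. by move=> i0; have := valP x; rewrite inE (negbTE i0) => /eqP. Qed.
Lemma cmod_act_sub i j k (e : i + j = k) (a : conc B0 i) (x : cmodT j) :
  val a *: val x \in cmod_pred k.
Proof.
rewrite inE; have [//|k0] := eqVneq k 0; apply/eqP.
have [i0|i0] := eqVneq i 0; last by rewrite conc_val0 // scale0r.
by rewrite [val x]cmod_val0 ?scaler0 //; move: k0; rewrite -e i0 add0r.
Qed.
Program Definition cmod : dgMod B :=
  @DGMod B cmodc (fun i j k e a x => Sub (val a *: val x) (cmod_act_sub e a x) : cmodT k) _ _ _ _ _.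
Next Obligation. by move=> *; apply: val_inj; rewrite [RHS]raddfD; exact: scalerDl. Qed.
Next Obligation.
move=> i j k e a m n; apply: val_inj; rewrite [RHS]raddfD -[RHS]scalerDr.
by congr (_ *: _); apply: raddfD.
Qed.
Next Obligation. by move=> *; apply: val_inj; rewrite /= scalerA. Qed.
Next Obligation. by move=> *; apply: val_inj; rewrite /= scale1r. Qed.
Next Obligation.
move=> i j k i' j' k' e ei ej ek e1 e2 a x; apply: val_inj.
by rewrite raddfD (morphD_zsign (raddfD val)) /= scale0r scaler0 zsign00 addr0.
Qed.

Definition cmk i (x : N) (h : i = 0 \/ x = 0) : cmod i.
Proof. by apply: (Sub x); rewrite inE; apply/orP; case: h => ->; [left | right]. Defined.
Lemma cmkE i x h : val (@cmk i x h : cmodT i) = x. Proof. by []. Qed.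
Lemma cmod_case i (x : cmod i) : i = 0 \/ val (x : cmodT i) = 0.
Proof. by have [e|h] := eqVneq i 0; [left | right; apply: cmod_val0]. Qed.
Lemma cmod_sc i a (x : cmod i) : val (sc (cin a) x : cmodT i) = a *: val (x : cmodT i).
Proof. by []. Qed.
Lemma cmod_cd i j (e : i + 1 = j) (x : cmod i) : cd e x = 0. Proof. by []. Qed.
Lemma cmod_Z i (x : cmod i) : isZ x. Proof. by []. Qed.
Lemma cmod_B i (x : cmod i) : isB x <-> x = 0.
Proof. by split=> [[j [e [y ->]]]|->] //; apply: isB0. Qed.
Lemma cmod_cst i j (e : i = j) (x : cmod i) : val (@cst cmod i j e x : cmodT j) = val (x : cmodT i).
Proof. by case: j / e. Qed.
Lemma cmod0 i : val (0 : cmodT i) = 0. Proof. by []. Qed.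
End OneModule.

Lemma cbk_sub i (x : B0) : i = 0 \/ x = 0 -> x \in conc_pred i.
Proof. by move=> h; rewrite inE; apply/orP; case: h => ->; [left | right]. Qed.
Definition cbk i (x : B0) (h : i = 0 \/ x = 0) : B i := Sub x (cbk_sub h).

Lemma cocyc_zero M M' n (f : hom M M' n) : (forall i j (e : i + 1 = j) (x : M i), cd e x = 0) ->
  (forall i j (e : i + 1 = j) (x : M' i), cd e x = 0) -> cocyc f.
Proof.
move=> h h' k e; apply: hom_ext => i j ej x.
rewrite (homdE e f ej (erefl (i + 1)) (erefl (i + n)) _ _ x); try lia.
by move=> e1 e2; rewrite h h' hfun0 zsign00 subr0.
Qed.

Program Definition clin N E (f : N -> E) (lf : lin f) : hom (cmod N) (cmod E) 0 :=
  @chom (cmod N) (cmod E) 0 (fun i j e x => @cmk E j (f (val (x : cmodT N i))) _) _ _.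
Next Obligation.
move=> N E f lf i j e x; have [i0|->] := cmod_case x; first by left; rewrite -e i0.
by right; apply: lin0.
Qed.
Next Obligation.
move=> N E f lf i j e x y; apply: val_inj; rewrite [RHS]raddfD -[RHS]lf.1.
by congr (f _); apply: raddfD.
Qed.
Next Obligation. by move=> N E f lf i j e a x; apply: val_inj; rewrite /= lf.2. Qed.
Lemma clinE N E (f : N -> E) (lf : lin f) i j (e : i + 0 = j) x :
  val (clin lf i j e x : cmodT E j) = f (val (x : cmodT N i)).
Proof. by []. Qed.
Lemma dclin N E (f : N -> E) (lf : lin f) : cocyc (clin lf).
Proof. exact: cocyc_zero. Qed.

Section Degree.
Variables (M : dgMod B) (k : int).
Definition degT : Type := M k.
HB.instance Definition _ := GRing.Zmodule.on degT.
Definition deg_scale (a : B0) (x : degT) : degT := sc (cin a) (x : M k).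
Lemma deg_A a b x : deg_scale a (deg_scale b x) = deg_scale (a * b) x.
Proof. by rewrite /deg_scale -scM dmul_cin. Qed.
Lemma deg_1 : left_id 1 deg_scale. Proof. by move=> x; apply: (sc1 (M := M)). Qed.
Lemma deg_Dr : right_distributive deg_scale +%R. Proof. by move=> a x y; apply: scDr. Qed.
Lemma deg_Dl x : {morph deg_scale^~ x : a b / a + b}.
Proof.
move=> a b; rewrite /deg_scale -scDl; congr (sc _ _); exact: val_inj.
Qed.
HB.instance Definition _ := GRing.Zmodule_isLmodule.Build B0 degT deg_A deg_1 deg_Dr deg_Dl.
Lemma degZ a (x : M k) : a *: (x : degT) = sc (cin a) x. Proof. by []. Qed.

Variables (N : lmodType B0) (n : int) (nk : k + n = 0) (h : degT -> N).
Hypothesis lh : lin h.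
Definition hext i (x : M i) : N :=
  if pselect (i = k) is left e then h (@cst M i k e x) else 0.
Lemma hextE (x : M k) : hext x = h x.
Proof. by rewrite /hext; case: pselect => // e; rewrite cst_id. Qed.
Lemma hext_ne i (x : M i) : i <> k -> hext x = 0.
Proof. by rewrite /hext; case: pselect. Qed.
Program Definition hdeg : hom M (cmod N) n :=
  @chom M (cmod N) n (fun i j e x => @cmk N j (hext x) _) _ _.
Next Obligation.
move=> i j e x; have [->|ne] := pselect (j = 0); [by left | right].
by apply: hext_ne; lia.
Qed.
Next Obligation.
move=> i j e x y; apply: val_inj; rewrite raddfD /=.
have [ik|ne] := pselect (i = k); last by rewrite !hext_ne ?addr0.
by subst i; rewrite !hextE lh.1.
Qed.
Next Obligation.
move=> i j e a x; apply: val_inj => /=.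
have [ik|ne] := pselect (i = k); last by rewrite !hext_ne ?scaler0.
by subst i; rewrite !hextE -degZ lh.2.
Qed.
Lemma hdegE i j (e : i + n = j) x : val (hdeg i j e x : cmodT N j) = hext x. Proof. by []. Qed.
End Degree.

Variable S0 : B0 -> Prop.
Definition Sc (b : B 0) : Prop := S0 (val b).

(** An amplitude bound that mentions only the localized cohomology of [X] but concludes honest
    vanishing: it combines injective dimension at most [n] with invertibility of [S0] on the
    target. *)
Definition idim_le (n : nat) (I : dgMod B) : Prop := forall (X : dgMod B) i,
  (forall k, (- i <= k)%R -> (k <= - i + n%:Z)%R -> svan Sc X k) -> van (Homdg X I) i.

(** A closed map into [N] is a linear form on [X^(- i)] that kills boundaries. Cocycles are
    boundaries up to [S0], and [N] has no [S0]-torsion, so the form kills cocycles; it therefore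
    factors through the differential and extends by injectivity. *)
Lemma idim_cmod N : inj N -> (forall s (x : N), S0 s -> s *: x = 0 -> x = 0) -> idim_le 0 (cmod N).
Proof.
move=> hN hS X i hX f Zf.
have e0 : - i + i = 0 by lia.
pose F (x : X (- i)) : N := val (f (- i) 0 e0 x : cmodT N 0).
have FD x y : F (x + y) = F x + F y by rewrite /F homD raddfD.
have FZ a x : F (sc (cin a) x) = a *: F x by rewrite /F hfun_sc.
have Fd j (e : j + 1 = - i) y : F (cd e y) = 0.
  have e1 : j + (i + 1) = 0 by lia.
  have e2 : j + i = -1 by lia.
  have E0 : homd (erefl (i + 1)) f = 0 := Zf (i + 1) erefl.
  have := congr1 (fun g : hom X (cmod N) (i + 1) => g j 0 e1 y) E0; cbv beta.
  rewrite (homdE erefl f e1 e e2 erefl e0 y) cmod_cd sub0r hom0E.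
  by move=> /eqP; rewrite oppr_eq0 => /eqP /(congr1 (@zsign i (cmod N 0))); rewrite zsignK zsign00 /F => ->.
have Fz z : isZ z -> F z = 0.
  move=> Zz; have [s [Ss [j [e [y sy]]]]] := hX (- i) (Order.POrderTheory.lexx _) ltac:(lia) z Zz.
  by apply: (hS (val s)) => //; rewrite -FZ -(conc0_in s) sy Fd.
have e1 : - i + 1 = - i + 1 by [].
pose U (w : degT X (- i + 1)) := exists x : X (- i), w = cd e1 x.
have sU : submod U.
  split=> [|_ _ [x ->] [y ->]|a _ [x ->]]; first by exists 0; rewrite cd0.
    by exists (x + y); rewrite cdD.
  by exists (sc (cin a) x); rewrite cd_sc.
have [G hG] : exists G : degT X (- i + 1) -> N, forall x, G (cd e1 x) = F x.
  have H w : exists v, forall x, w = cd e1 x -> v = F x.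
    have [[x ->]|nU] := pselect (U w); last by exists 0 => x hx; case: nU; exists x.
    exists (F x) => y hy; apply/eqP; rewrite -subr_eq0; apply/eqP.
    have -> : F x - F y = F (x - y) by rewrite /F hfunB raddfB.
    by apply: Fz; apply: (isZP (e := e1)); rewrite (morphDB (cdD e1)) hy subrr.
  by have [G hG] := choice H; exists G => x; apply: hG.
have [|h [lh hh]] := hN _ U G sU.
  split=> [_ _ [x ->] [y ->]|a _ [x ->]]; first by rewrite -(cdD e1) !hG FD.
  by rewrite degZ -cd_sc !hG FZ.
have e3 : - i + 1 + (i - 1) = 0 by lia.
have e4 : i - 1 + 1 = i by lia.
rewrite -(zsignK i f); apply: isB_zsign.
suff E0 : zsign i f = homd e4 (hdeg e3 lh) by exists (i - 1), e4, (hdeg e3 lh).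
apply: hom_ext => a b e x; apply: val_inj.
have e5 : a + 1 + (i - 1) = b by lia.
rewrite (homdE e4 (hdeg e3 lh) e (erefl (a + 1)) (erefl (a + (i - 1))) _ e5 x); first lia.
move=> e6; rewrite cmod_cd sub0r hom_zsignE.
have -> z : - zsign (i - 1) z = zsign i z :> cmod N b.
  by rewrite -zsign1 -zsignD; have -> : 1 + (i - 1) = i by lia.
have key b' (e' : - i + i = b') (y : X (- i)) : b' = 0 -> val (f (- i) b' e' y : cmodT N b') = F y.
  by move=> h0; move: e'; rewrite h0 => e'; rewrite (Prop_irrelevance e' e0).
suff -> : f a b e x = hdeg e3 lh (a + 1) b e5 (cd erefl x) by [].
apply: val_inj; rewrite hdegE.
have [b0|b0] := pselect (b = 0); last first.
  rewrite hext_ne; last by lia.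
  by have [//|->] := cmod_case (f a b e x).
have ai : a = - i by lia.
subst a; rewrite hextE hh (cd_irr _ e1); last by exists x.
by rewrite hG key.
Qed.

Lemma idim_cone n E (I : dgMod B) (u : hom (cmod E) I 0) (du : cocyc u) :
  idim_le 0 (cmod E) -> idim_le n I -> idim_le n.+1 (sh (- 1) (cone du)).
Proof.
move=> hE hI X i hX.
apply: (hinv_van (i := i - 1) _ (hinv_fun (HomR X) (hinv_sh (- 1) (cone du)))); first by lia.
apply/svan1; have e1 : i - 1 + 1 = i by lia.
apply: (svan_mid (striple_fun (HomR X) (st_cone du)) (mset1 B) (addr0 (i - 1)) e1).
  by apply/svan1/hI => k h1 h2; apply: hX; lia.
by apply/svan1/hE => k h1 h2; apply: hX; lia.
Qed.
End ConcModules.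

Lemma addBK (V : zmodType) (u v : V) : u + (v - u) = v. Proof. by rewrite addrC subrK. Qed.

Lemma cone_cd (A : cdgRing) (X Y : dgMod A) (f : hom X Y 0) (df : cocyc f) i j (e : i + 1 = j)
    (e1 : i + 1 + 0 = j) (e2 : i + 1 + 1 = j + 1) (x : X (i + 1)) (y : Y i) :
  cd e ((x, y) : cone df i) = (- cd e2 x, f (i + 1) j e1 x + cd e y) :> cone df j.
Proof.
by rewrite (Prop_irrelevance e1 (cone_e e)) (Prop_irrelevance e2 (cone_e2 e)).
Qed.

(** * Finite injective resolution of a localization *)

Section LocalGorenstein.
Variables (B0 L : comPzRingType) (g : {rmorphism B0 -> L}) (S0 : B0 -> Prop).
Hypothesis hS : mult_closed S0.
Hypothesis T1 : forall t, exists r s, S0 s /\ t * g s = g r.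
Hypothesis T2 : forall s, S0 s -> exists t, g s * t = 1.
Hypothesis T3 : forall r, g r = 0 <-> exists s, S0 s /\ s * r = 0.
Hypothesis hN : noetherian B0.
Local Notation B := (concRing B0).

(** Exact chains of matrices localize, so the bound for a module over the localization holds over
    [B0]. In particular injectives of the localization stay injective over [B0]. *)
Lemma EV_res k (E : lmodType L) : EV k E -> EV k (resL g E).
Proof.
move=> h a b c phi psi x hx hex hpsi.
have [|y hy] := h _ _ _ (map_mx g phi) (map_mx g psi) x (xch_loc hS T1 T2 T3 hx) (exact_loc hS T1 T2 T3 hex).
  by move=> i; rewrite -[RHS](hpsi i); apply: eq_bigr => j _; rewrite mxE.
by exists y => i; rewrite (hy i); apply: eq_bigr => j _; rewrite mxE.
Qed.

Lemma res_cancel (N : lmodType L) s (x : resL g N) : S0 s -> s *: x = 0 -> x = 0.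
Proof.
move=> /T2 [t ht]; rewrite resLE => h.
by rewrite -[x](scale1r (x : N)) -ht mulrC -scalerA h scaler0.
Qed.

Section Fiber.
Variables (N E C : lmodType B0) (i : N -> E) (p : E -> C) (s : ses i p).
Variables (I : dgMod B) (j : hom (cmod C) I 0).
Hypotheses (dj : cocyc j) (qj : qi j).
Let li : lin i. Proof. by case: s. Qed.
Let lp : lin p. Proof. by case: s. Qed.
Definition fib_map : hom (cmod E) I 0 := hcomp (addr0 0) j (clin lp).
Lemma dfib_map : cocyc fib_map. Proof. exact: cocyc_hcomp dj (dclin lp). Qed.
Local Notation cn := (cone dfib_map).
(** If [I] resolves [C], the cone of [E -> I] resolves [N] up to a shift; the degree is [- 1]
    because the cone places [E] one degree lower. *)
Definition fib_in : hom (cmod N) cn (- 1) := hcomp (add0r (- 1)) (ciX dfib_map) (clin li).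

Lemma fib_inE a b (e : a + - 1 = b) (x : cmod N a) (e1 : a = b + 1) :
  fib_in a b e x = (@cst (cmod E) a (b + 1) e1 (clin li a a (addr0 a) x), 0) :> cn b.
Proof.
rewrite /fib_in (hcompE (add0r (- 1)) _ _ e (addr0 a) e) /=.
by congr (_, _); congr (@cst _ _ _ _ _); apply: Prop_irrelevance.
Qed.

Lemma dfib_in : cocyc fib_in.
Proof.
move=> k ek; apply: hom_ext => a b e x; rewrite hom0E.
have e1 : a + - 1 = b - 1 by lia.
have e2 : b - 1 + 1 = b by lia.
have e3 : a + 1 + - 1 = b by lia.
rewrite (homdE ek fib_in e erefl e1 e2 e3 x) cmod_cd hfun0 zsign00 subr0.
have e4 : a = b - 1 + 1 by lia.
have e5 : b - 1 + 1 + 0 = b by lia.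
have e6 : b - 1 + 1 + 1 = b + 1 by lia.
rewrite (fib_inE e1 x e4) (cone_cd _ _ e5 e6) cmod_cd oppr0 cd0 addr0.
rewrite /fib_map (hcompE (addr0 0) j _ e5 (addr0 (b - 1 + 1)) e5).
rewrite -[RHS]/(0, 0); congr (_, _).
rewrite -[RHS](hfun0 j e5); congr (j _ _ _ _); apply: val_inj.
rewrite clinE cmod_cst clinE cmod0; case: s => _ _ _ _ ex; apply/ex; by eexists.
Qed.

Lemma qfib_in : qi fib_in.
Proof.
have [_ _ ii sp ex] := s.
move=> a; split=> [b e x _|b e [x w] Zy].
  have e1 : a = b + 1 by lia.
  rewrite (fib_inE e x e1) => -[b' [e' [[z1 z2]]]].
  have e5 : b' + 1 + 0 = b by lia.
  have e6 : b' + 1 + 1 = b + 1 by lia.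
  rewrite (cone_cd _ _ e5 e6) cmod_cd => /(congr1 (fun z : cmod E (b + 1) * I b => z.1)) h.
  apply/cmod_B/val_inj; apply: ii; rewrite (lin0 li).
  have := congr1 (fun z : cmod E (b + 1) => val (z : cmodT E (b + 1))) h; cbv beta.
  by rewrite oppr0 cmod_cst clinE cmod0.
have e1 : a = b + 1 by lia.
subst a; have := Zy _ (erefl (b + 1)).
rewrite (cone_cd _ _ (addr0 (b + 1)) (erefl _)).
rewrite /fib_map (hcompE (addr0 0) j _ (addr0 (b + 1)) (addr0 (b + 1)) (addr0 (b + 1))).
move=> /(congr1 (fun z : cmod E (b + 1 + 1) * I (b + 1) => z.2)) hw.
have {}hw : j (b + 1) (b + 1) (addr0 (b + 1)) (clin lp _ _ (addr0 (b + 1)) x) + cd (erefl (b + 1)) w = 0 := hw.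
have p0 : clin lp _ _ (addr0 (b + 1)) x = 0.
  apply/cmod_B; apply: ((qj (b + 1)).1 _ (addr0 _)); first exact: cmod_Z.
  exists b, erefl, (- w); rewrite (morphDN (cdD _)); apply/eqP; rewrite -addr_eq0; exact/eqP.
have [n hn] : exists n, val (x : cmodT E (b + 1)) = i n.
  apply/ex; by have := congr1 (fun z : cmod C (b + 1) => val (z : cmodT C (b + 1))) p0.
have ne : b + 1 = 0 \/ n = 0.
  have [->|h] := cmod_case x; [by left | right].
  by apply: ii; rewrite -hn h (lin0 li).
exists (cmk ne); split; first exact: cmod_Z.
rewrite (fib_inE e (cmk ne) erefl) cst_id.
have -> : clin li (b + 1) (b + 1) (addr0 (b + 1)) (cmk ne) = x.
  by apply: val_inj; rewrite clinE cmkE hn.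
rewrite p0 hfun0 add0r in hw.
have [c [_ [b' [e' [w' hw']]]]] := (qj b).2 b (addr0 b) w (isZP hw).
have [e0 he0] := sp (val (c : cmodT C b)).
have [e2 [ne2 he2]] : exists e2 : E, (b' + 1 = 0 \/ e2 = 0) /\ p e2 = val (c : cmodT C b).
  have [b0|->] := cmod_case c; first by exists e0; split=> //; left; lia.
  by exists 0; split; [right | rewrite (lin0 lp)].
subst b; exists b', erefl, (cmk ne2, w').
rewrite (cone_cd _ _ (addr0 (b' + 1)) (erefl _)) cmod_cd oppr0.
rewrite -[LHS]/(x - x, w - 0) subrr subr0; congr (_, _).
rewrite /fib_map (hcompE (addr0 0) j _ (addr0 (b' + 1)) (addr0 (b' + 1)) (addr0 (b' + 1))).
have -> : clin lp (b' + 1) (b' + 1) (addr0 (b' + 1)) (cmk ne2) = c by apply: val_inj; rewrite clinE cmkE.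
by rewrite -hw' addBK.
Qed.
End Fiber.

(** Each step embeds the module in an injective over the localization, resolves the cokernel, and
    splices by a shifted cone. Using injectives over [L] keeps [S0] invertible, while the count of
    steps uses the bound over [B0]. *)
Lemma resolve n (N : lmodType L) : EV n (resL g N) ->
  exists (I : dgMod B) (j : hom (cmod (resL g N)) I 0), [/\ cocyc j, qi j & idim_le S0 n I].
Proof.
elim: n N => [|n IH] N h.
  exists (cmod (resL g N)), (hid _); split; [exact: cocyc_zero | exact: qi_hid |].
  by apply: idim_cmod; [apply: EV0_inj | apply: res_cancel].
have [E [C [i [p [hE s]]]]] := enough_inj N.
have s' := ses_res g s.
have iE k : EV k (resL g E) by apply/EV_res/inj_EV.
have [I [j [dj qj hI]]] := IH C (ses_down hN s' (iE n) h).
exists (sh (- 1) (cone (dfib_map s' dj))), (hcomp (subrr (- 1)) (shin (- 1) (cone (dfib_map s' dj))) (fib_in s' dj)).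
have ds : cocyc (shin (- 1) (cone (dfib_map s' dj))) by apply: hinv_cocyc (hinv_sh _ _).
split.
- exact: cocyc_hcomp ds (dfib_in s' dj).
- exact: qi_comp (dfib_in s' dj) ds (qfib_in s' dj qj) (qi_hinv (hinv_sh _ _)).
by apply: idim_cone => //; apply: idim_cmod; [apply: EV0_inj | apply: res_cancel].
Qed.

Program Definition unit_map : hom (regMod B) (cmod (resL g (L^o : lmodType L))) 0 :=
  @chom B0 (regMod B) (cmod (resL g (L^o : lmodType L))) 0
    (fun i j e x => @cmk B0 (resL g (L^o : lmodType L)) j (g (val (x : conc B0 i))) _) _ _.
Next Obligation.
move=> i j e x; have [i0|i0] := eqVneq i 0; first by left; rewrite -e i0.
by right; rewrite (conc_val0 x i0) rmorph0.
Qed.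
Next Obligation.
move=> i j e x y; apply: val_inj; rewrite [RHS]raddfD -[RHS](rmorphD g).
by congr (g _); apply: raddfD.
Qed.
Next Obligation. by move=> i j e a x; apply: val_inj => /=; rewrite rmorphM. Qed.
Lemma unit_mapE i j e x : val (unit_map i j e x : cmodT (resL g (L^o : lmodType L)) j) = g (val (x : conc B0 i)).
Proof. by []. Qed.

(** Kernel and cokernel of [B0 -> L] are killed by elements of [S0], so composing with a resolution
    of [L] gives a map whose cone vanishes after localization. *)
Lemma local_resolution n : (forall N : lmodType B0, EV n N) ->
  exists (I : dgMod B) (j : hom (regMod B) I 0) (dj : cocyc j),
    idim_le S0 n I /\ forall i, svan (Sc S0) (cone dj) i.
Proof.
move=> h; have [I [j [dj qj hI]]] := resolve (h (resL g (L^o : lmodType L))).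
have du : cocyc unit_map by apply: cocyc_zero.
pose J := hcomp (addr0 0) j unit_map.
have dJ : cocyc J by apply: cocyc_hcomp.
exists I, J, dJ; split=> // i [r y] Zz.
have := Zz _ (erefl (i + 1)); rewrite (cone_cd _ _ (addr0 (i + 1)) (erefl _)).
rewrite /J (hcompE (addr0 0) j _ (addr0 (i + 1)) (addr0 (i + 1)) (addr0 (i + 1))).
move=> /(congr1 (fun z : B (i + 1 + 1) * I (i + 1) => z.2)) hy.
have {}hy : j (i + 1) (i + 1) (addr0 (i + 1)) (unit_map _ _ (addr0 (i + 1)) r) +
  cd (erefl (i + 1)) y = 0 := hy.
have u0 : unit_map _ _ (addr0 (i + 1)) r = 0.
  apply/cmod_B; apply: ((qj (i + 1)).1 _ (addr0 _)); first exact: cmod_Z.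
  exists i, erefl, (- y); rewrite (morphDN (cdD _)); apply/eqP; rewrite -addr_eq0; exact/eqP.
have /T3 [s [Ss sr]] : g (val (r : conc B0 (i + 1))) = 0.
  by have := congr1 (fun z : cmod (resL g (L^o : lmodType L)) (i + 1) => val (z : cmodT _ (i + 1))) u0.
rewrite u0 hfun0 add0r in hy.
have [c [_ hc]] := (qj i).2 i (addr0 i) y (isZP hy).
have [r' [s' [Ss' hr]]] := T1 (val (c : cmodT (resL g (L^o : lmodType L)) i)).
have [r2 [hr2 ne]] : exists r2 : B0,
    g r2 = g (s * s') * val (c : cmodT (resL g (L^o : lmodType L)) i) /\ (i = 0 \/ r2 = 0).
  have [i0|c0] := cmod_case c.
    exists (s * r'); rewrite !rmorphM -hr -!mulrA [_ * g s']mulrC; split=> //; by left.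
  by exists 0; rewrite c0 mulr0 rmorph0; split=> //; right.
exists (cin (s * s')); split; first by apply: hS.2.
have [k [e [w hw]]] := sc_B (cin (s * s')) hc.
have hcb : unit_map i i (addr0 i) (cbk ne) = sc (cin (s * s')) c.
  by apply: val_inj; rewrite unit_mapE cmod_sc.
subst i; exists k, erefl, (cbk ne, w).
rewrite (cone_cd _ _ (addr0 (k + 1)) (erefl _)).
rewrite /J (hcompE (addr0 0) j _ (addr0 (k + 1)) (addr0 (k + 1)) (addr0 (k + 1))) hcb hfun_sc -hw scBr addBK.
rewrite -[RHS]/(- (0 : B (k + 1 + 1)), sc (cin (s * s')) y) oppr0.
rewrite -[LHS]/(zsign 0 (act (cone_e3 (add0r (k + 1))) (cin (s * s')) r), sc (cin (s * s')) y).
by congr (_, _); apply: val_inj; rewrite /= mulrAC sr mul0r.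
Qed.
End LocalGorenstein.

(** * Dualizing DG modules over tractable DG rings *)

(** Polynomials are taken over nonzero rings; the equality of structures allows [K] to be replaced
    outright. *)
Lemma nz_pack (K : comPzRingType) : (1 : K) != 0 -> exists K' : comNzRingType, (K' : comPzRingType) = K.
Proof.
move=> nz; pose K' : comNzRingType :=
  HB.pack (GRing.ComPzRing.sort K) (GRing.PzSemiRing_isNonZero.Build (GRing.ComPzRing.sort K) nz).
by exists K'; rewrite {}/K'; destruct K as [T cK]; destruct cK.
Qed.

Section ZeroRing.
Variable A : cdgRing.
(** [A^0] as a nonzero commutative ring; the proof [nz] is carried by the type so that the structure
    can be declared on it. *)
Definition zring (nz : dunit A != 0) : Type := A 0.
Variable nz : dunit A != 0.
Local Notation T := (zring nz).
HB.instance Definition _ := GRing.Zmodule.on T.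
Definition zmul (a b : T) : T := dmul (add0r 0) a b.
Lemma zmulA : associative zmul.
Proof. by move=> a b c; rewrite /zmul (dmulA _ _ (add0r 0) (add0r 0)). Qed.
Lemma zmulC : commutative zmul.
Proof. by move=> a b; rewrite /zmul (dmulC (add0r 0) (add0r 0) b a) mul0r zsign0. Qed.
Lemma zmul1 : left_id (dunit A : T) zmul.
Proof. by move=> a; apply: dmul1l. Qed.
Lemma zmulDl : left_distributive zmul +%R.
Proof. by move=> a b c; apply: dmulDl. Qed.
HB.instance Definition _ := GRing.Zmodule_isComNzRing.Build T zmulA zmulC zmul1 zmulDl nz.

Lemma zbclM (a b : T) : bcl (a * b) = bcl a * bcl b.
Proof. exact: bclM. Qed.

Section ConcHom.
Variables (B0 : comPzRingType) (psi : {rmorphism B0 -> T}).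
Definition conc_map i (x : concRing B0 i) : A i :=
  if pselect (0 = i) is left e then @cst A 0 i e (psi (val (x : conc B0 i))) else 0.
Lemma conc_mapE (x : concRing B0 0) : conc_map x = psi (val (x : conc B0 0)).
Proof. by rewrite /conc_map; case: pselect => // e; rewrite cst_id. Qed.
Lemma conc_map_ne i (x : concRing B0 i) : 0 <> i -> conc_map x = 0.
Proof. by rewrite /conc_map; case: pselect. Qed.
Lemma conc_mapD i : {morph @conc_map i : x y / x + y}.
Proof.
move=> x y; have [e|ne] := pselect (0 = i); last by rewrite !conc_map_ne ?addr0.
by subst i; rewrite !conc_mapE -(rmorphD psi); congr (psi _); apply: raddfD.
Qed.
Program Definition conc_cmap : cmap (concRing B0) A := @CMap _ _ conc_map conc_mapD _.
Next Obligation.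
move=> i j e x; rewrite [X in conc_map X](_ : _ = 0) // (morphD0 (@conc_mapD j)).
have [e0|ne] := pselect (0 = i); last by rewrite conc_map_ne // cd0.
by subst i; rewrite A0_Z.
Qed.
Program Definition conc_hom : dgrHom (concRing B0) A := @DGRHom _ _ conc_cmap _ _.
Next Obligation. by rewrite [LHS]conc_mapE; exact: (rmorph1 psi). Qed.
Next Obligation.
move=> i j k e a b.
have [i0|ni] := pselect (0 = i); last first.
  have -> : dmul e a b = 0.
    by apply: val_inj; rewrite /= (conc_val0 a) ?mul0r //; apply/eqP => h; apply: ni.
  rewrite [LHS](morphD0 (@conc_mapD k)) [X in dmul e X _](conc_map_ne _ ni).
  by rewrite (morphD0 (fun x y => dmulDl e x y _)).
have [j0|nj] := pselect (0 = j); last first.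
  have -> : dmul e a b = 0.
    by apply: val_inj; rewrite /= (conc_val0 b) ?mulr0 //; apply/eqP => h; apply: nj.
  rewrite [LHS](morphD0 (@conc_mapD k)) [X in dmul e _ X](conc_map_ne _ nj).
  by rewrite (morphD0 (fun x y => dmulDr e _ x y)).
have k0 : 0 = k by rewrite -e -i0 -j0.
case: i / i0 a e => a e; case: j / j0 b e => b e; case: k / k0 e => e.
rewrite [LHS]conc_mapE -[RHS]/(dmul e (conc_map a) (conc_map b)) !conc_mapE.
by rewrite (Prop_irrelevance e (add0r 0)); apply: (rmorphM psi).
Qed.
Lemma conc_homE x : conc_hom 0 (cin x) = psi x.
Proof. exact: conc_mapE. Qed.
End ConcHom.

Section FromConc.
Variables (K : comNzRingType) (f : dgrHom (concRing K) A).
Definition zmap (x : K) : T := f 0 (cin x).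
Lemma zmap_add : zmod_morphism zmap.
Proof.
move=> x y; rewrite /zmap -(morphDB (@cmD _ _ f 0)); congr (f _ _); exact: val_inj.
Qed.
Lemma zmap_mul : monoid_morphism zmap.
Proof.
split; first exact: dgrh1 f.
by move=> x y; rewrite /zmap -dmul_cin dgrhM.
Qed.
HB.instance Definition _ := GRing.isZmodMorphism.Build K T zmap zmap_add.
HB.instance Definition _ := GRing.isMonoidMorphism.Build K T zmap zmap_mul.
Lemma bar_mapE x : bar_map f x = bcl (zmap x).
Proof. by rewrite /bar_map cohmapE; congr hcls; apply: val_inj. Qed.
End FromConc.
End ZeroRing.

(** Variables are adjoined one at a time. What is transported is noetherianity and the Ext bound
    rather than regularity, so that polynomial rings over regular rings need not be shown
    regular. *)
Lemma tower (T : comNzRingType) n (v : 'I_n -> T) (K : comNzRingType) (psi : {rmorphism K -> T}) m :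
  noetherian K -> (forall N : lmodType K, EV m N) ->
  exists (B0 : comNzRingType) (chi : {rmorphism B0 -> T}) m',
    [/\ noetherian B0, forall N : lmodType B0, EV m' N,
        forall x, exists b, chi b = psi x & forall i, exists b, chi b = v i].
Proof.
elim: n v K psi m => [|n IH] v K psi m hN h.
  by exists K, psi, m; split=> // [x|[]//]; exists x.
pose cfu : commr_rmorph psi (v ord0) := fun x => mulrC _ _.
have [B0 [chi [m' [h1 h2 h3 h4]]]] := IH (fun i => v (lift ord0 i)) {poly K}
  (horner_morph cfu : {rmorphism {poly K} -> T}) m.+1 (hilbert_basis hN) (EV_poly hN h).
exists B0, chi, m'; split=> // [x|i].
  by have [b hb] := h3 x%:P; exists b; rewrite hb /= horner_morphC.
have [j ->|->] := unliftP ord0 i; first exact: h4.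
by have [b hb] := h3 'X; exists b; rewrite hb /= horner_morphX.
Qed.

Lemma noetherian_conc (B0 : comPzRingType) : noetherian B0 -> noetherian (barRing (concRing B0)).
Proof.
move=> hN I iI; pose q (b : B0) := bcl (cin b : concRing B0 0).
have qD x y : q (x + y) = q x + q y by rewrite /q -bclD; congr bcl; apply: val_inj.
have qM x y : q (x * y) = q x * q y by rewrite /q -bclM; congr bcl; apply: val_inj.
have q0 : q 0 = 0 by apply: (addrI (q 0)); rewrite -qD !addr0.
have qs x : exists b, x = q b.
  by have [a ->] := bcl_surj x; exists (val (a : conc B0 0)); rewrite {1}[a]conc0_in.
have iJ : is_ideal (fun b => I (q b)).
  split=> [|x y hx hy|a x hx]; first by rewrite q0; apply: ideal0.
    by rewrite qD; apply: idealD.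
  by rewrite qM; apply: idealM.
have [n [v hv]] := hN _ iJ; exists n, (fun i => q (v i)) => x; split; last first.
  move=> [c ->]; apply: ideal_sum => // i; apply: idealM => //; exact: (gens_in hv i).
have [b ->] := qs x => /hv [c ->]; exists (fun i => q (c i)).
by rewrite (big_morph q qD q0); apply: eq_bigr => i _.
Qed.

Section Existence.
Variable A : cdgRing.
Local Notation A1 := (regMod A).
Local Notation fg M := (forall i, fgS (@S1 A) M i).

Definition duality_bounds (R1 : dgMod A) (d : int) : Prop := [/\ (0 <= d)%R,
  forall M i, (forall k, (- i <= k)%R -> (k <= - i + d)%R -> van M k) -> van (Homdg M R1) i,
  forall M i, fg M -> fgS (@S1 A) (Homdg M R1) i &
  forall M, fg M -> qi (bid R1 M)].

(** If 1 is a boundary, every DG module is acyclic, and nonzero rings need not be available. *)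
Lemma duality_trivial : isB (dunit A) -> duality_bounds A1 0.
Proof.
move=> h; have hv (M : dgMod A) i : van M i.
  by move=> x Zx; rewrite -(sc1 x); apply: scB_Z.
split=> [//|M i _|M i _|M _ i]; first exact: hv.
  exists 0%N, (fun=> 0); split=> [[]//|x Zx]; exists (dunit A), (fun=> 0); split=> //.
  by rewrite /lcomb big_ord0 subr0 sc1; apply: hv.
split=> [j e x Zx _|j e y Zy]; first exact: hv.
exists 0; split; first exact: isZ0.
by apply: hv; apply: isZB => //; rewrite hfun0; apply: isZ0.
Qed.

Lemma duality_exists : tractable A -> exists R1 d, duality_bounds R1 d.
Proof.
move=> [[hNA hAfg] [K [f [hK rK [n0 dK] [C [h [g [SC [ft lC fE]]]]]]]]].
have [hb|nb] := pselect (isB (dunit A)); first by exists A1, 0; apply: duality_trivial.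
have nz : dunit A != 0 by apply/eqP => E; apply: nb; rewrite E; apply: isB0.
have nzK : (1 : K) != 0.
  apply/eqP => E; move/eqP: nz; apply; rewrite -(dgrh1 f).
  have -> : dunit (concRing K) = 0 by apply: val_inj; rewrite /= E.
  exact: (morphD0 (@cmD _ _ f 0)).
have [K' EK] := nz_pack nzK; subst K.
have [w [v hv]] := ft.
have [v0 hv0] := choice (fun i => bcl_surj (g (v i))).
have [|B0 [chi [m [hB0 hEV hc1 hc2]]]] := @tower (zring nz) w v0 K' (zmap nz f) n0 hK.
  by move=> N; apply: EV_reg; apply: regular_reg.
have hD c : exists b, bcl (chi b) = g c.
  apply: (hv (fun c => exists b, bcl (chi b) = g c)) => [x|i|x y [b hx] [b' hy]|x y [b hx] [b' hy]].
  - by have [b hb] := hc1 x; exists b; rewrite hb -fE (bar_mapE nz).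
  - by have [b hb] := hc2 i; exists b; rewrite hb -hv0.
  - by exists (b + b'); rewrite rmorphD rmorphD -hx -hy; apply: bclD.
  by exists (b * b'); rewrite rmorphM rmorphM -hx -hy; apply: zbclM.
(* All elements that become invertible in [H^0(A)], not only chosen denominators: [hU] then holds by
   definition, and the denominators coming from [C] are reached through [hD]. *)
pose S0 (b : B0) := exists c : barRing A, c * bcl (chi b) = 1.
have mS0 : mult_closed S0.
  split; first by exists 1; rewrite rmorph1 mul1r; apply: bcl1.
  move=> s t [c hc] [c' hc']; exists (c * c').
  by rewrite rmorphM zbclM mulrACA hc hc' mulr1.
have iJ : is_ideal (fun x : B0 => x = 0).
  by split=> [//|x y -> ->|a x ->]; rewrite ?addr0 ?mulr0.
have [I [j [dj [hI hj]]]] := local_resolution (g := linj mS0 iJ) mS0 (@loc_frac _ _ _ mS0 iJ)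
  (@loc_unit _ _ _ mS0 iJ) (@loc0P _ _ _ mS0 iJ) hB0 hEV.
pose phi := conc_hom chi.
have phiE b : phi 0 b = chi (val (b : conc B0 0)) by rewrite {1}[b]conc0_in; apply: conc_homE.
have mS : mset (Sc S0).
  by split; [exact: mS0.1 | move=> s t hs ht; apply: mS0.2].
have hU s : Sc S0 s -> exists a, isB (sc (M := A1) a (phi 0 s) - dunit A).
  move=> [c hc]; have [a ha] := bcl_surj c; exists a; apply/bclP.
  by rewrite bclM bcl1 -ha phiE.
have [SC1 SC2 SC3 SC4] := lC.
have hF a : exists s b, Sc S0 s /\ isB (sc (M := A1) (phi 0 s) a - phi 0 b).
  have [x [s [Ss hs]]] := SC3 (bcl a); have [u hu] := SC2 s Ss.
  have [bs hbs] := hD s; have [bx hbx] := hD x.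
  exists (cin bs), (cin bx); split; first by exists u; rewrite [bcl _]hbs mulrC.
  by apply/bclP; rewrite bclM !phiE [bcl (chi _)]hbs [bcl (chi _)]hbx mulrC.
have hd : (0 <= m%:Z)%R by [].
have hB i : fgS (Sc S0) (regMod (concRing B0)) i.
  have ne : i = 0 \/ (if i == 0 then 1 else 0 : B0) = 0 by case: eqVneq; [left | right].
  exists 1%N, (fun _ => cbk ne); split=> [//|x _].
  exists (cin 1), (fun _ => cin (val (x : conc B0 i))); split; first exact: mS0.1.
  rewrite [X in isB X](_ : _ = 0); first exact: isB0.
  apply/eqP; rewrite subr_eq0; apply/eqP; rewrite /lcomb big_ord1; apply: val_inj => /=.
  rewrite mul1r; have [i0|i0] := eqVneq i 0; first by rewrite mulr1.
  by rewrite (conc_val0 x i0) mul0r.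
have hA1 i : fgS (@S1 A) A1 i by apply/fg_moduleP.
exists (coind phi I), m%:Z; split=> //.
- by move=> M i hM; apply: (coind_van mS hI).
- by move=> M i hM; apply: (coind_fg mS hU hF (noetherian_conc hB0) hd hB hI hj).
by move=> M hM; apply: (coind_bid mS hU hF (noetherian_conc hB0) hd hB hI hj).
Qed.
End Existence.

(** * The group action *)

Section IsoClasses.
Variable A : cdgRing.
Local Notation A1 := (regMod A).
Implicit Types M N P Q X Y R : dgMod A.

Lemma Kf_tensor X Y : Kf X -> Kf Y -> Kf (tensor X Y).
Proof.
move=> hX hY N aN i; apply: (sim_van (sim_sym (sim_assoc X Y N))).
exact: hX (hY _ aN) i.
Qed.

Lemma good_tensor X Y : good X -> good Y -> good (tensor X Y).
Proof. by move=> [h1 h2] [h3 h4]; split; [apply: Kp_tensor | apply: Kf_tensor]. Qed.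

Lemma sim_unir N : sim (tensor N A1) N.
Proof. exact: sim_trans (sim_comm _ _) (sim_uni _). Qed.

Lemma tpair_tensor X Y X' Y' : tpair X Y -> tpair X' Y' -> tpair (tensor X X') (tensor Y Y').
Proof.
move=> h h'; have [gX gY _] := h; have [gX' gY' _] := h'.
apply: tpairP; [exact: good_tensor | exact: good_tensor |].
apply: sim_trans (sim_assoc _ _ _) _.
apply: sim_trans (tpair_sim h); apply: sim_tensr gX.2 _.
apply: sim_trans (sim_sym (sim_assoc _ _ _)) _.
apply: sim_trans (sim_tensl gY'.2 (sim_comm _ _)) _.
apply: sim_trans (sim_assoc _ _ _) _.
apply: sim_trans (sim_tensr gY.2 (tpair_sim h')) _; exact: sim_unir.
Qed.

Lemma tpair_tilting X Y : tpair X Y -> tilting X.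
Proof.
move=> h; have [gX gY _] := h; exists Y; apply/is_LtensorP.
apply: sim_trans (tpair_sim h); apply: sim_tens_flat; [exact: (good_res X).2 | exact: gX.2 | exact: sim_res].
Qed.

Lemma tilting_sim M N : sim M N -> tilting M -> tilting N.
Proof.
move=> h [Y /is_LtensorP hY]; exists Y; apply/is_LtensorP; apply: sim_trans hY.
apply: sim_tens_flat; [exact: (good_res N).2 | exact: (good_res M).2 |].
exact: sim_trans (sim_res N) (sim_trans (sim_sym h) (sim_sym (sim_res M))).
Qed.

Lemma tpair_unit : tpair A1 A1.
Proof. apply: tpairP; [exact: good_reg | exact: good_reg | exact: sim_uni]. Qed.

Lemma dualizing_sim M N : sim M N -> dualizing M -> dualizing N.
Proof.
move=> h [h1 [d0 [d1 [d01 h2]]] h3]; split.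
- move=> i; apply/fg_moduleP; apply: (fg_sim h); exact/fg_moduleP.
- exists d0, d1; split=> // X; have [T /is_RHomP hT hc] := h2 X; exists T => //.
  apply/is_RHomP; apply: sim_trans hT; apply: sim_homR (sim_sym h); exact: (good_res X).1.
apply/adjoint_isoP; move/adjoint_isoP: h3 => h3.
exact: sim_trans h3 (sim_RHom2 h h).
Qed.

Definition lt M N : dgMod A := tensor (res M) N.

Lemma lt_flat M N X : Kf X -> sim M X -> sim (lt M N) (tensor X N).
Proof.
move=> hX h; apply: sim_tens_flat; [exact: (good_res M).2 | exact: hX |].
exact: sim_trans (sim_res M) h.
Qed.

Lemma lt_sim M M' N N' : sim M M' -> sim N N' -> sim (lt M N) (lt M' N').
Proof.
move=> h h'; apply: sim_trans (lt_flat N (good_res M').2 (sim_trans h (sim_sym (sim_res M')))) _.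
exact: sim_tensr (good_res M').2 h'.
Qed.

Lemma lt_assoc M N L : sim (lt M (lt N L)) (lt (lt M N) L).
Proof.
apply: sim_trans (sim_sym (sim_assoc _ _ _)) _; apply: sim_sym; apply: lt_flat.
  exact: Kf_tensor (good_res M).2 (good_res N).2.
exact: sim_tensr (good_res M).2 (sim_sym (sim_res N)).
Qed.

Lemma lt_comm M N : sim (lt M N) (lt N M).
Proof.
apply: sim_trans (sim_tensr (good_res M).2 (sim_sym (sim_res N))) _.
apply: sim_trans (sim_comm _ _) _; exact: sim_tensr (good_res N).2 (sim_res M).
Qed.

Lemma lt_unit N : sim (lt A1 N) N.
Proof. exact: sim_trans (lt_flat N (good_reg A).2 (sim_refl _)) (sim_uni N). Qed.

Lemma tilting_lt P Q : tilting P -> tilting Q -> tilting (lt P Q).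
Proof.
move=> /tiltingP [Y hY] /tiltingP [Z hZ].
apply: tilting_sim (tpair_tilting (tpair_tensor hY hZ)).
exact: sim_tensr (good_res P).2 (sim_res Q).
Qed.

Section Classes.
Variable Phi : dgMod A -> Prop.
Implicit Types c : isoclass Phi.

Definition rep c : dgMod A := projT1 (cid2 (svalP c)).
Lemma repP c : Phi (rep c) /\ forall M, sval c M <-> sim (rep c) M.
Proof.
rewrite /rep; case: cid2 => R h1 h2 /=; split=> // M; rewrite h2; exact: dIsoP.
Qed.
Definition cls M (h : Phi M) : isoclass Phi := exist _ (dIso M) (ex_intro2 _ _ M h erefl).
Lemma rep_cls M (h : Phi M) : sim (rep (cls h)) M.
Proof. by apply/(repP (cls h)).2 => /=; apply/dIsoP/sim_refl. Qed.
Lemma class_eq c c' : sim (rep c) (rep c') -> c = c'.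
Proof.
move=> h; have E : sval c = sval c'.
  apply: funext => M; apply: propext; rewrite (repP c).2 (repP c').2.
  by split=> h'; [apply: sim_trans (sim_sym h) h' | apply: sim_trans h h'].
case: c c' E {h} => C hC [C' hC'] /= E; subst C'; congr exist; exact: Prop_irrelevance.
Qed.

End Classes.

Section Operation.
Variable Phi : dgMod A -> Prop.
Hypothesis hPhi : forall P M, tilting P -> Phi M -> Phi (lt P M).
(** Parametrized by a class [Phi] stable under tilting, so that multiplication in [DPic] and the
    action on dualizing modules are instances of one operation and share the unit and associativity
    laws. *)
Definition lop (p : DPic A) (c : isoclass Phi) : isoclass Phi := cls (hPhi (repP p).1 (repP c).1).

Lemma rep_lop p c : sim (rep (lop p c)) (lt (rep p) (rep c)).
Proof. exact: rep_cls. Qed.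

Lemma lop_induced : induced_by_Ltensor lop.
Proof.
move=> p c P M /(repP p).2 hP /(repP c).2 hM T; rewrite is_LtensorP (repP (lop p c)).2.
have E : sim (rep (lop p c)) (lt P M) := sim_trans (rep_lop p c) (lt_sim hP hM).
by split=> h; [apply: sim_trans E h | apply: sim_trans (sim_sym E) h].
Qed.
End Operation.

Definition pic_mul : DPic A -> DPic A -> DPic A := lop tilting_lt.
Definition pic_one : DPic A := cls (tpair_tilting tpair_unit).
Lemma rep_inv (p : DPic A) : exists Y, tpair (res (rep p)) Y.
Proof. by apply/tiltingP; case: (repP p). Qed.
Definition pic_inv (p : DPic A) : DPic A := cls (tpair_tilting (tpair_sym (projT2 (cid (rep_inv p))))).

Section Action.
Variable Phi : dgMod A -> Prop.
Hypothesis hPhi : forall P M, tilting P -> Phi M -> Phi (lt P M).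
Lemma lop1 (c : isoclass Phi) : lop hPhi pic_one c = c.
Proof.
apply: class_eq; apply: sim_trans (rep_lop _ _ _) _.
exact: sim_trans (lt_sim (rep_cls _) (sim_refl _)) (lt_unit _).
Qed.
Lemma lopM p q (c : isoclass Phi) : lop hPhi (pic_mul p q) c = lop hPhi p (lop hPhi q c).
Proof.
apply: class_eq; apply: sim_trans (rep_lop _ _ _) _.
apply: sim_trans (lt_sim (rep_lop _ _ _) (sim_refl _)) _.
apply: sim_trans (sim_sym (lt_assoc _ _ _)) _; apply: sim_sym.
apply: sim_trans (rep_lop _ _ _) _; exact: lt_sim (sim_refl _) (rep_lop _ _ _).
Qed.
End Action.

Lemma pic_law : abelian_group_law pic_mul pic_one pic_inv.
Proof.
split.
- by move=> p q r; rewrite /pic_mul -lopM.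
- move=> p q; apply: class_eq; apply: sim_trans (rep_lop _ _ _) _.
  apply: sim_trans (lt_comm _ _) _; exact: sim_sym (rep_lop _ _ _).
- by move=> p; apply: lop1.
move=> p; apply: class_eq; apply: sim_trans (rep_lop _ _ _) _.
have h := projT2 (cid (rep_inv p)); have [gX gY _] := h.
apply: sim_trans (sim_sym (rep_cls _)).
apply: sim_trans (lt_flat _ gY.2 (rep_cls _)) _.
apply: sim_trans (sim_tensr gY.2 (sim_sym (sim_res _))) _.
exact: tpair_sim (tpair_sym h).
Qed.

Section DualizingAction.
Variables (R1 : dgMod A) (d : int).
Hypothesis hN : noetherian (barRing A).
Hypothesis hA : forall i, fgS (@S1 A) A1 i.
Hypothesis hR1 : duality_bounds R1 d.
Let hd : (0 <= d)%R. Proof. by case: hR1. Qed.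
Let Ra : forall M i, (forall k, (- i <= k)%R -> (k <= - i + d)%R -> van M k) -> van (Homdg M R1) i.
Proof. by case: hR1. Qed.
Let Rb : forall M i, (forall i, fgS (@S1 A) M i) -> fgS (@S1 A) (Homdg M R1) i.
Proof. by case: hR1. Qed.
Let Rc : forall M, (forall i, fgS (@S1 A) M i) -> qi (bid R1 M).
Proof. by case: hR1. Qed.

Lemma dualizing_normal R : dualizing R -> exists X Y, tpair X Y /\ sim (tensor X R1) R.
Proof. by move=> h; apply: (dualizing_form hN hA hd Ra Rb Rc). Qed.

Lemma dualizing_lt P R : tilting P -> dualizing R -> dualizing (lt P R).
Proof.
move=> /tiltingP [Y hY] /dualizing_normal [Z [W [hZ hR]]].
apply: (dualizing_sim (M := tensor (tensor (res P) Z) R1)).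
  exact: sim_trans (sim_assoc _ _ _) (sim_tensr (good_res P).2 hR).
exact: (dualizing_tilt hN hA hd Ra Rb Rc (tpair_tensor hY hZ)).
Qed.

Lemma dualizing_transitive : simply_transitive (lop dualizing_lt).
Proof.
have dR1 : dualizing R1 by eapply dualizing_R1; eassumption.
split; first exact: (inhabits (cls dR1)).
move=> x y; have [dx _] := repP x; have [dy _] := repP y.
have [X [Y [hX sX]]] := dualizing_normal dx; have [X' [Y' [hX' sX']]] := dualizing_normal dy.
have [gX gY _] := hX; have [gX' gY' _] := hX'.
have hg := tpair_tensor hX' (tpair_sym hX).
(* If [x] is [X (x) R1] and [y] is [X' (x) R1], then [X' (x) Y], with [Y] inverse to [X], carries
   [x] to [y]. *)
pose g0 : DPic A := cls (tpair_tilting hg).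
have E0 : lop dualizing_lt g0 x = y.
  apply: class_eq; apply: sim_trans (rep_lop _ _ _) _.
  apply: sim_trans (lt_flat _ (Kf_tensor gX'.2 gY.2) (rep_cls _)) _.
  apply: sim_trans (sim_assoc _ _ _) _; apply: sim_trans sX'; apply: sim_tensr gX'.2 _.
  apply: sim_trans (sim_tensr gY.2 (sim_sym sX)) _.
  apply: sim_trans (sim_sym (sim_assoc _ _ _)) _.
  apply: sim_trans (sim_uni _).
  apply: sim_tens_flat; [exact: Kf_tensor gY.2 gX.2 | exact: (good_reg A).2 |].
  exact: tpair_sim (tpair_sym hX).
exists g0; split=> //.
(* Uniqueness: an element carrying [x] to [y] is recovered as [RHom(x, y)]. *)
have key g : lop dualizing_lt g x = y -> sim (Homdg (res (rep x)) (rep y)) (rep g).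
  move=> E; have /tiltingP [Z hZ] := (repP g).1.
  have hr : sim (Homdg (res (rep x)) (tensor (res (rep g)) (rep x))) (res (rep g)).
    by eapply tpair_recover; eassumption.
  apply: sim_trans (sim_res _); apply: sim_trans hr.
  apply: sim_homR (good_res _).1 _; rewrite -E; exact: rep_lop.
move=> g /key hg'; apply: class_eq; apply: sim_trans hg'; apply: sim_sym; exact: key.
Qed.
End DualizingAction.
End IsoClasses.

Theorem theorem0p5 (A : cdgRing) (hA : tractable A) :
  (exists R : dgMod A, dualizing R) /\
  exists (mul : DPic A -> DPic A -> DPic A) (one : DPic A) (inv : DPic A -> DPic A)
    (to : DPic A -> dualizing_classes A -> dualizing_classes A),
    (induced_by_Ltensor mul /\ proj1_sig one (regMod A) /\
     abelian_group_law mul one inv) /\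
    (induced_by_Ltensor to /\ group_action mul one to /\ simply_transitive to).
Proof.
have [R1 [d hR]] := duality_exists hA; have [[hN fgA] _] := hA.
have fA i : fgS (@S1 A) (regMod A) i by apply/fg_moduleP.
have tr := dualizing_transitive hN fA hR; split.
  by case: tr => [[c] _]; exists (rep c); case: (repP c).
exists (@pic_mul A), (@pic_one A), (@pic_inv A), (lop (dualizing_lt hN fA hR)).
split; split; try exact: lop_induced; split=> //.
- by apply/(repP (pic_one A)).2; apply: rep_cls.
- exact: pic_law.
by split=> [x|g h x]; [apply: lop1 | apply: lopM].
Qed.
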